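(* Assume that $L$ satisfies the generalized curvature-dimension inequality $\mathrm{CD}(\rho_1,\rho_2,\kappa,d)$ with $\rho_1>0$ (and $\rho_2>0$, $\kappa\ge0$, $0<d<\infty$). Let $1\le p<\infty$. There exists a constant $C=C_p(\rho_1,\rho_2,\kappa,d)>0$ (depending only on $p,\rho_1,\rho_2,\kappa,d$) such that for every $f\in C_0^\infty(\mathbb{M})$, $$\|f-f_{\mathbb{M}}\|_p\le C\,\big\|\sqrt{\Gamma(f)}\big\|_p,$$ where $f_{\mathbb{M}}=\frac{1}{\mu(\mathbb{M})}\int_{\mathbb{M}}f\,d\mu$.
   Context: Setting. $\mathbb{M}$ is a connected finite-dimensional $C^\infty$ manifold endowed with a smooth measure $\mu$ and a second-order diffusion operator $L$ with smooth real coefficients, $L1=0$, which is locally subelliptic in the sense of Fefferman-Phong (each point has a neighborhood $U$ and constants $\varepsilon,c>0$ with $\|u\|_{H^\varepsilon}^2\le c\left(-\int uLu\,d\mu+\int u^2d\mu\right)$ for all $u\in C_0^\infty(U)$), and such that $\int_{\mathbb{M}} fLg\,d\mu=\int_{\mathbb{M}} gLf\,d\mu$ and $\int_{\mathbb{M}} fLf\,d\mu\le 0$ for all $f,g\in C_0^\infty(\mathbb{M})$ (smooth compactly supported functions). The carré du champ is $\Gamma(f,g)=\frac12(L(fg)-fLg-gLf)$, $\Gamma(f)=\Gamma(f,f)$. An absolutely continuous curve $\gamma:[0,T]\to\mathbb{M}$ is subunit for $L$ if $|\frac{d}{dt}f(\gamma(t))|\le\sqrt{\Gamma(f)(\gamma(t))}$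 for every smooth $f$; its length is $T$. It is assumed that any two points are joined by a subunit curve; then the infimum $d(x,y)$ of the lengths of subunit curves from $x$ to $y$ is a distance, and $(\mathbb{M},d)$ is assumed complete. (The distance $d(\cdot,\cdot)$ is not to be confused with the constant $d$ below.) $\mathbb{M}$ is also endowed with a smooth symmetric bilinear differential form $\Gamma^Z$ on $C^\infty(\mathbb{M})$ satisfying $\Gamma^Z(fg,h)=f\Gamma^Z(g,h)+g\Gamma^Z(f,h)$ and $\Gamma^Z(f)=\Gamma^Z(f,f)\ge0$. Standing assumptions. (H.1) There is an increasing sequence $h_k\in C_0^\infty(\mathbb{M})$ with $h_k\nearrow1$ on $\mathbb{M}$ and $\|\Gamma(h_k)\|_\infty+\|\Gamma^Z(h_k)\|_\infty\to0$. (H.2) $\Gamma(f,\Gamma^Z(f))=\Gamma^Z(f,\Gamma(f))$ for all $f\in C^\infty(\mathbb{M})$. (H.3) For every $f\in C_0^\infty(\mathbb{M})$ and $T\ge0$, $\sup_{t\in[0,T]}\left(\|\Gamma(P_tf)\|_\infty+\|\Gamma^Z(P_tf)\|_\infty\right)<\infty$. Here $P_t=e^{tL}$ is the heat semigroup, defined by the spectral theorem from the self-adjoint extension of $L$ in $L^2(\mu)$ (unique under (H.1)). Curvature-dimension inequality. Put $\Gamma_2(f)=\frac12[L\Gamma(f)-2\Gamma(f,Lf)]$ and $\Gamma_2^Z(f)=\frac12[L\Gamma^Z(f)-2\Gamma^Z(f,Lf)]$. For $\rho_1\in\mathbb{R}$, $\rho_2>0$, $\kappa\ge0$, $0<d<\infty$,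 $L$ satisfies $\mathrm{CD}(\rho_1,\rho_2,\kappa,d)$ if for every $f\in C^\infty(\mathbb{M})$ and every $\nu>0$, $$\Gamma_2(f)+\nu\Gamma_2^Z(f)\ge\frac1d(Lf)^2+\left(\rho_1-\frac{\kappa}{\nu}\right)\Gamma(f)+\rho_2\Gamma^Z(f).$$ It is known (Baudoin-Garofalo) that when $\rho_1>0$ the manifold $\mathbb{M}$ is compact and $\mu(\mathbb{M})<\infty$. $\|\cdot\|_p$ is the norm of $L^p(\mathbb{M},\mu)$. *)

(* Defs.v *)
From mathcomp Require Import all_boot all_order all_algebra.
From mathcomp Require Import all_classical all_reals all_analysis.

Set Implicit Arguments.
Unset Strict Implicit.
Unset Printing Implicit Defensive.

Import Order.TTheory GRing.Theory Num.Theory.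
Import numFieldNormedType.Exports.

Local Open Scope classical_set_scope.
Local Open Scope ring_scope.

(** * Calculus on R^n *)

Section euclidean.
Context {R : realType}.

Definition partial n (i : 'I_n) (f : 'rV[R]_n -> R) : 'rV[R]_n -> R :=
  fun x => 'D_(delta_mx 0 i) f x.

(* For U open: all iterated partial derivatives exist and are continuous
   on U. *)
Definition smooth_on n (U : set 'rV[R]_n) (f : 'rV[R]_n -> R) : Prop :=
  forall (s : seq 'I_n) (x : 'rV[R]_n), U x ->
    {for x, continuous (foldr (@partial n) f s)} /\
    forall i, derivable (foldr (@partial n) f s) x (delta_mx 0 i).

(* Integral over R^n as an iterated integral.  It is only applied to
   nonnegative Borel functions and to compactly supported continuous ones,
   for which it is the integral against n-dimensional Lebesgue measure. *)
Fixpoint integral_rV (n : nat) : ('rV[R]_n -> \bar R) -> \bar R :=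
  match n with
  | 0 => fun f => f 0
  | m.+1 => fun f =>
      (\int[@lebesgue_measure R]_x
         integral_rV (fun v : 'rV[R]_m => f (row_mx (x%:M : 'rV[R]_1) v)))%E
  end.

Definition dot n (x y : 'rV[R]_n) : R := \sum_i x 0 i * y 0 i.

(* |u^(xi)|^2, where u^(xi) is the integral of u(x) e^{-i x.xi} *)
Definition fourier_sqr n (u : 'rV[R]_n -> R) (xi : 'rV[R]_n) : R :=
  fine (integral_rV (fun x => (cos (dot x xi) * u x)%:E)) ^+ 2 +
  fine (integral_rV (fun x => (sin (dot x xi) * u x)%:E)) ^+ 2.

(* Squared H^e norm, up to the constant factor (2 pi)^n. *)
Definition sobolev_sqr n (e : R) (u : 'rV[R]_n -> R) : \bar R :=
  integral_rV (fun xi => ((1 + dot xi xi) `^ e * fourier_sqr u xi)%:E).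

Definition abs_continuous (T : R) (g : R -> R) : Prop :=
  forall e : R, 0 < e -> exists2 delta : R, 0 < delta &
    forall (m : nat) (a b : 'I_m -> R),
      (forall i, 0 <= a i /\ a i <= b i /\ b i <= T) ->
      (forall i j, i != j -> b i <= a j \/ b j <= a i) ->
      \sum_i (b i - a i) < delta -> \sum_i `|g (b i) - g (a i)| < e.

End euclidean.

(** * Smooth manifolds *)

Notation borel M := (g_sigma_algebraType (@open M)).

Section manifold.
Context {R : realType} {n : nat} {M : ptopologicalType}.

(* [chart_inv] is the inverse of [chart_map]; outside [chart_dom], respectively outside
   [chart_img], the values of the two maps are irrelevant. *)
Record chart := Chart {
  chart_dom : set M;
  chart_map : M -> 'rV[R]_n;
  chart_inv : 'rV[R]_n -> M }.

Definition chart_img (c : chart) : set 'rV[R]_n := chart_map c @` chart_dom c.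

Definition is_chart (c : chart) : Prop :=
  [/\ open (chart_dom c), open (chart_img c),
      forall x, chart_dom c x -> chart_inv c (chart_map c x) = x,
      {within chart_dom c, continuous (chart_map c)} &
      {within chart_img c, continuous (chart_inv c)}].

Definition compatible (c1 c2 : chart) : Prop :=
  forall i : 'I_n,
    smooth_on (chart_map c1 @` (chart_dom c1 `&` chart_dom c2))
              (fun x => chart_map c2 (chart_inv c1 x) 0 i).

Record smooth_manifold (A : set chart) : Prop := {
  manifold_hausdorff : hausdorff_space M;
  manifold_second_countable : @second_countable M;
  manifold_chart : forall c, A c -> is_chart c;
  manifold_compatible : forall c1 c2, A c1 -> A c2 -> compatible c1 c2;
  manifold_cover : forall x : M, exists2 c, A c & chart_dom c x }.

Context (A : set chart).

Definition smooth (f : M -> R) : Prop :=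
  forall c, A c -> smooth_on (chart_img c) (f \o chart_inv c).

Definition support (f : M -> R) : set M := closure [set x | f x != 0].

Definition smooth_c (f : M -> R) : Prop := smooth f /\ compact (support f).

Definition smooth_measure (mu : set (borel M) -> \bar R) : Prop :=
  forall c, A c -> exists rho : 'rV[R]_n -> R,
    [/\ smooth_on (chart_img c) rho,
        forall x, chart_img c x -> 0 < rho x &
        forall B : set (borel M), measurable B -> B `<=` chart_dom c ->
          mu B = integral_rV (fun x => (\1_(chart_map c @` B) x * rho x)%:E)].

(* The value of the operator on non-smooth functions is irrelevant.  There is
   no zeroth-order term, as L 1 = 0. *)
Definition diffusion_operator (L : (M -> R) -> (M -> R)) : Prop :=
  forall c, A c ->
  exists (a : 'I_n -> 'I_n -> 'rV[R]_n -> R) (b : 'I_n -> 'rV[R]_n -> R),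
    [/\ forall i j, smooth_on (chart_img c) (a i j),
        forall i, smooth_on (chart_img c) (b i),
        forall i j x, chart_img c x -> a i j x = a j i x,
        forall x (v : 'rV[R]_n), chart_img c x ->
          0 <= \sum_i \sum_j a i j x * v 0 i * v 0 j &
        forall f x, smooth f -> chart_img c x ->
          L f (chart_inv c x) =
            \sum_i \sum_j a i j x * partial i (partial j (f \o chart_inv c)) x +
            \sum_i b i x * partial i (f \o chart_inv c) x].

Definition locally_subelliptic (mu : {measure set (borel M) -> \bar R})
    (L : (M -> R) -> (M -> R)) : Prop :=
  forall x : M, exists c (U : set M) (e c0 : R),
    [/\ A c, open U, U x, U `<=` chart_dom c & 0 < e /\ 0 < c0] /\
    forall u, smooth_c u -> support u `<=` U ->
      (sobolev_sqr e ((u \o chart_inv c) \_ (chart_img c)) <=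
        (c0 * (- (\int[mu]_y (u y * L u y)) + \int[mu]_y (u y ^+ 2)))%:E)%E.

Definition symmetric_nonpositive (mu : {measure set (borel M) -> \bar R})
    (L : (M -> R) -> (M -> R)) : Prop :=
  (forall f g, smooth_c f -> smooth_c g ->
     \int[mu]_x (f x * L g x) = \int[mu]_x (g x * L f x)) /\
  (forall f, smooth_c f -> \int[mu]_x (f x * L f x) <= 0).

(** * Carre du champ and the subunit distance *)

Definition Gamma (L : (M -> R) -> (M -> R)) (f g : M -> R) : M -> R :=
  fun x => 2^-1 * (L (fun y => f y * g y) x - f x * L g x - g x * L f x).

Definition subunit (L : (M -> R) -> (M -> R)) (T : R) (gamma : R -> M) : Prop :=
  {within `[0, T], continuous gamma} /\
  forall f, smooth f ->
    abs_continuous T (f \o gamma) /\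
    {ae @lebesgue_measure R, forall t, 0 <= t <= T ->
       `| derive1 (f \o gamma) t | <= Num.sqrt (Gamma L f f (gamma t))}.

Definition subunit_lengths (L : (M -> R) -> (M -> R)) (x y : M) : set R :=
  [set T | 0 <= T /\
     exists gamma, [/\ subunit L T gamma, gamma 0 = x & gamma T = y]].

Definition subunit_connected (L : (M -> R) -> (M -> R)) : Prop :=
  forall x y, subunit_lengths L x y !=set0.

Definition subunit_dist (L : (M -> R) -> (M -> R)) (x y : M) : R :=
  inf (subunit_lengths L x y).

Definition subunit_complete (L : (M -> R) -> (M -> R)) : Prop :=
  forall u : nat -> M,
    (forall e : R, 0 < e -> exists N : nat, forall p q : nat,
       (N <= p)%N -> (N <= q)%N -> subunit_dist L (u p) (u q) < e) ->
    exists x : M, (fun k => subunit_dist L (u k) x) @ \oo --> 0.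

Record vertical_form (GZ : (M -> R) -> (M -> R) -> (M -> R)) : Prop := {
  vertical_smooth : forall f g, smooth f -> smooth g -> smooth (GZ f g);
  vertical_sym : forall f g, smooth f -> smooth g -> GZ f g = GZ g f;
  vertical_linear : forall (a : R) f g h, smooth f -> smooth g -> smooth h ->
    GZ (fun x => a * f x + g x) h = fun x => a * GZ f h x + GZ g h x;
  vertical_leibniz : forall f g h, smooth f -> smooth g -> smooth h ->
    GZ (fun x => f x * g x) h = fun x => f x * GZ g h x + g x * GZ f h x;
  vertical_ge0 : forall f x, smooth f -> 0 <= GZ f f x }.

(** * Heat semigroup *)

Section heat.
Variable mu : {measure set (borel M) -> \bar R}.

(* Elements of L^2(mu) are represented by functions, and operators on L^2(mu)
   by maps or relations on representatives. *)
Definition L2 (f : M -> R) : Prop :=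
  measurable_fun [set: borel M] (f : borel M -> R) /\
  (\int[mu]_x (f x ^+ 2)%:E < +oo)%E.

Definition ip (f g : M -> R) : R := \int[mu]_x (f x * g x).

Definition ae_eq_fun (f g : M -> R) : Prop := {ae mu, forall x, f x = g x}.

(* A possibly unbounded operator, given by its graph: it is densely defined and
   equal to its adjoint. *)
Definition selfadjoint (D : (M -> R) -> (M -> R) -> Prop) : Prop :=
  [/\ forall f h, D f h -> L2 f /\ L2 h,
      forall f, L2 f -> forall e : R, 0 < e -> exists g h,
        D g h /\ ip (fun x => f x - g x) (fun x => f x - g x) < e &
      forall f h, L2 f -> L2 h ->
        (D f h <-> forall g k, D g k -> ip h g = ip f k)].

(* A projection-valued measure on the Borel sets of R.  Linearity of [E B] and
   its compatibility with almost everywhere equality follow from [pvm_sym]. *)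
Record projection_valued_measure (E : set R -> (M -> R) -> (M -> R)) : Prop := {
  pvm_L2 : forall B f, measurable B -> L2 f -> L2 (E B f);
  pvm_sym : forall B f g, measurable B -> L2 f -> L2 g ->
    ip (E B f) g = ip f (E B g);
  pvm_setI : forall B B' f, measurable B -> measurable B' -> L2 f ->
    ae_eq_fun (E (B `&` B') f) (E B (E B' f));
  pvm_setT : forall f, L2 f -> ae_eq_fun (E setT f) f;
  pvm_sigma_additive : forall (F : (set R)^nat) f,
    (forall i, measurable (F i)) -> trivIset setT F -> L2 f ->
    (fun k => \sum_(0 <= i < k) ip (E (F i) f) f) @ \oo -->
      ip (E (\bigcup_i F i) f) f }.

Definition scalar_spectral_measure (E : set R -> (M -> R) -> (M -> R))
    (f : M -> R) : set R -> \bar R :=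
  fun B => (ip (E B f) f)%:E.

Definition spectral_dom E (phi : R -> R) (f : M -> R) : Prop :=
  L2 f /\ (\int[scalar_spectral_measure E f]_l (phi l ^+ 2)%:E < +oo)%E.

Definition spectral_form E (phi : R -> R) (f : M -> R) : R :=
  fine (\int[scalar_spectral_measure E f]_l (phi l)%:E)%E.

(* h is the image of f by the operator "integral of phi dE".  The integral of
   phi against the signed measure B |-> <E(B) f, g> is written by polarization;
   the vectors g in the domain are dense, so that h is determined. *)
Definition spectral_apply E (phi : R -> R) (f h : M -> R) : Prop :=
  [/\ spectral_dom E phi f, L2 h &
      forall g, spectral_dom E phi g ->
        ip h g = 4^-1 * (spectral_form E phi (fun x => f x + g x) -
                         spectral_form E phi (fun x => f x - g x))].

(* P t = e^{t L}, where L stands for its self-adjoint extension D, with spectral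
   resolution E.  For f smooth with compact support, [P t f] denotes the smooth
   representative, so that Gamma (P t f) makes sense. *)
Definition heat_semigroup (L : (M -> R) -> (M -> R))
    (P : R -> (M -> R) -> (M -> R)) : Prop :=
  (exists (D : (M -> R) -> (M -> R) -> Prop)
          (E : set R -> (M -> R) -> (M -> R)),
    [/\ selfadjoint D,
        forall f, smooth_c f -> D f (L f),
        projection_valued_measure E,
        forall f h, D f h <-> spectral_apply E id f h &
        forall (t : R) f, 0 <= t -> L2 f ->
          spectral_apply E (fun l => expR (t * l)) f (P t f)]) /\
  (forall (t : R) f, 0 <= t -> smooth_c f -> smooth (P t f)).

End heat.

(** * Standing assumptions and the curvature-dimension inequality *)

Definition supnorm (f : M -> R) : \bar R :=
  ereal_sup (range (fun x => (`|f x|)%:E)).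

Definition H1 (L : (M -> R) -> (M -> R))
    (GZ : (M -> R) -> (M -> R) -> (M -> R)) : Prop :=
  exists h : nat -> M -> R,
    [/\ forall k, smooth_c (h k),
        forall k x, h k x <= h k.+1 x,
        forall x, (fun k => h k x) @ \oo --> (1 : R) &
        (fun k => supnorm (Gamma L (h k) (h k)) + supnorm (GZ (h k) (h k)))%E
          @ \oo --> 0%E].

Definition H2 (L : (M -> R) -> (M -> R))
    (GZ : (M -> R) -> (M -> R) -> (M -> R)) : Prop :=
  forall f, smooth f -> Gamma L f (GZ f f) = GZ f (Gamma L f f).

Definition H3 (L : (M -> R) -> (M -> R))
    (GZ : (M -> R) -> (M -> R) -> (M -> R))
    (P : R -> (M -> R) -> (M -> R)) : Prop :=
  forall f (T : R), smooth_c f -> 0 <= T ->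
    (ereal_sup [set supnorm (Gamma L (P t f) (P t f)) +
                    supnorm (GZ (P t f) (P t f)) | t in [set t : R | (0 <= t <= T)%R]]
       < +oo)%E.

Definition Gamma2 (L : (M -> R) -> (M -> R)) (f : M -> R) : M -> R :=
  fun x => 2^-1 * (L (Gamma L f f) x - 2 * Gamma L f (L f) x).

Definition Gamma2Z (L : (M -> R) -> (M -> R))
    (GZ : (M -> R) -> (M -> R) -> (M -> R)) (f : M -> R) : M -> R :=
  fun x => 2^-1 * (L (GZ f f) x - 2 * GZ f (L f) x).

Definition CD (L : (M -> R) -> (M -> R))
    (GZ : (M -> R) -> (M -> R) -> (M -> R)) (rho1 rho2 kappa d : R) : Prop :=
  forall f (nu : R) x, smooth f -> 0 < nu ->
    d^-1 * L f x ^+ 2 + (rho1 - kappa / nu) * Gamma L f f x + rho2 * GZ f f x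
    <= Gamma2 L f x + nu * Gamma2Z L GZ f x.

Definition mean (mu : {measure set (borel M) -> \bar R}) (f : M -> R) : R :=
  (fine (mu setT))^-1 * \int[mu]_x f x.

End manifold.

Arguments chart R n M : clear implicits.

(* Main.v *)
Require Import Defs.
From HB Require Import structures.
From mathcomp Require Import all_boot all_order all_algebra.
From mathcomp Require Import all_classical all_reals all_analysis.
From mathcomp Require Import measurable_realfun.
From mathcomp Require Import ring lra.

Set Implicit Arguments.
Unset Strict Implicit.
Unset Printing Implicit Defensive.

Import Order.TTheory GRing.Theory Num.Theory.
Import numFieldNormedType.Exports.

Local Open Scope classical_set_scope.
Local Open Scope ring_scope.

(* Put c = rho1 rho2 / (rho2 + kappa).  Along the heat flow u = P_t f the quantity
   a(t) Gamma(u) + b(t) Gamma^Z(u) + e(t) (u^2 - sup f^2), with b = (exp(c t) - 1)^2 and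
   a = b' / (2 rho2), is a subsolution of the heat equation by CD, and the maximum
   principle gives (exp(c t) - 1) Gamma(P_t f) <= rho1 (sup |f|)^2.  The maximum principle
   is proved by cut-off energy estimates, so that neither compactness nor hypoellipticity
   is needed; Gamma^Z(u) is first shown to be square integrable, by damping with
   Gamma + nu Gamma^Z for nu -> 0.
   By duality |int (f - P_t f) g| <= int_0^t int |Gamma(P_s f, g)| ds is at most
   C (sup |f|) int sqrt(Gamma(g)).  As t -> oo, P_t f tends to its mean, since the decay of
   Gamma(P_t f) bounds oscillations along subunit curves; this is the case p = 1.  For
   p > 1 it is applied to g |-> (g - m) |g - m|^(p-1), with m such that its mean vanishes,
   followed by Young's inequality. *)

(** * Smooth functions on a manifold *)

(** For each t, [P t f] is smooth in space, but the spectral calculus describes its dependence on t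
    only through pairings with test functions. No time derivative of Gamma (P t f) is therefore ever
    formed. Each evolution argument is an implicit Euler scheme: between s and t a quantity grows by
    at most (t - s) B + K (t - s)^2, and K may be arbitrarily bad, since it disappears when the step
    is refined. Convexity, of the integrand and of the quadratic forms, allows each step to be
    expanded at the later time t, where L (P t f) and CD are at hand. The price is the Taylor
    remainder P s f - P t f + (t - s) L P t f, whose Gamma^Z must be small on compact sets while
    (H.3) gives only sup bounds. CD applied to a remainder of higher order, with nu a power of t -
    s, transfers smallness from Gamma to Gamma^Z. The rate c is the positive number for which the
    term in exp(2 c t) cancels in the equation of the weights. *)

Section directional_derivative.
Context {R : realType} {V : normedModType R}.
Implicit Types (f : V -> R) (F : R -> R).

Lemma derive_line f x v : 'D_v f x = derive1 (fun h : R => f (h *: v + x)) 0.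
Proof.
rewrite derive1E /derive; set g1 := fun h => h^-1 *: _; set g2 := fun h => h^-1 *: _.
suff -> : g1 = g2 by [].
by rewrite funeqE /g1 /g2 => h /=; rewrite addr0 scale0r add0r [_%:A]mulr1.
Qed.

(** Restricting to the line [h *: v + x] reduces the chain rule for a directional derivative to the
    one-variable rule. *)
Lemma is_derive_compl F f x v : derivable f x v -> derivable F (f x) 1 ->
  is_derive x v (F \o f) (derive1 F (f x) * 'D_v f x).
Proof.
move=> df dF; have df' := (derivable1P f x v).1 df.
have dF' : derivable F (f (0 *: v + x)) 1 by rewrite scale0r add0r.
have d1 : differentiable (F \o (fun h : R => f (h *: v + x))) 0.
  exact: (differentiable_comp ((derivable1_diffP _ _).1 df')
    ((derivable1_diffP _ _).1 dF')).
apply: DeriveDef.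
  by apply/derivable1P/derivable1_diffP.
rewrite derive_line.
have := derive1_comp df' dF'; rewrite /comp => ->.
by rewrite scale0r add0r derive_line.
Qed.

End directional_derivative.

Section smooth_on_theory.
Context {R : realType} {n : nat}.
Implicit Types (U : set 'rV[R]_n) (f g : 'rV[R]_n -> R).

Definition diff1_on U f := forall x, U x ->
  {for x, continuous f} /\ forall i, derivable f x (delta_mx 0 i).

(** This recursion peels off the partial derivative that acts first, whereas [smooth_on] quantifies
    over whole sequences of derivatives. In this form the Leibniz and chain rules give closure
    properties by induction on the order. *)
Fixpoint diffk_on k U f : Prop :=
  diff1_on U f /\
  if k is k'.+1 then forall i, diffk_on k' U (partial i f) else True.

Lemma diffk_onW k U f : diffk_on k.+1 U f -> diffk_on k U f.
Proof.
elim: k f => [|k IH] f [f1 fk]; first by split.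
by split => // i; apply: IH; apply: fk.
Qed.

Lemma smooth_on_partial U f i : smooth_on U f -> smooth_on U (partial i f).
Proof. by move=> fU s x Ux; have := fU (rcons s i) x Ux; rewrite foldr_rcons. Qed.

Lemma smooth_onP U f : smooth_on U f <-> forall k, diffk_on k U f.
Proof.
split=> [fU k|fU s].
  elim: k f fU => [|k IH] f fU; split => //; try exact: (fU [::]).
  by move=> i; apply: IH; exact: smooth_on_partial.
have : diffk_on (size s) U f by [].
elim/last_ind: s f {fU} => [|s i IH] f.
  by move=> [].
by rewrite size_rcons foldr_rcons => -[_ /(_ i)]; exact: IH.
Qed.

Lemma eq_on_near U f g x : open U -> (forall x, U x -> f x = g x) -> U x ->
  \near x, f x = g x.
Proof. by move=> oU fg Ux; apply: filterS (open_nbhs_nbhs (conj oU Ux)). Qed.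

Lemma eq_on_partial U f g i : open U -> (forall x, U x -> f x = g x) ->
  forall x, U x -> partial i f x = partial i g x.
Proof.
by move=> oU fg x Ux; apply: near_eq_derive; exact: eq_on_near oU fg Ux.
Qed.

Lemma eq_diff1_on U f g : open U -> (forall x, U x -> f x = g x) ->
  diff1_on U f -> diff1_on U g.
Proof.
move=> oU fg f1 x Ux; have nfg := eq_on_near oU fg Ux; split=> [|i].
  apply: cvg_trans (near_eq_cvg nfg) _; rewrite -(fg _ Ux); exact: (f1 x Ux).1.
exact: near_eq_derivable nfg ((f1 x Ux).2 i).
Qed.

(** The rules for products and composites identify partial derivatives only on [U], so regularity
    has to be transported along equality on an open set before an induction hypothesis applies. *)
Lemma eq_diffk_on k U f g : open U -> (forall x, U x -> f x = g x) ->
  diffk_on k U f -> diffk_on k U g.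
Proof.
move=> oU; elim: k f g => [|k IH] f g fg [f1 fk].
  by split; [exact: eq_diff1_on oU fg f1|].
split; [exact: eq_diff1_on oU fg f1|].
by move=> i; apply: IH (fk i); exact: eq_on_partial.
Qed.

Lemma eq_smooth_on U f g : open U -> (forall x, U x -> f x = g x) ->
  smooth_on U f -> smooth_on U g.
Proof.
by move=> oU fg /smooth_onP fU; apply/smooth_onP => k; apply: eq_diffk_on (fU k).
Qed.

Lemma partialD f g i x : derivable f x (delta_mx 0 i) ->
  derivable g x (delta_mx 0 i) ->
  partial i (fun y => f y + g y) x = partial i f x + partial i g x.
Proof. exact: deriveD. Qed.

Lemma partialM f g i x : derivable f x (delta_mx 0 i) ->
  derivable g x (delta_mx 0 i) ->
  partial i (fun y => f y * g y) x = f x * partial i g x + g x * partial i f x.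
Proof. exact: deriveM. Qed.

Lemma diff1_onD U f g : diff1_on U f -> diff1_on U g ->
  diff1_on U (fun x => f x + g x).
Proof.
move=> f1 g1 x Ux; have [fc fd] := f1 x Ux; have [gc gd] := g1 x Ux.
by split=> [|i]; [exact: continuousD|exact: derivableD].
Qed.

Lemma diff1_onM U f g : diff1_on U f -> diff1_on U g ->
  diff1_on U (fun x => f x * g x).
Proof.
move=> f1 g1 x Ux; have [fc fd] := f1 x Ux; have [gc gd] := g1 x Ux.
by split=> [|i]; [exact: continuousM|exact: derivableM].
Qed.

Lemma diffk_onD k U f g : open U -> diffk_on k U f -> diffk_on k U g ->
  diffk_on k U (fun x => f x + g x).
Proof.
move=> oU; elim: k f g => [|k IH] f g [f1 fk] [g1 gk].
  by split; [exact: diff1_onD|].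
split; first exact: diff1_onD.
move=> i; apply: eq_diffk_on oU _ (IH _ _ (fk i) (gk i)) => x Ux.
by rewrite partialD; [|exact: (f1 x Ux).2|exact: (g1 x Ux).2].
Qed.

Lemma diffk_onM k U f g : open U -> diffk_on k U f -> diffk_on k U g ->
  diffk_on k U (fun x => f x * g x).
Proof.
move=> oU; elim: k f g => [|k IH] f g fk gk.
  by split; [exact: diff1_onM fk.1 gk.1|].
split; [exact: diff1_onM fk.1 gk.1|move=> i].
have fi := diffk_onW fk; have gi := diffk_onW gk.
apply: eq_diffk_on oU _ (diffk_onD oU (IH _ _ fi (gk.2 i)) (IH _ _ gi (fk.2 i))).
by move=> x Ux; rewrite partialM; [|exact: (fk.1 x Ux).2|exact: (gk.1 x Ux).2].
Qed.

Definition smooth_real (F : R -> R) := forall m x, derivable (derive1n m F) x 1.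

Lemma smooth_real_derive1 F : smooth_real F -> smooth_real (derive1 F).
Proof. by move=> sF m x; rewrite -derive1Sn. Qed.

Lemma smooth_real_continuous F : smooth_real F -> continuous F.
Proof.
by move=> sF x; apply/differentiable_continuous/derivable1_diffP/(sF 0%N x).
Qed.

Lemma partial_comp (F : R -> R) f i x : derivable F (f x) 1 ->
  derivable f x (delta_mx 0 i) ->
  partial i (fun y => F (f y)) x = derive1 F (f x) * partial i f x.
Proof. by move=> dF df; have [_] := is_derive_compl df dF. Qed.

Lemma diff1_on_comp (F : R -> R) U f : smooth_real F ->
  diff1_on U f -> diff1_on U (fun x => F (f x)).
Proof.
move=> sF f1 x Ux; have [fc fd] := f1 x Ux; split=> [|i].
  by apply: continuous_comp; [exact: fc|exact: smooth_real_continuous].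
by have [] := is_derive_compl (fd i) (sF 0%N (f x)).
Qed.

Lemma diffk_on_comp (F : R -> R) k U f : open U -> smooth_real F ->
  diffk_on k U f -> diffk_on k U (fun x => F (f x)).
Proof.
move=> oU; elim: k F f => [|k IH] F f sF fk.
  by split; [exact: diff1_on_comp fk.1|].
split; [exact: diff1_on_comp fk.1|move=> i].
have FF := IH _ _ (smooth_real_derive1 sF) (diffk_onW fk).
apply: eq_diffk_on oU _ (diffk_onM oU FF (fk.2 i)) => x Ux.
by rewrite partial_comp; [|exact: (sF 0%N)|exact: (fk.1 x Ux).2].
Qed.

Lemma diff1_on_cst U a : diff1_on U (fun=> a).
Proof. by move=> x _; split=> [|i]; [exact: cst_continuous|exact: derivable_cst]. Qed.

Lemma diffk_on_cst k U a : diffk_on k U (fun=> a).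
Proof.
elim: k a => [|k IH] a; split; [exact: diff1_on_cst|by []|exact: diff1_on_cst|].
move=> i; rewrite (_ : partial i _ = fun=> 0); first exact: IH.
by apply/funext => x; rewrite /partial derive_cst.
Qed.

Lemma smooth_on_cst U a : smooth_on U (fun=> a).
Proof. by apply/smooth_onP => k; exact: diffk_on_cst. Qed.

Lemma smooth_onD U f g : open U -> smooth_on U f -> smooth_on U g ->
  smooth_on U (fun x => f x + g x).
Proof.
move=> oU /smooth_onP fU /smooth_onP gU; apply/smooth_onP => k.
exact: diffk_onD.
Qed.

Lemma smooth_onM U f g : open U -> smooth_on U f -> smooth_on U g ->
  smooth_on U (fun x => f x * g x).
Proof.
move=> oU /smooth_onP fU /smooth_onP gU; apply/smooth_onP => k.
exact: diffk_onM.
Qed.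

Lemma smooth_on_comp (F : R -> R) U f : open U -> smooth_real F ->
  smooth_on U f -> smooth_on U (fun x => F (f x)).
Proof.
move=> oU sF /smooth_onP fU; apply/smooth_onP => k.
exact: diffk_on_comp.
Qed.

Lemma smooth_on_sum U (I : Type) (r : seq I) (f : I -> 'rV[R]_n -> R) :
  open U -> (forall i, smooth_on U (f i)) ->
  smooth_on U (fun x => \sum_(i <- r) f i x).
Proof.
move=> oU fU; elim: r => [|i r IH].
  rewrite (_ : (fun x => _) = fun=> 0); first exact: smooth_on_cst.
  by apply/funext => x; rewrite big_nil.
rewrite (_ : (fun x => _) = fun x => f i x + \sum_(i <- r) f i x).
  exact: smooth_onD (fU i) IH.
by apply/funext => x; rewrite big_cons.
Qed.

Lemma smooth_on_derivable U f i x : smooth_on U f -> U x ->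
  derivable f x (delta_mx 0 i).
Proof. by move=> fU Ux; exact: (fU [::] x Ux).2. Qed.

Lemma partial2M U f g i j x : open U -> smooth_on U f -> smooth_on U g -> U x ->
  partial i (partial j (fun y => f y * g y)) x =
  f x * partial i (partial j g) x + g x * partial i (partial j f) x +
  (partial i f x * partial j g x + partial i g x * partial j f x).
Proof.
move=> oU fU gU Ux.
have E y : U y -> partial j (fun y => f y * g y) y =
    f y * partial j g y + g y * partial j f y.
  move=> Uy; apply: partialM; [exact: smooth_on_derivable fU Uy|].
  exact: smooth_on_derivable gU Uy.
rewrite (eq_on_partial _ oU E Ux).
have fj := smooth_on_partial j fU; have gj := smooth_on_partial j gU.
have d h k : smooth_on U h -> derivable h x (delta_mx 0 k).
  by move=> hU; exact: smooth_on_derivable hU Ux.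
rewrite partialD; [|apply: d; exact: smooth_onM..].
rewrite !partialM; [|exact: d..].
move: (partial i (partial j g) x) (partial i (partial j f) x) (partial i f x)
  (partial i g x) (partial j f x) (partial j g x) (f x) (g x) => *.
by ring.
Qed.

Lemma partial2_comp U (F : R -> R) f i j x : open U -> smooth_real F ->
  smooth_on U f -> U x ->
  partial i (partial j (fun y => F (f y))) x =
  derive1 F (f x) * partial i (partial j f) x +
  derive1 (derive1 F) (f x) * (partial i f x * partial j f x).
Proof.
move=> oU sF fU Ux.
have E y : U y -> partial j (fun y => F (f y)) y =
    derive1 F (f y) * partial j f y.
  by move=> Uy; apply: partial_comp; [exact: (sF 0%N)|exact: smooth_on_derivable fU Uy].
rewrite (eq_on_partial _ oU E Ux).
have fj := smooth_on_partial j fU.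
have sF' := smooth_real_derive1 sF.
have d h k : smooth_on U h -> derivable h x (delta_mx 0 k).
  by move=> hU; exact: smooth_on_derivable hU Ux.
rewrite (partialM (d _ i (smooth_on_comp oU sF' fU)) (d _ i fj)).
rewrite partial_comp; [|exact: (sF' 0%N)|exact: d].
move: (partial i (partial j f) x) (partial i f x) (partial j f x)
  (derive1 F (f x)) (derive1 (derive1 F) (f x)) => *.
by ring.
Qed.

Lemma partial2D U f g i j x : open U -> smooth_on U f -> smooth_on U g -> U x ->
  partial i (partial j (fun y => f y + g y)) x =
  partial i (partial j f) x + partial i (partial j g) x.
Proof.
move=> oU fU gU Ux.
have E y : U y -> partial j (fun y => f y + g y) y =
    partial j f y + partial j g y.
  move=> Uy; apply: partialD; [exact: smooth_on_derivable fU Uy|].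
  exact: smooth_on_derivable gU Uy.
rewrite (eq_on_partial _ oU E Ux) partialD //.
  exact: smooth_on_derivable (smooth_on_partial j fU) Ux.
exact: smooth_on_derivable (smooth_on_partial j gU) Ux.
Qed.

End smooth_on_theory.

Section manifold_calculus.
Context {R : realType} {n : nat} {M : ptopologicalType}.
Context (A : set (chart R n M)) (L : (M -> R) -> (M -> R)).
Hypothesis manifoldA : smooth_manifold A.
Hypothesis diffusionL : diffusion_operator A L.
Implicit Types (f g h : M -> R) (F : R -> R).

Lemma open_chart_img c : A c -> open (chart_img c).
Proof. by move=> /(manifold_chart manifoldA) []. Qed.

Lemma chart_at x : exists c, [/\ A c, chart_dom c x,
  chart_img c (chart_map c x) & chart_inv c (chart_map c x) = x].
Proof.
have [c Ac cx] := manifold_cover manifoldA x; exists c.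
by split=> //; [exists x|case: (manifold_chart manifoldA Ac) => _ _ ->].
Qed.

Lemma smooth_cst a : smooth A (fun=> a).
Proof. by move=> c Ac; exact: smooth_on_cst. Qed.

Lemma smoothD f g : smooth A f -> smooth A g -> smooth A (fun x => f x + g x).
Proof.
by move=> sf sg c Ac; exact: (smooth_onD (open_chart_img Ac) (sf c Ac) (sg c Ac)).
Qed.

Lemma smoothM f g : smooth A f -> smooth A g -> smooth A (fun x => f x * g x).
Proof.
by move=> sf sg c Ac; exact: (smooth_onM (open_chart_img Ac) (sf c Ac) (sg c Ac)).
Qed.

Lemma smooth_comp F f : smooth_real F -> smooth A f -> smooth A (fun x => F (f x)).
Proof.
by move=> sF sf c Ac; exact: (smooth_on_comp (open_chart_img Ac) sF (sf c Ac)).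
Qed.

Lemma smooth_continuous f : smooth A f -> continuous f.
Proof.
move=> sf x; have [c [Ac cx ix invx]] := chart_at x.
have [odom oimg invK cmap cinv] := manifold_chart manifoldA Ac.
have fc := (sf c Ac [::] _ ix).1; rewrite /= in fc.
have mapx : {for x, continuous (chart_map c)}.
  by move: cmap; rewrite continuous_open_subspace // => /(_ x (mem_set cx)).
have cont : {for x, continuous ((f \o chart_inv c) \o chart_map c)}.
  by apply: continuous_comp.
have nfg : \near x, ((f \o chart_inv c) \o chart_map c) x = f x.
  by apply: filterS (open_nbhs_nbhs (conj odom cx)) => y cy /=; rewrite invK.
apply: cvg_trans (near_eq_cvg nfg) _.
by have := cont; rewrite /prop_for /continuous_at /comp invx.
Qed.

Lemma smooth_L f : smooth A f -> smooth A (L f).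
Proof.
move=> sf c Ac; have [a [b [sa sb _ _ E]]] := diffusionL Ac.
have oU := open_chart_img Ac.
apply: (eq_smooth_on oU (fun x Ux => esym (E f x sf Ux))).
have sfc := sf c Ac.
pose fc := f \o chart_inv c.
have s2 i j : smooth_on (chart_img c) (fun x => a i j x * partial i (partial j fc) x).
  exact: (smooth_onM oU (sa i j) (smooth_on_partial i (smooth_on_partial j sfc))).
have s1 i : smooth_on (chart_img c) (fun x => b i x * partial i fc x).
  exact: (smooth_onM oU (sb i) (smooth_on_partial i sfc)).
exact: (smooth_onD oU (smooth_on_sum _ oU (fun i => smooth_on_sum _ oU (s2 i)))
  (smooth_on_sum _ oU s1)).
Qed.

(* The symbol of [L] at a point: [d1] and [d2] are the first and second partial
   derivatives in a chart around [x]. *)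
Lemma diffusion_at x :
  exists (a : 'I_n -> 'I_n -> R) (b : 'I_n -> R)
    (d1 : (M -> R) -> 'I_n -> R) (d2 : (M -> R) -> 'I_n -> 'I_n -> R),
  [/\ forall i j, a i j = a j i,
      forall v : 'I_n -> R, 0 <= \sum_i \sum_j a i j * v i * v j,
      forall f, smooth A f ->
        L f x = \sum_i \sum_j a i j * d2 f i j + \sum_i b i * d1 f i,
      [/\ forall f g i, smooth A f -> smooth A g ->
          d1 (fun y => f y + g y) i = d1 f i + d1 g i,
          forall f g i, smooth A f -> smooth A g ->
          d1 (fun y => f y * g y) i = f x * d1 g i + g x * d1 f i &
          forall F f i, smooth_real F -> smooth A f ->
          d1 (fun y => F (f y)) i = derive1 F (f x) * d1 f i] &
      [/\ forall f g i j, smooth A f -> smooth A g ->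
          d2 (fun y => f y + g y) i j = d2 f i j + d2 g i j,
          forall f g i j, smooth A f -> smooth A g ->
          d2 (fun y => f y * g y) i j = f x * d2 g i j + g x * d2 f i j +
          (d1 f i * d1 g j + d1 g i * d1 f j) &
          forall F f i j, smooth_real F -> smooth A f ->
          d2 (fun y => F (f y)) i j = derive1 F (f x) * d2 f i j +
            derive1 (derive1 F) (f x) * (d1 f i * d1 f j)]].
Proof.
have [c [Ac cx ix invx]] := chart_at x.
have [a [b [sa sb asym apos E]]] := diffusionL Ac.
have oU := open_chart_img Ac.
set y := chart_map c x in ix invx.
exists (fun i j => a i j y), (fun i => b i y),
  (fun f i => partial i (f \o chart_inv c) y),
  (fun f i j => partial i (partial j (f \o chart_inv c)) y).
have dd f i : smooth A f -> derivable (f \o chart_inv c) y (delta_mx 0 i).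
  by move=> sf; exact: (smooth_on_derivable (sf c Ac) ix).
have Ex h : h x = (h \o chart_inv c) y by rewrite /= invx.
split.
- by move=> i j; exact: asym.
- move=> v; have := apos y (\row_i v i) ix.
  by under eq_bigr do under eq_bigr do rewrite !mxE.
- by move=> f sf; rewrite (Ex (L f)); exact: E.
- split.
  + by move=> f g i sf sg; exact: (partialD (dd f i sf) (dd g i sg)).
  + move=> f g i sf sg; rewrite (Ex f) (Ex g).
    exact: (partialM (dd f i sf) (dd g i sg)).
  + move=> F f i sF sf; rewrite (Ex f).
    exact: (partial_comp (sF 0%N _) (dd f i sf)).
- split.
  + by move=> f g i j sf sg; exact: (partial2D i j oU (sf c Ac) (sg c Ac) ix).
  + move=> f g i j sf sg; rewrite (Ex f) (Ex g).
    exact: (partial2M i j oU (sf c Ac) (sg c Ac) ix).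
  + move=> F f i j sF sf; rewrite (Ex f).
    exact: (partial2_comp i j oU sF (sf c Ac) ix).
Qed.

(** In [Gamma] the second derivatives and the first-order part of [L] cancel, which leaves the
    symbol of [L]. The same symbol multiplies [F''] when [L] is applied to [F (f y)]. *)
Lemma Gamma_at x : exists (a : 'I_n -> 'I_n -> R) (d1 : (M -> R) -> 'I_n -> R),
  [/\ forall v : 'I_n -> R, 0 <= \sum_i \sum_j a i j * v i * v j,
      forall f g, smooth A f -> smooth A g ->
        Gamma L f g x = \sum_i \sum_j a i j * d1 f i * d1 g j,
      forall f g i, smooth A f -> smooth A g ->
        d1 (fun y => f y * g y) i = f x * d1 g i + g x * d1 f i,
      forall F f i, smooth_real F -> smooth A f ->
        d1 (fun y => F (f y)) i = derive1 F (f x) * d1 f i &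
      forall F f, smooth_real F -> smooth A f ->
        L (fun y => F (f y)) x = derive1 F (f x) * L f x +
          derive1 (derive1 F) (f x) * Gamma L f f x].
Proof.
have [a [b [d1 [d2 [asym apos E [d1D d1M d1C] [d2D d2M d2C]]]]]] := diffusion_at x.
have GE f g : smooth A f -> smooth A g ->
    Gamma L f g x = \sum_i \sum_j a i j * d1 f i * d1 g j.
  move=> sf sg; rewrite /Gamma (E _ (smoothM sf sg)) (E _ sf) (E _ sg).
  set S := RHS.
  (* Symmetry of [a] makes the two cross terms of the second-order Leibniz rule equal; their sum
     [S + S] absorbs the factor 1/2 of [Gamma]. *)
  have S' : S = \sum_i \sum_j a i j * d1 g i * d1 f j.
    rewrite /S exchange_big; apply: eq_bigr => i _; apply: eq_bigr => j _.
    by rewrite asym mulrAC.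
  have -> : \sum_i \sum_j a i j * d2 (fun y => f y * g y) i j =
     f x * (\sum_i \sum_j a i j * d2 g i j) +
     g x * (\sum_i \sum_j a i j * d2 f i j) + (S + S).
    rewrite {2}S' /S !mulr_sumr -!big_split /=; apply: eq_bigr => i _.
    rewrite !mulr_sumr -!big_split /=; apply: eq_bigr => j _.
    rewrite (d2M _ _ _ _ sf sg).
    move: (d2 f i j) (d2 g i j) (d1 f i) (d1 g i) (d1 f j) (d1 g j) (a i j).
    by move: (f x) (g x) => *; ring.
  have -> : \sum_i b i * d1 (fun y => f y * g y) i =
     f x * (\sum_i b i * d1 g i) + g x * (\sum_i b i * d1 f i).
    rewrite !mulr_sumr -!big_split /=; apply: eq_bigr => i _.
    rewrite (d1M _ _ _ sf sg).
    move: (d1 f i) (d1 g i) (b i).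
    by move: (f x) (g x) => *; ring.
  move: S (\sum_i \sum_j a i j * d2 g i j) (\sum_i \sum_j a i j * d2 f i j) {S'}.
  move: (\sum_i b i * d1 g i) (\sum_i b i * d1 f i) (f x) (g x) => *.
  by field.
exists a, d1; split=> // F f sF sf.
rewrite (E _ (smooth_comp sF sf)) (E _ sf) (GE _ _ sf sf).
rewrite mulrDr !mulr_sumr -addrA [X in _ = _ + X]addrC addrA; congr (_ + _).
  rewrite -big_split /=; apply: eq_bigr => i _.
  rewrite !mulr_sumr -big_split /=; apply: eq_bigr => j _.
  rewrite (d2C _ _ _ _ sF sf).
  move: (d2 f i j) (d1 f i) (d1 f j) (a i j).
  by move: (derive1 F (f x)) (derive1 (derive1 F) (f x)) => *; ring.
apply: eq_bigr => i _; rewrite (d1C _ _ _ sF sf).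
by rewrite mulrCA.
Qed.

End manifold_calculus.

(** Interface between charts and analysis: the energy and heat flow arguments see the smooth
    functions only as a class [S] with these closure and calculus rules. *)
Record gamma_calculus {R : realType} {M : ptopologicalType}
    (S : (M -> R) -> Prop) (L : (M -> R) -> (M -> R)) : Prop := {
  gc_continuous : forall f, S f -> continuous f;
  gc_cst : forall a, S (fun=> a);
  gcD : forall f g, S f -> S g -> S (fun x => f x + g x);
  gcM : forall f g, S f -> S g -> S (fun x => f x * g x);
  gc_comp : forall F f, smooth_real F -> S f -> S (fun x => F (f x));
  gc_L : forall f, S f -> S (L f);
  gc_LD : forall f g x, S f -> S g -> L (fun y => f y + g y) x = L f x + L g x;
  gc_LZ : forall a f x, S f -> L (fun y => a * f y) x = a * L f x;
  gc_Lcomp : forall F f x, smooth_real F -> S f ->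
    L (fun y => F (f y)) x =
      derive1 F (f x) * L f x + derive1 (derive1 F) (f x) * Gamma L f f x;
  gc_GammaM : forall f g h x, S f -> S g -> S h ->
    Gamma L (fun y => f y * g y) h x =
      f x * Gamma L g h x + g x * Gamma L f h x;
  gc_Gamma_comp : forall F f g x, smooth_real F -> S f -> S g ->
    Gamma L (fun y => F (f y)) g x = derive1 F (f x) * Gamma L f g x;
  gc_Gamma_ge0 : forall f x, S f -> 0 <= Gamma L f f x }.

Lemma manifold_gamma_calculus {R : realType} {n : nat} {M : ptopologicalType}
    (A : set (chart R n M)) (L : (M -> R) -> (M -> R)) :
  smooth_manifold A -> diffusion_operator A L -> gamma_calculus (smooth A) L.
Proof.
move=> mA dL.
have GM f g h x : smooth A f -> smooth A g -> smooth A h ->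
    Gamma L (fun y => f y * g y) h x =
      f x * Gamma L g h x + g x * Gamma L f h x.
  move=> sf sg sh; have [a [d1 [_ GE d1M _ _]]] := Gamma_at mA dL x.
  rewrite (GE _ _ (smoothM mA sf sg) sh) (GE _ _ sg sh) (GE _ _ sf sh).
  rewrite !mulr_sumr -big_split; apply: eq_bigr => i _ /=.
  rewrite !mulr_sumr -big_split; apply: eq_bigr => j _ /=.
  rewrite (d1M _ _ _ sf sg); move: (a i j) (d1 f i) (d1 g i) (d1 h j).
  by move: (f x) (g x) => *; ring.
have GC F f g x : smooth_real F -> smooth A f -> smooth A g ->
    Gamma L (fun y => F (f y)) g x = derive1 F (f x) * Gamma L f g x.
  move=> sF sf sg; have [a [d1 [_ GE _ d1C _]]] := Gamma_at mA dL x.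
  rewrite (GE _ _ (smooth_comp mA sF sf) sg) (GE _ _ sf sg).
  rewrite !mulr_sumr; apply: eq_bigr => i _ /=.
  rewrite !mulr_sumr; apply: eq_bigr => j _ /=.
  rewrite (d1C _ _ _ sF sf); move: (derive1 F (f x)) (a i j) (d1 f i) (d1 g j) => *.
  by ring.
have sC (a : R) : smooth_real (fun=> a).
  move=> m; have -> : derive1n m (fun=> a) = fun=> if m is 0 then a else 0 :> R.
    elim: m => [//|m IH]; rewrite derive1nS IH; apply/funext => y.
    exact: derive1_cst.
  by move=> y; exact: derivable_cst.
have dC (a : R) : derive1 (fun=> a : R) = fun=> 0.
  by apply/funext => y; exact: derive1_cst.
have s0 := @smooth_cst _ _ _ A 0.
(* A constant is the composite of a constant [F] with the zero function, so the chain rule for [L]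
   applies and both of its terms vanish. *)
have Lcst a x : L (fun=> a) x = 0.
  have [_ [_ [_ _ _ _ Lc]]] := Gamma_at mA dL x.
  by rewrite (Lc _ _ (sC a) s0) dC derive1_cst !mul0r addr0.
split.
- exact: smooth_continuous.
- exact: smooth_cst.
- exact: smoothD.
- exact: smoothM.
- exact: smooth_comp.
- exact: smooth_L.
- move=> f g x sf sg.
  have [a [b [d1 [d2 [_ _ E [d1D _ _] [d2D _ _]]]]]] := diffusion_at mA dL x.
  rewrite (E _ (smoothD mA sf sg)) (E _ sf) (E _ sg) addrACA; congr (_ + _).
    rewrite -big_split; apply: eq_bigr => i _ /=.
    rewrite -big_split; apply: eq_bigr => j _ /=.
    by rewrite (d2D _ _ _ _ sf sg) mulrDr.
  rewrite -big_split; apply: eq_bigr => i _ /=.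
  by rewrite (d1D _ _ _ sf sg) mulrDr.
(* Homogeneity comes from [Gamma]: the chain rule gives Gamma(a, f) = 0 for a constant a, and
   unfolding it with L a = 0 leaves L (a f) = a L f. *)
- move=> a f x sf; have := GC _ _ f x (sC a) s0 sf.
  rewrite dC mul0r /Gamma Lcst mulr0 subr0 => /eqP.
  by rewrite mulf_eq0 invr_eq0 pnatr_eq0 /= subr_eq0 => /eqP.
- by move=> F f x sF sf; have [_ [_ [_ _ _ _ ->]]] := Gamma_at mA dL x.
- exact: GM.
- exact: GC.
- move=> f x sf; have [a [d1 [apos GE _ _ _]]] := Gamma_at mA dL x.
  by rewrite (GE _ _ sf sf).
Qed.

(** * Positivity of the measure of nonempty open sets *)

Section positivity_on_open_sets.
Context {R : realType}.

(* No measurability is needed: the integral of a nonnegative function is a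
   supremum over the simple functions below it. *)
Lemma ge0_le_integral_nomeas d (T : measurableType d)
    (mu : {measure set T -> \bar R}) (f g : T -> \bar R) :
  (forall x, 0 <= f x)%E -> (forall x, f x <= g x)%E ->
  (\int[mu]_x f x <= \int[mu]_x g x)%E.
Proof.
move=> f0 fg; have g0 x := le_trans (f0 x) (fg x).
rewrite /integral !patch_setT; apply: leeB.
  apply: le_ereal_sup => _ [h /= hf <-]; exists h => //= x.
  by apply: le_trans (hf x) _; rewrite !funeposE !max_l.
apply: le_ereal_sup => _ [h /= hf <-]; exists h => //= x.
by apply: le_trans (hf x) _; rewrite !funenegE !max_r // leeNl oppe0.
Qed.

Lemma integral_rV_ge0 n (f : 'rV[R]_n -> \bar R) :
  (forall y, 0 <= f y)%E -> (0 <= integral_rV f)%E.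
Proof.
elim: n f => [|n IH] f f0 //=; apply: integral_ge0 => x _; exact: IH.
Qed.

(** Induction on the dimension: each slice close to [y0] contributes at least c r^n, and the slices
    fill an interval of length 2 r, of which the factor 2 is dropped. The inner integrals are not
    known to be measurable in the outer variable, hence the monotonicity lemma without
    measurability. *)
Lemma integral_rV_cube n (f : 'rV[R]_n -> \bar R) (y0 : 'rV[R]_n) (c r : R) :
  0 < r -> 0 <= c -> (forall y : 'rV[R]_n, 0 <= f y)%E ->
  (forall y : 'rV[R]_n, (forall i, `|y 0 i - y0 0 i| < r) -> (c%:E <= f y)%E) ->
  ((c * r ^+ n)%:E <= integral_rV f)%E.
Proof.
move=> r0 c0; elim: n f y0 => [|n IH] f y0 f0 fc /=.
  by rewrite expr0 mulr1; apply: fc => -[].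
pose a : R := y0 0 0; pose v0 : 'rV_n := \row_i y0 0 (lift 0 i).
set g := fun x : R => integral_rV _.
have g0 x : (0 <= g x)%E by apply: integral_rV_ge0.
have gc x : `|x - a| < r -> ((c * r ^+ n)%:E <= g x)%E.
  move=> xa; apply: (IH _ v0) => // v vi; apply: fc => i.
  rewrite mxE; case: splitP => j /= ij.
    by rewrite ord1 !mxE mulr1n; congr (`|_ - _| < _) : xa; rewrite /a; congr (y0 _ _); apply/val_inj; rewrite /= ij ord1.
  have := vi j; rewrite !mxE; congr (`|_ - y0 _ _| < _).
  by apply/val_inj; rewrite /= ij.
pose J : set R := `]a - r, a + r[%classic.
have mJ : measurable J by exact: measurable_itv.
have lJ : lebesgue_measure J = (r + r)%:E.
  have := lebesgue_measure_itv `]a - r, a + r[; rewrite /J => ->.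
  by rewrite /= lte_fin ltrD2l gtrN // -EFinB; congr EFin; ring.
pose h (x : R) : \bar R := ((c * r ^+ n) * \1_J x)%:E.
have cr0 : 0 <= c * r ^+ n by rewrite mulr_ge0 // exprn_ge0 // ltW.
have : ((c * r ^+ n.+1)%:E <= \int[@lebesgue_measure R]_x g x)%E.
  apply: (@le_trans _ _ (\int[@lebesgue_measure R]_x h x)%E).
    rewrite /h (@integralZl_indic _ _ _ lebesgue_measure setT measurableT (fun=> J)) //.
      rewrite integral_indic // setIT; apply: le_trans (lee_wpmul2l _ _).
      - have : ((c * r ^+ n.+1)%:E <= (c * r ^+ n)%:E * (r + r)%:E)%E.
          by rewrite -EFinM lee_fin exprSr mulrA ler_wpM2l //; lra.
        exact.
      - by rewrite lee_fin.
      - by rewrite -lJ.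
    by rewrite ltNge cr0.
  apply: ge0_le_integral_nomeas => x.
    by rewrite /h lee_fin mulr_ge0.
  rewrite /h indicE; have [|_] := boolP (x \in J); last by rewrite mulr0.
  rewrite inE /J /= in_itv /= => xr; rewrite mulr1; apply: gc.
  by rewrite ltr_norml; lra.
by [].
Qed.

Lemma borel_open {M : ptopologicalType} (U : set M) :
  open U -> measurable (U : set (borel M)).
Proof. by move=> oU; exact: sub_sigma_algebra. Qed.

(** In a chart the density is positive and continuous, so on a small cube inside the image of [U] it
    exceeds half its central value, and [integral_rV_cube] bounds the integral from below. *)
Lemma smooth_measure_open_gt0 n (M : ptopologicalType) (A : set (chart R n M))
    (mu : {measure set (borel M) -> \bar R}) (U : set M) :
  smooth_manifold A -> smooth_measure A mu -> open U -> U !=set0 ->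
  (0 < mu U)%E.
Proof.
move=> mA smu oU [x Ux]; have [c [Ac cx ix invx]] := chart_at mA x.
have [odom oimg invK cmap cinv] := manifold_chart mA Ac.
have [rho [srho rho0 rhoE]] := smu c Ac.
set V : set M := U `&` chart_dom c.
have oV : open V by exact: openI.
have mV := borel_open oV.
have VU : (mu V <= mu U)%E.
  by apply: le_measure; rewrite ?inE //; [exact: borel_open|exact: subIsetl].
apply: lt_le_trans VU.
rewrite (rhoE V mV (@subIsetr _ _ _)).
set y0 := chart_map c x in ix invx.
have Vinv : \near y0, V (chart_inv c y0).
  have : {for y0, continuous (chart_inv c)}.
    by move: cinv; rewrite continuous_open_subspace // => /(_ y0 (mem_set ix)).
  by move=> /(_ V); apply; rewrite /= invx; apply: open_nbhs_nbhs; split.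
have r0 := rho0 _ ix.
pose c0 := rho y0 / 2.
have c00 : 0 < c0 by rewrite divr_gt0.
have rhoc : \near y0, c0 < rho y0.
  have rc : rho y @[y --> y0] --> rho y0 := (srho [::] y0 ix).1.
  apply: (@cvgr_gt R _ _ (nbhs_filter y0) _ _ rc); rewrite /c0; lra.
have imgn : \near y0, chart_img c y0 by apply: open_nbhs_nbhs.
have near3 : nbhs y0 (chart_img c `&` ([set y | V (chart_inv c y)] `&`
    [set y | c0 < rho y])).
  have FF := nbhs_filter y0.
  by apply: filterI => //; apply: filterI.
have [e /= e0 He] := (nbhs_ballP _ _).1 near3.
have : ((c0 * e ^+ n)%:E <=
    integral_rV (fun y => (\1_(chart_map c @` V) y * rho y)%:E))%E.
  apply: (integral_rV_cube (y0 := y0)) => //; first exact: ltW.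
    move=> y; rewrite lee_fin indicE; have [|_] := boolP (y \in _).
      rewrite inE => -[z [_ cz] <-]; rewrite mul1r ltW //; apply: rho0.
      by exists z.
    by rewrite mul0r.
  move=> y ye; have [[z cz zy] [Vy ry]] : (chart_img c `&`
      ([set y | V (chart_inv c y)] `&` [set y | c0 < rho y])) y.
    apply: He; split=> // i j; rewrite ord1 /ball /= distrC; exact: ye.
  rewrite lee_fin indicE mem_set ?mul1r; first exact: ltW.
  by exists z => //; move: Vy; rewrite -zy /= invK.
by apply: lt_le_trans; rewrite lte_fin mulr_gt0 ?exprn_gt0.
Qed.

End positivity_on_open_sets.

(** * Auxiliary functions of one variable *)

Section smooth_real_theory.
Context {R : realType}.
Implicit Types (F G : R -> R) (p : {poly R}) (x y : R).

(** The algebra generated by the smooth functions under sums, products and composition is stable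
    under [derive1]. By [smooth_real_coind] it then contains only smooth functions, which avoids any
    formula for iterated derivatives of products or composites. *)
Inductive smooth_alg : (R -> R) -> Prop :=
| smooth_alg_base F : smooth_real F -> smooth_alg F
| smooth_algD F G : smooth_alg F -> smooth_alg G ->
    smooth_alg (fun x => F x + G x)
| smooth_algM F G : smooth_alg F -> smooth_alg G ->
    smooth_alg (fun x => F x * G x)
| smooth_algC F G : smooth_real F -> smooth_alg G ->
    smooth_alg (fun x => F (G x)).

Lemma smooth_real_coind (P : (R -> R) -> Prop) :
  (forall F, P F -> (forall x, derivable F x 1) /\ P (derive1 F)) ->
  forall F, P F -> smooth_real F.
Proof.
move=> HP F PF m; suff : P (derive1n m F) by move/HP => -[].
by elim: m => [//|m /HP[_]]; rewrite derive1nS.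
Qed.

Lemma smooth_alg_real F : smooth_alg F -> smooth_real F.
Proof.
apply: smooth_real_coind => {}F; elim=> {F}[F sF|F G _ [dF F'] _ [dG G']|
    F G aF [dF F'] aG [dG G']|F G sF aG [dG G']].
- by split; [exact: (sF 0%N)|exact/smooth_alg_base/smooth_real_derive1].
- split=> [x|]; first exact: derivableD.
  rewrite (_ : derive1 _ = fun x => derive1 F x + derive1 G x).
    exact: smooth_algD.
  by apply/funext => x; rewrite !derive1E; exact: deriveD.
- split=> [x|]; first exact: derivableM.
  rewrite (_ : derive1 _ = fun x => F x * derive1 G x + G x * derive1 F x).
    by apply: smooth_algD; apply: smooth_algM.
  by apply/funext => x; rewrite !derive1E; exact: deriveM.
- split=> [x|].
    by have [] := is_derive_compl (dG x) (sF 0%N (G x)).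
  rewrite (_ : derive1 _ = fun x => derive1 F (G x) * derive1 G x).
    apply: smooth_algM => //.
    by apply: smooth_algC => //; exact: smooth_real_derive1.
  apply/funext => x; rewrite (derive1E G).
  by rewrite derive1E; have [_] := is_derive_compl (dG x) (sF 0%N (G x)).
Qed.

Lemma is_derive_comp1 F G x f' g' : is_derive x 1 G g' ->
  is_derive (G x) 1 F f' -> is_derive x 1 (fun y => F (G y)) (f' * g').
Proof.
move=> [dG <-] [dF <-]; rewrite -(derive1E F); exact: is_derive_compl.
Qed.

Lemma is_derive_mul1 F G x f' g' : is_derive x 1 F f' ->
  is_derive x 1 G g' -> is_derive x 1 (fun y => F y * G y) (F x * g' + G x * f').
Proof. by move=> dF dG; exact: is_deriveM. Qed.

Lemma smooth_real_cst (a : R) : smooth_real (fun=> a).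
Proof.
apply: (@smooth_real_coind [set fun=> a | a in setT]); last by exists a.
move=> _ [b _ <-]; split=> [x|]; first exact: derivable_cst.
by exists 0 => //; apply/funext => x; rewrite derive1_cst.
Qed.

Lemma smooth_realD F G : smooth_real F -> smooth_real G ->
  smooth_real (fun x => F x + G x).
Proof.
by move=> sF sG; apply: smooth_alg_real; apply: smooth_algD; exact: smooth_alg_base.
Qed.

Lemma smooth_realM F G : smooth_real F -> smooth_real G ->
  smooth_real (fun x => F x * G x).
Proof.
by move=> sF sG; apply: smooth_alg_real; apply: smooth_algM; exact: smooth_alg_base.
Qed.

Lemma smooth_real_comp F G : smooth_real F -> smooth_real G ->
  smooth_real (fun x => F (G x)).
Proof.
by move=> sF sG; apply: smooth_alg_real; apply: smooth_algC => //; exact: smooth_alg_base.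
Qed.

Lemma smooth_real_id : smooth_real (fun x : R => x).
Proof.
move=> [|m] x; first exact: derivable_id.
rewrite derive1Sn (_ : derive1 (fun x : R => x) = fun=> (1 : R)); first exact: smooth_real_cst.
by apply/funext => y; exact: derive1_id.
Qed.

Lemma horner_le_expR p : exists2 C, 0 <= C & forall y, 0 <= y -> `|p.[y]| <= C * expR y.
Proof.
exists (\sum_(i < size p) `|p`_i| * i`!%:R).
  by apply: sumr_ge0 => i _; rewrite mulr_ge0.
move=> y y0; rewrite horner_coef mulr_suml (le_trans (ler_norm_sum _ _ _)) //.
apply: ler_sum => i _; rewrite normrM -mulrA ler_wpM2l // normrX ger0_norm //.
case: i => -[|i] _ /=.
  by rewrite expr0 mul1r -expR0 ler_expR.
have := le_trans (ler_wpDl ler01 (lexx _)) (expR_ge1Dxn i y0).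
by rewrite ler_pdivrMr ?ltr0n ?fact_gt0 // mulrC.
Qed.

(** Differentiation preserves this family, replacing p by X^2 (p - p'), so its members are smooth by
    [smooth_real_coind]. The case p = 1 is the classical function exp(-1/x) that is flat at 0. *)
Definition flat p x : R := if 0 < x then p.[x^-1] * expR (- x^-1) else 0.

Lemma is_derive_flat p x : is_derive x 1 (flat p) (flat ('X^2 * (p - p^`())) x).
Proof.
have [x0|x0|->] := ltgtP x 0.
- have nf : \near x, cst 0 x = flat p x.
    near=> z; rewrite /flat /= ifF //; apply/negbTE; rewrite -leNgt ltW //.
    by near: z; exact: lt_nbhsl.
  apply: near_eq_is_derive nf _; rewrite /flat ifF; first exact: is_derive_cst.
  by apply/negbTE; rewrite -leNgt ltW.
- have nf : \near x, (fun x => p.[x^-1] * expR (- x^-1)) x = flat p x.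
    near=> z; rewrite /flat /= ifT //.
    by near: z; exact: lt_nbhsr.
  apply: near_eq_is_derive nf _; rewrite /flat x0.
  have di : is_derive x 1 (fun x : R => x^-1) (- x ^- 2).
    have dx : derivable (fun x : R => x) x 1 by exact: derivable_id.
    apply: DeriveDef; first exact: (derivableV (lt0r_neq0 x0) dx).
    by rewrite (deriveV (lt0r_neq0 x0) dx) derive_id [_ *: _]mulr1.
  have dp : is_derive (x^-1) 1 (horner p) (p^`().[x^-1]).
    by apply: DeriveDef; [exact: derivable_horner|rewrite -derive1E -derivE].
  have dn : is_derive (- x^-1) 1 (@expR R) (expR (- x^-1)) by exact: is_derive_expR.
  have dN : is_derive x 1 (fun x : R => - x^-1) (x ^- 2).
    by rewrite -[X in is_derive _ _ _ X]opprK; exact: is_deriveN.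
  have H : is_derive x 1 (fun y => p.[y^-1] * expR (- y^-1))
    (p.[x^-1] * (expR (- x^-1) * x ^- 2) +
     expR (- x^-1) * (p^`().[x^-1] * - x ^- 2)).
    exact: is_derive_mul1 (is_derive_comp1 di dp) (is_derive_comp1 dN dn).
  apply: (is_derive_eq H); rewrite hornerM hornerXn hornerD hornerN -exprVn.
  move: (expR (- x^-1)) (p.[x^-1]) (p^`().[x^-1]) (x^-1) => *; ring.
(* At 0 the difference quotient is p(1/h) exp(-1/h) / h = (1/h)^2 p(1/h) exp(-1/h) h for h > 0, so
   an exponential bound for the polynomial X^2 p makes it O(h). *)
- have [C C0 HC] := horner_le_expR ('X^2 * p).
  have f0 : flat p 0 = 0 by rewrite /flat ltxx.
  have bnd h : `|h^-1 * flat p h| <= C * `|h|.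
    rewrite /flat; case: ifPn => [h0|_]; last by rewrite mulr0 normr0 mulr_ge0.
    have hi : 0 <= h^-1 by rewrite invr_ge0 ltW.
    have := HC _ hi; rewrite hornerM hornerXn => Hh.
    rewrite (gtr0_norm h0) expRN.
    have -> : h^-1 * (p.[h^-1] / expR h^-1) = (h^-1 ^+ 2 * p.[h^-1]) / expR h^-1 * h.
      by field; rewrite gt_eqF ?expR_gt0 // gt_eqF.
    rewrite normrM (gtr0_norm h0) ler_pM2r // normrM.
    rewrite [`|(expR _)^-1|]ger0_norm ?invr_ge0 ?expR_ge0 //.
    by rewrite ler_pdivrMr ?expR_gt0.
  have : (fun h => h^-1 *: ((flat p \o shift 0) (h *: (1 : R)) - flat p 0)) @ 0^' --> (0 : R).
    apply/cvgrPdist_le => e e0.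
    near=> h; rewrite /= f0 !subr0 sub0r normrN addr0 [_%:A]mulr1.
    apply: le_trans (bnd h) _.
    have : `|h| <= e / (C + 1).
      near: h; apply: dnbhs0_le; rewrite divr_gt0 //; lra.
    rewrite ler_pdivlMr; last lra.
    move=> he; apply: le_trans he; rewrite mulrC ler_wpM2l //; lra.
  move=> cv; apply: DeriveDef; first exact: cvgP cv.
  by rewrite /flat ltxx; exact: cvg_lim cv.
Unshelve. all: by end_near. Qed.

Lemma smooth_flat p : smooth_real (flat p).
Proof.
apply: (@smooth_real_coind [set flat q | q in setT]); last by exists p.
move=> _ [q _ <-]; split=> [x|]; first by have [] := is_derive_flat q x.
exists ('X^2 * (q - q^`())) => //; apply/funext => x; rewrite derive1E.
by have [_ ->] := is_derive_flat q x.
Qed.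

Lemma derive1_flat p x : derive1 (flat p) x = flat ('X^2 * (p - p^`())) x.
Proof. by rewrite derive1E; have [_] := is_derive_flat p x. Qed.

Lemma is_derive_smooth F x : smooth_real F -> is_derive x 1 F (derive1 F x).
Proof. by move=> sF; rewrite derive1E; apply: derivableP; exact: (sF 0%N). Qed.

Lemma smooth_real_MVT F x y : smooth_real F ->
  exists2 c, F y - F x = derive1 F c * (y - x) &
    Num.min x y <= c <= Num.max x y.
Proof.
move=> sF; have cF : continuous F by exact: smooth_real_continuous.
have dF (c : R) : is_derive c 1 F (derive1 F c) by exact: is_derive_smooth.
have [xy|yx|->] := ltgtP x y.
- have [c] := MVT xy (fun c _ => dF c) (continuous_subspaceT cF).
  by rewrite in_itv /= => /andP[/ltW xc /ltW cy] E; exists c; rewrite // xc.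
- have [c] := MVT yx (fun c _ => dF c) (continuous_subspaceT cF).
  rewrite in_itv /= => /andP[/ltW xc /ltW cy] E; exists c; last by rewrite xc.
  by rewrite -(opprB (F x)) E -mulrN opprB.
- by exists y; rewrite ?subrr ?mulr0 ?lexx.
Qed.

(** The tangent is taken at the endpoint [y]. In a time step [y] is the new value, and this is what
    makes the energy scheme implicit. *)
Lemma smooth_real_convex F x y : smooth_real F ->
  (forall z, 0 <= derive1 (derive1 F) z) -> F y - F x <= derive1 F y * (y - x).
Proof.
move=> sF F2; have sF' := smooth_real_derive1 sF.
have mono a b : a <= b -> derive1 F a <= derive1 F b.
  move=> ab; rewrite -subr_ge0; have [c -> _] := smooth_real_MVT a b sF'.
  by rewrite mulr_ge0 // subr_ge0.
have [c -> ] := smooth_real_MVT x y sF.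
have [xy|/ltW yx] := leP x y.
  move=> /andP[_ cy]; apply: ler_wpM2r; first by rewrite subr_ge0.
  exact: mono.
move=> /andP[yc _]; apply: ler_wnM2r; first by rewrite subr_le0.
exact: mono.
Qed.

Definition expinv := flat 1.

Lemma smooth_expinv : smooth_real expinv. Proof. exact: smooth_flat. Qed.

Lemma derive1_expinv x : derive1 expinv x = flat 'X^2 x.
Proof. by rewrite /expinv derive1_flat derivC subr0 mulr1. Qed.

Lemma expinv_pos x : 0 < x -> expinv x = expR (- x^-1).
Proof. by move=> x0; rewrite /expinv /flat x0 hornerC mul1r. Qed.

Lemma expinv_neg x : x <= 0 -> expinv x = 0.
Proof. by rewrite /expinv /flat leNgt; case: ifP. Qed.

Lemma derive1_expinv_pos x : 0 < x -> derive1 expinv x = x ^- 2 * expinv x.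
Proof. by move=> x0; rewrite derive1_expinv expinv_pos // /flat x0 hornerXn exprVn. Qed.

Lemma derive1_expinv_neg x : x <= 0 -> derive1 expinv x = 0.
Proof. by rewrite derive1_expinv /flat leNgt; case: ifP. Qed.

Lemma expinv_ge0 x : 0 <= expinv x.
Proof.
have [x0|x0] := ltP 0 x; first by rewrite expinv_pos // expR_ge0.
by rewrite expinv_neg.
Qed.

Lemma expinv_gt0 x : 0 < x -> 0 < expinv x.
Proof. by move=> x0; rewrite expinv_pos // expR_gt0. Qed.

Lemma derive1_expinv_ge0 x : 0 <= derive1 expinv x.
Proof.
have [x0|x0] := ltP 0 x; last by rewrite derive1_expinv_neg.
by rewrite derive1_expinv_pos // mulr_ge0 ?expinv_ge0 // invr_ge0 exprn_ge0 // ltW.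
Qed.

Lemma expinv_le x y : x <= y -> expinv x <= expinv y.
Proof.
move=> xy; rewrite -subr_ge0; have [c -> _] := smooth_real_MVT x y smooth_expinv.
by rewrite mulr_ge0 ?derive1_expinv_ge0 // subr_ge0.
Qed.

Lemma expinv_le1 x : expinv x <= 1.
Proof.
have [x0|x0] := ltP 0 x; last by rewrite expinv_neg.
by rewrite expinv_pos // expR_le1 oppr_le0 invr_ge0 ltW.
Qed.

Lemma expinv_le_id x : 0 <= x -> expinv x <= x.
Proof.
rewrite le_eqVlt => /predU1P[<-|x0]; first by rewrite expinv_neg.
rewrite expinv_pos // expRN invf_ple ?posrE ?expR_gt0 //.
by apply: le_trans (expR_ge1Dx _); rewrite lerDr.
Qed.

Lemma derive1_expinv_le2 x : derive1 expinv x <= 2.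
Proof.
have [x0|x0] := ltP 0 x; last by rewrite derive1_expinv_neg.
rewrite derive1_expinv_pos // expinv_pos // expRN ler_pdivrMr ?expR_gt0 //.
have y0 : 0 <= x^-1 by rewrite invr_ge0 ltW.
have := expR_ge1Dxn 1 y0; rewrite -exprVn (_ : 2`!%:R = 2 :> R) //.
move: (expR _) (x^-1 ^+ 2) => a b; lra.
Qed.

(** A smooth convex substitute for the squared positive part. It vanishes exactly on x <= 0, and
    with x+ = max(x, 0) it satisfies phi' <= 3 x+ and phi'^2 <= 2 (x+)^2 phi'', the last being the
    condition under which an energy estimate with cut-off closes. *)
Definition softplus2 x := x ^+ 2 * expinv x.

Lemma smooth_softplus2 : smooth_real softplus2.
Proof.
have := smooth_realM (smooth_realM smooth_real_id smooth_real_id) smooth_expinv.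
exact.
Qed.

Lemma derive1_softplus2 x : derive1 softplus2 x = (2 * x + 1) * expinv x.
Proof.
rewrite derive1E.
have d1 := is_derive_smooth x smooth_expinv.
have d0 : is_derive x 1 (fun x : R => x ^+ 2) (2 * x).
  have := @is_derive_mul1 (fun x => x) (fun x => x) x 1 1 (is_derive_id _ _) (is_derive_id _ _).
  by move=> H; apply: (is_derive_eq H); lra.
have [_ ->] := is_derive_mul1 d0 d1.
have [x0|x0] := ltP 0 x.
  by rewrite derive1_expinv_pos //; field; rewrite gt_eqF.
by rewrite derive1_expinv_neg // expinv_neg //; lra.
Qed.

Lemma derive2_softplus2 x : derive1 (derive1 softplus2) x =
  2 * expinv x + (2 * x + 1) * derive1 expinv x.
Proof.
rewrite (_ : derive1 softplus2 = fun x => (2 * x + 1) * expinv x).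
  rewrite derive1E.
  have d1 := is_derive_smooth x smooth_expinv.
  have d0 : is_derive x 1 (fun x : R => 2 * x + 1) 2.
    have H := is_deriveD (is_deriveZ 2 (is_derive_id x (1:R))) (is_derive_cst (1:R) x (1:R)).
    by apply: (is_derive_eq H); rewrite addr0 [_ *: _]mulr1.
  by have [_ ->] := is_derive_mul1 d0 d1; lra.
by apply/funext => y; rewrite derive1_softplus2.
Qed.

Lemma softplus2_neg x : x <= 0 -> softplus2 x = 0.
Proof. by move=> x0; rewrite /softplus2 expinv_neg // mulr0. Qed.

Lemma softplus2_ge0 x : 0 <= softplus2 x.
Proof. by rewrite mulr_ge0 ?sqr_ge0 ?expinv_ge0. Qed.

Lemma softplus2_gt0 x : 0 < x -> 0 < softplus2 x.
Proof. by move=> x0; rewrite mulr_gt0 ?exprn_gt0 ?expinv_gt0. Qed.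

Lemma derive1_softplus2_neg x : x <= 0 -> derive1 softplus2 x = 0.
Proof. by move=> x0; rewrite derive1_softplus2 expinv_neg // mulr0. Qed.

Lemma derive1_softplus2_ge0 x : 0 <= derive1 softplus2 x.
Proof.
have [x0|x0] := ltP 0 x; last by rewrite derive1_softplus2_neg.
by rewrite derive1_softplus2 mulr_ge0 ?expinv_ge0 //; lra.
Qed.

Lemma derive1_softplus2_le x : derive1 softplus2 x <= 3 * Num.max x 0.
Proof.
have [x0|x0] := ltP 0 x; last by rewrite derive1_softplus2_neg // mulr0.
have := expinv_le_id (ltW x0); have := expinv_le1 x; have := expinv_ge0 x.
by rewrite derive1_softplus2; move: (expinv x) => g; nra.
Qed.

Lemma derive2_softplus2_ge0 x : 0 <= derive1 (derive1 softplus2) x.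
Proof.
rewrite derive2_softplus2; have [x0|x0] := ltP 0 x; last first.
  by rewrite expinv_neg // derive1_expinv_neg //; lra.
by rewrite addr_ge0 // mulr_ge0 ?expinv_ge0 ?derive1_expinv_ge0 //; lra.
Qed.

(* [(2 x + 1)^2 <= 2 (2 x^2 + 2 x + 1)] and [expinv <= 1] *)
Lemma softplus2_quotient x :
  derive1 softplus2 x ^+ 2 <= 2 * Num.max x 0 ^+ 2 * derive1 (derive1 softplus2) x.
Proof.
have [x0|x0] := ltP 0 x; last first.
  by rewrite derive1_softplus2_neg // !expr0n /= mulr0 mul0r.
rewrite derive2_softplus2 derive1_softplus2 derive1_expinv_pos //.
have g1 := expinv_le1 x; have g0 := expinv_ge0 x.
have -> : 2 * x ^+ 2 * (2 * expinv x + (2 * x + 1) * (x ^- 2 * expinv x)) =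
  2 * (2 * x ^+ 2 + 2 * x + 1) * expinv x by field; rewrite gt_eqF.
move: (expinv x) g0 g1 => g g0 g1; rewrite exprMn.
have : g ^+ 2 <= g by rewrite expr2; nra.
move: (g ^+ 2) => g2 g2g; nra.
Qed.

(** A smooth transition from 0 on x <= 1/2 to 1 on x >= 1: the inner difference is nonpositive up to
    1/2 and equals [expinv 2^-1] from 1 on, and the outer [expinv] flattens it at 1/2. Nesting two
    copies of [expinv] spares the integration of a bump function. *)
Definition step x := expinv (expinv 2^-1 - expinv (1 - x)) / expinv (expinv 2^-1).

Lemma smooth_step : smooth_real step.
Proof.
apply: smooth_realM; last exact: smooth_real_cst.
apply: smooth_real_comp smooth_expinv _.
rewrite (_ : (fun x => _) = fun x => expinv 2^-1 + (-1) * expinv (1 + (-1) * x)).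
  apply: smooth_realD; first exact: smooth_real_cst.
  apply: smooth_realM; first exact: smooth_real_cst.
  apply: smooth_real_comp smooth_expinv _.
  apply: smooth_realD; first exact: smooth_real_cst.
  by apply: smooth_realM; [exact: smooth_real_cst|exact: smooth_real_id].
by apply/funext => x; rewrite !mulN1r.
Qed.

Lemma step_den_gt0 : 0 < expinv (expinv 2^-1).
Proof. by do 2 apply: expinv_gt0. Qed.

Lemma step_ge0 x : 0 <= step x.
Proof. by rewrite divr_ge0 ?expinv_ge0. Qed.

Lemma step_le1 x : step x <= 1.
Proof.
rewrite ler_pdivrMr ?step_den_gt0 // mul1r expinv_le //.
by rewrite gerBl expinv_ge0.
Qed.

Lemma step_eq0 x : x <= 2^-1 -> step x = 0.
Proof.
move=> x2; rewrite /step expinv_neg ?mul0r // subr_le0 expinv_le //; lra.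
Qed.

Lemma step_eq1 x : 1 <= x -> step x = 1.
Proof.
move=> x1; rewrite /step (@expinv_neg (1 - x)) ?subr_le0 // subr0 divff //.
by rewrite gt_eqF ?step_den_gt0.
Qed.

Lemma derive1_step x : derive1 step x =
  derive1 expinv (expinv 2^-1 - expinv (1 - x)) * derive1 expinv (1 - x) /
    expinv (expinv 2^-1).
Proof.
have d1 : is_derive x 1 (fun x => 1 - x) (-1).
  have H := is_deriveB (is_derive_cst (1:R) x (1:R)) (is_derive_id x (1:R)).
  by apply: (is_derive_eq H); rewrite sub0r.
have d2 := is_derive_comp1 d1 (is_derive_smooth (1 - x) smooth_expinv).
have d3 : is_derive x 1 (fun x => expinv 2^-1 - expinv (1 - x)) (derive1 expinv (1 - x)).
  have H := is_deriveB (is_derive_cst (expinv 2^-1) x (1:R)) d2.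
  by apply: (is_derive_eq H); rewrite mulrN1 sub0r opprK.
have d4 := is_derive_comp1 d3 (is_derive_smooth _ smooth_expinv).
have d5 := is_derive_mul1 d4 (is_derive_cst (expinv (expinv 2^-1))^-1 x (1:R)).
rewrite derive1E; have [_ ->] := d5.
by rewrite mulr0 add0r mulrC.
Qed.

Lemma derive1_step_eq0 x : (x <= 2^-1) || (1 <= x) -> derive1 step x = 0.
Proof.
rewrite derive1_step => /orP[x2|x1]; last first.
  by rewrite (@derive1_expinv_neg (1 - x)) ?subr_le0 // mulr0 mul0r.
rewrite derive1_expinv_neg ?mul0r // subr_le0 expinv_le //; lra.
Qed.

Lemma derive2_step_eq0 x : (x < 2^-1) || (1 < x) -> derive1 (derive1 step) x = 0.
Proof.
move=> xx; rewrite derive1E (@near_eq_derive _ _ _ _ (cst 0)) ?derive_cst //.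
case/orP : xx => xx; near=> z; apply: derive1_step_eq0; apply/orP.
  by left; apply: ltW; near: z; exact: lt_nbhsl.
by right; apply: ltW; near: z; exact: lt_nbhsr.
Unshelve. all: by end_near. Qed.

Lemma derive1_step_bounded : exists2 C, 0 <= C & forall x, `|derive1 step x| <= C.
Proof.
exists (4 / expinv (expinv 2^-1)); first by rewrite divr_ge0 // expinv_ge0.
move=> x; rewrite derive1_step ger0_norm; last first.
  by rewrite !mulr_ge0 ?derive1_expinv_ge0 // invr_ge0 expinv_ge0.
rewrite ler_pM2r ?invr_gt0 ?step_den_gt0 // (_ : 4 = 2 * 2); last by lra.
by apply: ler_pM; rewrite ?derive1_expinv_ge0 ?derive1_expinv_le2.
Qed.

End smooth_real_theory.

(** Over N equal steps the quadratic errors add up to N K (T / N)^2 = K T^2 / N, which is below any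
    positive gap for N large. This replaces integration in time, with no derivative of [psi]
    involved. *)
Lemma increments_le {R : realType} (psi : R -> R) (T B K : R) : 0 <= T ->
  (forall s t, 0 <= s -> s <= t -> t <= T ->
     psi t - psi s <= (t - s) * B + K * (t - s) ^+ 2) ->
  psi T <= psi 0 + T * B.
Proof.
move=> T0 H; rewrite leNgt; apply/negP => Hlt.
pose dl := psi T - psi 0 - T * B.
have dl0 : 0 < dl by rewrite /dl; lra.
pose N := (Num.truncn (K * T ^+ 2 / dl)).+1.
have N0 : (0 : R) < N%:R by rewrite ltr0n.
have HN : K * T ^+ 2 / dl < N%:R by exact: truncnS_gt.
pose h := T / N%:R.
have h0 : 0 <= h by rewrite divr_ge0 // ltW.
have hN : N%:R * h = T by rewrite /h mulrC divfK // gt_eqF.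
have step i : (i <= N)%N -> psi (i%:R * h) - psi 0 <= i%:R * (h * B + K * h ^+ 2).
  elim: i => [|i IH] iN; first by rewrite !mul0r subrr.
  have := IH (ltnW iN).
  have iT : i.+1%:R * h <= T by rewrite -hN ler_wpM2r // ler_nat.
  have hs : i.+1%:R * h - i%:R * h = h by rewrite -mulrBl -natrB // subSnn mul1r.
  have := H (i%:R * h) (i.+1%:R * h); rewrite hs.
  rewrite mulr_ge0 // => /(_ isT); rewrite ler_wpM2r ?ler_nat // => /(_ isT iT).
  rewrite -(natr1 i) mulrDl mul1r mulrDl mul1r.
  by move: (psi _) (psi _) (psi _) => *; lra.
have := step N (leqnn N); rewrite hN mulrDr mulrA hN.
rewrite -/dl => Hs.
have : dl <= N%:R * (K * h ^+ 2) by rewrite /dl; lra.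
have -> : N%:R * (K * h ^+ 2) = K * T ^+ 2 / N%:R.
  by rewrite /h; field; rewrite gt_eqF.
rewrite ler_pdivlMr // => Hd.
move: HN; rewrite ltr_pdivrMr // => /(le_lt_trans Hd).
by rewrite mulrC ltxx.
Qed.

(** * Integration of real functions against [mu] *)

Section integrals.
Context {R : realType} {M : ptopologicalType}.
Variable mu : {measure set (borel M) -> \bar R}.
Implicit Types (f g : M -> R).

Definition intg f := mu.-integrable [set: borel M] (EFin \o (f : borel M -> R)).
Definition meas f := measurable_fun [set: borel M] (f : borel M -> R).

Lemma intg_meas f : intg f -> meas f.
Proof. by move=> /measurable_int /measurable_EFinP. Qed.

Lemma continuous_meas f : continuous f -> meas f.
Proof.
move=> /continuousP cf; apply: (measurability _ (RGenOpens.measurableE R)).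
move=> _ [_ [a [b ->] <-]]; rewrite setTI; apply: sub_sigma_algebra.
by apply: cf; exact: interval_open.
Qed.

Lemma intgD f g : intg f -> intg g -> intg (fun x => f x + g x).
Proof. by move=> If Ig; exact: (integrableD measurableT If Ig). Qed.

Lemma intgZ a f : intg f -> intg (fun x => a * f x).
Proof. by move=> If; exact: (integrableZl measurableT a If). Qed.

Lemma intgN f : intg f -> intg (fun x => - f x).
Proof.
move=> /(intgZ (-1)); rewrite (_ : (fun x => -1 * f x) = fun x => - f x) //.
by apply/funext => x; rewrite mulN1r.
Qed.

Lemma intgB f g : intg f -> intg g -> intg (fun x => f x - g x).
Proof. by move=> If Ig; exact: intgD If (intgN Ig). Qed.

Lemma le_intg f g : meas f -> (forall x, `|f x| <= g x) -> intg g -> intg f.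
Proof.
move=> mf fg Ig; apply: (le_integrable measurableT _ _ Ig).
  exact/measurable_EFinP.
by move=> x _ /=; rewrite lee_fin (le_trans (fg x)) // ler_norm.
Qed.

Lemma intg_norm f : intg f -> intg (fun x => `|f x|).
Proof. by move=> If; exact: (integrable_norm If). Qed.

Lemma IntD f g : intg f -> intg g ->
  \int[mu]_x (f x + g x) = \int[mu]_x f x + \int[mu]_x g x.
Proof. by move=> If Ig; exact: (RintegralD measurableT If Ig). Qed.

Lemma IntB f g : intg f -> intg g ->
  \int[mu]_x (f x - g x) = \int[mu]_x f x - \int[mu]_x g x.
Proof. by move=> If Ig; exact: (RintegralB measurableT If Ig). Qed.

Lemma IntZ a f : intg f -> \int[mu]_x (a * f x) = a * \int[mu]_x f x.
Proof. by move=> If; exact: (RintegralZl a measurableT If). Qed.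

Lemma IntN f : intg f -> \int[mu]_x (- f x) = - \int[mu]_x f x.
Proof.
move=> If; rewrite -mulN1r -IntZ //; apply: eq_Rintegral => x _.
by rewrite mulN1r.
Qed.

Lemma le_Int f g : intg f -> intg g -> (forall x, f x <= g x) ->
  \int[mu]_x f x <= \int[mu]_x g x.
Proof. by move=> If Ig fg; apply: (le_Rintegral measurableT If Ig) => x _. Qed.

Lemma Int_ge0 f : (forall x, 0 <= f x) -> 0 <= \int[mu]_x f x.
Proof. by move=> f0; exact: Rintegral_ge0. Qed.

Lemma eq_Int f g : (forall x, f x = g x) -> \int[mu]_x f x = \int[mu]_x g x.
Proof. by move=> fg; apply: eq_Rintegral => x _. Qed.

Lemma eq_intg f g : (forall x, f x = g x) -> intg f -> intg g.
Proof. by move=> /funext ->. Qed.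

Lemma norm_Int f : intg f -> `|\int[mu]_x f x| <= \int[mu]_x `|f x|.
Proof. by move=> If; exact: (le_normr_Rintegral measurableT If). Qed.

Lemma EFin_Int f : intg f -> (\int[mu]_x f x)%:E = (\int[mu]_x (f x)%:E)%E.
Proof.
by move=> If; rewrite fineK //; exact: (integrable_fin_num measurableT If).
Qed.

Lemma measM f g : meas f -> meas g -> meas (fun x => f x * g x).
Proof. by move=> mf mg; exact: measurable_funM. Qed.

Lemma measD f g : meas f -> meas g -> meas (fun x => f x + g x).
Proof. by move=> mf mg; exact: measurable_funD. Qed.

Lemma L2_intg f : L2 mu f <-> meas f /\ intg (fun x => f x ^+ 2).
Proof.
split=> -[mf If]; split => //.
  apply/integrableP; split; first exact/measurable_EFinP/measurable_funX.
  by under eq_integral do rewrite /= ger0_norm ?sqr_ge0 //.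
move: If => /integrableP[_]; apply: le_lt_trans.
by under [leRHS]eq_integral do rewrite /= ger0_norm ?sqr_ge0 //.
Qed.

Lemma L2_intgM f g : L2 mu f -> L2 mu g -> intg (fun x => f x * g x).
Proof.
move=> /L2_intg[mf If] /L2_intg[mg Ig].
apply: le_intg (intgD If Ig) => [|x]; first exact: measM.
move: (f x) (g x) => a b; rewrite ler_norml; apply/andP; split; nra.
Qed.

Lemma L2D f g : L2 mu f -> L2 mu g -> L2 mu (fun x => f x + g x).
Proof.
move=> f2 g2; have Ifg := L2_intgM f2 g2.
move: f2 g2 => /L2_intg[mf If] /L2_intg[mg Ig]; apply/L2_intg; split.
  exact: measD.
apply: eq_intg (intgD (intgD If Ig) (intgZ 2 Ifg)) => x.
by move: (f x) (g x) => a b; ring.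
Qed.

Lemma L2Z a f : L2 mu f -> L2 mu (fun x => a * f x).
Proof.
move=> /L2_intg[mf If]; apply/L2_intg; split.
  by apply: measM => //; exact: measurable_cst.
by apply: eq_intg (intgZ (a ^+ 2) If) => x; rewrite exprMn.
Qed.

Lemma L2B f g : L2 mu f -> L2 mu g -> L2 mu (fun x => f x - g x).
Proof.
move=> f2 g2; rewrite (_ : (fun x => _) = fun x => f x + -1 * g x).
  exact: L2D f2 (L2Z _ g2).
by apply/funext => x; rewrite mulN1r.
Qed.

Lemma cauchy_schwarz_L2 f g : L2 mu f -> L2 mu g ->
  (\int[mu]_x (f x * g x)) ^+ 2 <=
  (\int[mu]_x (f x ^+ 2)) * \int[mu]_x (g x ^+ 2).
Proof.
move=> f2 g2; have Ifg := L2_intgM f2 g2.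
move: f2 g2 => /L2_intg[mf If] /L2_intg[mg Ig].
set a := \int[mu]_x (f x ^+ 2); set b := \int[mu]_x (f x * g x).
set c := \int[mu]_x (g x ^+ 2).
have H t : 0 <= a + t * (2 * b) + t ^+ 2 * c.
  have := @Int_ge0 (fun x => (f x + t * g x) ^+ 2) (fun x => sqr_ge0 _).
  rewrite (eq_Int (g := fun x => f x ^+ 2 + t * (2 * (f x * g x)) + t ^+ 2 * (g x ^+ 2))).
    rewrite IntD; [|by apply: intgD => //; do 2 apply: intgZ|exact: intgZ].
    by rewrite IntD // ?IntZ //; do ?apply: intgZ.
  by move=> x; move: (f x) (g x) => u v; ring.
have a0 : 0 <= a by apply: Int_ge0 => x; exact: sqr_ge0.
have c0 : 0 <= c by apply: Int_ge0 => x; exact: sqr_ge0.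
have [cp|] := ltP 0 c; last first.
  move=> cn; have c00 : c = 0 by lra.
  move: H; rewrite c00 => H; rewrite mulr0.
  have [->|bn] := eqVneq b 0; first by rewrite expr0n.
  (* With c = 0 the quadratic in t is affine of slope 2 b; this t would give it the value -1. *)
  have := H (- (a + 1) / (2 * b)); rewrite mulrC => {H}.
  have -> : 2 * b * (- (a + 1) / (2 * b)) = - (a + 1).
    by field; rewrite bn.
  by lra.
have := H (- b / c).
have -> : a + - b / c * (2 * b) + (- b / c) ^+ 2 * c = (a * c - b ^+ 2) / c.
  by field; rewrite gt_eqF.
by rewrite pmulr_lge0 ?invr_gt0 // subr_ge0.
Qed.

End integrals.

(** * Energy estimates *)

Section psd_form.
Context {R : realType} {M : ptopologicalType} (S : (M -> R) -> Prop).

(** Shared by [Gamma], [GZ] and the combinations a [Gamma] + b [GZ], so that the Cauchy-Schwarz and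
    Young inequalities and the convexity of the quadratic form are proved once. *)
Record psd_form (q : (M -> R) -> (M -> R) -> (M -> R)) : Prop := {
  pf_S : forall f g, S f -> S g -> S (q f g);
  pfC : forall f g x, S f -> S g -> q f g x = q g f x;
  pfD : forall f g h x, S f -> S g -> S h ->
    q (fun y => f y + g y) h x = q f h x + q g h x;
  pfZ : forall a f g x, S f -> S g -> q (fun y => a * f y) g x = a * q f g x;
  pf_ge0 : forall f x, S f -> 0 <= q f f x }.

Variable q : (M -> R) -> (M -> R) -> (M -> R).
Hypothesis qf : psd_form q.
Hypothesis SD : forall f g, S f -> S g -> S (fun x => f x + g x).
Hypothesis SZ : forall a f, S f -> S (fun x => a * f x).

Lemma pf_combine a b f g x : S f -> S g ->
  q (fun y => a * f y + b * g y) (fun y => a * f y + b * g y) x =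
  a ^+ 2 * q f f x + 2 * a * b * q f g x + b ^+ 2 * q g g x.
Proof.
move=> Sf Sg; have Saf := SZ a Sf; have Sbg := SZ b Sg.
have Sh := SD Saf Sbg.
rewrite (pfD qf) // (pfZ qf) // (pfZ qf) //.
rewrite (pfC qf _ Sf Sh) (pfC qf _ Sg Sh).
rewrite !(pfD qf) // !(pfZ qf) //.
rewrite (pfC qf _ Sg Sf).
by move: (q f f x) (q f g x) (q g g x) => *; ring.
Qed.

Lemma pf_cauchy_schwarz f g x : S f -> S g ->
  q f g x ^+ 2 <= q f f x * q g g x.
Proof.
move=> Sf Sg; set a := q f f x; set b := q f g x; set c := q g g x.
have H t : 0 <= a + t * (2 * b) + t ^+ 2 * c.
  have := pf_ge0 qf x (SD (SZ 1 Sf) (SZ t Sg)).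
  by rewrite pf_combine // -/a -/b -/c; move: a b c => a b c; nra.
have a0 : 0 <= a by exact: pf_ge0.
have c0 : 0 <= c by exact: pf_ge0.
have [cp|] := ltP 0 c; last first.
  move=> cn; have c00 : c = 0 by lra.
  move: H; rewrite c00 => H; rewrite mulr0.
  have [->|bn] := eqVneq b 0; first by rewrite expr0n.
  have := H (- (a + 1) / (2 * b)); rewrite mulrC => {H}.
  have -> : 2 * b * (- (a + 1) / (2 * b)) = - (a + 1).
    by field; rewrite bn.
  by lra.
have := H (- b / c).
have -> : a + - b / c * (2 * b) + (- b / c) ^+ 2 * c = (a * c - b ^+ 2) / c.
  by field; rewrite gt_eqF.
by rewrite pmulr_lge0 ?invr_gt0 // subr_ge0.
Qed.

Lemma pf_young f g x : S f -> S g -> `|2 * q f g x| <= q f f x + q g g x.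
Proof.
move=> Sf Sg.
have := pf_ge0 qf x (SD (SZ 1 Sf) (SZ 1 Sg)).
have := pf_ge0 qf x (SD (SZ 1 Sf) (SZ (-1) Sg)).
rewrite !pf_combine //; move: (q f f x) (q f g x) (q g g x) => a b c.
by move=> H1 H2; rewrite ler_norml; apply/andP; split; lra.
Qed.

(* convexity of the quadratic form at the first argument *)
Lemma pf_diff f g h w z x : S f -> S w -> S z ->
  (forall y, g y = f y - h * w y + z y) ->
  q f f x - q g g x <= h * (2 * q f w x) - 2 * q f z x.
Proof.
move=> Sf Sw Sz E.
have Sv : S (fun y => (- h) * w y + 1 * z y) by apply: SD; exact: SZ.
have -> : g = fun y => 1 * f y + 1 * ((- h) * w y + 1 * z y).
  by apply/funext => y; rewrite E; lra.
rewrite pf_combine //; have := pf_ge0 qf x Sv.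
rewrite (pfC qf _ Sf Sv) (pfD qf _ (SZ (- h) Sw) (SZ 1 Sz) Sf) !(pfZ qf) //.
rewrite (pfC qf _ Sw Sf) (pfC qf _ Sz Sf).
move: (q f f x) (q f w x) (q f z x) => a b c.
move: (q (fun _ => _) _ x) => d d0; lra.
Qed.

End psd_form.

Section calculus.
Context {R : realType} {M : ptopologicalType} {S : (M -> R) -> Prop}.
Context {L : (M -> R) -> (M -> R)}.
Hypothesis gc : gamma_calculus S L.
Implicit Types (f g : M -> R) (F : R -> R).

Local Notation Gam := (Gamma L).

Lemma gcZ a f : S f -> S (fun x => a * f x).
Proof. by move=> Sf; exact: (gcM gc (gc_cst gc a) Sf). Qed.

Lemma gcN f : S f -> S (fun x => - f x).
Proof.
by move=> /(gcZ (-1)); rewrite (_ : (fun x => -1 * f x) = fun x => - f x) //;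
  apply/funext => x; rewrite mulN1r.
Qed.

Lemma gcB f g : S f -> S g -> S (fun x => f x - g x).
Proof. by move=> Sf Sg; exact: (gcD gc Sf (gcN Sg)). Qed.

Lemma gc_sqr f : S f -> S (fun x => f x ^+ 2).
Proof. by move=> Sf; exact: (gcM gc Sf Sf). Qed.

Lemma gc_Gamma f g : S f -> S g -> S (Gam f g).
Proof.
move=> Sf Sg; have SL f' : S f' -> S (L f') by exact: (gc_L gc).
exact: (gcZ 2^-1 (gcB (gcB (SL _ (gcM gc Sf Sg)) (gcM gc Sf (SL _ Sg)))
  (gcM gc Sg (SL _ Sf)))).
Qed.

Lemma Gamma_form : psd_form S Gam.
Proof.
split.
- exact: gc_Gamma.
- move=> f g x Sf Sg; rewrite /Gamma (_ : (fun y => f y * g y) = fun y => g y * f y).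
    by move: (L _ x) (L f x) (L g x) => *; ring.
  by apply/funext => y; rewrite mulrC.
- move=> f g h x Sf Sg Sh; rewrite /Gamma.
  rewrite (_ : (fun y => (f y + g y) * h y) = fun y => f y * h y + g y * h y).
    rewrite (gc_LD gc x (gcM gc Sf Sh) (gcM gc Sg Sh)) (gc_LD gc x Sf Sg).
    by move: (L _ x) (L _ x) (L f x) (L g x) (L h x) => *; ring.
  by apply/funext => y; rewrite mulrDl.
- move=> a f g x Sf Sg; rewrite /Gamma.
  rewrite (_ : (fun y => a * f y * g y) = fun y => a * (f y * g y)).
    rewrite (gc_LZ gc a x (gcM gc Sf Sg)) (gc_LZ gc a x Sf).
    by move: (L _ x) (L f x) (L g x) => *; ring.
  by apply/funext => y; rewrite mulrA.
- by move=> f x; exact: (gc_Gamma_ge0 gc).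
Qed.

Lemma Gamma_CS f g x : S f -> S g -> Gam f g x ^+ 2 <= Gam f f x * Gam g g x.
Proof. by move=> Sf Sg; exact: (pf_cauchy_schwarz Gamma_form (gcD gc) gcZ). Qed.

Lemma GammaC f g x : S f -> S g -> Gam f g x = Gam g f x.
Proof. exact: (pfC Gamma_form). Qed.

Lemma LM f g x : L (fun y => f y * g y) x =
  f x * L g x + g x * L f x + 2 * Gam f g x.
Proof. by rewrite /Gamma; move: (L _ x) (L f x) (L g x) => *; field. Qed.

Lemma L_cst a x : L (fun=> a) x = 0.
Proof.
have := gc_Lcomp gc x (@smooth_real_cst R a) (gc_cst gc 0) => /= ->.
have -> : derive1 (fun=> a : R) = fun=> 0 by apply/funext => y; exact: derive1_cst.
by rewrite derive1_cst !mul0r addr0.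
Qed.

Lemma Gamma_comp2 F f x : smooth_real F -> S f ->
  Gam (fun y => F (f y)) (fun y => F (f y)) x = derive1 F (f x) ^+ 2 * Gam f f x.
Proof.
move=> sF Sf; have SFf := gc_comp gc sF Sf.
rewrite (gc_Gamma_comp gc) // GammaC // (gc_Gamma_comp gc) //.
by rewrite mulrA expr2.
Qed.

Lemma Gamma_eq0 f g x : S f -> S g -> Gam f f x = 0 -> Gam f g x = 0.
Proof.
move=> Sf Sg f0; have := Gamma_CS x Sf Sg; rewrite f0 mul0r => H.
by apply/eqP; rewrite -sqrf_eq0 eq_le H sqr_ge0.
Qed.

Lemma Gamma_sqrM f F g x : S f -> S g -> smooth_real F ->
  Gam (fun y => f y ^+ 2 * F (g y)) g x =
  f x ^+ 2 * derive1 F (g x) * Gam g g x + 2 * f x * F (g x) * Gam f g x.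
Proof.
move=> Sf Sg sF; have SFg := gc_comp gc sF Sg.
rewrite (gc_GammaM gc x (gc_sqr Sf) SFg Sg) (gc_Gamma_comp gc) //.
rewrite (_ : (fun y => f y ^+ 2) = fun y => f y * f y) // (gc_GammaM gc) //.
by move: (Gam g g x) (Gam f g x) => *; ring.
Qed.

End calculus.

Section convergence.
Context {R : realType} {M : ptopologicalType}.
Variable mu : {measure set (borel M) -> \bar R}.
Implicit Types (f g : M -> R).

Lemma dominated_Int (f_ : nat -> M -> R) f g : (forall n, meas (f_ n)) -> meas f ->
  (forall x, (fun n => f_ n x) @ \oo --> f x) -> (forall n x, `|f_ n x| <= g x) ->
  intg mu g ->
  intg mu f /\ (fun n => \int[mu]_x f_ n x) @ \oo --> \int[mu]_x f x.
Proof.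
move=> mf_ mf cf fg Ig.
have In n : intg mu (f_ n) by apply: le_intg Ig.
have h1 : {ae mu, forall x : borel M, setT x ->
    (fun n => (f_ n x)%:E) @ \oo --> (f x)%:E}.
  by apply: aeW => x _; apply: cvg_EFin (cf x); exact: nearW.
have h2 : {ae mu, forall (x : borel M) n, setT x -> (`|(f_ n x)%:E| <= (g x)%:E)%E}.
  by apply: aeW => x n _; rewrite /= lee_fin.
have [If _ cI] := @dominated_convergence _ (borel M) R mu setT measurableT
  (fun n x => (f_ n x)%:E) (fun x => (f x)%:E) (fun x => (g x)%:E)
  (fun n => (measurable_EFinP _ _).2 (mf_ n)) ((measurable_EFinP _ _).2 mf) h1 Ig h2.
split=> //; apply: fine_cvg; move: cI.
by rewrite EFin_Int.
Qed.

(** Integrability and the bound come together: global integrability of a nonnegative function is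
    obtained this way from cut-off estimates whose bound does not depend on the cut-off. *)
Lemma fatou_Int (f_ : nat -> M -> R) f (B : R) :
  (forall n, intg mu (f_ n)) -> (forall n x, 0 <= f_ n x) -> meas f ->
  (forall x, (fun n => f_ n x) @ \oo --> f x) ->
  (\forall n \near \oo, \int[mu]_x f_ n x <= B) ->
  intg mu f /\ \int[mu]_x f x <= B.
Proof.
move=> If_ f0 mf cf HB.
have fx0 x : 0 <= f x.
  rewrite -(cvg_lim _ (cf x)) //; apply: limr_ge; first exact: cvgP (cf x).
  by apply: nearW.
have le : (\int[mu]_x (f x)%:E <= B%:E)%E.
  have E x : (f x)%:E = limn_einf (fun n => (f_ n x)%:E).
    have c : (fun n => (f_ n x)%:E) @ \oo --> (f x)%:E.
      by apply: cvg_EFin (cf x); exact: nearW.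
    by rewrite (is_cvg_limn_einfE (cvgP _ c)) (cvg_lim _ c).
  under eq_integral do rewrite E.
  apply: le_trans (@fatou _ _ _ mu setT measurableT (fun n x => (f_ n x)%:E) _ _) _.
  - by move=> n; exact: ((measurable_EFinP _ _).2 (intg_meas (If_ n))).
  - by move=> n x _; rewrite lee_fin.
  have [N _ HN] := HB.
  rewrite limn_einf_lim; apply: lime_le; first exact: is_cvg_einfs.
  apply: nearW => k; apply: le_trans (ereal_inf_lbound _) _.
    by exists (maxn k N) => //=; rewrite leq_maxl.
  rewrite /= -EFin_Int // lee_fin; apply: HN; exact: leq_maxr.
have If : intg mu f.
  apply/integrableP; split; first exact/measurable_EFinP.
  under eq_integral do rewrite /= ger0_norm //.
  by apply: le_lt_trans le _; rewrite ltry.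
by split=> //; rewrite -lee_fin EFin_Int.
Qed.

End convergence.

Local Notation supp := Defs.support.

(** Put X = c p1 g, P = c^2 p2 b and T = 2 B a. The hypotheses give X^2 <= P T, hence -2 X <= P + T.
    In use, c is the cut-off, p1 and p2 are the values of phi' and phi'' at Q, and a, b, g are Gamma
    of the cut-off, of Q, and of the two together. *)
Lemma young_discriminant {R : realType} (c p1 p2 B a b g : R) :
  0 <= p2 -> 0 <= B -> p1 ^+ 2 <= 2 * B * p2 -> 0 <= b -> 0 <= a ->
  g ^+ 2 <= a * b ->
  - (c ^+ 2 * p2 * b + 2 * c * p1 * g) <= 2 * (B * a).
Proof.
move=> p20 B0 H b0 a0 CS.
pose X := c * p1 * g; pose P := c ^+ 2 * p2 * b; pose T := 2 * (B * a).
have P0 : 0 <= P := mulr_ge0 (mulr_ge0 (sqr_ge0 c) p20) b0.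
have T0 : 0 <= T by rewrite /T mulr_ge0 // mulr_ge0.
have XPT : X ^+ 2 <= P * T.
  have -> : X ^+ 2 = c ^+ 2 * (p1 ^+ 2 * g ^+ 2) by rewrite /X; ring.
  have -> : P * T = c ^+ 2 * ((2 * B * p2) * (a * b)) by rewrite /P /T; ring.
  by rewrite ler_wpM2l ?sqr_ge0 // ler_pM ?sqr_ge0.
have : - (2 * X) <= P + T.
  rewrite leNgt; apply/negP => lt; have := sqr_ge0 (P - T).
  by move: P T X P0 T0 XPT lt => *; nra.
rewrite /X /P /T => K.
have -> : 2 * c * p1 * g = 2 * (c * p1 * g) by ring.
lra.
Qed.

Record diffusion_space {R : realType} {M : ptopologicalType}
    (S : (M -> R) -> Prop) (L : (M -> R) -> (M -> R))
    (mu : {measure set (borel M) -> \bar R}) (h : nat -> M -> R) : Prop := {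
  ds_gc : gamma_calculus S L;
  ds_open : forall U : set M, open U -> U !=set0 -> (0 < mu U)%E;
  ds_sym : forall f g, S f /\ compact (supp f) -> S g /\ compact (supp g) ->
     \int[mu]_x (f x * L g x) = \int[mu]_x (g x * L f x);
  ds_L2 : forall f, S f /\ compact (supp f) -> L2 mu f;
  ds_h : forall k, S (h k) /\ compact (supp (h k));
  ds_h_mono : forall k x, h k x <= h k.+1 x;
  ds_h_cvg : forall x, (fun k => h k x) @ \oo --> (1 : R);
  ds_h_Gamma : forall e : R, 0 < e ->
    \forall k \near \oo, forall x, Gamma L (h k) (h k) x <= e }.

Section diffusion.
Context {R : realType} {M : ptopologicalType} {S : (M -> R) -> Prop}.
Context {L : (M -> R) -> (M -> R)} {mu : {measure set (borel M) -> \bar R}}.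
Context {h : nat -> M -> R}.
Hypothesis ds : diffusion_space S L mu h.
Implicit Types (f g : M -> R).

Local Notation Gam := (Gamma L).
Let gc := ds_gc ds.
Let hC : forall k, S (h k) /\ compact (supp (h k)) := ds_h ds.
Let hS k : S (h k) := (hC k).1.

Definition Sc f := S f /\ compact (supp f).

Lemma h_le j k x : (j <= k)%N -> h j x <= h k x.
Proof.
move=> /subnK <-; elim: (k - j)%N => [//|m IH].
by rewrite addSn (le_trans IH) // (ds_h_mono ds).
Qed.

Lemma ScS f : Sc f -> S f. Proof. by case. Qed.

Lemma sub_support f g : (forall x, f x = 0 -> g x = 0) -> supp g `<=` supp f.
Proof.
move=> fg; apply: closure_subset => x /=.
by apply: contra_neq => /fg.
Qed.

Lemma Sc_sub f g : Sc f -> S g -> (forall x, f x = 0 -> g x = 0) -> Sc g.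
Proof.
move=> [_ cf] Sg fg; split=> //; apply: subclosed_compact cf _.
  exact: closed_closure.
exact: sub_support.
Qed.

Lemma Sc_h f k : S f -> (forall x, h k x = 0 -> f x = 0) -> Sc f.
Proof. by move=> Sf; exact: Sc_sub. Qed.

Lemma notin_support f x : ~ supp f x -> f x = 0.
Proof.
move=> nfx; apply/eqP; apply/negPn/negP => fx; apply: nfx.
by apply: subset_closure.
Qed.

(** Dini's argument: at each point of the support some [h k] exceeds 1/2, this persists nearby by
    continuity and for larger k by monotonicity, and compactness makes k uniform. *)
Lemma Sc_plateau f : Sc f -> \forall k \near \oo, forall x, f x != 0 -> 2^-1 < h k x.
Proof.
move=> [_ /compact_near_coveringP cf].
have := cf nat \oo (fun k x => 2^-1 < h k x) _ _.
have H : forall x, supp f x ->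
    \forall x' \near x & k \near \oo, 2^-1 < h k x'.
  move=> x _; have [k0 hk0] : exists k, 2^-1 < h k x.
    have half : (2^-1 : R) < 1 by lra.
    have [N _ HN] := @cvgr_gt R _ _ _ _ _ (ds_h_cvg ds x) _ half.
    by exists N; apply: HN => /=.
  have cont := gc_continuous gc (hS k0).
  have nx : \forall x' \near x, 2^-1 < h k0 x'.
    exact: (@cvgr_gt R _ _ _ _ _ (cont x) _ hk0).
  exists ([set x' | 2^-1 < h k0 x'], [set k | (k0 <= k)%N]).
    by split => //=; exists k0.
  by move=> [x' k] [/= hx' k0k]; apply: lt_le_trans hx' _; exact: h_le.
move=> /(_ _ H); apply: filterS => k Hk x fx; apply: Hk.
by apply: subset_closure.
Qed.

(** The scale [c] yields nested cut-offs from a single [h k]: [cut (2 c) k] equals 1 wherever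
    [cut c k] is nonzero. With c = 2 the plateau contains the set where [h k] > 1/2. *)
Definition cut (c : R) k : M -> R := fun x => step (c * h k x).

Lemma S_cut c k : S (cut c k).
Proof. exact: (gc_comp gc smooth_step (gcZ gc c (hS k))). Qed.

Lemma cut_h0 c k x : h k x = 0 -> cut c k x = 0.
Proof. by move=> h0; rewrite /cut h0 mulr0 step_eq0 // invr_ge0. Qed.

Lemma Sc_cut c k : Sc (cut c k).
Proof. by apply: (@Sc_h _ k); [exact: S_cut|move=> x; exact: cut_h0]. Qed.

Lemma cut_ge0 c k x : 0 <= cut c k x. Proof. exact: step_ge0. Qed.
Lemma cut_le1 c k x : cut c k x <= 1. Proof. exact: step_le1. Qed.

Lemma Gamma_cut c k x :
  Gam (cut c k) (cut c k) x = derive1 step (c * h k x) ^+ 2 * (c ^+ 2 * Gam (h k) (h k) x).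
Proof.
rewrite (Gamma_comp2 gc x smooth_step (gcZ gc c (hS k))).
have Gf := Gamma_form gc.
rewrite (pfZ Gf c x (hS k) (gcZ gc c (hS k))) (GammaC gc x (hS k) (gcZ gc c (hS k))).
by rewrite (pfZ Gf c x (hS k) (hS k)) expr2 mulrA.
Qed.

Lemma Gamma_cut0 c k x g : S g -> (c * h k x <= 2^-1) || (1 <= c * h k x) ->
  Gam (cut c k) g x = 0.
Proof.
move=> Sg cx; apply: (Gamma_eq0 gc (S_cut c k) Sg).
by rewrite Gamma_cut derive1_step_eq0 // expr0n mul0r.
Qed.

Lemma L_cut0 c k x : (c * h k x < 2^-1) || (1 < c * h k x) -> L (cut c k) x = 0.
Proof.
move=> cx; rewrite (gc_Lcomp gc x smooth_step (gcZ gc c (hS k))).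
rewrite derive2_step_eq0 // derive1_step_eq0 ?mul0r ?addr0 //.
by case/orP : cx => /ltW ->; rewrite ?orbT.
Qed.

Lemma cut2_plateau k x : 2^-1 < h k x -> cut 2 k x = 1 /\ 1 < 2 * h k x.
Proof.
move=> hx; have h1 : 1 < 2 * h k x by lra.
by split=> //; rewrite /cut step_eq1 // ltW.
Qed.

Lemma cut2_id f k : (forall x, f x != 0 -> 2^-1 < h k x) ->
  (fun x => cut 2 k x * f x) = f.
Proof.
move=> kf; apply/funext => x; have [->|fx] := eqVneq (f x) 0.
  by rewrite mulr0.
by have [-> _] := cut2_plateau (kf x fx); rewrite mul1r.
Qed.

Lemma plateau_h0 f k x : (forall x, f x != 0 -> 2^-1 < h k x) -> h k x = 0 -> f x = 0.
Proof.
move=> kf hx; apply/eqP/negPn/negP => /kf; rewrite hx; lra.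
Qed.

Lemma ScD f g : Sc f -> Sc g -> Sc (fun x => f x + g x).
Proof.
move=> cf cg; have [N _ HN] := filterI (Sc_plateau cf) (Sc_plateau cg).
have [kf kg] := HN N (leqnn _).
apply: (@Sc_h _ N); first exact: (gcD gc cf.1 cg.1).
by move=> x hx; rewrite (plateau_h0 kf) // (plateau_h0 kg) // addr0.
Qed.

Lemma ScM f g : Sc f -> S g -> Sc (fun x => f x * g x).
Proof.
move=> cf Sg; apply: (Sc_sub cf); first exact: (gcM gc cf.1 Sg).
by move=> x ->; rewrite mul0r.
Qed.

Lemma ScMr f g : S f -> Sc g -> Sc (fun x => f x * g x).
Proof.
move=> Sf cg; rewrite (_ : (fun x => _) = fun x => g x * f x); first exact: ScM.
by apply/funext => x; rewrite mulrC.
Qed.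

Lemma ScZ a f : Sc f -> Sc (fun x => a * f x).
Proof. by move=> cf; apply: ScMr cf; exact: gc_cst gc _. Qed.

Lemma Sc_sqr f : Sc f -> Sc (fun x => f x ^+ 2).
Proof. by move=> cf; exact: ScM cf cf.1. Qed.

(* [f = cut * f] for a cut equal to 1 on the support of [f] *)
Lemma Sc_L f : Sc f -> exists k, forall x, h k x = 0 -> f x = 0 /\ L f x = 0.
Proof.
move=> cf; have [k _ Hk] := Sc_plateau cf; have kf := Hk k (leqnn _).
exists k => x hx; have fx := plateau_h0 kf hx; split => //.
have c0 : 2 * h k x < 2^-1 by rewrite hx mulr0 invr_gt0.
rewrite -(cut2_id kf) LM (cut_h0 _ hx) fx mul0r mul0r !add0r.
by rewrite Gamma_cut0 ?mulr0 ?(ltW c0) //; exact: ScS.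
Qed.

Lemma ScL f : Sc f -> Sc (L f).
Proof.
move=> cf; have [k Hk] := Sc_L cf.
by apply: (@Sc_h _ k); [exact: gc_L gc _ cf.1|move=> x /Hk[]].
Qed.

Definition derivation_form (q : (M -> R) -> (M -> R) -> (M -> R)) :=
  psd_form S q /\ forall f g k x, S f -> S g -> S k ->
    q (fun y => f y * g y) k x = f x * q g k x + g x * q f k x.

Lemma Gamma_derivation : derivation_form Gam.
Proof. by split; [exact: Gamma_form|move=> f g k x; exact: gc_GammaM]. Qed.

(** Locality of [q] comes from the Leibniz rule applied to [cut 2 k] times [f], which is [f]: each
    of the two terms carries a factor that vanishes where [h k] does. *)
Lemma Sc_form q f g : derivation_form q -> Sc f -> S g -> Sc (q f g).
Proof.
move=> [qf qM] cf Sg; have [k _ Hk] := Sc_plateau cf; have kf := Hk k (leqnn _).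
apply: (@Sc_h _ k) => [|x hx]; first exact: (pf_S qf cf.1 Sg).
rewrite -(cut2_id kf) qM //; [|exact: S_cut|exact: ScS].
by rewrite (cut_h0 _ hx) (plateau_h0 kf hx) !mul0r addr0.
Qed.

Lemma Sc_continuousM f g : continuous g -> Sc f ->
  exists2 K, 0 <= K & forall x, `|g x * f x| <= K * `|f x|.
Proof.
move=> cg [_ cf]; have [f0|/set0P sf] := eqVneq (supp f) set0.
  exists 0 => // x; rewrite (@notin_support f x) ?f0 //.
  by rewrite mulr0 !normr0 mulr0.
have cn : continuous (fun x => `|g x|).
  by move=> x; apply: continuous_comp; [exact: cg|exact: norm_continuous].
have [c _ Hc] := compact_EVT_max sf cf (continuous_subspaceT cn).
exists `|g c| => // x; rewrite normrM.
have [->|fx] := eqVneq (f x) 0; first by rewrite normr0 !mulr0.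
rewrite ler_wpM2r // Hc // inE; exact: subset_closure.
Qed.

Lemma S_meas f : S f -> meas f.
Proof. by move=> Sf; apply: continuous_meas; exact: (gc_continuous gc Sf). Qed.

(** Here [f] is written as [cut 2 k] times [f], a product of two square integrable functions. *)
Lemma Sc_intg f : Sc f -> intg mu f.
Proof.
move=> cf; have [k _ Hk] := Sc_plateau cf; have kf := Hk k (leqnn _).
rewrite -(cut2_id kf); apply: L2_intgM; first exact: (ds_L2 ds (Sc_cut _ _)).
exact: (ds_L2 ds cf).
Qed.

Lemma Sc_intgM f g : continuous g -> Sc f -> intg mu (fun x => g x * f x).
Proof.
move=> cg cf; have [K K0 HK] := Sc_continuousM cg cf.
apply: le_intg HK (intgZ K (intg_norm (Sc_intg cf))).
by apply: measM; [exact: continuous_meas|exact: S_meas cf.1].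
Qed.

(** The symmetry of [L] is known for two compactly supported functions, so [g] is replaced by
    [cut 2 j] times [g]. With j such that [h j] > 1/2 wherever [h k] is nonzero, the cut-off is 1
    there, its [L] and its [Gamma] vanish, and neither integrand changes. *)
Lemma Int_by_parts f g : Sc f -> S g ->
  \int[mu]_x (f x * L g x) = \int[mu]_x (g x * L f x).
Proof.
move=> cf Sg; have [k Hk] := Sc_L cf; have [j _ Hj] := Sc_plateau (hC k).
have kj := Hj j (leqnn _).
pose g' x := cut 2 j x * g x.
have cg' : Sc g' by apply: ScM Sg; exact: Sc_cut.
have := ds_sym ds cf cg'.
rewrite (eq_Int mu (g := fun x => f x * L g x)).
  rewrite (eq_Int mu (f := fun x => g' x * L f x) (g := fun x => g x * L f x)) //.
  move=> x; have [hx|hx] := eqVneq (h k x) 0.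
    by have [_ ->] := Hk x hx; rewrite !mulr0.
  by rewrite /g'; have [-> _] := cut2_plateau (kj x hx); rewrite mul1r.
move=> x; have [hx|hx] := eqVneq (h k x) 0.
  by have [-> _] := Hk x hx; rewrite !mul0r.
have [c1 c2] := cut2_plateau (kj x hx).
rewrite /g' LM c1 L_cut0 ?c2 ?orbT // Gamma_cut0 ?(ltW c2) ?orbT //.
by rewrite mul1r !mulr0 !addr0.
Qed.

Lemma Int_L0 f : Sc f -> \int[mu]_x L f x = 0.
Proof.
move=> cf; have := Int_by_parts cf (gc_cst gc 1).
rewrite (eq_Int mu (g := fun x => 0 * f x)); last first.
  by move=> x; rewrite (L_cst gc) mulr0 mul0r.
rewrite IntZ ?mul0r => [->|]; last exact: Sc_intg.
by apply: eq_Int => x; rewrite mul1r.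
Qed.

Lemma Int_LGamma f g : Sc f -> S g ->
  \int[mu]_x (f x * L g x) = - \int[mu]_x Gam f g x.
Proof.
move=> cf Sg; have := Int_L0 (ScM cf Sg).
have SLg := gc_L gc Sg; have SLf := gc_L gc cf.1.
have i1 : intg mu (fun x => f x * L g x) by apply: Sc_intg; exact: ScM.
have i2 : intg mu (fun x => g x * L f x).
  by apply: Sc_intg; apply: ScMr => //; exact: ScL.
have i3 : intg mu (Gam f g) by apply: Sc_intg; exact: Sc_form Gamma_derivation cf Sg.
rewrite (eq_Int mu (g := fun x => f x * L g x + g x * L f x + 2 * Gam f g x)).
  rewrite IntD; [|exact: intgD|exact: intgZ].
  rewrite IntD // -(Int_by_parts cf Sg) IntZ //.
  by move: (Rintegral _ _ _) (Rintegral _ _ _) => *; lra.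
by move=> x; exact: LM.
Qed.

(* Static energy estimate: [B] dominates [phi'^2 / (2 phi'')] along [Q]. *)
Lemma energy_le (phi : R -> R) Q B chi : smooth_real phi -> S Q -> S B -> Sc chi ->
  (forall x, 0 <= derive1 (derive1 phi) x) ->
  (forall x, derive1 phi (Q x) ^+ 2 <= 2 * B x * derive1 (derive1 phi) (Q x)) ->
  (forall x, 0 <= B x) ->
  \int[mu]_x (chi x ^+ 2 * derive1 phi (Q x) * L Q x) <=
  \int[mu]_x (2 * (B x * Gam chi chi x)).
Proof.
move=> sphi SQ SB cchi phi2 HB B0.
have sphi' := smooth_real_derive1 sphi.
have SA := gc_comp gc sphi' SQ.
have cA : Sc (fun x => chi x ^+ 2 * derive1 phi (Q x)).
  by apply: ScM SA; exact: Sc_sqr.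
rewrite (Int_LGamma cA SQ) -IntN; last first.
  by apply: Sc_intg; exact: Sc_form Gamma_derivation cA SQ.
have cG : Sc (Gam chi chi) by apply: Sc_form Gamma_derivation cchi cchi.1.
apply: le_Int.
- by apply/intgN/Sc_intg; exact: Sc_form Gamma_derivation cA SQ.
- by apply/intgZ/Sc_intg; apply: ScMr.
move=> x; rewrite (Gamma_sqrM gc x cchi.1 SQ sphi').
have CS := Gamma_CS gc x cchi.1 SQ.
have GQ := gc_Gamma_ge0 gc x SQ; have Gc := gc_Gamma_ge0 gc x cchi.1.
exact: (young_discriminant (chi x) (phi2 (Q x)) (B0 x) (HB x) GQ Gc CS).
Qed.

End diffusion.

(** * Integration against a measure with a density *)

Section density.
Context {d : measure_display} {T : measurableType d} {R : realType}.
Variables (n : {measure set T -> \bar R}) (w : T -> R).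
Hypotheses (mw : measurable_fun setT w) (w0 : forall x, 0 <= w x).

Definition density (B : set T) : \bar R := (\int[n]_(x in B) (w x)%:E)%E.

Let density0 : density set0 = 0%E.
Proof. exact: integral_set0. Qed.

Let density_ge0 B : (0 <= density B)%E.
Proof. by apply: integral_ge0 => x _; rewrite lee_fin. Qed.

Let density_sigma_additive : semi_sigma_additive density.
Proof.
move=> F mF tF mUF; rewrite /density ge0_integral_bigcup //.
- by apply: is_cvg_nneseries => k _ _; exact: density_ge0.
- exact/measurable_EFinP/(measurable_funS measurableT).
- by move=> x _; rewrite lee_fin.
Qed.

HB.instance Definition _ := isMeasure.Build _ _ _ density
  density0 density_ge0 density_sigma_additive.

Import HBNNSimple.

Lemma integral_density (phi : T -> R) : measurable_fun setT phi ->
  (forall x, 0 <= phi x) ->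
  (\int[density]_x (phi x)%:E = \int[n]_x (phi x * w x)%:E)%E.
Proof.
move=> mphi phi0.
have mf := (measurable_EFinP _ _).2 mphi.
pose f_ := nnsfun_approx measurableT mf.
have cvf x : (f_ k x)%:E @[k --> \oo] --> (phi x)%:E.
  by apply: cvg_nnsfun_approx => // y _; rewrite /= lee_fin.
have ndf x : {homo f_^~ x : a b / (a <= b)%N >-> a <= b}.
  by move=> a b ab; exact/lefP/nd_nnsfun_approx.
have mwE := (measurable_EFinP _ _).2 mw.
transitivity (limn (fun k => \int[density]_x (f_ k x)%:E)%E).
  rewrite -monotone_convergence //.
  - by apply: eq_integral => x _; apply/esym/cvg_lim.
  - by move=> k; exact/measurable_EFinP/measurable_funP.
  - by move=> k x _; rewrite lee_fin.
  - by move=> x _ a b ab; rewrite lee_fin; exact: ndf.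
transitivity (limn (fun k => \int[n]_x (f_ k x * w x)%:E)%E); last first.
  rewrite -monotone_convergence //.
  - apply: eq_integral => x _; apply/cvg_lim => //=.
    under eq_fun do rewrite EFinM; rewrite EFinM.
    by apply: cvgeM; [exact: mule_def_fin|exact: cvf|exact: cvg_cst].
  - by move=> k; apply/measurable_EFinP/measurable_funM => //; exact/measurable_funP.
  - by move=> k x _; rewrite lee_fin mulr_ge0.
  - by move=> x _ a b ab; rewrite lee_fin ler_wpM2r //; exact: ndf.
congr (limn _); apply/funext => k.
transitivity (\sum_(r \in range (f_ k))
    \int[n]_x (r * \1_(f_ k @^-1` [set r]) x * w x)%:E)%E.
  under eq_integral do rewrite fimfunE -fsumEFin //.
  rewrite ge0_integral_fsum //; last 2 first.
  - by move=> y; exact/measurable_EFinP/measurable_funM.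
  - by move=> y x _; rewrite nnfun_muleindic_ge0.
  apply: eq_fsbigr => r _; rewrite integralZl_indic_nnsfun // integral_indic //=.
  rewrite setIT /density; have [r0|r0] := ltP r 0.
    by rewrite preimage_nnfun0 // integral_set0 mule0 integral0_eq // => x _;
      rewrite indic0 mulr0 mul0r.
  rewrite integral_mkcond -ge0_integralZl //.
  - apply: eq_integral => x _; rewrite patchE indicE; case: ifPn => _.
      by rewrite mulr1 EFinM.
    by rewrite mulr0 mul0r mule0.
  - by apply/(measurable_restrictT _ _).1 => //; exact: (measurable_funS measurableT).
  - by move=> x _; rewrite patchE; case: ifP => // _; rewrite lee_fin.
rewrite -ge0_integral_fsum //.
- apply: eq_integral => x _; rewrite [in RHS]fimfunE.
  by rewrite fsumEFin // mulr_fsuml.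
- by move=> r; apply/measurable_EFinP/measurable_funM => //; exact: measurable_funM.
- by move=> r x _; rewrite EFinM mule_ge0 ?nnfun_muleindic_ge0 ?lee_fin.
Qed.

End density.

(** The spectral identities obtained by polarization are between signed measures. Their negative
    terms are moved across, so that both sides are positive measures and the integrals can be
    compared without signed measures. *)
Lemma eq_density_sum d (T : measurableType d) (R : realType)
    (m1 m2 n1 n2 : {measure set T -> \bar R}) (w : T -> R) (phi : T -> R) :
  measurable_fun setT w -> (forall x, 0 <= w x) ->
  (forall B, measurable B -> m1 B + \int[n1]_(x in B) (w x)%:E =
     m2 B + \int[n2]_(x in B) (w x)%:E)%E ->
  measurable_fun setT phi -> (forall x, 0 <= phi x) ->
  (\int[m1]_x (phi x)%:E + \int[n1]_x (phi x * w x)%:E =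
   \int[m2]_x (phi x)%:E + \int[n2]_x (phi x * w x)%:E)%E.
Proof.
move=> mw w0 H mphi phi0.
have mE := (measurable_EFinP _ _).2 mphi.
rewrite -!(integral_density _ mw w0 mphi phi0).
rewrite -!ge0_integral_measure_add //; try by move=> x _; rewrite lee_fin.
apply: eq_measure_integral => A mA _.
transitivity (m1 A + density n1 w A)%E; first exact: measure_addE.
transitivity (m2 A + density n2 w A)%E; first exact: H.
by rewrite -measure_addE.
Qed.

(** * Spectral calculus *)

Section spectral.
Context {R : realType} {M : ptopologicalType}.
Context {mu : {measure set (borel M) -> \bar R}}.
Implicit Types (f g k : M -> R) (B : set R).

Local Notation ip := (Defs.ip mu).
Local Notation L2 := (Defs.L2 mu).

Lemma ipC f g : ip f g = ip g f.
Proof. by apply: eq_Int => x; rewrite mulrC. Qed.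

Lemma ipDl f g k : L2 f -> L2 g -> L2 k -> ip (fun x => f x + g x) k = ip f k + ip g k.
Proof.
move=> f2 g2 k2; rewrite /Defs.ip -IntD; [|exact: L2_intgM..].
by apply: eq_Int => x; rewrite mulrDl.
Qed.

Lemma ipBl f g k : L2 f -> L2 g -> L2 k -> ip (fun x => f x - g x) k = ip f k - ip g k.
Proof.
move=> f2 g2 k2; rewrite /Defs.ip -IntB; [|exact: L2_intgM..].
by apply: eq_Int => x; rewrite mulrBl.
Qed.

Lemma ipZl a f k : L2 f -> L2 k -> ip (fun x => a * f x) k = a * ip f k.
Proof.
move=> f2 k2; rewrite /Defs.ip -IntZ; last exact: L2_intgM.
by apply: eq_Int => x; rewrite mulrA.
Qed.

Lemma ipDr f g k : L2 f -> L2 g -> L2 k -> ip k (fun x => f x + g x) = ip k f + ip k g.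
Proof. by move=> *; rewrite ipC ipDl // !(ipC k). Qed.

Lemma ip_ge0 f : 0 <= ip f f.
Proof. by apply: Int_ge0 => x; rewrite -expr2 sqr_ge0. Qed.

Lemma ip_ae f f' g : L2 f -> L2 f' -> L2 g -> ae_eq_fun mu f f' -> ip f g = ip f' g.
Proof.
move=> [mf _] [mf' _] [mg _] ff'; rewrite /Defs.ip /Rintegral; congr fine.
apply: ae_eq_integral => //.
- exact: ((measurable_EFinP _ _).2 (measM mf mg)).
- exact: ((measurable_EFinP _ _).2 (measM mf' mg)).
- case: ff' => N [mN N0 sN]; exists N; split=> // x /= nx; apply: sN => /= fx.
  by apply: nx => _; rewrite fx.
Qed.

Context {D : (M -> R) -> (M -> R) -> Prop} {E : set R -> (M -> R) -> (M -> R)}.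
Context {P : R -> (M -> R) -> (M -> R)}.
Hypothesis pvm : projection_valued_measure mu E.
Hypothesis sa : selfadjoint mu D.
Hypothesis DE : forall f k, D f k <-> spectral_apply mu E id f k.
Hypothesis PE : forall (t : R) f, 0 <= t -> L2 f ->
  spectral_apply mu E (fun l => expR (t * l)) f (P t f).

Let E2 B f : measurable B -> L2 f -> L2 (E B f).
Proof. exact: pvm_L2. Qed.

Let c B f g := ip (E B f) g.

Let cC B f g : measurable B -> L2 f -> L2 g -> c B f g = c B g f.
Proof. by move=> mB f2 g2; rewrite /c (pvm_sym pvm) // ipC. Qed.

Let cDl B f g k : measurable B -> L2 f -> L2 g -> L2 k ->
  c B (fun x => f x + g x) k = c B f k + c B g k.
Proof.
move=> mB f2 g2 k2; rewrite /c !(pvm_sym pvm) //; last exact: L2D.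
by rewrite ipDl //; exact: E2.
Qed.

Let cBl B f g k : measurable B -> L2 f -> L2 g -> L2 k ->
  c B (fun x => f x - g x) k = c B f k - c B g k.
Proof.
move=> mB f2 g2 k2; rewrite /c !(pvm_sym pvm) //; last exact: L2B.
by rewrite ipBl //; exact: E2.
Qed.

Let c_E B C f g : measurable B -> measurable C -> L2 f -> L2 g ->
  c C f (E B g) = c (B `&` C) f g.
Proof.
move=> mB mC f2 g2; rewrite /c -(pvm_sym pvm) //; last exact: E2.
apply/esym/ip_ae => //; [|exact: (E2 mB (E2 mC f2))|exact: (pvm_setI pvm)].
by apply: E2 => //; exact: measurableI.
Qed.

Let cff B f : measurable B -> L2 f -> c B f f = ip (E B f) (E B f).
Proof. by move=> mB f2; rewrite -[RHS]/(c B f (E B f)) c_E // setIid. Qed.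

(** Nonnegativity holds because <E(B) f, f> is the squared norm of E(B) f. Nothing is known about E
    on nonmeasurable sets, where the value 0 is imposed. *)
Lemma spectral_measure_exists f : L2 f ->
  {m : {measure set R -> \bar R} | forall B, measurable B -> m B = (ip (E B f) f)%:E}.
Proof.
move=> f2.
pose m B : \bar R := if `[< measurable B >] then (c B f f)%:E else 0%E.
have mE B : measurable B -> m B = (c B f f)%:E by move=> mB; rewrite /m asboolT.
have msa : forall F : (set R)^nat, (forall i, measurable (F i)) -> trivIset setT F ->
    (fun n => \sum_(0 <= i < n) m (F i))%E @ \oo --> m (\bigcup_n F n).
  move=> F mF tF; rewrite mE; last exact: bigcup_measurable.
  rewrite (_ : (fun n => _) = fun n => (\sum_(0 <= i < n) ip (E (F i) f) f)%:E).
    by apply: cvg_EFin; [exact: nearW|exact: (pvm_sigma_additive pvm mF tF f2)].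
  by apply/funext => n; rewrite -sumEFin; apply: eq_bigr => i _; rewrite mE.
have m0 : m set0 = 0%E.
  rewrite mE //; congr EFin.
  (* For the constant sequence of empty sets the partial sums are n times one number; they converge,
     so their increments, all equal to that number, tend to 0. *)
  have := pvm_sigma_additive pvm (fun i => measurable0) (@trivIset_set0 _ _ _) f2.
  rewrite bigcup0 // => cv.
  have cv1 : (fun n => \sum_(0 <= i < n.+1) ip (E set0 f) f) @ \oo --> ip (E set0 f) f.
    have := cv; rewrite -(cvg_shiftS (fun n => \sum_(0 <= i < n) ip (E set0 f) f)).
    exact.
  have cv0 := cvgB cv1 cv; rewrite subrr in cv0.
  have eqf : (fun n => \sum_(0 <= i < n.+1) ip (E set0 f) f) -
      (fun n => \sum_(0 <= i < n) ip (E set0 f) f) = fun=> ip (E set0 f) f.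
    apply/funext => n; rewrite -[LHS]/(\sum_(0 <= i < n.+1) ip (E set0 f) f -
      \sum_(0 <= i < n) ip (E set0 f) f).
    by rewrite big_nat_recr //= addrAC subrr add0r.
  have cvc : (fun n : nat => ip (E set0 f) f) @ \oo --> (0 : R).
    by rewrite -eqf; exact: cv0.
  exact: (cvg_unique _ (cvg_cst _) cvc).
have mge0 B : (0 <= m B)%E.
  rewrite /m; case: asboolP => // mB; rewrite lee_fin cff //; exact: ip_ge0.
have msa' : semi_sigma_additive m by move=> F mF tF _; exact: msa.
pose mm : {measure set R -> \bar R} := HB.pack m (isMeasure.Build _ _ _ m m0 mge0 msa').
exists mm => B mB; exact: mE.
Qed.

Definition smeas f : {measure set R -> \bar R} :=
  if pselect (L2 f) is left f2 then sval (spectral_measure_exists f2) else mzero.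

Let smeasE f B : L2 f -> measurable B -> smeas f B = (c B f f)%:E.
Proof.
by move=> f2 mB; rewrite /smeas; case: pselect => // f2'; case: spectral_measure_exists => m /= ->.
Qed.

Import HBNNSimple.

(** The integral is built from simple functions, and these evaluate the set function only on
    measurable level sets, where it agrees with [smeas f]. *)
Let integral_scalar f (phi : R -> \bar R) : L2 f ->
  (\int[scalar_spectral_measure mu E f]_l phi l = \int[smeas f]_l phi l)%E.
Proof.
move=> f2; rewrite /integral; congr (ereal_sup _ - ereal_sup _)%E; apply/seteqP; split;
  move=> _ [k hk <-]; exists k => //; apply: eq_fsbigr => r _; congr (_ * _)%E;
  by rewrite /scalar_spectral_measure smeasE.
Qed.

Let c_pm B f g : measurable B -> L2 f -> L2 g ->
  c B (fun x => f x + g x) (fun x => f x + g x) = c B f f + 2 * c B f g + c B g g /\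
  c B (fun x => f x - g x) (fun x => f x - g x) = c B f f - 2 * c B f g + c B g g.
Proof.
move=> mB f2 g2; split.
  rewrite cDl //; last exact: L2D.
  rewrite !(cC mB _ (L2D f2 g2)) // !cDl // (cC mB g2 f2); lra.
rewrite cBl //; last exact: L2B.
rewrite !(cC mB _ (L2B f2 g2)) // !cBl // (cC mB g2 f2); lra.
Qed.

Let c_set0 f g : L2 f -> L2 g -> c set0 f g = 0.
Proof.
move=> f2 g2; have z k : L2 k -> c set0 k k = 0.
  by move=> k2; have := smeasE k2 measurable0; rewrite measure0 => -[].
have [+ _] := c_pm measurable0 f2 g2.
by rewrite !z //; [lra|exact: L2D].
Qed.

Let smeasBC f g : L2 f -> L2 g -> forall B, measurable B ->
  smeas (fun x => f x - g x) B = smeas (fun x => g x - f x) B.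
Proof.
move=> f2 g2 B mB; rewrite !smeasE //; try exact: L2B.
have [_ ->] := c_pm mB f2 g2; have [_ ->] := c_pm mB g2 f2.
by rewrite (cC mB g2 f2); congr EFin; lra.
Qed.

Let addfC f g : (fun x : M => f x + g x) = (fun x => g x + f x).
Proof. by apply/funext => x; rewrite addrC. Qed.

Let e (t l : R) := expR (t * l).

Let me t : measurable_fun setT (e t).
Proof. by apply: measurableT_comp => //; exact: measurable_funM. Qed.

Let e0 t l : 0 <= e t l. Proof. exact: expR_ge0. Qed.

Let sint f (phi : R -> R) := (smeas f).-integrable setT (EFin \o phi).

Let sint_le f (phi psi : R -> R) : measurable_fun setT phi -> (forall l, `|phi l| <= psi l) ->
  sint f psi -> sint f phi.
Proof.
move=> mphi le; apply: le_integrable => //; first exact/measurable_EFinP.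
by move=> l _ /=; rewrite lee_fin (le_trans (le l)) // ler_norm.
Qed.

Let sint_ge0 f (phi : R -> R) : measurable_fun setT phi -> (forall l, 0 <= phi l) ->
  sint f phi <-> (\int[smeas f]_l (phi l)%:E < +oo)%E.
Proof.
move=> mphi p0; split.
  move=> /integrableP[_]; by under eq_integral do rewrite /= ger0_norm //.
move=> lt; apply/integrableP; split; first exact/measurable_EFinP.
by under eq_integral do rewrite /= ger0_norm //.
Qed.

Let e_int f t : 0 <= t -> L2 f -> sint f (e t).
Proof.
move=> t0 f2; apply/sint_ge0 => //.
(* The integrability of exp(t l) is read off from the domain of [P (t / 2)], which requires its
   square root exp(t l / 2) to be square integrable. *)
have t20 : 0 <= t / 2 by rewrite divr_ge0.
have [[_ +] _ _] := PE t20 f2.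
rewrite integral_scalar //; congr (_ < _)%E; apply: eq_integral => l _.
by congr EFin; rewrite /e expr2 -expRD; congr expR; lra.
Qed.

Lemma P_L2 t f : 0 <= t -> L2 f -> L2 (P t f).
Proof. by move=> t0 f2; have [_ ] := PE t0 f2. Qed.

Let ipP t f g : 0 <= t -> L2 f -> L2 g ->
  ip (P t f) g = 4^-1 * ((\int[smeas (fun x => f x + g x)]_l e t l) -
                         (\int[smeas (fun x => f x - g x)]_l e t l)).
Proof.
move=> t0 f2 g2; have [_ _ ->] := PE t0 f2; last by have [] := PE t0 g2.
by rewrite /spectral_form !integral_scalar //; [exact: L2B|exact: L2D].
Qed.

Let eq_smeas f1 f2 B (phi : R -> R) :
  (forall A, measurable A -> A `<=` B -> smeas f1 A = smeas f2 A) ->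
  \int[smeas f1]_(l in B) phi l = \int[smeas f2]_(l in B) phi l.
Proof. by move=> H; congr fine; apply: eq_measure_integral => A mA AB; exact: H. Qed.

Lemma P_sym t f g : 0 <= t -> L2 f -> L2 g -> ip (P t f) g = ip f (P t g).
Proof.
move=> t0 f2 g2; rewrite (ipP t0 f2 g2) (ipC f) (ipP t0 g2 f2) (addfC g f).
have -> : \int[smeas (fun x => f x - g x)]_l e t l =
    \int[smeas (fun x => g x - f x)]_l e t l.
  by apply: eq_smeas => B mB _; exact: smeasBC.
by [].
Qed.

Let sint_on f (phi : R -> R) B : measurable B -> sint f phi ->
  (smeas f).-integrable B (EFin \o phi).
Proof. by move=> mB; apply: integrableS. Qed.

Let smeas_in B f g A : measurable B -> L2 f -> L2 g -> measurable A -> A `<=` B ->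
  smeas (fun x => g x + E B f x) A = smeas (fun x => g x + f x) A /\
  smeas (fun x => g x - E B f x) A = smeas (fun x => g x - f x) A.
Proof.
move=> mB f2 g2 mA AB; have w2 := E2 mB f2.
have BA : B `&` A = A by apply/setIidPr.
have e1 : c A g (E B f) = c A g f by rewrite c_E // BA.
have e2 : c A (E B f) (E B f) = c A f f by rewrite c_E // BA cC // c_E // BA.
rewrite !smeasE //; try exact: L2D; try exact: L2B.
have [-> ->] := c_pm mA g2 w2; have [-> ->] := c_pm mA g2 f2.
by rewrite e1 e2.
Qed.

Let smeas_out B f g A : measurable B -> L2 f -> L2 g -> measurable A -> A `<=` ~` B ->
  smeas (fun x => g x + E B f x) A = smeas (fun x => g x - E B f x) A.
Proof.
move=> mB f2 g2 mA AB; have w2 := E2 mB f2.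
have BA : B `&` A = set0 by apply/disjoints_subset; rewrite -(setCK B); exact: subsetC.
have e1 : c A g (E B f) = 0 by rewrite c_E // BA c_set0.
rewrite !smeasE //; try exact: L2D; try exact: L2B.
have [-> ->] := c_pm mA g2 w2.
by rewrite e1 mulr0 addr0 subr0.
Qed.

(** Pairing [P s g] with E(B) f localizes the spectral integral: on B, E(B) f acts as f in the
    polarized measures, and off B the measures of the sum and of the difference coincide and
    cancel. *)
Let c_P B f g s : measurable B -> 0 <= s -> L2 f -> L2 g ->
  c B f (P s g) =
  4^-1 * ((\int[smeas (fun x => g x + f x)]_(l in B) e s l) -
          (\int[smeas (fun x => g x - f x)]_(l in B) e s l)).
Proof.
move=> mB s0 f2 g2; have w2 := E2 mB f2.
rewrite /c ipC (ipP s0 g2 w2).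
have split k : L2 k -> \int[smeas k]_l e s l =
    (\int[smeas k]_(l in B) e s l) + \int[smeas k]_(l in ~` B) e s l.
  move=> k2; rewrite -Rintegral_setU ?setUv //; first exact: measurableC.
    exact: e_int.
  by apply/disj_setPCl.
rewrite !split; [|exact: L2B|exact: L2D].
have -> : \int[smeas (fun x => g x + E B f x)]_(l in B) e s l =
    \int[smeas (fun x => g x + f x)]_(l in B) e s l.
  apply: eq_smeas => A mA AB.
  exact: (smeas_in mB f2 g2 mA AB).1.
have -> : \int[smeas (fun x => g x - E B f x)]_(l in B) e s l =
    \int[smeas (fun x => g x - f x)]_(l in B) e s l.
  apply: eq_smeas => A mA AB.
  exact: (smeas_in mB f2 g2 mA AB).2.
have -> : \int[smeas (fun x => g x + E B f x)]_(l in ~` B) e s l =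
    \int[smeas (fun x => g x - E B f x)]_(l in ~` B) e s l.
  by apply: eq_smeas => A mA AB; exact: smeas_out.
move: (Rintegral _ _ _) (Rintegral _ _ _) (Rintegral _ _ _) => a b r; lra.
Qed.

Let sintE f (phi : R -> R) B : measurable B -> sint f phi ->
  (\int[smeas f]_(l in B) phi l)%:E = (\int[smeas f]_(l in B) (phi l)%:E)%E.
Proof.
by move=> mB Ip; rewrite fineK //; apply: (integrable_fin_num mB); exact: sint_on.
Qed.

Let density_ereal f1 f2 g1 g2 s (phi : R -> R) :
  L2 f1 -> L2 f2 -> L2 g1 -> L2 g2 -> 0 <= s ->
  (forall B, measurable B -> c B f1 f1 + \int[smeas g1]_(l in B) e s l =
     c B f2 f2 + \int[smeas g2]_(l in B) e s l) ->
  measurable_fun setT phi -> (forall l, 0 <= phi l) ->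
  (\int[smeas f1]_l (phi l)%:E + \int[smeas g1]_l (phi l * e s l)%:E =
   \int[smeas f2]_l (phi l)%:E + \int[smeas g2]_l (phi l * e s l)%:E)%E.
Proof.
move=> f12 f22 g12 g22 s0 H mphi p0.
apply: (eq_density_sum (me s) (e0 s) _ mphi p0) => B mB.
have sumE u v : L2 u -> L2 v -> (smeas u B + \int[smeas v]_(l in B) (e s l)%:E)%E =
    (c B u u + \int[smeas v]_(l in B) e s l)%:E.
  by move=> u2 v2; rewrite EFinD smeasE // (sintE mB (e_int s0 v2)).
exact: (etrans (sumE _ _ f12 g12) (etrans (congr1 _ (H B mB)) (esym (sumE _ _ f22 g22)))).
Qed.

Let density_real0 f1 f2 g1 g2 s (phi : R -> R) :
  L2 f1 -> L2 f2 -> L2 g1 -> L2 g2 -> 0 <= s ->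
  (forall B, measurable B -> c B f1 f1 + \int[smeas g1]_(l in B) e s l =
     c B f2 f2 + \int[smeas g2]_(l in B) e s l) ->
  (forall l, 0 <= phi l) ->
  sint f1 phi -> sint f2 phi -> sint g1 (fun l => phi l * e s l) ->
  sint g2 (fun l => phi l * e s l) ->
  \int[smeas f1]_l phi l + \int[smeas g1]_l (phi l * e s l) =
  \int[smeas f2]_l phi l + \int[smeas g2]_l (phi l * e s l).
Proof.
move=> f12 f22 g12 g22 s0 H p0 i1 i2 j1 j2.
have mphi : measurable_fun setT phi by move/measurable_int : i1 => /measurable_EFinP.
have := density_ereal f12 f22 g12 g22 s0 H mphi p0.
have sumE u v p q : sint u p -> sint v q ->
    (\int[smeas u]_l (p l)%:E + \int[smeas v]_l (q l)%:E)%E =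
    (\int[smeas u]_l p l + \int[smeas v]_l q l)%:E.
  by move=> iu iv; rewrite EFinD !sintE.
by move=> H'; apply: EFin_inj; exact: (etrans (esym (sumE _ _ _ _ i1 j1)) (etrans H' (sumE _ _ _ _ i2 j2))).
Qed.

Let sintD f (phi psi : R -> R) : sint f phi -> sint f psi ->
  sint f (fun l => phi l + psi l).
Proof. by move=> i j; exact: (integrableD measurableT i j). Qed.

Let IsintD f (phi psi : R -> R) : sint f phi -> sint f psi ->
  \int[smeas f]_l (phi l + psi l) = \int[smeas f]_l phi l + \int[smeas f]_l psi l.
Proof. by move=> i j; exact: (RintegralD measurableT i j). Qed.

Let sint_norm f (phi : R -> R) : sint f phi -> sint f (fun l => `|phi l|).
Proof. by move=> i; exact: (integrable_norm i). Qed.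

Let density_real f1 f2 g1 g2 s (phi : R -> R) :
  L2 f1 -> L2 f2 -> L2 g1 -> L2 g2 -> 0 <= s ->
  (forall B, measurable B -> c B f1 f1 + \int[smeas g1]_(l in B) e s l =
     c B f2 f2 + \int[smeas g2]_(l in B) e s l) ->
  sint f1 phi -> sint f2 phi -> sint g1 (fun l => phi l * e s l) ->
  sint g2 (fun l => phi l * e s l) ->
  \int[smeas f1]_l phi l + \int[smeas g1]_l (phi l * e s l) =
  \int[smeas f2]_l phi l + \int[smeas g2]_l (phi l * e s l).
Proof.
move=> f12 f22 g12 g22 s0 H i1 i2 j1 j2.
have nE : (fun l => `|phi l| * e s l) = (fun l => `|phi l * e s l|).
  by apply/funext => l; rewrite normrM (ger0_norm (e0 s l)).
have n1 : sint g1 (fun l => `|phi l| * e s l) by rewrite nE; exact: sint_norm.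
have n2 : sint g2 (fun l => `|phi l| * e s l) by rewrite nE; exact: sint_norm.
have DE' : (fun l => (phi l + `|phi l|) * e s l) =
    (fun l => phi l * e s l + `|phi l| * e s l).
  by apply/funext => l; rewrite mulrDl.
have := density_real0 f12 f22 g12 g22 s0 H (fun l => normr_ge0 (phi l))
  (sint_norm i1) (sint_norm i2) n1 n2.
have s1 : sint g1 (fun l => (phi l + `|phi l|) * e s l) by rewrite DE'; exact: sintD.
have s2 : sint g2 (fun l => (phi l + `|phi l|) * e s l) by rewrite DE'; exact: sintD.
have p0 l : 0 <= phi l + `|phi l| by have := ler_norm (- phi l); rewrite normrN; lra.
have := density_real0 f12 f22 g12 g22 s0 H p0 (sintD i1 (sint_norm i1))
  (sintD i2 (sint_norm i2)) s1 s2.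
rewrite DE' (IsintD i1 (sint_norm i1)) (IsintD i2 (sint_norm i2)).
rewrite (IsintD j1 n1) (IsintD j2 n2).
move: (\int[smeas f1]_l phi l) (\int[smeas f2]_l phi l) => a1 a2.
move: (\int[smeas g1]_l (phi l * e s l)) (\int[smeas g2]_l (phi l * e s l)) => b1 b2.
move: (Rintegral _ _ _) (Rintegral _ _ _) (Rintegral _ _ _) (Rintegral _ _ _).
by move=> x1 x2 x3 x4; lra.
Qed.

(** Polarized form of d<E f, P_s g> = exp(s l) d<E f, g>, with the negative terms moved to the other
    side so that [eq_density_sum] applies. *)
Let shift_id f g s : 0 <= s -> L2 f -> L2 g -> forall B, measurable B ->
  c B (fun x => f x + P s g x) (fun x => f x + P s g x) +
    \int[smeas (fun x => g x - f x)]_(l in B) e s l =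
  c B (fun x => f x - P s g x) (fun x => f x - P s g x) +
    \int[smeas (fun x => g x + f x)]_(l in B) e s l.
Proof.
move=> s0 f2 g2 B mB; have v2 := P_L2 s0 g2.
have [-> ->] := c_pm mB f2 v2; rewrite (c_P mB s0 f2 g2).
move: (Rintegral _ _ _) (Rintegral _ _ _) => a b; lra.
Qed.

Let eM s t l : e s l * e t l = e (s + t) l.
Proof. by rewrite /e -expRD mulrDl. Qed.

(** The spectral measure of P_s g is exp(2 s l) times that of g: one factor exp(s l) comes from
    [c_P], the other from [shift_id] tested with exp(s l) on B. The measures of g + g and g - g are
    the two terms of the polarization formula. *)
Let c_PP B g s : 0 <= s -> L2 g -> measurable B ->
  c B (P s g) (P s g) =
  4^-1 * ((\int[smeas (fun x => g x + g x)]_(l in B) e (s + s) l) -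
          (\int[smeas (fun x => g x - g x)]_(l in B) e (s + s) l)).
Proof.
move=> s0 g2 mB; have v2 := P_L2 s0 g2; rewrite (c_P mB s0 v2 g2).
pose phi l := e s l * \1_B l.
have mphi : measurable_fun setT phi by apply: measurable_funM => //; exact: measurable_indic.
have phile l : `|phi l| <= e s l.
  rewrite /phi normrM (ger0_norm (e0 s l)) ler_piMr //.
  by rewrite indicE; case: (l \in B); rewrite ?normr1 ?normr0.
have ip f : L2 f -> sint f phi by move=> f2; exact: sint_le mphi phile (e_int s0 f2).
have phiE l : phi l * e s l = e (s + s) l * \1_B l by rewrite /phi mulrAC eM.
have s20 : 0 <= s + s by exact: addr_ge0.
have ip2 f : L2 f -> sint f (fun l => phi l * e s l).
  move=> f2; apply: sint_le (e_int s20 f2).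
    exact: measurable_funM.
  move=> l; rewrite phiE normrM (ger0_norm (e0 _ l)) ler_piMr //.
  by rewrite indicE; case: (l \in B); rewrite ?normr1 ?normr0.
have on k t : \int[smeas k]_(l in B) e t l = \int[smeas k]_l (e t l * \1_B l).
  rewrite Rintegral_mkcond; apply: eq_Rintegral => l _; rewrite patchE indicE.
  by case: ifPn; rewrite ?mulr1 ?mulr0.
have := density_real (L2D g2 v2) (L2B g2 v2) (L2B g2 g2) (L2D g2 g2) s0
  (shift_id s0 g2 g2) (ip _ (L2D g2 v2)) (ip _ (L2B g2 v2))
  (ip2 _ (L2B g2 g2)) (ip2 _ (L2D g2 g2)).
have -> : (fun l => phi l * e s l) = (fun l => e (s + s) l * \1_B l) by apply/funext.
rewrite !on /phi.
move: (Rintegral _ _ _) (Rintegral _ _ _) (Rintegral _ _ _) (Rintegral _ _ _).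
by move=> x1 x2 x3 x4; lra.
Qed.

Let cT f g : L2 f -> L2 g -> c setT f g = ip f g.
Proof.
move=> f2 g2; apply: ip_ae => //; first exact: E2.
exact: (pvm_setT pvm).
Qed.

Lemma P_norm s g : 0 <= s -> L2 g -> ip (P s g) (P s g) = ip (P (s + s) g) g.
Proof.
move=> s0 g2; have v2 := P_L2 s0 g2; have s20 : 0 <= s + s by exact: addr_ge0.
by rewrite -(cT v2 v2) (c_PP s0 g2 measurableT) (ipP s20 g2 g2).
Qed.

Lemma P0 f g : L2 f -> L2 g -> ip (P 0 f) g = ip f g.
Proof.
move=> f2 g2; rewrite (ipP (lexx 0) f2 g2).
have tot k : L2 k -> \int[smeas k]_l e 0 l = c setT k k.
  move=> k2; apply: EFin_inj; rewrite (sintE measurableT (e_int (lexx 0) k2)) -smeasE //.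
  under eq_integral do rewrite /e mul0r expR0.
  by rewrite integral_cst // mul1e.
rewrite !tot; [|exact: L2B|exact: L2D].
have [-> ->] := c_pm measurableT f2 g2; rewrite !cT //.
by move: (ip f g) (ip f f) (ip g g) => x y z; lra.
Qed.

Lemma P_add t f g k : 0 <= t -> L2 f -> L2 g -> L2 k ->
  ip (P t (fun x => f x + g x)) k = ip (P t f) k + ip (P t g) k.
Proof.
move=> t0 f2 g2 k2; rewrite !P_sym //; last exact: L2D.
by rewrite ipDl //; exact: P_L2.
Qed.

(** Polarization of [P_norm]: the identity for f + g is expanded by additivity and symmetry, and
    those for f and g are subtracted. *)
Lemma P_semigroup s f g : 0 <= s -> L2 f -> L2 g ->
  ip (P s f) (P s g) = ip (P (s + s) f) g.
Proof.
move=> s0 f2 g2; have s20 : 0 <= s + s by exact: addr_ge0.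
have fg2 := L2D f2 g2.
have nD := P_norm s0 fg2; have nf := P_norm s0 f2; have ng := P_norm s0 g2.
have Pf := P_L2 s0 f2; have Pg := P_L2 s0 g2; have Pfg := P_L2 s0 fg2.
move: nD; rewrite (P_add s0 f2 g2 Pfg) (ipC (P s f)) (ipC (P s g)).
rewrite (P_add s0 f2 g2 Pf) (P_add s0 f2 g2 Pg) (ipC (P s g) (P s f)) nf ng.
have P2f := P_L2 s20 f2; have P2g := P_L2 s20 g2.
rewrite (P_add s20 f2 g2 fg2) (ipDr f2 g2 P2f) (ipDr f2 g2 P2g).
rewrite (P_sym s20 g2 f2) (ipC g (P (s + s) f)).
move: (ip (P s f) (P s g)) (ip (P (s + s) f) g) (ip (P (s + s) f) f) => x1 x2 x3.
by move: (ip (P (s + s) g) g) => x4 h; lra.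
Qed.

Let id_dom f := (\int[smeas f]_l (l ^+ 2)%:E < +oo)%E.

Lemma D_L2 f f' : D f f' -> L2 f /\ L2 f'.
Proof. by case: sa => H _ _; exact: H. Qed.

Let D_dom f f' : D f f' -> id_dom f.
Proof. by move=> H; have [[f2 +] _ _] := (DE f f').1 H; rewrite integral_scalar. Qed.

Let DD f f' g g' : D f f' -> D g g' -> D (fun x => f x + g x) (fun x => f' x + g' x).
Proof.
move=> Df Dg; have [f2 f'2] := D_L2 Df; have [g2 g'2] := D_L2 Dg.
case: sa => _ _ adj; apply/adj; [exact: L2D|exact: L2D|] => k k' Dk.
have [k2 k'2] := D_L2 Dk.
rewrite !ipDl //; congr (_ + _); [exact: (adj f f' f2 f'2).1|exact: (adj g g' g2 g'2).1].
Qed.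

Let DB f f' g g' : D f f' -> D g g' -> D (fun x => f x - g x) (fun x => f' x - g' x).
Proof.
move=> Df Dg; have [f2 f'2] := D_L2 Df; have [g2 g'2] := D_L2 Dg.
case: sa => _ _ adj; apply/adj; [exact: L2B|exact: L2B|] => k k' Dk.
have [k2 k'2] := D_L2 Dk.
rewrite !ipBl //; congr (_ - _); [exact: (adj f f' f2 f'2).1|exact: (adj g g' g2 g'2).1].
Qed.

Let m2 : measurable_fun setT (fun l : R => l ^+ 2).
Proof. exact: measurable_funX. Qed.

Let sq_int f : id_dom f <-> sint f (fun l => l ^+ 2).
Proof. by rewrite (sint_ge0 f m2) // => l; exact: sqr_ge0. Qed.

(** At this stage the spectrum may have a positive part. For l <= 0 the exponential is at most 1;
    for l > 0, l^2 <= 4 exp(l), at the cost of one more unit of time. *)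
Let sq_e_le t T l : 0 <= t -> t <= T -> l ^+ 2 * e t l <= l ^+ 2 + 4 * e (T + 1) l.
Proof.
move=> t0 tT; have [l0|l0] := leP l 0.
  have h : e t l <= 1 by rewrite /e -expR0 ler_expR mulr_ge0_le0.
  have := e0 (T + 1) l; have := sqr_ge0 l; nra.
have h1 : e t l <= e T l by rewrite /e ler_expR ler_pM2r.
have h2 : l ^+ 2 <= 4 * e 1 l.
  have h := expR_ge1Dx (l / 2); rewrite /e mul1r.
  have -> : expR l = expR (l / 2) ^+ 2 by rewrite expr2 -expRD; congr expR; lra.
  move: (expR _) h => E1 h; nra.
rewrite -eM; have := e0 T l; have := e0 1 l; have := e0 t l; have := sqr_ge0 l.
move: (e t l) (e T l) (e 1 l) h1 h2 => a b r h1 h2 p1 p2 p3 p4.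
have : l ^+ 2 * a <= 4 * r * b by apply: ler_pM.
lra.
Qed.

Let sq_e_int f t : 0 <= t -> L2 f -> id_dom f -> sint f (fun l => l ^+ 2 * e t l).
Proof.
move=> t0 f2 df.
have i2 : sint f (fun l => l ^+ 2 + 4 * e (t + 1) l).
  apply: sintD; first exact/sq_int.
  by have t1 := addr_ge0 t0 ler01; exact: (integrableZl measurableT _ (e_int t1 f2)).
apply: sint_le i2; first exact: measurable_funM.
move=> l; rewrite (ger0_norm (mulr_ge0 (sqr_ge0 l) (e0 t l))).
exact: (sq_e_le l t0 (lexx t)).
Qed.

Let id_e_int f t : 0 <= t -> L2 f -> id_dom f -> sint f (fun l => l * e t l).
Proof.
move=> t0 f2 df.
have := sintD (e_int t0 f2) (sq_e_int t0 f2 df); apply: sint_le.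
  exact: measurable_funM.
move=> l; rewrite normrM (ger0_norm (e0 t l)).
have h : `|l| <= 1 + l ^+ 2 by rewrite -(real_normK (num_real l)); have := normr_ge0 l; nra.
by have := e0 t l; move: (e t l) => a a0; nra.
Qed.

Let id_int f : L2 f -> id_dom f -> sint f id.
Proof.
move=> f2 df; have := id_e_int (lexx 0) f2 df.
by congr integrable; apply/funext => l /=; rewrite /e mul0r expR0 mulr1.
Qed.

(** By [c_PP] the spectral measure of P_s g has density exp(2 s l), and l^2 exp(2 s l) is integrable
    for vectors in the domain of the generator. [mzero] fills the empty place in [eq_density_sum],
    and the weight 1/4 is that of polarization. *)
Let P_dom g g' s : 0 <= s -> D g g' -> id_dom (P s g).
Proof.
move=> s0 Dg; have [g2 _] := D_L2 Dg; have v2 := P_L2 s0 g2.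
have s20 : 0 <= s + s by exact: addr_ge0.
pose w l := 4^-1 * e (s + s) l.
have mw : measurable_fun setT w by exact: measurable_funM.
have w0 l : 0 <= w l by rewrite mulr_ge0.
have wE k B : L2 k -> measurable B ->
    (\int[smeas k]_(l in B) (w l)%:E)%E = (4^-1 * \int[smeas k]_(l in B) e (s + s) l)%:E.
  move=> k2 mB; rewrite EFinM (sintE mB (e_int s20 k2)).
  rewrite /w; under eq_integral do rewrite EFinM.
  rewrite ge0_integralZl //; last by move=> l _; rewrite lee_fin.
  by apply/measurable_EFinP; exact: (measurable_funS measurableT).
have := eq_density_sum mw w0 _ m2 (fun l => sqr_ge0 l).
move=> /(_ (smeas (P s g)) mzero (smeas (fun x => g x - g x)) (smeas (fun x => g x + g x))).
move=> eqd; rewrite /id_dom.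
have {eqd} eqd := eqd _.
have fin : (\int[smeas (fun x => g x + g x)%R]_l (l ^+ 2 * w l)%:E < +oo)%E.
  have := sq_e_int s20 (L2D g2 g2) (D_dom (DD Dg Dg)) => i.
  apply/sint_ge0; [exact: measurable_funM|by move=> l; rewrite mulr_ge0 ?sqr_ge0|].
  apply: sint_le i; first exact: measurable_funM.
  move=> l; rewrite (ger0_norm (mulr_ge0 (sqr_ge0 l) (w0 l))) /w.
  have := mulr_ge0 (sqr_ge0 l) (e0 (s + s) l); move: (e _ l) => a; lra.
apply: le_lt_trans fin; rewrite -[leRHS]add0e -[X in (_ <= X + _)%E](integral_measure_zero setT (fun l : R => (l ^+ 2)%:E)).
rewrite -eqd.
  apply: leeDl; apply: integral_ge0 => l _; rewrite lee_fin mulr_ge0 ?sqr_ge0 //.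
move=> B mB; rewrite (wE _ B (L2B g2 g2) mB) (wE _ B (L2D g2 g2) mB).
rewrite (smeasE v2 mB) (c_PP s0 g2 mB); apply: (etrans _ (esym (add0e _))).
rewrite -EFinD; congr EFin.
move: (Rintegral _ _ _) (Rintegral _ _ _) => a b; lra.
Qed.

(** Parallelogram law for spectral measures: those of f + g and f - g add up to twice the sum of
    those of f and g. *)
Let dom_pm f g : L2 f -> L2 g -> id_dom f -> id_dom g ->
  id_dom (fun x => f x + g x) /\ id_dom (fun x => f x - g x).
Proof.
move=> f2 g2 df dg.
have i0 : forall l : R, setT l -> (0 <= (l ^+ 2)%:E)%E by move=> l _; rewrite lee_fin sqr_ge0.
have mE := (measurable_EFinP _ _).2 m2.
have H : (\int[smeas (fun x => f x + g x)%R]_l (l ^+ 2)%:E +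
    \int[smeas (fun x => f x - g x)%R]_l (l ^+ 2)%:E < +oo)%E.
  rewrite -ge0_integral_measure_add //.
  rewrite (@eq_measure_integral _ _ _ _
    (measure_add (measure_add (smeas f) (smeas f)) (measure_add (smeas g) (smeas g)))).
    rewrite !ge0_integral_measure_add //.
    exact: (lte_add_pinfty (lte_add_pinfty df df) (lte_add_pinfty dg dg)).
  move=> B mB _; apply: (etrans (measure_addE _ _ _)).
  apply: (etrans _ (esym (etrans (measure_addE _ _ _)
    (congr2 _ (measure_addE _ _ _) (measure_addE _ _ _))))).
  rewrite (smeasE f2 mB) (smeasE g2 mB).
  rewrite (smeasE (L2D f2 g2) mB) (smeasE (L2B f2 g2) mB) -!EFinD; congr EFin.
  have [-> ->] := c_pm mB f2 g2; lra.
by split; apply: le_lt_trans H; [apply: leeDl|apply: leeDr]; exact: integral_ge0.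
Qed.

(** This expresses <L f, P_s g> as the integral of l exp(s l) against d<E f, g>. The formula is
    symmetric in f and g, whence L commutes weakly with P_s. *)
Let ipDP f f' g g' s : 0 <= s -> D f f' -> D g g' ->
  ip f' (P s g) = 4^-1 * (\int[smeas (fun x => g x + f x)]_l (l * e s l) -
                          \int[smeas (fun x => g x - f x)]_l (l * e s l)).
Proof.
move=> s0 Df Dg; have [f2 f'2] := D_L2 Df; have [g2 g'2] := D_L2 Dg.
have solve (a b x y : R) : a + x = b + y -> a - b = y - x by lra.
have v2 := P_L2 s0 g2; have vd := P_dom s0 Dg.
have [_ _ ->] := (DE f f').1 Df; last by split => //; rewrite integral_scalar.
have [dp dm] := dom_pm f2 v2 (D_dom Df) vd.
have H := density_real (L2D f2 v2) (L2B f2 v2) (L2B g2 f2) (L2D g2 f2) s0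
  (shift_id s0 f2 g2) (id_int (L2D f2 v2) dp) (id_int (L2B f2 v2) dm)
  (id_e_int s0 (L2B g2 f2) (D_dom (DB Dg Df))) (id_e_int s0 (L2D g2 f2) (D_dom (DD Dg Df))).
rewrite /spectral_form (integral_scalar _ (L2D f2 v2)) (integral_scalar _ (L2B f2 v2)).
exact: (congr1 ( *%R 4^-1) (solve _ _ _ _ H)).
Qed.

Lemma P_generator_sym f f' g g' s : 0 <= s -> D f f' -> D g g' ->
  ip (P s f') g = ip (P s f) g'.
Proof.
move=> s0 Df Dg; have [f2 f'2] := D_L2 Df; have [g2 g'2] := D_L2 Dg.
rewrite (P_sym s0 f'2 g2) (ipC _ g') (ipDP s0 Df Dg) (ipDP s0 Dg Df) (addfC g f).
have -> : \int[smeas (fun x => g x - f x)]_l (l * e s l) =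
    \int[smeas (fun x => f x - g x)]_l (l * e s l).
  by apply: eq_smeas => B mB _; exact: smeasBC.
by [].
Qed.

(** With x = (t - s) l the claim is |exp(x) - 1 - x| <= x^2 (1 + exp(x)); it follows from exp(x) >=
    1 + x and exp(-x) >= 1 - x according to the sign of x. *)
Let taylor_e s t l : `|e t l - e s l - (t - s) * (l * e s l)| <=
  (t - s) ^+ 2 * (l ^+ 2 * e s l + l ^+ 2 * e t l).
Proof.
have -> : e t l = e s l * expR ((t - s) * l) by rewrite /e -expRD; congr expR; lra.
move: (e s l) (e0 s l) => a a0.
have : `|expR ((t - s) * l) - 1 - (t - s) * l| <=
    ((t - s) * l) ^+ 2 * (1 + expR ((t - s) * l)).
  move: ((t - s) * l) => x; have := expR_ge1Dx x; have := expR_ge1Dx (- x).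
  have := expRxMexpNx_1 x; move: (expR x) (expR (- x)) (expR_gt0 x) (expR_gt0 (- x)) => X Y.
  move=> X0 Y0 XY h1 h2; rewrite ger0_norm; last lra.
  (* X(1-x) <= 1 *)
  have h3 : X * (1 - x) <= 1 by rewrite -XY ler_pM2l //; lra.
  have h4 := sqr_ge0 x; have [x0|x0] := leP 0 x.
    have : x * (X - 1) <= x * (x * X) by apply: ler_wpM2l => //; lra.
    nra.
  have : x * (X - 1) <= x * x by rewrite ler_nM2l //; lra.
  nra.
move: (t - s) => r; set X := expR _ => h.
have -> : a * X - a - r * (l * a) = a * (X - 1 - r * l) by ring.
rewrite normrM (ger0_norm a0).
have -> : r ^+ 2 * (l ^+ 2 * a + l ^+ 2 * (a * X)) = a * ((r * l) ^+ 2 * (1 + X)) by ring.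
exact: ler_wpM2l.
Qed.

Lemma P_taylor f f' g g' T : 0 <= T -> D f f' -> D g g' -> exists2 K : R, 0 <= K &
  forall s t, 0 <= s -> s <= T -> 0 <= t -> t <= T ->
    `|ip (P t f) g - ip (P s f) g - (t - s) * ip (P s f') g| <= K * (t - s) ^+ 2.
Proof.
move=> T0 Df Dg; have [f2 f'2] := D_L2 Df; have [g2 g'2] := D_L2 Dg.
have T1 : 0 <= T + 1 by rewrite addr_ge0.
pose psi l := 2 * (l ^+ 2 + 4 * e (T + 1) l).
pose I k := \int[smeas k]_l psi l.
have Ipsi k : L2 k -> id_dom k -> sint k psi.
  move=> k2 dk; apply: (integrableZl measurableT 2 (f := EFin \o (fun l => l ^+ 2 + 4 * e (T + 1) l))).
  apply: sintD; first exact/sq_int.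
  exact: (integrableZl measurableT 4 (e_int T1 k2)).
have psi0 l : 0 <= psi l.
  by have := sqr_ge0 l; have := e0 (T + 1) l; rewrite /psi; move: (e _ _) => a; nra.
have I0 k : 0 <= I k by apply: Rintegral_ge0.
have main k s t : L2 k -> id_dom k -> 0 <= s -> s <= T -> 0 <= t -> t <= T ->
    `|\int[smeas k]_l e t l - \int[smeas k]_l e s l - (t - s) * \int[smeas k]_l (l * e s l)|
    <= (t - s) ^+ 2 * I k.
  move=> k2 dk s0 sT t0 tT.
  have it := e_int t0 k2; have is_ := e_int s0 k2; have il := id_e_int s0 k2 dk.
  have il' := integrableZl measurableT (t - s) il.
  rewrite -RintegralZl // -RintegralB // -RintegralB //; last exact: (integrableB measurableT it is_).
  apply: le_trans (le_normr_Rintegral _ _) _ => //.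
    exact: (integrableB measurableT (integrableB measurableT it is_) il').
  rewrite /I -RintegralZl //; last exact: Ipsi.
  apply: le_Rintegral => //.
  - exact: (integrable_norm (integrableB measurableT (integrableB measurableT it is_) il')).
  - exact: (integrableZl measurableT _ (Ipsi _ k2 dk)).
  move=> l _; apply: le_trans (taylor_e s t l) _; apply: ler_wpM2l; first exact: sqr_ge0.
  have := sq_e_le l s0 sT; have := sq_e_le l t0 tT; rewrite /psi.
  move: (_ * e s l) (_ * e t l) (_ + _ * e _ l) => x1 x2 x3; lra.
exists (4^-1 * (I (fun x => f x + g x) + I (fun x => f x - g x))).
  by rewrite mulr_ge0 // addr_ge0.
move=> s t s0 sT t0 tT.
have h1 := main _ s t (L2D f2 g2) (D_dom (DD Df Dg)) s0 sT t0 tT.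
have h2 := main _ s t (L2B f2 g2) (D_dom (DB Df Dg)) s0 sT t0 tT.
rewrite (P_sym s0 f'2 g2) (ipDP s0 Df Dg) !ipP // (addfC g f).
have -> : \int[smeas (fun x => g x - f x)]_l (l * e s l) =
    \int[smeas (fun x => f x - g x)]_l (l * e s l).
  by apply: eq_smeas => B mB _; exact: smeasBC.
move: (I _) (I _) h1 h2 => i1 i2.
move: (Rintegral _ _ _) (Rintegral _ _ _) (Rintegral _ _ _).
move: (Rintegral _ _ _) (Rintegral _ _ _) (Rintegral _ _ _) => x1 x2 x3 y1 y2 y3.
rewrite !ler_norml => /andP[h1 h2] /andP[h3 h4]; apply/andP; split; lra.
Qed.

End spectral.

(** * The heat semigroup on smooth functions *)

(** Spectral identities hold almost everywhere, so they are recorded as pairings with test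
    functions. Since each [P t f] is given as its smooth representative, [S_eq] later turns them
    into pointwise identities. *)
Record heat_space {R : realType} {M : ptopologicalType}
    (S : (M -> R) -> Prop) (L : (M -> R) -> (M -> R))
    (mu : {measure set (borel M) -> \bar R}) (P : R -> (M -> R) -> (M -> R)) : Prop := {
  hp_S : forall t f, 0 <= t -> @Sc R M S f -> S (P t f);
  hp_L2 : forall t f, 0 <= t -> @Sc R M S f -> L2 mu (P t f);
  hp_0 : forall f g, @Sc R M S f -> @Sc R M S g -> ip mu (P 0 f) g = ip mu f g;
  hp_sym : forall t f g, 0 <= t -> @Sc R M S f -> @Sc R M S g -> ip mu (P t f) g = ip mu f (P t g);
  hp_semi : forall s f g, 0 <= s -> @Sc R M S f -> @Sc R M S g ->
    ip mu (P s f) (P s g) = ip mu (P (s + s) f) g;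
  hp_gen : forall s f g, 0 <= s -> @Sc R M S f -> @Sc R M S g ->
    ip mu (P s (L f)) g = ip mu (P s f) (L g);
  hp_taylor : forall f g T, 0 <= T -> @Sc R M S f -> @Sc R M S g -> exists2 K : R, 0 <= K &
    forall s t, 0 <= s -> s <= T -> 0 <= t -> t <= T ->
    `|ip mu (P t f) g - ip mu (P s f) g - (t - s) * ip mu (P s (L f)) g| <= K * (t - s) ^+ 2 }.

(* [psi] is the derivative of [phi], with a uniform quadratic remainder. *)
Definition quad_diff {R : realType} (T : R) (phi psi : R -> R) := exists2 K : R, 0 <= K &
  forall s t, 0 <= s -> s <= T -> 0 <= t -> t <= T ->
    `|phi t - phi s - (t - s) * psi s| <= K * (t - s) ^+ 2.

Section quad_diff.
Context {R : realType}.
Implicit Types (phi psi : R -> R).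

Lemma quad_diffD T phi psi phi' psi' a : quad_diff T phi psi -> quad_diff T phi' psi' ->
  quad_diff T (fun t => phi t + a * phi' t) (fun t => psi t + a * psi' t).
Proof.
move=> [K K0 H] [K' K0' H']; exists (K + `|a| * K'); first by rewrite addr_ge0 // mulr_ge0.
move=> s t s0 sT t0 tT; have h := H s t s0 sT t0 tT; have h' := H' s t s0 sT t0 tT.
have -> : phi t + a * phi' t - (phi s + a * phi' s) - (t - s) * (psi s + a * psi' s) =
  (phi t - phi s - (t - s) * psi s) + a * (phi' t - phi' s - (t - s) * psi' s) by ring.
have -> : (K + `|a| * K') * (t - s) ^+ 2 = K * (t - s) ^+ 2 + `|a| * (K' * (t - s) ^+ 2).
  by move: ((t - s) ^+ 2) `|a| => r b; ring.
by apply: (le_trans (ler_normD _ _)); rewrite lerD // normrM ler_wpM2l.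
Qed.

Lemma quad_diff_rev T phi psi : quad_diff T phi psi ->
  quad_diff T (fun t => phi (T - t)) (fun t => - psi (T - t)).
Proof.
move=> [K K0 H]; exists K => // s t s0 sT t0 tT.
have := H (T - s) (T - t); rewrite !subr_ge0 !gerBl.
move=> /(_ sT s0 tT t0).
have -> : T - t - (T - s) = - (t - s) by ring.
by rewrite sqrrN mulNr mulrN.
Qed.

Lemma quad_diff_cst T (a : R) : quad_diff T (fun=> a) (fun=> 0).
Proof. by exists 0 => // s t *; rewrite mulr0 subr0 subrr normr0 mul0r. Qed.

Lemma quad_diff_id T : quad_diff T (fun t : R => t) (fun=> 1).
Proof. by exists 0 => // s t *; rewrite mulr1 subrr normr0 mul0r. Qed.

Lemma quad_diff_sqr T : quad_diff T (fun t : R => t ^+ 2) (fun t => 2 * t).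
Proof.
exists 1 => // s t _ _ _ _; have -> : t ^+ 2 - s ^+ 2 - (t - s) * (2 * s) = (t - s) ^+ 2 by ring.
by rewrite mul1r ger0_norm // sqr_ge0.
Qed.

Lemma quad_diff_cube (T : R) : 0 <= T -> quad_diff T (fun t : R => t ^+ 3) (fun t => 3 * t ^+ 2).
Proof.
move=> T0; exists (3 * T); first exact: mulr_ge0.
move=> s t s0 sT t0 tT.
have -> : t ^+ 3 - s ^+ 3 - (t - s) * (3 * s ^+ 2) = (t + 2 * s) * (t - s) ^+ 2 by ring.
have h0 : 0 <= t + 2 * s by lra.
rewrite (ger0_norm (mulr_ge0 h0 (sqr_ge0 (t - s)))).
by apply: (ler_wpM2r (sqr_ge0 (t - s))); lra.
Qed.

Lemma quad_diff_le T phi psi (B : R) : 0 <= T -> quad_diff T phi psi ->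
  (forall t, 0 <= t -> t <= T -> psi t <= B) -> phi T <= phi 0 + T * B.
Proof.
move=> T0 [K K0 H] psiB; apply: (@increments_le _ _ _ _ K) => // s t s0 st tT.
have s1 := le_trans st tT; have t0 := le_trans s0 st.
have := H s t s0 s1 t0 tT; rewrite ler_norml => /andP[_].
have : (t - s) * psi s <= (t - s) * B by rewrite ler_wpM2l ?subr_ge0 // psiB.
move: ((t - s) * _) ((t - s) * _) (K * _) (phi t) (phi s) => *; lra.
Qed.

Lemma quad_diff_sub T T' phi psi : T' <= T -> quad_diff T phi psi -> quad_diff T' phi psi.
Proof.
move=> T'T [K K0 H]; exists K => // s t s0 sT t0 tT.
by apply: H => //; exact: le_trans T'T.
Qed.

Lemma eq_quad_diff T phi phi' psi psi' : (forall t, phi t = phi' t) ->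
  (forall t, psi t = psi' t) -> quad_diff T phi psi -> quad_diff T phi' psi'.
Proof. by move=> /funext -> /funext ->. Qed.

Lemma quad_diff_norm_le T phi psi (B : R) : 0 <= T -> quad_diff T phi psi ->
  (forall t, 0 <= t -> t <= T -> `|psi t| <= B) -> phi 0 = 0 -> `|phi T| <= T * B.
Proof.
move=> T0 H psiB p0; rewrite ler_norml; apply/andP; split.
  have H' := quad_diffD (-1) (quad_diff_cst T 0) H.
  have : 0 + -1 * phi T <= 0 + -1 * phi 0 + T * B.
    apply: (quad_diff_le T0 H') => t t0 tT.
    by have := psiB t t0 tT; rewrite ler_norml => /andP[]; lra.
  by rewrite p0; move: (T * B) => TB; lra.
have := quad_diff_le (B := B) T0 H; rewrite p0 add0r; apply => t t0 tT.
exact: le_trans (ler_norm _) (psiB t t0 tT).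
Qed.

End quad_diff.

Section heat.
Context {R : realType} {M : ptopologicalType} {S : (M -> R) -> Prop}.
Context {L : (M -> R) -> (M -> R)} {mu : {measure set (borel M) -> \bar R}}.
Context {h : nat -> M -> R} {P : R -> (M -> R) -> (M -> R)}.
Hypothesis ds : diffusion_space S L mu h.
Hypothesis hp : heat_space S L mu P.
Implicit Types (f g : M -> R).

Local Notation Gam := (Gamma L).
Local Notation ip := (Defs.ip mu).
Local Notation Sc := (@Sc R M S).
Local Notation cut := (@cut R M h).
Let gc := ds_gc ds.

(** The set where [f] is positive is open, hence of positive measure as soon as it is nonempty. *)
Lemma S_Int0 f : S f -> (forall x, 0 <= f x) -> intg mu f -> \int[mu]_x f x <= 0 ->
  forall x, f x = 0.
Proof.
move=> Sf f0 If le x; apply/eqP/negPn/negP => fx.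
pose U := [set y | 0 < f y].
have oU : open U by apply: (@open_comp _ _ f [set y | 0 < y]) => [y _|]; [exact: (gc_continuous gc Sf)|exact: open_gt].
have Ux : U x by rewrite /U /= lt_neqAle f0 eq_sym fx.
have := ds_open ds oU (ex_intro _ x Ux).
suff -> : mu U = 0%E by rewrite ltxx.
have I0 : (\int[mu]_x `|(f x)%:E| = 0)%E.
  under eq_integral do rewrite abse_EFin ger0_norm //.
  rewrite -(EFin_Int If); congr EFin; apply/eqP; rewrite eq_le le.
  exact: Int_ge0.
have := (ae_eq_integral_abs mu measurableT ((measurable_EFinP _ _).2 (S_meas ds Sf))).1 I0.
move=> [N [mN N0 sN]]; apply/eqP; rewrite eq_le measure_ge0 andbT -N0.
apply: le_measure; rewrite ?inE //; first exact: borel_open.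
move=> y Uy; apply: sN => /= /(_ I)[fy]; by move: Uy; rewrite /U /= fy ltxx.
Qed.

Lemma cut2_cvg (w : M -> R) x : (fun k => cut 2 k x ^+ 2 * w x) @ \oo --> w x.
Proof.
have half : (2^-1 : R) < 1 by lra.
have H : \forall k \near \oo, 2^-1 < h k x.
  exact: (@cvgr_gt R _ _ _ _ _ (ds_h_cvg ds x) _ half).
apply: cvg_near_cst; apply: filterS H => k /cut2_plateau[-> _].
by rewrite expr1n mul1r.
Qed.

(** Testing against the compactly supported function cut^2 (f - g) gives a vanishing integral of
    cut^2 (f - g)^2, and the cut-offs reach 1 at every point. *)
Lemma S_eq f g : S f -> S g -> (forall k, Sc k -> ip f k = ip g k) -> f = g.
Proof.
move=> Sf Sg fg; apply/funext => x.
pose w y := f y - g y.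
have Sw : S w := gcB gc Sf Sg.
have z k : forall y, cut 2 k y ^+ 2 * w y ^+ 2 = 0.
  have cw : Sc (fun y => cut 2 k y ^+ 2 * w y).
    by apply: (ScM ds) Sw; exact: (Sc_sqr ds (Sc_cut ds 2 k)).
  have cf := ScMr ds Sf cw; have cg := ScMr ds Sg cw.
  have cw2 : Sc (fun y => cut 2 k y ^+ 2 * w y ^+ 2).
    by apply: (ScM ds (Sc_sqr ds (Sc_cut ds 2 k))); exact: (gc_sqr gc Sw).
  apply: (S_Int0 cw2.1 _ (Sc_intg ds cw2)) => [y|].
    by rewrite mulr_ge0 ?sqr_ge0.
  rewrite (eq_Int mu (g := fun y => f y * (cut 2 k y ^+ 2 * w y) -
      g y * (cut 2 k y ^+ 2 * w y))).
    rewrite IntB; [|exact: (Sc_intg ds cf)|exact: (Sc_intg ds cg)].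
    by have := fg _ cw; rewrite /Defs.ip => ->; rewrite subrr.
  by move=> y; rewrite /w; move: (f y) (g y) (cut 2 k y) => a b r; ring.
have := @cut2_cvg (fun y => w y ^+ 2) x.
rewrite (_ : (fun k => _) = fun=> 0); last by apply/funext => k; rewrite z.
move=> c0; have w0 : w x ^+ 2 = 0 by exact: (cvg_unique _ c0 (cvg_cst _)).
by apply/eqP; rewrite -subr_eq0 -sqrf_eq0; apply/eqP.
Qed.

Lemma Sc_ipL f g : S f -> Sc g -> ip (L f) g = ip f (L g).
Proof.
move=> Sf cg; rewrite /Defs.ip -(Int_by_parts ds cg Sf).
by apply: eq_Int => x; rewrite mulrC.
Qed.

Lemma P_zero f : Sc f -> P 0 f = f.
Proof.
move=> cf; apply: S_eq; [exact: (hp_S hp (lexx 0) cf)|exact: cf.1|].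
by move=> k ck; exact: (hp_0 hp).
Qed.

Lemma P_L t f : 0 <= t -> Sc f -> L (P t f) = P t (L f).
Proof.
move=> t0 cf; have SP := hp_S hp t0 cf.
apply: S_eq; [exact: (gc_L gc SP)|exact: (hp_S hp t0 (ScL ds cf))|].
by move=> k ck; rewrite (Sc_ipL SP ck) (hp_gen hp).
Qed.

Lemma P_opp t f : 0 <= t -> Sc f -> P t (fun x => -1 * f x) = fun x => -1 * P t f x.
Proof.
move=> t0 cf; have cN := ScZ ds (-1) cf; have SP := hp_S hp t0 cf.
apply: S_eq; [exact: (hp_S hp t0 cN)|exact: (gcZ gc)|] => k ck.
have f2 := ds_L2 ds cf; have k2 := ds_L2 ds ck.
rewrite (hp_sym hp) // (ipZl _ f2 (hp_L2 hp t0 ck)) (ipZl _ (hp_L2 hp t0 cf) k2).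
by rewrite (hp_sym hp).
Qed.

(** One k serves all scales c, with the explicit price c^2: the iteration of [form_L2] uses
    infinitely many scales on the same [h k]. *)
Lemma Gamma_cut_le (e : R) : 0 < e ->
  \forall k \near \oo, forall c x, 0 <= c -> Gam (cut c k) (cut c k) x <= c ^+ 2 * e.
Proof.
move=> e0; have [K K0 HK] := @derive1_step_bounded R.
have e1 : 0 < e / (K ^+ 2 + 1) by rewrite divr_gt0 // ltr_pwDr ?sqr_ge0.
move: (ds_h_Gamma ds e1); apply: filterS => k Hk c x c0.
rewrite (Gamma_cut ds c k x).
have s2 : derive1 step (c * h k x) ^+ 2 <= K ^+ 2.
  have := HK (c * h k x); rewrite ler_norml => /andP[].
  by move: (derive1 step (c * h k x)) => r r1 r2; nra.
have G0 := gc_Gamma_ge0 gc x (ds_h ds k).1.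
have c20 := sqr_ge0 c.
have K1 : 0 < K ^+ 2 + 1 by rewrite ltr_pwDr ?sqr_ge0.
apply: (@le_trans _ _ (K ^+ 2 * (c ^+ 2 * (e / (K ^+ 2 + 1))))).
  by apply: (ler_pM (sqr_ge0 _) (mulr_ge0 c20 G0) s2); rewrite ler_wpM2l.
rewrite mulrCA ler_wpM2l // mulrCA; apply: (ler_piMr (ltW e0)).
by rewrite ler_pdivrMr ?mul1r ?lerDl.
Qed.

(** Caccioppoli inequality: chi^2 f L f is integrated by parts and half of chi^2 Gamma(f) absorbs
    the cross term with Gamma(chi, f), which explains the factors 2 and 4. *)
Lemma cut_energy f k (e : R) : S f -> L2 mu f -> 0 < e ->
  (forall x, Gam (cut 2 k) (cut 2 k) x <= e) ->
  \int[mu]_x (cut 2 k x ^+ 2 * Gam f f x) <=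
  - (2 * \int[mu]_x (cut 2 k x ^+ 2 * (f x * L f x))) + 4 * e * \int[mu]_x (f x ^+ 2).
Proof.
move=> Sf f2 e0 He; set chi := cut 2 k.
have cc : Sc chi := Sc_cut ds 2 k.
have cc2 := Sc_sqr ds cc.
have SL := gc_L gc Sf; have SG := gc_Gamma gc Sf Sf.
have c1 : Sc (fun x => chi x ^+ 2 * f x) := ScM ds cc2 Sf.
have iG : intg mu (fun x => chi x ^+ 2 * Gam f f x) := Sc_intg ds (ScM ds cc2 SG).
have ifL : intg mu (fun x => chi x ^+ 2 * (f x * L f x)).
  exact: (Sc_intg ds (ScM ds cc2 (gcM gc Sf SL))).
have if2 := ((L2_intg mu f).1 f2).2.
have := Int_LGamma ds c1 Sf.
rewrite (eq_Int mu (g := fun x => chi x ^+ 2 * (f x * L f x))); last by move=> x; rewrite mulrA.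
move=> E; rewrite E mulrN opprK.
have iGG : intg mu (Gam (fun x => chi x ^+ 2 * f x) f).
  exact: (Sc_intg ds (Sc_form ds (Gamma_derivation ds) c1 Sf)).
rewrite -!IntZ // -IntD; [|exact: intgZ|exact: intgZ].
apply: le_Int => //; first by apply: intgD; exact: intgZ.
move=> x; rewrite (Gamma_sqrM gc x cc.1 Sf smooth_real_id) derive1_id mulr1.
have CS := Gamma_CS gc x cc.1 Sf; have G0 := gc_Gamma_ge0 gc x Sf.
have Gc := gc_Gamma_ge0 gc x cc.1; have Hx := He x.
rewrite -/chi in Hx.
move: (Gam chi f x) (Gam f f x) (Gam chi chi x) (chi x) (f x) CS G0 Gc Hx.
move=> g a b r y CS a0 b0 be.
(* AM-GM *)
have h1 : (r * y * g) ^+ 2 <= (r ^+ 2 * a) * (e * y ^+ 2).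
  have -> : (r * y * g) ^+ 2 = (r ^+ 2 * y ^+ 2) * g ^+ 2 by ring.
  have -> : (r ^+ 2 * a) * (e * y ^+ 2) = (r ^+ 2 * y ^+ 2) * (e * a) by ring.
  apply: (ler_wpM2l (mulr_ge0 (sqr_ge0 r) (sqr_ge0 y))); apply: (le_trans CS).
  by rewrite ler_wpM2r.
have p1 : 0 <= r ^+ 2 * a by rewrite mulr_ge0 ?sqr_ge0.
have p2 : 0 <= e * y ^+ 2 by rewrite mulr_ge0 ?sqr_ge0 // ltW.
have -> : 2 * r * y * g = 2 * (r * y * g) by ring.
have -> : 4 * e * y ^+ 2 = 4 * (e * y ^+ 2) by ring.
move: (r * y * g) (r ^+ 2 * a) (e * y ^+ 2) h1 p1 p2 => X A B h1 A0 B0.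
have : - X * 4 <= A + 4 * B by have := sqr_ge0 (A - 4 * B); nra.
lra.
Qed.

(** Limits of [cut_energy] along cut-offs with Gamma tending to 0: Fatou gives the first two claims,
    and dominated convergence of the cut integrals of f L f gives the sign. *)
Lemma Gamma_intg f : S f -> L2 mu f -> L2 mu (L f) ->
  [/\ intg mu (Gam f f),
      \int[mu]_x Gam f f x <= 2 * \int[mu]_x `|f x * L f x| &
      \int[mu]_x (f x * L f x) <= 0].
Proof.
move=> Sf f2 Lf2; have SL := gc_L gc Sf; have SG := gc_Gamma gc Sf Sf.
have ifL := L2_intgM f2 Lf2; have if2 := ((L2_intg mu f).1 f2).2.
have iaL := intg_norm ifL.
pose N2 := \int[mu]_x (f x ^+ 2).
have N20 : 0 <= N2 by apply: Int_ge0 => x; exact: sqr_ge0.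
have cut01 k x : 0 <= cut 2 k x ^+ 2 <= 1.
  by rewrite sqr_ge0 expr_le1 // ?cut_ge0 ?cut_le1.
have icut k g : S g -> intg mu (fun x => cut 2 k x ^+ 2 * g x).
  by move=> Sg; exact: (Sc_intg ds (ScM ds (Sc_sqr ds (Sc_cut ds 2 k)) Sg)).
have bound (e : R) : 0 < e -> \forall k \near \oo,
    \int[mu]_x (cut 2 k x ^+ 2 * Gam f f x) <=
    - (2 * \int[mu]_x (cut 2 k x ^+ 2 * (f x * L f x))) + e.
  move=> e0; have e1 : 0 < e / (16 * (N2 + 1)) by rewrite divr_gt0 // mulr_gt0 // ltr_pwDr.
  move: (Gamma_cut_le e1); apply: filterS => k Hk.
  have e2 : 0 < 4 * (e / (16 * (N2 + 1))) by rewrite mulr_gt0.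
  have Hk' x : Gam (cut 2 k) (cut 2 k) x <= 4 * (e / (16 * (N2 + 1))).
    by have := Hk 2 x; rewrite -natrX; apply.
  apply: le_trans (cut_energy Sf f2 e2 Hk') _.
  rewrite lerD2l -/N2.
  have dE : e / (16 * (N2 + 1)) * (16 * (N2 + 1)) = e.
    by rewrite divfK // gt_eqF // mulr_gt0 // ltr_pwDr.
  by move: (e / _) dE e1 => r dE r0; nra.
have Gi (e : R) : 0 < e -> intg mu (Gam f f) /\
    \int[mu]_x Gam f f x <= 2 * \int[mu]_x `|f x * L f x| + e.
  move=> e0; apply: (fatou_Int (f_ := fun k x => cut 2 k x ^+ 2 * Gam f f x)).
  - by move=> k; exact: icut.
  - by move=> k x; rewrite mulr_ge0 ?sqr_ge0 ?(gc_Gamma_ge0 gc).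
  - exact: (S_meas ds SG).
  - by move=> x; exact: cut2_cvg.
  move: (bound e e0); apply: filterS => k /le_trans; apply; rewrite lerD2r.
  rewrite -mulrN ler_wpM2l // -IntN; last exact: icut (gcM gc Sf SL).
  apply: le_Int => //; first by apply: intgN; exact: icut (gcM gc Sf SL).
  move=> x; have /andP[c0 c1] := cut01 k x; rewrite -mulrN.
  apply: le_trans (ler_norm _) _; rewrite normrM normrN (ger0_norm c0).
  exact: ler_piMl.
split; first by have [] := Gi 1 ltr01.
  by apply/ler_addgt0Pr => e /Gi[].
have dom k x : `|cut 2 k x ^+ 2 * (f x * L f x)| <= `|f x * L f x|.
  have /andP[c0 c1] := cut01 k x.
  by rewrite normrM (ger0_norm c0); exact: ler_piMl.
have [_ cv] := dominated_Int (fun k => intg_meas (icut k _ (gcM gc Sf SL)))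
  (intg_meas ifL) (fun x => @cut2_cvg (fun x => f x * L f x) x) dom iaL.
apply/ler_addgt0Pr => e e0; rewrite add0r.
rewrite -(cvg_lim _ cv) //; apply: limr_le; first exact: cvgP cv.
move: (bound e e0); apply: filterS => k H.
have : 0 <= \int[mu]_x (cut 2 k x ^+ 2 * Gam f f x).
  by apply: Int_ge0 => x; rewrite mulr_ge0 ?sqr_ge0 ?(gc_Gamma_ge0 gc).
move: H; move: (\int[mu]_x _) (\int[mu]_x _) => a b; lra.
Qed.

(** The squared norm of P_t f is <P_2t f, f>, whose derivative in the time s of P_s is <L P_(s/2) f,
    P_(s/2) f>, nonpositive by [Gamma_intg]. *)
Lemma P_contract t f : 0 <= t -> Sc f -> ip (P t f) (P t f) <= ip f f.
Proof.
move=> t0 cf; have T0 : 0 <= t + t by exact: addr_ge0.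
have cLf := ScL ds cf.
rewrite (hp_semi hp t0 cf cf) -[leRHS](hp_0 hp cf cf).
have := quad_diff_le (phi := fun r => ip (P r f) f) (psi := fun r => ip (P r (L f)) f)
  (B := 0) T0 (hp_taylor hp T0 cf cf).
rewrite mulr0 addr0; apply => s s0 sT.
have s20 : 0 <= s / 2 by rewrite divr_ge0.
have -> : s = s / 2 + s / 2 by lra.
rewrite -(hp_semi hp s20 cLf cf) -P_L //.
have Pf2 := hp_L2 hp s20 cf.
have LP2 : L2 mu (L (P (s / 2) f)) by rewrite P_L //; exact: (hp_L2 hp).
have [_ _] := Gamma_intg (hp_S hp s20 cf) Pf2 LP2.
by congr (_ <= _); apply: eq_Int => x; rewrite mulrC.
Qed.

(** Backward Taylor remainders about the later time t. In norm they are of order (t - s)^2 for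
    [rem2] and (t - s)^4 for [rem4]; the longer expansion compensates the powers lost when Gamma^Z
    of a remainder is estimated through CD in [GZ_rem4]. *)
Definition rem2 t s f x := P s f x - P t f x + (t - s) * P t (L f) x.

Definition rem4 t s f x := P s f x - P t f x + (t - s) * P t (L f) x +
  - (2^-1 * (t - s) ^+ 2) * P t (L (L f)) x + 6^-1 * (t - s) ^+ 3 * P t (L (L (L f))) x.

Section weak.
Variables (t : R) (g : M -> R).
Hypotheses (t0 : 0 <= t) (cg : Sc g).
Let a f r := ip (P r f) g.

(** As a function of the backward time r, the remainder of each order, tested against g, has as
    derivative minus the remainder of the preceding order for L f. Bounds r^m N therefore integrate
    up; factorials are not tracked. *)
Let phi1 f r := a f (t - r) - a f t.
Let phi2 f r := phi1 f r + r * a (L f) t.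
Let phi3 f r := phi2 f r + - (2^-1 * r ^+ 2) * a (L (L f)) t.
Let phi4 f r := phi3 f r + 6^-1 * r ^+ 3 * a (L (L (L f))) t.

Let d1 f : Sc f -> quad_diff t (phi1 f) (fun r => - a (L f) (t - r)).
Proof.
move=> cf; have H := quad_diff_rev (hp_taylor hp t0 cf cg).
have := quad_diffD (-1) H (quad_diff_cst t (a f t)).
by apply: eq_quad_diff => r; rewrite ?mulr0 ?addr0 ?mulN1r.
Qed.

Let d2 f : Sc f -> quad_diff t (phi2 f) (fun r => - phi1 (L f) r).
Proof.
move=> cf; have := quad_diffD (a (L f) t) (d1 cf) (quad_diff_id t).
apply: eq_quad_diff => r; rewrite /phi2 ?(mulrC (a _ t)) //.
by rewrite mul1r /phi1 opprB addrC.
Qed.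

Let d3 f : Sc f -> quad_diff t (phi3 f) (fun r => - phi2 (L f) r).
Proof.
move=> cf; have := quad_diffD (- (2^-1 * a (L (L f)) t)) (d2 cf) (quad_diff_sqr t).
apply: eq_quad_diff => r; rewrite /= /phi3; first by ring.
by rewrite /phi2; field.
Qed.

Let d4 f : Sc f -> quad_diff t (phi4 f) (fun r => - phi3 (L f) r).
Proof.
move=> cf; have := quad_diffD (6^-1 * a (L (L (L f))) t) (d3 cf) (quad_diff_cube t0).
apply: eq_quad_diff => r; rewrite /= /phi4; first by ring.
by rewrite /phi3; field.
Qed.

Let bound (N r : R) (m : nat) phi psi : quad_diff t phi psi -> phi 0 = 0 -> 0 <= r -> r <= t ->
  0 <= N -> (forall q, 0 <= q -> q <= t -> `|psi q| <= q ^+ m * N) -> `|phi r| <= r ^+ m.+1 * N.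
Proof.
move=> d p0 r0 rt N0 H; rewrite exprS -mulrA.
apply: (quad_diff_norm_le r0 (quad_diff_sub rt d)) => // q q0 qr.
apply: (le_trans (H q q0 (le_trans qr rt))).
by rewrite ler_wpM2r //; exact: lerXn2r.
Qed.

Lemma weak_rem f (N r : R) : Sc f -> 0 <= r -> r <= t -> 0 <= N ->
  ((forall q, 0 <= q -> `|a (L (L f)) q| <= N) -> `|phi2 f r| <= r ^+ 2 * N) /\
  ((forall q, 0 <= q -> `|a (L (L (L (L f)))) q| <= N) -> `|phi4 f r| <= r ^+ 4 * N).
Proof.
move=> cf r0 rt N0.
have b1 k q : Sc k -> 0 <= q -> q <= t -> (forall q, 0 <= q -> `|a (L k) q| <= N) ->
    `|phi1 k q| <= q ^+ 1 * N.
  move=> ck q0 qt H; apply: (bound (d1 ck)) => //; first by rewrite /phi1 subr0 subrr.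
  by move=> p p0 pt; rewrite normrN expr0 mul1r H // subr_ge0.
have b2 k q : Sc k -> 0 <= q -> q <= t -> (forall q, 0 <= q -> `|a (L (L k)) q| <= N) ->
    `|phi2 k q| <= q ^+ 2 * N.
  move=> ck q0 qt H; apply: (bound (d2 ck)) => //.
    by rewrite /phi2 /phi1 subr0 subrr mul0r addr0.
  by move=> p p0 pt; rewrite normrN; apply: b1 => //; exact: (ScL ds).
have b3 k q : Sc k -> 0 <= q -> q <= t -> (forall q, 0 <= q -> `|a (L (L (L k))) q| <= N) ->
    `|phi3 k q| <= q ^+ 3 * N.
  move=> ck q0 qt H; apply: (bound (d3 ck)) => //.
    by rewrite /phi3 /phi2 /phi1 subr0 subrr expr0n mulr0 oppr0 !mul0r !addr0.
  by move=> p p0 pt; rewrite normrN; apply: b2 => //; exact: (ScL ds).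
split=> H; first exact: b2.
apply: (bound (d4 cf)) => //.
  by rewrite /phi4 /phi3 /phi2 /phi1 subr0 subrr !expr0n !mulr0 oppr0 !mul0r !addr0.
by move=> p p0 pt; rewrite normrN; apply: b3 => //; exact: (ScL ds).
Qed.

End weak.

(** With the test function cut^2 w the hypothesis bounds the square of I, the integral of cut^2 w^2,
    by c times the integral of cut^4 w^2, hence by c I. So I <= c for every cut-off, and Fatou
    concludes. *)
Lemma L2_of_weak w (c : R) : S w -> 0 <= c ->
  (forall k, Sc k -> ip w k ^+ 2 <= c * ip k k) ->
  intg mu (fun x => w x ^+ 2) /\ \int[mu]_x (w x ^+ 2) <= c.
Proof.
move=> Sw c0 H; have Sw2 := gc_sqr gc Sw.
have icut k : intg mu (fun x => cut 2 k x ^+ 2 * w x ^+ 2).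
  exact: (Sc_intg ds (ScM ds (Sc_sqr ds (Sc_cut ds 2 k)) Sw2)).
apply: (fatou_Int (f_ := fun k x => cut 2 k x ^+ 2 * w x ^+ 2)) => //.
- by move=> k x; rewrite mulr_ge0 ?sqr_ge0.
- exact: (S_meas ds Sw2).
- by move=> x; exact: (@cut2_cvg (fun x => w x ^+ 2)).
apply: nearW => k.
have cw := ScM ds (Sc_sqr ds (Sc_cut ds 2 k)) Sw.
have := H _ cw; rewrite {1}/Defs.ip.
rewrite (eq_Int mu (g := fun x => cut 2 k x ^+ 2 * w x ^+ 2)); last first.
  by move=> x; rewrite mulrCA expr2.
set I := \int[mu]_x _ => HI.
have I0 : 0 <= I by apply: Int_ge0 => x; rewrite mulr_ge0 ?sqr_ge0.
have : ip (fun x => cut 2 k x ^+ 2 * w x) (fun x => cut 2 k x ^+ 2 * w x) <= I.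
  apply: le_Int => //; first exact: (Sc_intg ds (ScM ds cw cw.1)).
  move=> x; have -> : cut 2 k x ^+ 2 * w x * (cut 2 k x ^+ 2 * w x) =
    cut 2 k x ^+ 2 * (cut 2 k x ^+ 2 * w x ^+ 2) by rewrite expr2 expr2; move: (cut _ _ _) (w x) => *; ring.
  have h0 : 0 <= cut 2 k x ^+ 2 * w x ^+ 2 by rewrite mulr_ge0 ?sqr_ge0.
  by apply: (ler_piMl h0); rewrite expr_le1 // ?cut_ge0 ?cut_le1.
move: HI; move: (ip _ _) => J HI JI.
have HI' : I ^+ 2 <= c * I by apply: le_trans HI _; rewrite ler_wpM2l.
by rewrite leNgt; apply/negP => cI; nra.
Qed.

Lemma S_rem2 t s f : 0 <= s -> s <= t -> Sc f -> S (rem2 t s f).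
Proof.
move=> s0 st cf; have t0 := le_trans s0 st; have c1 := ScL ds cf.
exact: (gcD gc (gcB gc (hp_S hp s0 cf) (hp_S hp t0 cf)) (gcZ gc _ (hp_S hp t0 c1))).
Qed.

Lemma S_rem4 t s f : 0 <= s -> s <= t -> Sc f -> S (rem4 t s f).
Proof.
move=> s0 st cf; have t0 := le_trans s0 st; have c1 := ScL ds cf.
have c2 := ScL ds c1; have c3 := ScL ds c2.
exact: (gcD gc (gcD gc (S_rem2 s0 st cf) (gcZ gc _ (hp_S hp t0 c2)))
  (gcZ gc _ (hp_S hp t0 c3))).
Qed.

Lemma P_CS q f k : 0 <= q -> Sc f -> Sc k ->
  `|ip (P q f) k| <= Num.sqrt (ip f f * ip k k).
Proof.
move=> q0 cf ck; have CS := cauchy_schwarz_L2 (hp_L2 hp q0 cf) (ds_L2 ds ck).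
rewrite -sqrtr_sqr; apply: ler_wsqrtr; apply: (le_trans CS).
have sq u : \int[mu]_x (u x ^+ 2) = ip u u by apply: eq_Int => x; rewrite expr2.
by rewrite !sq ler_wpM2r ?ip_ge0 // P_contract.
Qed.

Lemma rem_L2 t s f : 0 <= s -> s <= t -> Sc f ->
  (intg mu (fun x => rem2 t s f x ^+ 2) /\
   \int[mu]_x (rem2 t s f x ^+ 2) <= (t - s) ^+ 4 * ip (L (L f)) (L (L f))) /\
  (intg mu (fun x => rem4 t s f x ^+ 2) /\
   \int[mu]_x (rem4 t s f x ^+ 2) <=
     (t - s) ^+ 8 * ip (L (L (L (L f)))) (L (L (L (L f))))).
Proof.
move=> s0 st cf; have t0 := le_trans s0 st; have c1 := ScL ds cf.
have c2 := ScL ds c1; have c3 := ScL ds c2; have c4 := ScL ds c3.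
have r0 : 0 <= t - s by rewrite subr_ge0.
have rt : t - s <= t by rewrite gerBl.
have Pt2 k : Sc k -> L2 mu (P t k) := fun ck => hp_L2 hp t0 ck.
have Ps2 := hp_L2 hp s0 cf.
have E2 k : Sc k -> ip (rem2 t s f) k = ip (P s f) k - ip (P t f) k + (t - s) * ip (P t (L f)) k.
  move=> ck; have k2 := ds_L2 ds ck.
  rewrite (ipDl (L2B Ps2 (Pt2 _ cf)) (L2Z _ (Pt2 _ c1)) k2) (ipBl Ps2 (Pt2 _ cf) k2).
  by rewrite (ipZl _ (Pt2 _ c1) k2).
have r22 : L2 mu (rem2 t s f) := L2D (L2B Ps2 (Pt2 _ cf)) (L2Z _ (Pt2 _ c1)).
have E4 k : Sc k -> ip (rem4 t s f) k = ip (rem2 t s f) k +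
    - (2^-1 * (t - s) ^+ 2) * ip (P t (L (L f))) k +
    6^-1 * (t - s) ^+ 3 * ip (P t (L (L (L f)))) k.
  move=> ck; have k2 := ds_L2 ds ck.
  rewrite (ipDl (L2D r22 (L2Z _ (Pt2 _ c2))) (L2Z _ (Pt2 _ c3)) k2).
  rewrite (ipDl r22 (L2Z _ (Pt2 _ c2)) k2).
  by rewrite (ipZl _ (Pt2 _ c2) k2) (ipZl _ (Pt2 _ c3) k2).
have ts : t - (t - s) = s by ring.
have sqr_bound m (x A B : R) : 0 <= A -> 0 <= B ->
    `|x| <= (t - s) ^+ m * Num.sqrt (A * B) -> x ^+ 2 <= (t - s) ^+ (m * 2) * A * B.
  move=> A0 B0 Hx; rewrite -(real_normK (num_real x)) -mulrA exprM -[A * B]sqr_sqrtr ?mulr_ge0 //.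
  by rewrite -exprMn lerXn2r // nnegrE // mulr_ge0 ?exprn_ge0.
split; apply: L2_of_weak.
- exact: S_rem2.
- by rewrite mulr_ge0 ?exprn_ge0 ?ip_ge0.
- move=> k ck; apply: (sqr_bound 2%N); rewrite ?ip_ge0 // E2 //.
  have [+ _] := weak_rem t0 ck cf r0 rt (sqrtr_ge0 (ip (L (L f)) (L (L f)) * ip k k)).
  by rewrite ts; apply => q q0; exact: P_CS.
- exact: S_rem4.
- by rewrite mulr_ge0 ?exprn_ge0 ?ip_ge0.
- move=> k ck; apply: (sqr_bound 4%N); rewrite ?ip_ge0 // E4 // E2 //.
  have [_] := weak_rem t0 ck cf r0 rt
    (sqrtr_ge0 (ip (L (L (L (L f)))) (L (L (L (L f)))) * ip k k)).
  by rewrite ts; apply => q q0; exact: P_CS.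
Qed.

Lemma L_rem2 t s f : 0 <= s -> s <= t -> Sc f -> L (rem2 t s f) = rem2 t s (L f).
Proof.
move=> s0 st cf; have t0 := le_trans s0 st; have c1 := ScL ds cf.
have Ss := hp_S hp s0 cf; have St := hp_S hp t0 cf; have S1 := hp_S hp t0 c1.
apply/funext => x; rewrite (gc_LD gc x (gcB gc Ss St) (gcZ gc _ S1)).
rewrite (gc_LZ gc _ x S1) /rem2 -!P_L //; congr (_ + _).
rewrite (_ : (fun y => P s f y - P t f y) = fun y => P s f y + -1 * P t f y); last first.
  by apply/funext => y; rewrite mulN1r.
by rewrite (gc_LD gc x Ss (gcZ gc _ St)) (gc_LZ gc _ x St) mulN1r.
Qed.

Lemma L_rem4 t s f : 0 <= s -> s <= t -> Sc f -> L (rem4 t s f) = rem4 t s (L f).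
Proof.
move=> s0 st cf; have t0 := le_trans s0 st; have c1 := ScL ds cf.
have c2 := ScL ds c1; have c3 := ScL ds c2.
have S2 := hp_S hp t0 c2; have S3 := hp_S hp t0 c3; have Sr := S_rem2 s0 st cf.
apply/funext => x.
rewrite (gc_LD gc x (gcD gc Sr (gcZ gc _ S2)) (gcZ gc _ S3)) (gc_LZ gc _ x S3).
rewrite (gc_LD gc x Sr (gcZ gc _ S2)) (gc_LZ gc _ x S2) L_rem2 //.
by rewrite /rem4 !P_L.
Qed.

Lemma Gamma_le_sqr w (a b : R) : S w -> L2 mu w -> L2 mu (L w) ->
  \int[mu]_x (w x ^+ 2) <= a -> \int[mu]_x (L w x ^+ 2) <= b ->
  intg mu (Gam w w) /\ \int[mu]_x Gam w w x <= a + b.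
Proof.
move=> Sw w2 Lw2 wa wb; have [Ig le _] := Gamma_intg Sw w2 Lw2; split=> //.
have i1 := ((L2_intg mu w).1 w2).2; have i2 := ((L2_intg mu (L w)).1 Lw2).2.
apply: (le_trans le); rewrite -IntZ; last exact: (intg_norm (L2_intgM w2 Lw2)).
apply: (@le_trans _ _ (\int[mu]_x (w x ^+ 2 + L w x ^+ 2))); last by rewrite IntD // lerD.
apply: le_Int; [exact: (intgZ 2 (intg_norm (L2_intgM w2 Lw2)))|exact: intgD|] => x.
rewrite normrM -(real_normK (num_real (w x))) -(real_normK (num_real (L w x))).
by move: `|w x| `|L w x| => p q; have := sqr_ge0 (p - q); nra.
Qed.

(** [L] commutes with the formation of remainders, so a remainder and its image under [L] have the
    same order, and [Gamma_le_sqr] controls Gamma by the two squared norms. *)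
Lemma rem_Gamma f : Sc f -> exists2 C, 0 <= C & forall s t, 0 <= s -> s <= t ->
  [/\ intg mu (Gam (rem2 t s f) (rem2 t s f)),
      \int[mu]_x Gam (rem2 t s f) (rem2 t s f) x <= C * (t - s) ^+ 4,
      intg mu (Gam (rem4 t s f) (rem4 t s f)) &
      \int[mu]_x Gam (rem4 t s f) (rem4 t s f) x <= C * (t - s) ^+ 8].
Proof.
move=> cf; have c1 := ScL ds cf; have c2 := ScL ds c1; have c3 := ScL ds c2.
have c4 := ScL ds c3.
pose n k := ip k k; have n0 k : 0 <= n k by exact: ip_ge0.
exists (n (L (L f)) + n (L (L (L f))) + n (L (L (L (L f)))) + n (L (L (L (L (L f)))))).
  by rewrite !addr_ge0.
move=> s t s0 st; have [[i2 b2] [i4 b4]] := rem_L2 s0 st cf.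
have [[j2 d2] [j4 d4]] := rem_L2 s0 st c1.
have S2 := S_rem2 s0 st cf; have S4 := S_rem4 s0 st cf.
have L2S k : S k -> intg mu (fun x => k x ^+ 2) -> L2 mu k.
  by move=> Sk Ik; apply/L2_intg; split => //; exact: (S_meas ds Sk).
have SL2 := gc_L gc S2; have SL4 := gc_L gc S4.
have E2 := L_rem2 s0 st cf; have E4 := L_rem4 s0 st cf.
have [I2 B2] := Gamma_le_sqr S2 (L2S _ S2 i2) (L2S _ SL2 (eq_ind_r (fun u => intg mu (fun x => u x ^+ 2)) j2 E2)) b2
  (eq_ind_r (fun u => \int[mu]_x (u x ^+ 2) <= _) d2 E2).
have [I4 B4] := Gamma_le_sqr S4 (L2S _ S4 i4) (L2S _ SL4 (eq_ind_r (fun u => intg mu (fun x => u x ^+ 2)) j4 E4)) b4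
  (eq_ind_r (fun u => \int[mu]_x (u x ^+ 2) <= _) d4 E4).
have r0 : 0 <= t - s by rewrite subr_ge0.
have r4 := exprn_ge0 4 r0; have r8 := exprn_ge0 8 r0.
split=> //; [apply: (le_trans B2)|apply: (le_trans B4)]; rewrite -/(n _) -/(n _).
  have := n0 (L (L (L (L f)))); have := n0 (L (L (L (L (L f))))).
  by move: (n _) (n _) (n _) (n _) ((t - s) ^+ 4) r4 => x1 x2 x3 x4 r r_ge0 h1 h2; nra.
have := n0 (L (L f)); have := n0 (L (L (L f))).
by move: (n _) (n _) (n _) (n _) ((t - s) ^+ 8) r8 => x1 x2 x3 x4 r r_ge0 h1 h2; nra.
Qed.

(* One time step of an energy: [phi] convex, [2 B phi'' >= phi'^2] along [Q']. *)
Lemma energy_step (phi : R -> R) Q Q' B W chi (r : R) : smooth_real phi ->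
  S Q -> S Q' -> S B -> S W -> Sc chi -> phi 0 = 0 -> 0 <= r ->
  (forall x, 0 <= derive1 (derive1 phi) x) ->
  (forall x, 0 <= derive1 phi (Q' x)) ->
  (forall x, derive1 phi (Q' x) ^+ 2 <= 2 * B x * derive1 (derive1 phi) (Q' x)) ->
  (forall x, 0 <= B x) ->
  (forall x, Q' x - Q x <= r * L Q' x + W x) ->
  \int[mu]_x (chi x ^+ 2 * phi (Q' x)) - \int[mu]_x (chi x ^+ 2 * phi (Q x)) <=
  r * \int[mu]_x (2 * (B x * Gam chi chi x)) +
  \int[mu]_x (chi x ^+ 2 * derive1 phi (Q' x) * W x).
Proof.
move=> sphi SQ SQ' SB SW cc p0 r0 phi2 phi1 HB B0 HQ.
have c2 := Sc_sqr ds cc; have sphi' := smooth_real_derive1 sphi.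
have SP := gc_comp gc sphi SQ; have SP' := gc_comp gc sphi SQ'.
have cA := ScM ds c2 (gc_comp gc sphi' SQ').
have := energy_le ds sphi SQ' SB cc phi2 HB B0.
have i1 := Sc_intg ds (ScM ds c2 SP); have i2 := Sc_intg ds (ScM ds c2 SP').
have i3 := Sc_intg ds (ScM ds cA (gc_L gc SQ')); have i4 := Sc_intg ds (ScM ds cA SW).
move=> /(ler_wpM2l r0) H; apply: le_trans (lerD H (lexx _)).
rewrite -IntB // -IntZ // -IntD //; last exact: intgZ.
apply: le_Int; [exact: intgB|by apply: intgD => //; exact: intgZ|] => x.
have conv := smooth_real_convex (Q x) (Q' x) sphi phi2.
have HQx := HQ x; have p1 := phi1 x; have c20 := sqr_ge0 (chi x).
move: (phi (Q' x)) (phi (Q x)) (derive1 phi (Q' x)) (chi x ^+ 2) conv p1 c20.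
move: (Q' x) (Q x) (L Q' x) (W x) HQx => q' q l w HQx u' u p b conv p1 b0.
have h1 : p * (q' - q) <= p * (r * l + w) by rewrite ler_wpM2l.
have h2 : b * (u' - u) <= b * (p * (r * l + w)).
  by rewrite ler_wpM2l //; exact: le_trans conv h1.
lra.
Qed.

End heat.

Lemma pos_part_sub_le {R : realType} (a c : R) : 0 <= c ->
  0 <= Num.max (a - c) 0 /\ Num.max (a - c) 0 ^+ 2 <= a ^+ 2.
Proof.
move=> c0; case: (leP (a - c) 0) => ac; first by rewrite lexx expr0n sqr_ge0.
by split; [exact: ltW|nra].
Qed.

(** Used with r = (t - s)^2 and q = 1 / r: since the remainder z satisfies int z^2 = O((t - s)^4),
    both terms on the right integrate to O((t - s)^2). *)
Lemma remainder_young {R : realType} (r q z p m u b : R) : 0 < r -> r * q = 1 ->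
  0 <= p -> p <= 3 * m -> 0 <= m -> m ^+ 2 <= u ^+ 2 -> 0 <= b -> b <= 1 ->
  b * p * - z <= 3 / 2 * (r * u ^+ 2 + q * z ^+ 2).
Proof.
move=> r0 rq p0 p1 m0 m1 b0 b1.
have h1 : b * p * - z <= 3 * m * `|z|.
  have h2 : b * p <= 3 * m by apply: le_trans p1; exact: ler_piMl.
  have h3 : - z <= `|z| by rewrite -normrN ler_norm.
  apply: (@le_trans _ _ (b * p * `|z|)); first by rewrite ler_wpM2l // mulr_ge0.
  by rewrite ler_wpM2r.
apply: (le_trans h1); rewrite -(real_normK (num_real z)).
move: `|z| (normr_ge0 z) => w w0.
have h4 : 2 * m * w <= r * m ^+ 2 + q * w ^+ 2.
  have : 0 <= r * (m - q * w) ^+ 2 by rewrite mulr_ge0 ?sqr_ge0 // ltW.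
  have -> : r * (m - q * w) ^+ 2 = r * m ^+ 2 - 2 * (r * q) * m * w + (r * q) * q * w ^+ 2 by ring.
  by rewrite rq; lra.
have : r * m ^+ 2 <= r * u ^+ 2 by rewrite ler_pM2l.
lra.
Qed.

Lemma derive1_sqr {R : realType} : derive1 (fun x : R => x ^+ 2) = fun x => 2 * x.
Proof.
apply/funext => x; rewrite derive1E.
have [_ ->] := is_derive_mul1 (is_derive_id x 1) (is_derive_id x 1).
by rewrite !mulr1; lra.
Qed.

Lemma derive2_sqr {R : realType} (x : R) : derive1 (derive1 (fun x : R => x ^+ 2)) x = 2.
Proof.
rewrite derive1_sqr derive1E.
have [_ ->] := is_derive_mul1 (is_derive_cst (2 : R) x 1) (is_derive_id x 1).
by rewrite mulr1 mulr0 addr0.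
Qed.

Lemma smooth_sqr {R : realType} : smooth_real (fun x : R => x ^+ 2).
Proof. exact: smooth_realM smooth_real_id smooth_real_id. Qed.

(* Implicit Euler for [A' <= - l (A - beta)]. *)
Lemma damped_increments {R : realType} (A : R -> R) (T l beta K : R) :
  0 <= T -> 0 <= l -> 0 <= K -> 0 <= A 0 -> 0 <= beta ->
  (forall s t, 0 <= s -> s < t -> t <= T ->
    A t - A s <= (t - s) * (- l * (A t - beta)) + K * (t - s) ^+ 2) ->
  A T <= A 0 + beta.
Proof.
move=> T0 l0 K0 A0 b0 H.
have := @increments_le R (fun s => Num.max (A s - beta) 0) T 0 K T0.
have -> : (Num.max (A T - beta) 0 <= Num.max (A 0 - beta) 0 + T * 0) =
  (Num.max (A T - beta) 0 <= Num.max (A 0 - beta) 0) by rewrite mulr0 addr0.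
move=> main; have : Num.max (A T - beta) 0 <= Num.max (A 0 - beta) 0.
  apply: main => s t s0 st tT; rewrite mulr0 add0r.
  have K2 : 0 <= K * (t - s) ^+ 2 by rewrite mulr_ge0 ?sqr_ge0.
  have [->|ts] := eqVneq s t; first by rewrite !subrr expr0n mulr0.
  have lt : s < t by rewrite lt_neqAle ts.
  have := H s t s0 lt tT; move: K2; move: (K * _) => k k0.
  have r0 : 0 <= (t - s) * l by rewrite mulr_ge0 // subr_ge0.
  have -> : (t - s) * (- l * (A t - beta)) = - ((t - s) * l * (A t - beta)) by ring.
  move: ((t - s) * l) r0 => r r0 HA.
  case: (leP (A t - beta) 0) => ht; case: (leP (A s - beta) 0) => hs; try lra.
    by have := mulr_ge0 r0 (ltW ht); lra.
  by have := mulr_ge0 r0 (ltW ht); lra.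
by case: (leP (A T - beta) 0) => ht; case: (leP (A 0 - beta) 0) => hs; lra.
Qed.

Lemma exp2_gt {R : realType} (v e : R) : 0 < e -> exists n, v / 2 ^+ n <= e.
Proof.
move=> e0; exists (Num.truncn (v / e)).+1.
rewrite ler_pdivrMr ?exprn_gt0 // mulrC -ler_pdivrMr //.
apply: (le_trans (ltW (truncnS_gt _))); rewrite -natrX ler_nat.
exact: ltnW (ltn_expl _ _).
Qed.

(* The weights [a = (c / rho2) (E^2 - E)] and [b = (E - 1)^2], [E = exp (c s)], solve
   [b' = 2 a rho2] and [a' - 2 a rho1 + 2 kappa a^2 / b = E (2 rho1 c - c^2) / rho2]. *)
Lemma weight_increments {R : realType} (c rho2 E E' r : R) : 0 < c -> 0 < rho2 -> 1 <= E ->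
  E <= E' -> E' - E <= c * r * E' ->
  [/\ c / rho2 * (E' ^+ 2 - E') - c / rho2 * (E ^+ 2 - E) <=
        r * (c ^+ 2 / rho2 * (E' * (2 * E' - 1))),
      (E' - 1) ^+ 2 - (E - 1) ^+ 2 <= r * (2 * c * (E' * (E' - 1))),
      0 <= c / rho2 * (E ^+ 2 - E) <= c / rho2 * (E' ^+ 2 - E') &
      0 <= (E - 1) ^+ 2 <= (E' - 1) ^+ 2].
Proof.
move=> c0 r0 E1 EE dE.
have q0 : 0 <= c / rho2 by rewrite divr_ge0 // ltW.
have h0 : 0 <= E' - E by rewrite subr_ge0.
have h1 : (E' - E) * (E' + E - 1) <= (c * r * E') * (2 * E' - 1).
  by apply: ler_pM => //; lra.
have h2 : (E' - E) * (E' + E - 2) <= (c * r * E') * (2 * E' - 2).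
  by apply: ler_pM => //; lra.
have h3 : 0 <= E ^+ 2 - E by have := mulr_ge0 (ler0n R 1) h0; nra.
split.
- have -> : c / rho2 * (E' ^+ 2 - E') - c / rho2 * (E ^+ 2 - E) =
    c / rho2 * ((E' - E) * (E' + E - 1)) by ring.
  have -> : r * (c ^+ 2 / rho2 * (E' * (2 * E' - 1))) =
    c / rho2 * ((c * r * E') * (2 * E' - 1)) by ring.
  exact: ler_wpM2l.
- have -> : (E' - 1) ^+ 2 - (E - 1) ^+ 2 = (E' - E) * (E' + E - 2) by ring.
  by apply: (le_trans h2); rewrite le_eqVlt; apply/orP; left; apply/eqP; ring.
- rewrite mulr_ge0 //= ler_wpM2l //; have : 0 <= (E' - E) * (E' + E - 1) by apply: mulr_ge0; lra.
  by lra.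
- by rewrite sqr_ge0 /= lerXn2r ?nnegrE ?subr_ge0 //; lra.
Qed.

(** In powers of E, the coefficient of E^2 on the left is 2 c / rho2 times c (rho2 + kappa) / rho2 -
    rho1. The stated value of c makes it vanish, and the term linear in E is what remains. *)
Lemma weight_equation {R : realType} (c rho1 rho2 kappa E : R) : 0 < rho2 -> 0 <= kappa ->
  c = rho1 * rho2 / (rho2 + kappa) -> 1 < E ->
  c ^+ 2 / rho2 * (E * (2 * E - 1)) - 2 * (c / rho2 * (E ^+ 2 - E)) * rho1 +
    2 * (kappa * (c / rho2 * (E ^+ 2 - E)) ^+ 2 / (E - 1) ^+ 2) =
  (2 * rho1 * c - c ^+ 2) / rho2 * E.
Proof.
move=> r0 k0 cE E1; have s0 : rho2 + kappa != 0 by rewrite gt_eqF // ltr_pwDl.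
have -> : rho1 = c * (rho2 + kappa) / rho2 by rewrite cE; field; rewrite gt_eqF //= gt_eqF.
by field; rewrite gt_eqF //= subr_eq0 gt_eqF.
Qed.

(** The algebra of one implicit step. The forms are differenced with the old weights a, b, while CD
    is used with the new ones a', b'; as the weights move by at most r d, the mismatch costs r^2
    times 2 d KK, which is an admissible quadratic error. *)
Lemma gradient_step {R : realType} (r da db a' a b' b G Z g z X zz LF e u v l w KE q rho1 rho2 d KK : R) :
  0 <= r -> 0 <= G -> 0 <= Z -> a' - a <= r * da -> b' - b <= r * db ->
  0 <= a' - a -> 0 <= b' - b -> da <= d -> db <= d -> 0 <= KK ->
  X <= r * (2 * (a * g + b * z)) - 2 * zz -> `|2 * g| <= KK -> `|2 * z| <= KK ->
  2 * (a' * g + b' * z) <= LF - 2 * ((a' * rho1 - q) * G + a' * rho2 * Z) ->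
  v = u - r * l + w -> da - 2 * a' * rho1 + 2 * q = KE -> KE <= 2 * e ->
  db = 2 * a' * rho2 -> 0 <= e ->
  (a' - a) * G + (b' - b) * Z + X + e * (u ^+ 2 - v ^+ 2) <=
  r * (LF + e * (2 * (u * l) + 2 * G)) +
    (r ^+ 2 * (2 * d * KK) + (- (2 * zz) + e * - (2 * (u * w)))).
Proof.
move=> r0 G0 Z0 ha hb ha0 hb0 hda hdb KK0 hX hg hz hcd hv hKE hKe hdbE e0.
have h1 := ler_wpM2r G0 ha; have h2 := ler_wpM2r Z0 hb.
have corr (y yd p : R) : 0 <= y -> y <= r * yd -> yd <= d -> `|2 * p| <= KK -> - (y * (2 * p)) <= r * d * KK.
  move=> y0 yr yd_d pK; rewrite -mulrN; apply: (@le_trans _ _ (y * KK)).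
    by rewrite ler_wpM2l // (le_trans (ler_norm _)) // normrN.
  by rewrite ler_wpM2r //; apply: (le_trans yr); rewrite ler_wpM2l.
have h3 := ler_wpM2l r0 (corr _ _ _ ha0 ha hda hg).
have h4 := ler_wpM2l r0 (corr _ _ _ hb0 hb hdb hz).
have h5 : e * (u ^+ 2 - v ^+ 2) <= e * (2 * u * (r * l - w)).
  by apply: ler_wpM2l => //; rewrite hv; have := sqr_ge0 (r * l - w); lra.
have h6 := ler_wpM2r G0 (ler_wpM2l r0 hKe); have h7 := ler_wpM2l r0 hcd.
have h8 : r * da * G = r * (KE + 2 * a' * rho1 - 2 * q) * G by rewrite -hKE; ring.
move: h2 h1; rewrite h8 hdbE; clear ha hb ha0 hb0 hda hdb hg hz hcd hv hKE hKe hdbE corr h8.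
lra.
Qed.

(** * Maximum principle and gradient bound *)

Section maximum.
Context {R : realType} {M : ptopologicalType} {S : (M -> R) -> Prop}.
Context {L : (M -> R) -> (M -> R)} {mu : {measure set (borel M) -> \bar R}}.
Context {h : nat -> M -> R} {P : R -> (M -> R) -> (M -> R)}.
Hypothesis ds : diffusion_space S L mu h.
Hypothesis hp : heat_space S L mu P.
Implicit Types (f g : M -> R).

Local Notation Gam := (Gamma L).
Local Notation ip := (Defs.ip mu).
Local Notation Sc := (@Sc R M S).
Local Notation cut := (@cut R M h).
Local Notation rem2 := (@rem2 R M L P).
Let gc := ds_gc ds.

Lemma cut_sqr01 c k x : 0 <= cut c k x ^+ 2 <= 1.
Proof. by rewrite sqr_ge0 expr_le1 // ?cut_ge0 ?cut_le1. Qed.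

(** The cut energies of [softplus2 (Q t)] start at 0 and grow at rate at most e, with e arbitrarily
    small along the cut-offs, so Fatou makes the full energy at time T vanish. K may depend on k and
    e because [increments_le] removes it. *)
Lemma energy_max (Q : R -> M -> R) (T : R) : 0 <= T ->
  (forall s, 0 <= s -> s <= T -> S (Q s)) -> (forall x, Q 0 x <= 0) ->
  (forall e : R, 0 < e -> \forall k \near \oo,
    exists K, forall s t, 0 <= s -> s <= t -> t <= T ->
    \int[mu]_x (cut 2 k x ^+ 2 * softplus2 (Q t x)) -
    \int[mu]_x (cut 2 k x ^+ 2 * softplus2 (Q s x)) <= (t - s) * e + K * (t - s) ^+ 2) ->
  forall x, Q T x <= 0.
Proof.
move=> T0 SQ Q0 H.
have SFT := gc_comp gc smooth_softplus2 (SQ T T0 (lexx T)).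
have F (e : R) : 0 < e -> intg mu (fun x => softplus2 (Q T x)) /\
    \int[mu]_x softplus2 (Q T x) <= T * e.
  move=> e0; apply: (fatou_Int (f_ := fun k x => cut 2 k x ^+ 2 * softplus2 (Q T x))).
  - by move=> k; exact: (Sc_intg ds (ScM ds (Sc_sqr ds (Sc_cut ds 2 k)) SFT)).
  - by move=> k x; rewrite mulr_ge0 ?sqr_ge0 ?softplus2_ge0.
  - exact: (S_meas ds SFT).
  - by move=> x; exact: (@cut2_cvg R M S L mu h ds (fun x => softplus2 (Q T x)) x).
  move: (H e e0); apply: filterS => k [K HK].
  have := increments_le (psi := fun s => \int[mu]_x (cut 2 k x ^+ 2 * softplus2 (Q s x))) T0 HK.
  rewrite [X in _ <= X + _](eq_Int mu (g := fun x => 0 * cut 2 k x)).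
    by rewrite IntZ ?mul0r ?add0r //; exact: (Sc_intg ds (Sc_cut ds 2 k)).
  by move=> x; rewrite softplus2_neg // mulr0 mul0r.
have z := S_Int0 ds SFT (fun x => softplus2_ge0 (Q T x)) (F 1 ltr01).1.
move=> x; rewrite leNgt; apply/negP => /softplus2_gt0.
rewrite z ?ltxx //; apply/ler_addgt0Pr => e e0; rewrite add0r.
have T1 : 0 < T + 1 by rewrite ltr_pwDr.
apply: (le_trans (F _ (divr_gt0 e0 T1)).2).
rewrite mulrCA; apply: (ler_piMr (ltW e0)).
by rewrite ler_pdivrMr // mul1r lerDl.
Qed.

Lemma L_sub_cst f (c : R) x : S f -> L (fun y => f y - c) x = L f x.
Proof. by move=> Sf; rewrite (gc_LD gc x Sf (gc_cst gc (- c))) (L_cst gc) addr0. Qed.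

(** In the energy estimate B = (P t f)^2 is admissible: as c >= 0, the positive part of P t f - c is
    at most |P t f|. Its integral is bounded by that of f^2 for all times, so the cut-off error
    tends to 0. *)
Lemma P_le f c t : Sc f -> 0 <= c -> (forall x, f x <= c) -> 0 <= t ->
  forall x, P t f x <= c.
Proof.
move=> cf c0 fc t0 x; rewrite -subr_le0.
have lin (x1 x2 x3 : R) : x1 - c - (x2 - c) <= x3 + - (x2 - x1 + x3) by lra.
have quad (p q r : R) : 0 <= q -> p <= 2 ^+ 2 * (8^-1 * r) -> 2 * (q * p) <= r * q.
  by move=> q0 pr; nra.
pose N := ip f f; pose N2 := ip (L (L f)) (L (L f)).
have N0 : 0 <= N by exact: ip_ge0.
have N20 : 0 <= N2 by exact: ip_ge0.
have Ssc s : 0 <= s -> S (fun x => P s f x - c).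
  by move=> s0; exact: (gcD gc (hp_S hp s0 cf) (gc_cst gc (- c))).
have Pn s : 0 <= s -> intg mu (fun x => P s f x ^+ 2) /\ \int[mu]_x (P s f x ^+ 2) <= N.
  move=> s0; split; first exact: ((L2_intg mu _).1 (hp_L2 hp s0 cf)).2.
  rewrite (eq_Int mu (g := fun x => P s f x * P s f x)); last by move=> y; rewrite expr2.
  exact: (P_contract ds hp).
apply: (energy_max (Q := fun s x => P s f x - c) t0); rewrite ?(P_zero ds hp cf) //.
- by move=> s s0 _; exact: Ssc.
- by move=> y; rewrite subr_le0.
(* 8 = 2 times 2^2: the factor 2 of the energy estimate and the scale 2 of the cut-off, squared in
   [Gamma_cut_le]. *)
move=> e e0; have N1 : 0 < 8 * (N + 1) by rewrite mulr_gt0 // ltr_pwDr.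
move: (Gamma_cut_le ds (divr_gt0 e0 N1)); apply: filterS => k Hk.
exists (3 / 2 * (N + N2)) => {t0} s {}t s0 st _; have t0 := le_trans s0 st.
have [->|ts] := eqVneq s t; first by rewrite !subrr mul0r expr0n mulr0 addr0.
have r0 : 0 < t - s by rewrite subr_gt0 lt_neqAle ts.
have Su := hp_S hp t0 cf; have Sz := S_rem2 ds hp s0 st cf.
have SB := gc_sqr gc Su.
have [iu ub] := Pn t t0; have [[iz zb] _] := rem_L2 ds hp s0 st cf.
have cc := Sc_cut ds 2 k.
have H := energy_step ds smooth_softplus2 (Ssc s s0) (Ssc t t0) SB (gcN gc Sz) cc
  (softplus2_neg (lexx 0)) (ltW r0) derive2_softplus2_ge0 (fun x => derive1_softplus2_ge0 _).
have max_le (a : R) := pos_part_sub_le a c0.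
apply: (le_trans (H _ _ _)) => [y|y|y|].
- apply: le_trans (softplus2_quotient _) _.
  by apply: ler_wpM2r; [exact: derive2_softplus2_ge0|rewrite ler_pM2l // (max_le _).2].
- exact: sqr_ge0.
- rewrite (L_sub_cst _ _ Su) (P_L ds hp t0 cf) /rem2.
  exact: lin.
have cG : Sc (Gam (cut 2 k) (cut 2 k)) := Sc_form ds (Gamma_derivation ds) cc cc.1.
apply: lerD.
  rewrite ler_pM2l //.
  apply: (@le_trans _ _ (\int[mu]_x (e / (N + 1) * P t f x ^+ 2))).
    apply: le_Int; [|exact: intgZ|].
      exact: (intgZ 2 (Sc_intg ds (ScMr ds SB cG))).
    move=> y; apply: quad; first exact: sqr_ge0.
    rewrite (_ : 8^-1 * (e / (N + 1)) = e / (8 * (N + 1))); first exact: (Hk 2 y (ler0n _ 2)).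
    by rewrite invfM mulrCA.
  rewrite IntZ //; apply: (@le_trans _ _ (e / (N + 1) * N)).
    by rewrite ler_wpM2l // divr_ge0 ?(ltW e0) // addr_ge0.
  by rewrite -mulrA ler_piMr ?(ltW e0) // mulrC ler_pdivrMr ?ltr_pwDr // mul1r lerDl.
have r2 : 0 < (t - s) ^+ 2 by rewrite exprn_gt0.
have i2 : intg mu (fun x => 3 / 2 * ((t - s) ^+ 2 * P t f x ^+ 2 + (t - s) ^- 2 * rem2 t s f x ^+ 2)).
  by apply/intgZ/intgD; exact: intgZ.
apply: (@le_trans _ _ (\int[mu]_x (3 / 2 * ((t - s) ^+ 2 * P t f x ^+ 2 +
    (t - s) ^- 2 * rem2 t s f x ^+ 2)))).
  apply: le_Int => //.
    apply: (Sc_intg ds); apply: (ScM ds _ (gcN gc Sz)); apply: (ScM ds (Sc_sqr ds cc)).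
    exact: (gc_comp gc (smooth_real_derive1 smooth_softplus2) (Ssc t t0)).
  move=> y; have p0 := derive1_softplus2_ge0 (P t f y - c).
  have p1 := derive1_softplus2_le (P t f y - c); have [m0 m1] := max_le (P t f y).
  have /andP[c20 c21] := cut_sqr01 2 k y.
  have rI : (t - s) ^+ 2 * (t - s) ^- 2 = 1 by rewrite mulfV // gt_eqF.
  exact: (remainder_young _ r2 rI p0 p1 m0 m1 c20 c21).
rewrite IntZ; last by apply: intgD; exact: intgZ.
rewrite IntD ?IntZ //; [|exact: intgZ|exact: intgZ].
rewrite -[leRHS]mulrA; apply: ler_wpM2l => //; rewrite mulrDl; apply: lerD.
  by rewrite mulrC ler_wpM2r // ltW.
rewrite mulrC ler_pdivrMr //; apply: (le_trans zb); rewrite -/N2.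
by rewrite [leRHS](_ : _ = (t - s) ^+ 4 * N2) //; move: (t - s) => r; ring.
Qed.

Lemma norm_P_le f c t : Sc f -> 0 <= c -> (forall x, `|f x| <= c) -> 0 <= t ->
  forall x, `|P t f x| <= c.
Proof.
move=> cf c0 fc t0 x; rewrite ler_norml; apply/andP; split.
  have := P_le (ScZ ds (-1) cf) c0 _ t0 x; rewrite (P_opp ds hp t0 cf) mulN1r lerNl; apply.
  by move=> y; rewrite mulN1r; apply: le_trans (fc y); rewrite -normrN ler_norm.
by apply: P_le => // y; exact: le_trans (ler_norm _) (fc y).
Qed.

End maximum.

(** * Control of the vertical form along the heat flow, and the gradient bound *)

Section vertical.
Context {R : realType} {M : ptopologicalType} {S : (M -> R) -> Prop}.
Context {L : (M -> R) -> (M -> R)} {mu : {measure set (borel M) -> \bar R}}.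
Context {h : nat -> M -> R} {P : R -> (M -> R) -> (M -> R)}.
Context {GZ : (M -> R) -> (M -> R) -> (M -> R)} {rho1 rho2 kappa : R}.
Hypothesis ds : diffusion_space S L mu h.
Hypothesis hp : heat_space S L mu P.
Hypothesis gz : @derivation_form R M S GZ.
Hypothesis H3 : forall f (T : R), @Sc R M S f -> 0 <= T -> exists2 K, 0 <= K &
  forall t x, 0 <= t -> t <= T ->
    Gamma L (P t f) (P t f) x <= K /\ GZ (P t f) (P t f) x <= K.
Hypothesis rho1_gt0 : 0 < rho1.
Hypothesis rho2_gt0 : 0 < rho2.
Hypothesis kappa_ge0 : 0 <= kappa.
Hypothesis cd : forall f (nu : R) x, S f -> 0 < nu ->
  (rho1 - kappa / nu) * Gamma L f f x + rho2 * GZ f f x <=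
  Gamma2 L f x + nu * Gamma2Z L GZ f x.
Implicit Types (f g : M -> R).

Local Notation Gam := (Gamma L).
Local Notation ip := (Defs.ip mu).
Local Notation Sc := (@Sc R M S).
Local Notation cut := (@cut R M h).
Local Notation rem2 := (@rem2 R M L P).
Local Notation rem4 := (@rem4 R M L P).
Let gc := ds_gc ds.
Let SD := gcD gc.
Let SZ := gcZ gc.
Let Gf := Gamma_form gc.
Let Zf := gz.1.

Lemma psd_add q f g x : psd_form S q -> S f -> S g ->
  q (fun y => f y + g y) (fun y => f y + g y) x <= 2 * q f f x + 2 * q g g x.
Proof.
move=> qf Sf Sg.
have := pf_combine qf SD SZ 1 1 x Sf Sg; have := pf_young qf SD SZ x Sf Sg.
rewrite (_ : (fun y => 1 * f y + 1 * g y) = fun y => f y + g y); last first.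
  by apply/funext => y; rewrite !mul1r.
rewrite ler_norml => /andP[_]; move: (q _ _ x) (q f f x) (q f g x) (q g g x).
by move=> a b r s H ->; lra.
Qed.

Lemma psd_scale q f a x : psd_form S q -> S f ->
  q (fun y => a * f y) (fun y => a * f y) x = a ^+ 2 * q f f x.
Proof.
move=> qf Sf; have Saf := SZ a Sf.
by rewrite (pfZ qf) // (pfC qf) // (pfZ qf) // mulrA expr2.
Qed.

Lemma psd_mixed a b : 0 <= a -> 0 <= b ->
  psd_form S (fun f g x => a * Gam f g x + b * GZ f g x).
Proof.
move=> a0 b0; split.
- by move=> f g Sf Sg; exact: (SD (SZ a (pf_S Gf Sf Sg)) (SZ b (pf_S Zf Sf Sg))).
- by move=> f g x Sf Sg; rewrite (pfC Gf) // (pfC Zf).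
- move=> f g k x Sf Sg Sk; rewrite (pfD Gf) // (pfD Zf) // !mulrDr.
  by move: (a * _) (a * _) (b * _) (b * _) => *; ring.
- move=> r f g x Sf Sg; rewrite (pfZ Gf) // (pfZ Zf) //.
  by move: (Gam f g x) (GZ f g x) => *; ring.
- by move=> f x Sf; rewrite addr_ge0 // mulr_ge0 // ?(pf_ge0 Gf) // (pf_ge0 Zf).
Qed.

Lemma Sc_bounded f : Sc f -> exists2 K, 0 <= K & forall x, `|f x| <= K.
Proof.
move=> cf; have [k _ Hk] := Sc_plateau ds cf; have kf := Hk k (leqnn _).
have [K K0 HK] := Sc_continuousM (gc_continuous gc cf.1) (Sc_cut ds 2 k).
exists K => // x; have := HK x; rewrite mulrC.
have -> : cut 2 k x * f x = f x by exact: (congr1 (fun u => u x) (cut2_id kf)).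
move/le_trans; apply; apply: ler_piMr => //.
by rewrite ger0_norm ?cut_ge0 ?cut_le1.
Qed.

Definition bounded_family (q : (M -> R) -> (M -> R) -> M -> R) (T : R)
    (u : R -> R -> M -> R) := exists2 C, 0 <= C &
  forall s t, 0 <= s -> s <= t -> t <= T -> S (u s t) /\ forall x, q (u s t) (u s t) x <= C.

Lemma bounded_familyD q T u v : psd_form S q -> bounded_family q T u ->
  bounded_family q T v -> bounded_family q T (fun s t x => u s t x + v s t x).
Proof.
move=> qf [C C0 H] [C' C'0 H']; exists (2 * C + 2 * C'); first by rewrite addr_ge0 // mulr_ge0.
move=> s t s0 st tT; have [Su Hu] := H s t s0 st tT; have [Sv Hv] := H' s t s0 st tT.
split=> [|x]; first exact: SD.
by apply: (le_trans (psd_add x qf Su Sv)); rewrite lerD // ler_pM2l.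
Qed.

Lemma bounded_familyZ q T (a : R -> R -> R) A u : psd_form S q -> bounded_family q T u ->
  (forall s t, 0 <= s -> s <= t -> t <= T -> a s t ^+ 2 <= A) ->
  bounded_family q T (fun s t x => a s t * u s t x).
Proof.
move=> qf [C C0 H] aA; exists (`|A| * C); first by rewrite mulr_ge0.
move=> s t s0 st tT; have [Su Hu] := H s t s0 st tT.
split=> [|x]; first exact: SZ.
rewrite (psd_scale (a s t) x qf Su); apply: ler_pM; rewrite ?sqr_ge0 ?(pf_ge0 qf) //.
exact: le_trans (aA s t s0 st tT) (ler_norm _).
Qed.

Lemma bounded_family_P f T : 0 <= T -> Sc f ->
  [/\ bounded_family Gam T (fun s _ => P s f), bounded_family Gam T (fun _ t => P t f),
      bounded_family GZ T (fun s _ => P s f) & bounded_family GZ T (fun _ t => P t f)].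
Proof.
move=> T0 cf; have [K K0 HK] := H3 cf T0.
split; exists K => // s t s0 st tT; have t0 := le_trans s0 st; have sT := le_trans st tT;
  split=> [|x]; try exact: (hp_S hp).
- by have [] := HK s x s0 sT.
- by have [] := HK t x t0 tT.
- by have [] := HK s x s0 sT.
- by have [] := HK t x t0 tT.
Qed.

(** Only a sup bound, without smallness in t - s: each term of the expansion is a bounded
    coefficient times P applied to an iterate L^i f, to which (H.3) applies. *)
Lemma bounded_family_rem4 f T : 0 <= T -> Sc f ->
  bounded_family GZ T (fun s t => rem4 t s f).
Proof.
move=> T0 cf; have c1 := ScL ds cf; have c2 := ScL ds c1; have c3 := ScL ds c2.
have [_ _ b0 b0'] := bounded_family_P T0 cf.
have [_ _ _ b1] := bounded_family_P T0 c1.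
have [_ _ _ b2] := bounded_family_P T0 c2.
have [_ _ _ b3] := bounded_family_P T0 c3.
have rT s t : 0 <= s -> s <= t -> t <= T -> 0 <= t - s /\ t - s <= T.
  by move=> s0 st tT; split; lra.
have pw m s t : 0 <= s -> s <= t -> t <= T -> (t - s) ^+ m <= T ^+ m.
  by move=> s0 st tT; have [r0 rr] := rT s t s0 st tT; exact: lerXn2r.
have bN : bounded_family GZ T (fun s t x => -1 * P t f x).
  by apply: (bounded_familyZ (a := fun _ _ => -1) (A := 1) Zf b0') => s t *; rewrite sqrrN expr1n.
have b1' := bounded_familyZ (a := fun s t => t - s) (A := T ^+ 2) Zf b1 (pw 2).
have b2' : bounded_family GZ T (fun s t x => - (2^-1 * (t - s) ^+ 2) * P t (L (L f)) x).
  apply: (bounded_familyZ (a := fun s t => - (2^-1 * (t - s) ^+ 2)) (A := T ^+ 4) Zf b2).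
  move=> s t s0 st tT; rewrite sqrrN exprMn -exprM.
  apply: (le_trans _ (pw 4 s t s0 st tT)); apply: ler_piMl; last by rewrite expr_le1 //; lra.
  by have [r0 _] := rT s t s0 st tT; exact: exprn_ge0.
have b3' : bounded_family GZ T (fun s t x => 6^-1 * (t - s) ^+ 3 * P t (L (L (L f))) x).
  apply: (bounded_familyZ (a := fun s t => 6^-1 * (t - s) ^+ 3) (A := T ^+ 6) Zf b3).
  move=> s t s0 st tT; rewrite exprMn -exprM.
  apply: (le_trans _ (pw 6 s t s0 st tT)); apply: ler_piMl; last by rewrite expr_le1 //; lra.
  by have [r0 _] := rT s t s0 st tT; exact: exprn_ge0.
have := bounded_familyD Zf (bounded_familyD Zf (bounded_familyD Zf
  (bounded_familyD Zf b0 bN) b1') b2') b3'.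
congr bounded_family; apply/funext => s; apply/funext => t; apply/funext => x.
by rewrite /rem4 mulN1r.
Qed.

Lemma Gamma2_Int theta y : Sc theta -> S y ->
  \int[mu]_x (theta x * Gamma2 L y x) =
  2^-1 * \int[mu]_x (Gam y y x * L theta x) - \int[mu]_x (theta x * Gam y (L y) x).
Proof.
move=> ct Sy; have SL := gc_L gc Sy; have SG := pf_S Gf Sy Sy; have SGL := pf_S Gf Sy SL.
rewrite -(Int_by_parts ds ct SG) -IntZ; last exact: (Sc_intg ds (ScM ds ct (gc_L gc SG))).
rewrite -IntB; last exact: (Sc_intg ds (ScM ds ct SGL)).
  by apply: eq_Int => x; rewrite /Gamma2; move: (L _ x) (Gam _ _ x) => a b; field.
exact: (intgZ _ (Sc_intg ds (ScM ds ct (gc_L gc SG)))).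
Qed.

Lemma Gamma2Z_Int theta y : Sc theta -> S y ->
  \int[mu]_x (theta x * Gamma2Z L GZ y x) =
  2^-1 * \int[mu]_x (GZ y y x * L theta x) - \int[mu]_x (theta x * GZ y (L y) x).
Proof.
move=> ct Sy; have SL := gc_L gc Sy; have SG := pf_S Zf Sy Sy; have SGL := pf_S Zf Sy SL.
rewrite -(Int_by_parts ds ct SG) -IntZ; last exact: (Sc_intg ds (ScM ds ct (gc_L gc SG))).
rewrite -IntB; last exact: (Sc_intg ds (ScM ds ct SGL)).
  by apply: eq_Int => x; rewrite /Gamma2Z; move: (L _ x) (GZ _ _ x) => a b; field.
exact: (intgZ _ (Sc_intg ds (ScM ds ct (gc_L gc SG)))).
Qed.

Lemma ge0_weighted_Int_le theta g (A a : R) : Sc theta -> S g -> (forall x, 0 <= theta x) ->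
  (forall x, theta x <= A) -> 0 <= A -> (forall x, 0 <= g x) -> intg mu g ->
  \int[mu]_x g x <= a -> \int[mu]_x (theta x * g x) <= A * a.
Proof.
move=> ct Sg t0 tA A0 g0 Ig ga; apply: (@le_trans _ _ (\int[mu]_x (A * g x))).
  apply: le_Int; [exact: (Sc_intg ds (ScM ds ct Sg))|exact: intgZ|] => x.
  by rewrite ler_wpM2r.
by rewrite IntZ // ler_wpM2l.
Qed.

(** CD is read as an upper bound for Gamma^Z of y = rem4. Integrated by parts, Gamma2(y) involves
    Gamma of y and of L y, of order (t - s)^8, while Gamma2^Z(y) is merely bounded. Taking nu = (t -
    s)^4 balances nu times a constant against (kappa / nu) (t - s)^8. *)
Lemma GZ_rem4 f T theta : Sc f -> 0 <= T -> Sc theta -> (forall x, 0 <= theta x) ->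
  exists2 C, 0 <= C & forall s t, 0 <= s -> s < t -> t <= T ->
    \int[mu]_x (theta x * GZ (rem4 t s f) (rem4 t s f) x) <= C * (t - s) ^+ 4.
Proof.
move=> cf T0 ct t0.
have lin1 (p q r b : R) : 0 <= b -> - (q + r) <= 2 * p ->
    - (b * p) <= 2^-1 * (b * q + b * r).
  by move=> b0 /(ler_wpM2l b0); lra.
have lin2 (p q b x y r A : R) : p <= b * (x * r) -> - q <= 2^-1 * (A * (x * r) + A * (y * r)) ->
    2^-1 * p - q <= (2^-1 * (b * x) + 2^-1 * (A * x + A * y)) * r by lra.
have lin3 (p q r b c c' : R) : 0 <= b -> q <= c -> r <= c' -> - (q + r) <= 2 * p ->
    - (b * p) <= 2^-1 * (c + c') * b.
  move=> b0 qc rc H; have : - (2 * p) <= c + c' by lra.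
  by move=> /(ler_wpM2l b0); lra.
have lin4 (p q x y b : R) : p <= x * y -> - q <= 2^-1 * b ->
    2^-1 * p - q <= 2^-1 * (x * y) + 2^-1 * b by lra.
have lin5 (g2 g2z g z b k n : R) : 0 <= b -> 0 <= g ->
    (rho1 - k) * g + rho2 * z <= g2 + n * g2z ->
    rho2 * (b * z) <= b * g2 + n * (b * g2z) + k * (b * g).
  move=> b0 g0 H; have rg : 0 <= rho1 * g by rewrite mulr_ge0 // ltW.
  have : rho2 * z <= g2 + n * g2z + k * g by lra.
  by move=> /(ler_wpM2l b0); lra.
have lin6 (p q r x8 x4 T4 d1 d2 k : R) : p <= d1 * x8 -> r <= k * x4 -> d1 * x8 <= d1 * (T4 * x4) ->
    q <= x4 * d2 -> p + q + r <= (d1 * T4 + d2 + k) * x4 by lra.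
have c1 := ScL ds cf; have cL := ScL ds ct.
have [A A0 HA'] := Sc_bounded ct; have [B B0 HB] := Sc_bounded cL.
have HA x : theta x <= A := le_trans (ler_norm _) (HA' x).
have [CG CG0 HG] := rem_Gamma ds hp cf; have [CG' CG'0 HG'] := rem_Gamma ds hp c1.
have [C1 C10 H1] := bounded_family_rem4 T0 cf.
have [C1' C1'0 H1'] := bounded_family_rem4 T0 c1.
pose IL := \int[mu]_x `|L theta x|; pose It := \int[mu]_x theta x.
have IL0 : 0 <= IL by exact: Int_ge0.
have It0 : 0 <= It by exact: Int_ge0.
pose D1 := 2^-1 * (B * CG) + 2^-1 * (A * CG + A * CG').
pose D2 := 2^-1 * (C1 * IL) + 2^-1 * (C1 + C1') * It.
have D10 : 0 <= D1 by rewrite /D1 addr_ge0 // mulr_ge0 // ?addr_ge0 // mulr_ge0.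
have D20 : 0 <= D2.
  by rewrite /D2 addr_ge0 // mulr_ge0 // ?mulr_ge0 // addr_ge0.
exists (rho2^-1 * (D1 * T ^+ 4 + D2 + kappa * (A * CG))).
  apply: mulr_ge0; first by rewrite invr_ge0 ltW.
  apply: addr_ge0; first by apply: addr_ge0 => //; apply: mulr_ge0 => //; exact: exprn_ge0.
  by apply: mulr_ge0 => //; exact: mulr_ge0.
move=> s t s0 st tT; have r0 : 0 < t - s by rewrite subr_gt0.
have st' := ltW st.
have [_ _ Iy Ey] := HG s t s0 st'; have [_ _ Iy' Ey'] := HG' s t s0 st'.
have [Sy Hy] := H1 s t s0 st' tT; have [Sy' Hy'] := H1' s t s0 st' tT.
have LE := L_rem4 ds hp s0 st' cf.
set y := rem4 t s f in Iy Ey Sy Hy LE *.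
rewrite -LE in Iy' Ey' Sy' Hy'.
have SGy := pf_S Gf Sy Sy; have SGy' := pf_S Gf Sy' Sy'; have SZy := pf_S Zf Sy Sy.
have SGm := pf_S Gf Sy Sy'; have SZm := pf_S Zf Sy Sy'; have SZy' := pf_S Zf Sy' Sy'.
have w u : S u -> intg mu (fun x => theta x * u x) by move=> Su; exact: (Sc_intg ds (ScM ds ct Su)).
have S2 : S (Gamma2 L y).
  by apply: SZ; apply: (gcB gc); [exact: (gc_L gc)|exact: SZ].
have S2Z : S (Gamma2Z L GZ y).
  by apply: SZ; apply: (gcB gc); [exact: (gc_L gc)|exact: SZ].
have e1 : \int[mu]_x (theta x * Gamma2 L y x) <= D1 * (t - s) ^+ 8.
  rewrite Gamma2_Int //.
  have h1 : \int[mu]_x (Gam y y x * L theta x) <= B * (CG * (t - s) ^+ 8).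
    apply: (@le_trans _ _ (\int[mu]_x (B * Gam y y x))).
      apply: le_Int; [exact: (Sc_intg ds (ScMr ds SGy cL))|exact: intgZ|] => x.
      rewrite mulrC ler_wpM2r ?(pf_ge0 Gf) //; exact: le_trans (ler_norm _) (HB x).
    by rewrite IntZ // ler_wpM2l.
  have h2 : - (\int[mu]_x (theta x * Gam y (L y) x)) <=
      2^-1 * (A * (CG * (t - s) ^+ 8) + A * (CG' * (t - s) ^+ 8)).
    have g1 := ge0_weighted_Int_le ct SGy t0 HA A0 (fun x => pf_ge0 Gf x Sy) Iy Ey.
    have g2 := ge0_weighted_Int_le ct SGy' t0 HA A0 (fun x => pf_ge0 Gf x Sy') Iy' Ey'.
    apply: (@le_trans _ _ (\int[mu]_x (2^-1 * (theta x * Gam y y x + theta x * Gam (L y) (L y) x)))).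
      rewrite -IntN; last exact: w.
      apply: le_Int; [by apply/intgN/w|by apply/intgZ/intgD; exact: w|] => x.
      have := pf_young Gf SD SZ x Sy Sy'; rewrite ler_norml => /andP[].
      by move=> b1 _; exact: lin1.
    rewrite IntZ; last by apply: intgD; exact: w.
    by rewrite IntD; [rewrite ler_wpM2l // lerD|exact: w|exact: w].
  exact: lin2.
have e2 : \int[mu]_x (theta x * Gamma2Z L GZ y x) <= D2.
  rewrite Gamma2Z_Int //.
  have h1 : \int[mu]_x (GZ y y x * L theta x) <= C1 * IL.
    rewrite -IntZ; last exact: (intg_norm (Sc_intg ds cL)).
    apply: le_Int; [exact: (Sc_intg ds (ScMr ds SZy cL))|exact: (intgZ _ (intg_norm (Sc_intg ds cL)))|].
    move=> x; apply: (le_trans (ler_norm _)); rewrite normrM ger0_norm ?(pf_ge0 Zf) //.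
    by rewrite ler_wpM2r.
  have h2 : - (\int[mu]_x (theta x * GZ y (L y) x)) <= 2^-1 * (C1 + C1') * It.
    rewrite -IntN; last exact: w.
    rewrite -IntZ; last exact: (Sc_intg ds ct).
    apply: le_Int; [by apply/intgN/w|exact: (intgZ _ (Sc_intg ds ct))|] => x.
    have := pf_young Zf SD SZ x Sy Sy'; rewrite ler_norml => /andP[].
    by move=> b1 _; exact: (lin3 _ _ _ _ _ _ (t0 x) (Hy x) (Hy' x) b1).
  by rewrite /D2 -mulrA; apply: lin4 => //; rewrite mulrA.
have e3 : \int[mu]_x (theta x * Gam y y x) <= A * (CG * (t - s) ^+ 8).
  exact: ge0_weighted_Int_le ct SGy t0 HA A0 (fun x => pf_ge0 Gf x Sy) Iy Ey.
(* The parameter nu of CD is (t - s)^4, half the order of the Gamma estimate. *)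
have nu0 : 0 < (t - s) ^+ 4 by rewrite exprn_gt0.
have e4 : rho2 * \int[mu]_x (theta x * GZ y y x) <=
    \int[mu]_x (theta x * Gamma2 L y x) + (t - s) ^+ 4 * \int[mu]_x (theta x * Gamma2Z L GZ y x)
    + kappa / (t - s) ^+ 4 * \int[mu]_x (theta x * Gam y y x).
  rewrite -!IntZ; do ?exact: w.
  rewrite -IntD; [|exact: w|exact/intgZ/w].
  rewrite -IntD; [|by apply: intgD; [exact: w|exact/intgZ/w]|exact/intgZ/w].
  apply: le_Int; [exact/intgZ/w|by do ?apply: intgD; do ?exact/intgZ/w; exact: w|] => x.
  exact: (lin5 _ _ _ _ _ _ _ (t0 x) (pf_ge0 Gf x Sy) (cd x Sy nu0)).
rewrite -mulrA mulrC ler_pdivlMr // mulrC; apply: (le_trans e4).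
have e5 : kappa / (t - s) ^+ 4 * \int[mu]_x (theta x * Gam y y x) <=
    kappa * (A * CG) * (t - s) ^+ 4.
  apply: (@le_trans _ _ (kappa / (t - s) ^+ 4 * (A * (CG * (t - s) ^+ 8)))).
    by rewrite ler_wpM2l // divr_ge0 // ltW.
  rewrite le_eqVlt; apply/orP; left; apply/eqP.
  by field; rewrite gt_eqF.
have e6 : (t - s) ^+ 8 <= T ^+ 4 * (t - s) ^+ 4.
  rewrite -[8%N]/(4 + 4)%N exprD ler_wpM2r ?(ltW nu0) //.
  by apply: lerXn2r; rewrite ?nnegrE ?(ltW r0) //; lra.
have e7 := ler_wpM2l D10 e6; have e8 := ler_wpM2l (ltW nu0) e2.
exact: (lin6 _ _ _ _ _ _ _ _ _ e1 e5 e7 e8).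
Qed.

(** [rem2] differs from [rem4] by the second and third order terms, whose Gamma^Z is O((t - s)^4) by
    the sup bounds at time t; [GZ_rem4] has the same order. *)
Lemma form_rem2 f T theta : Sc f -> 0 <= T -> Sc theta -> (forall x, 0 <= theta x) ->
  exists2 C, 0 <= C & forall s t, 0 <= s -> s < t -> t <= T ->
    \int[mu]_x (theta x * (Gam (rem2 t s f) (rem2 t s f) x + GZ (rem2 t s f) (rem2 t s f) x))
      <= C * (t - s) ^+ 4.
Proof.
move=> cf T0 ct t0.
have lin1 (z y a b c d K r r2 r3 T2 : R) : z <= 2 * y + 2 * (2 * a + 2 * b) ->
    a = r2 * c -> b = r3 * d -> c <= K -> d <= K -> r2 = 4^-1 * r -> r3 <= T2 * r ->
    0 <= r -> 0 <= r3 -> 0 <= K ->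
    z <= 2 * y + (2 * K + 4 * K * T2) * r.
  move=> hz aE bE cK dK r2E h3 r0 r30 K0; move: hz; rewrite aE bE r2E => hz.
  have := ler_wpM2l r0 cK; have := ler_wpM2l r30 dK; have := ler_wpM2l K0 h3.
  by have := mulr_ge0 K0 r0; lra.
have lin2 (p q r x y I c : R) : p <= x * r -> q <= 2 * (y * r) + c * r * I ->
    p + q <= (x + 2 * y + c * I) * r by lra.
have [A A0 HA'] := Sc_bounded ct.
have HA x : theta x <= A := le_trans (ler_norm _) (HA' x).
have c1 := ScL ds cf; have c2 := ScL ds c1; have c3 := ScL ds c2.
have [CG CG0 HG] := rem_Gamma ds hp cf; have [C4 C40 H4] := GZ_rem4 cf T0 ct t0.
have [K2 K20 HK2] := H3 c2 T0; have [K3 K30 HK3] := H3 c3 T0.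
pose K := K2 + K3; have K0 : 0 <= K by exact: addr_ge0.
pose It := \int[mu]_x theta x; have It0 : 0 <= It by exact: Int_ge0.
exists (A * CG + 2 * C4 + (2 * K + 4 * K * T ^+ 2) * It).
  apply: addr_ge0; first by rewrite addr_ge0 // mulr_ge0.
  apply: mulr_ge0 => //; apply: addr_ge0; first exact: mulr_ge0.
  by apply: mulr_ge0; [exact: mulr_ge0|exact: sqr_ge0].
move=> s t s0 st tT; have r0 : 0 < t - s by rewrite subr_gt0.
have st' := ltW st; have tt0 := le_trans s0 st'.
have [Iz Ez _ _] := HG s t s0 st'.
have Sz := S_rem2 ds hp s0 st' cf; have Sy := S_rem4 ds hp s0 st' cf.
have S2 := hp_S hp tt0 c2; have S3 := hp_S hp tt0 c3.
have SGz := pf_S Gf Sz Sz; have SZz := pf_S Zf Sz Sz; have SZy := pf_S Zf Sy Sy.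
have w u : S u -> intg mu (fun x => theta x * u x) by move=> Su; exact: (Sc_intg ds (ScM ds ct Su)).
have e1 : \int[mu]_x (theta x * Gam (rem2 t s f) (rem2 t s f) x) <= A * CG * (t - s) ^+ 4.
  by rewrite -mulrA; exact: (ge0_weighted_Int_le ct SGz t0 HA A0 (fun x => pf_ge0 Gf x Sz) Iz Ez).
rewrite (eq_Int mu (g := fun x => theta x * Gam (rem2 t s f) (rem2 t s f) x +
    theta x * GZ (rem2 t s f) (rem2 t s f) x)); last by move=> x; rewrite mulrDr.
rewrite IntD; [|exact: w|exact: w].
apply: (lin2 _ _ _ _ _ _ _ e1).
have e2 := H4 s t s0 st tT.
have pt x : GZ (rem2 t s f) (rem2 t s f) x <= 2 * GZ (rem4 t s f) (rem4 t s f) x +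
    (2 * K + 4 * K * T ^+ 2) * (t - s) ^+ 4.
  pose w2 y := 2^-1 * (t - s) ^+ 2 * P t (L (L f)) y.
  pose w3 y := - (6^-1 * (t - s) ^+ 3) * P t (L (L (L f))) y.
  have Sw2 : S w2 := SZ _ S2.
  have Sw3 : S w3 := SZ _ S3.
  have zE : rem2 t s f = fun y => rem4 t s f y + (w2 y + w3 y).
    apply/funext => y; rewrite /w2 /w3 /rem4 /rem2.
    by move: (P s f y) (P t f y) (P t (L f) y) (P t (L (L f)) y) => x1 x2 x3 x4; ring.
  have h1 := psd_add x Zf Sy (SD Sw2 Sw3).
  have h2 := psd_add x Zf Sw2 Sw3.
  rewrite -zE in h1.
  have h3 : GZ (rem2 t s f) (rem2 t s f) x <= 2 * GZ (rem4 t s f) (rem4 t s f) x +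
      2 * (2 * GZ w2 w2 x + 2 * GZ w3 w3 x).
    by apply: (le_trans h1); rewrite lerD2l ler_pM2l.
  have h4 := psd_scale (2^-1 * (t - s) ^+ 2) x Zf S2.
  have h5 := psd_scale (- (6^-1 * (t - s) ^+ 3)) x Zf S3.
  have k2 : GZ (P t (L (L f))) (P t (L (L f))) x <= K.
    by apply: le_trans (HK2 t x tt0 tT).2 _; rewrite lerDl.
  have k3 : GZ (P t (L (L (L f)))) (P t (L (L (L f)))) x <= K.
    by apply: le_trans (HK3 t x tt0 tT).2 _; rewrite lerDr.
  apply: (lin1 _ _ _ _ _ _ _ _ _ _ _ h3 h4 h5 k2 k3 _ _ _ _ K0).
  - by rewrite exprMn -exprM exprVn; congr (_^-1 * _); ring.
  - rewrite sqrrN exprMn -exprM -[(3 * 2)%N]/(2 + 4)%N exprD.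
    apply: (@le_trans _ _ ((t - s) ^+ 2 * (t - s) ^+ 4)).
      by apply: ler_piMl; [rewrite mulr_ge0 ?exprn_ge0 // ltW|rewrite expr_le1 //; lra].
    rewrite ler_wpM2r ?exprn_ge0 ?(ltW r0) //.
    by apply: lerXn2r; rewrite ?nnegrE ?(ltW r0) //; lra.
  - by rewrite exprn_ge0 // ltW.
  - exact: sqr_ge0.
apply: (@le_trans _ _ (\int[mu]_x (2 * (theta x * GZ (rem4 t s f) (rem4 t s f) x) +
   (2 * K + 4 * K * T ^+ 2) * (t - s) ^+ 4 * theta x))).
  apply: le_Int; [exact: w|apply: intgD; [exact/intgZ/w|exact: (intgZ _ (Sc_intg ds ct))]|] => x.
  by apply: (le_trans (ler_wpM2l (t0 x) (pt x))); rewrite mulrDr mulrCA [X in _ + X]mulrC.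
rewrite IntD; [|exact/intgZ/w|exact: (intgZ _ (Sc_intg ds ct))].
rewrite IntZ; last exact: w.
rewrite IntZ; last exact: (Sc_intg ds ct).
by rewrite lerD // ler_pM2l.
Qed.

(* Cost of the Taylor remainder in one time step of an energy. *)
Lemma remainder_bound f T theta A : Sc f -> 0 <= T -> Sc theta -> (forall x, 0 <= theta x) ->
  0 <= A -> exists2 C, 0 <= C & forall s t a b p, 0 <= s -> s < t -> t <= T ->
    0 <= a -> a <= A -> 0 <= b -> b <= A -> S p -> (forall x, 0 <= p x <= A) ->
    \int[mu]_x (theta x * p x *
      - (2 * (a * Gam (P t f) (rem2 t s f) x + b * GZ (P t f) (rem2 t s f) x))) <=
    C * (t - s) ^+ 2.
Proof.
move=> cf T0 ct t0 A0.
have lin1 (th p q r V a b g1 g2 z1 z2 K : R) : 0 <= th -> 0 <= p -> p <= A -> 0 <= r ->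
    0 <= V -> 0 <= a -> a <= A -> 0 <= b -> b <= A ->
    g1 <= K -> g2 <= K -> 0 <= z1 -> 0 <= z2 -> 0 <= K ->
    `|2 * q| <= r * (a * g1 + b * g2) + V * (a * z1 + b * z2) ->
    th * p * - (2 * q) <= 2 * A * A * K * r * th + A * A * V * (th * (z1 + z2)).
  move=> th0 p0 pA r0 V0 a0 aA b0 bA g1K g2K z10 z20 K0 Hq.
  have h1 : - (2 * q) <= r * (2 * A * K) + V * (A * (z1 + z2)).
    apply: (le_trans (ler_norm _)); rewrite normrN; apply: (le_trans Hq); apply: lerD.
      rewrite ler_wpM2l //; have := ler_wpM2l a0 g1K; have := ler_wpM2l b0 g2K.
      have := ler_wpM2r K0 aA; have := ler_wpM2r K0 bA; lra.
    rewrite ler_wpM2l //; have := ler_wpM2r z10 aA; have := ler_wpM2r z20 bA; lra.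
  have h2 : 0 <= r * (2 * A * K) + V * (A * (z1 + z2)).
    by rewrite addr_ge0 // mulr_ge0 // mulr_ge0 // ?addr_ge0 // mulr_ge0.
  have h3 : th * p * - (2 * q) <= th * p * (r * (2 * A * K) + V * (A * (z1 + z2))).
    by rewrite ler_wpM2l // mulr_ge0.
  have h4 : th * p * (r * (2 * A * K) + V * (A * (z1 + z2))) <=
      th * A * (r * (2 * A * K) + V * (A * (z1 + z2))).
    by rewrite ler_wpM2r // ler_wpM2l.
  lra.
have [C C0 HC] := form_rem2 cf T0 ct t0; have [K K0 HK] := H3 cf T0.
pose It := \int[mu]_x theta x; have It0 : 0 <= It by exact: Int_ge0.
have AA0 : 0 <= A * A by exact: mulr_ge0.
exists (2 * A * A * K * It + A * A * C).
  by apply: addr_ge0; [rewrite mulr_ge0 // mulr_ge0 // -mulrA mulr_ge0|rewrite mulr_ge0].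
move=> s t a b p s0 st tT a0 aA b0 bA Sp p01; have r0 : 0 < t - s by rewrite subr_gt0.
have st' := ltW st; have tt0 := le_trans s0 st'.
have Sz := S_rem2 ds hp s0 st' cf; have Su := hp_S hp tt0 cf.
have SGz := pf_S Gf Sz Sz; have SZz := pf_S Zf Sz Sz.
have SGm := pf_S Gf Su Sz; have SZm := pf_S Zf Su Sz.
have w u : S u -> intg mu (fun x => theta x * u x) by move=> Sv; exact: (Sc_intg ds (ScM ds ct Sv)).
have mf := psd_mixed a0 b0.
have rI : (t - s) * (t - s)^-1 = 1 by rewrite mulfV // gt_eqF.
have r20 : 0 <= (t - s) ^+ 2 by exact: sqr_ge0.
have r20V : 0 <= (t - s)^-1 ^+ 2 by exact: sqr_ge0.
pose g1 x := 2 * A * A * K * (t - s) ^+ 2 * theta x.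
pose g2 x := A * A * (t - s)^-1 ^+ 2 * (theta x *
  (Gam (rem2 t s f) (rem2 t s f) x + GZ (rem2 t s f) (rem2 t s f) x)).
have i1 : intg mu g1 := intgZ _ (Sc_intg ds ct).
have i2 : intg mu g2 := intgZ _ (w _ (SD SGz SZz)).
apply: (@le_trans _ _ (\int[mu]_x (g1 x + g2 x))).
  apply: le_Int; [|exact: intgD|] => [|x].
    apply: (Sc_intg ds (ScM ds (ScM ds ct Sp) _)); apply: (gcN gc); apply: SZ.
    exact: (SD (SZ a SGm) (SZ b SZm)).
  have /andP[p0 pA] := p01 x; have [k1 k2] := HK t x tt0 tT.
  apply: (lin1 _ _ _ _ _ a b _ _ _ _ _ (t0 x) p0 pA r20 r20V a0 aA b0 bA k1 k2
    (pf_ge0 Gf x Sz) (pf_ge0 Zf x Sz) K0).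
  (* Young's inequality with weights t - s and its inverse: the square of the first is already (t -
     s)^2, and the inverse square times the O((t - s)^4) of the remainder gives the same order. *)
  have := pf_young mf SD SZ x (SZ (t - s) Su) (SZ (t - s)^-1 Sz).
  rewrite (psd_scale _ x mf Su) (psd_scale _ x mf Sz).
  have -> : 2 * (a * Gam (fun y => (t - s) * P t f y) (fun y => (t - s)^-1 * rem2 t s f y) x +
      b * GZ (fun y => (t - s) * P t f y) (fun y => (t - s)^-1 * rem2 t s f y) x) =
    2 * (a * Gam (P t f) (rem2 t s f) x + b * GZ (P t f) (rem2 t s f) x) => //.
  have Sz' := SZ (t - s)^-1 Sz.
  rewrite (pfZ Gf) // (pfC Gf) // (pfZ Gf) // (pfZ Zf) // (pfC Zf) // (pfZ Zf) //.
  by rewrite !(mulrA (t - s)) rI !mul1r (pfC Gf) // (pfC Zf).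
rewrite IntD // IntZ; last exact: (Sc_intg ds ct).
rewrite IntZ; last exact: (w _ (SD SGz SZz)).
rewrite [leRHS]mulrDl; apply: lerD; first by rewrite mulrAC.
have := ler_wpM2l (mulr_ge0 AA0 r20V) (HC s t s0 st tT).
move/le_trans; apply; rewrite le_eqVlt; apply/orP; left; apply/eqP.
by field; rewrite gt_eqF.
Qed.

Local Notation form a b f g := (fun x => a * Gam f g x + b * GZ f g x).

Lemma form_step f (a b s t : R) x : Sc f -> 0 <= a -> 0 <= b -> 0 <= s -> s <= t ->
  form a b (P t f) (P t f) x - form a b (P s f) (P s f) x <=
  (t - s) * (2 * form a b (P t f) (L (P t f)) x) - 2 * form a b (P t f) (rem2 t s f) x.
Proof.
move=> cf a0 b0 s0 st; have t0 := le_trans s0 st.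
have Su := hp_S hp t0 cf; have Sz := S_rem2 ds hp s0 st cf.
apply: (pf_diff (psd_mixed a0 b0) SD SZ x Su (gc_L gc Su) Sz) => y.
rewrite (P_L ds hp t0 cf) /rem2.
by move: (P s f y) (P t f y) (P t (L f) y) => *; ring.
Qed.

(** CD with nu = b / a, multiplied by a. *)
Lemma form_CD u (a b : R) x : 0 < a -> 0 < b -> S u ->
  2 * form a b u (L u) x <= L (form a b u u) x -
    2 * ((a * rho1 - kappa * a ^+ 2 / b) * Gam u u x + a * rho2 * GZ u u x).
Proof.
move=> a0 b0 Su; have SG := pf_S Gf Su Su; have SGZ := pf_S Zf Su Su.
have := ler_wpM2l (ltW a0) (cd x Su (divr_gt0 b0 a0)).
rewrite (gc_LD gc x (SZ a SG) (SZ b SGZ)) (gc_LZ gc a x SG) (gc_LZ gc b x SGZ).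
rewrite /Gamma2 /Gamma2Z.
move: (L (Gam u u) x) (L (GZ u u) x) (Gam u (L u) x) (GZ u (L u) x) (Gam u u x) (GZ u u x).
move=> l1 l2 g z G Z.
have -> : a * ((rho1 - kappa / (b / a)) * G + rho2 * Z) =
    (a * rho1 - kappa * a ^+ 2 / b) * G + a * rho2 * Z.
  by field; rewrite !gt_eqF.
have -> : a * (2^-1 * (l1 - 2 * g) + b / a * (2^-1 * (l2 - 2 * z))) =
    2^-1 * (a * l1 + b * l2) - (a * g + b * z).
  by field; rewrite !gt_eqF.
move: (_ * G + _) (a * l1) => X Y; lra.
Qed.

(** For F = Gamma + nu Gamma^Z, CD bounds the growth of F by L F + (1 / nu) (2 (kappa + rho2) Gamma
    - 2 rho2 F): rewriting Gamma^Z through F creates a damping of rate 2 rho2 / nu. This is the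
    energy step for phi(x) = x^2 with B = F^2. *)
Lemma form_increment f T nu chi : Sc f -> 0 <= T -> 0 < nu -> nu <= 1 -> Sc chi ->
  exists2 K, 0 <= K & forall s t, 0 <= s -> s < t -> t <= T ->
  \int[mu]_x (chi x ^+ 2 * form 1 nu (P t f) (P t f) x ^+ 2) -
  \int[mu]_x (chi x ^+ 2 * form 1 nu (P s f) (P s f) x ^+ 2) <=
  (t - s) * (\int[mu]_x (2 * (form 1 nu (P t f) (P t f) x ^+ 2 * Gam chi chi x)) +
    nu^-1 * (- (2 * rho2 * \int[mu]_x (chi x ^+ 2 * form 1 nu (P t f) (P t f) x ^+ 2)) +
      2 * (kappa + rho2) ^+ 2 / rho2 * \int[mu]_x (chi x ^+ 2 * Gam (P t f) (P t f) x ^+ 2)))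
  + K * (t - s) ^+ 2.
Proof.
move=> cf T0 nu0 nu1 cc.
have cdF (l q G Z : R) : 0 <= G ->
    2 * q <= l - 2 * ((1 * rho1 - kappa * 1 ^+ 2 / nu) * G + 1 * rho2 * Z) ->
    2 * q <= l + nu^-1 * (2 * (kappa + rho2) * G - 2 * rho2 * (1 * G + nu * Z)).
  move=> G0; have -> : nu^-1 * (2 * (kappa + rho2) * G - 2 * rho2 * (1 * G + nu * Z)) =
      2 * (kappa / nu * G) - 2 * (rho2 * Z) by field; rewrite gt_eqF.
  rewrite expr1n mulr1 !mul1r; have := mulr_ge0 (ltW rho1_gt0) G0.
  by move: (kappa / nu) => k; lra.
have young (c2 F G : R) : 0 <= c2 ->
    c2 * (2 * F) * (2 * (kappa + rho2) * G - 2 * rho2 * F) <=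
    - (2 * rho2) * (c2 * F ^+ 2) + 2 * (kappa + rho2) ^+ 2 / rho2 * (c2 * G ^+ 2).
  move=> c20; rewrite -subr_ge0.
  have -> : - (2 * rho2) * (c2 * F ^+ 2) + 2 * (kappa + rho2) ^+ 2 / rho2 * (c2 * G ^+ 2) -
      c2 * (2 * F) * (2 * (kappa + rho2) * G - 2 * rho2 * F) =
      2 * c2 / rho2 * (rho2 * F - (kappa + rho2) * G) ^+ 2.
    by field; rewrite gt_eqF.
  by rewrite mulr_ge0 ?sqr_ge0 // divr_ge0 ?(ltW rho2_gt0) // mulr_ge0.
have [K K0 HK] := H3 cf T0.
have c2 := Sc_sqr ds cc.
have A0 : 0 <= 4 * K + 1 by rewrite addr_ge0 // mulr_ge0.
have A1 : 1 <= 4 * K + 1 by rewrite lerDr mulr_ge0.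
have [C C0 HC] := remainder_bound cf T0 c2 (fun x => sqr_ge0 (chi x)) A0.
exists C => // s t s0 st tT.
have r0 : 0 < t - s by rewrite subr_gt0.
have st' := ltW st; have t0 := le_trans s0 st'.
have Su := hp_S hp t0 cf; have Sz := S_rem2 ds hp s0 st' cf; have Sus := hp_S hp s0 cf.
have mf := psd_mixed ler01 (ltW nu0).
have SFs := pf_S mf Sus Sus; have SFz := pf_S mf Su Sz.
have SG := pf_S Gf Su Su.
pose F := form 1 nu (P t f) (P t f).
have SF : S F := pf_S mf Su Su.
pose X x := 2 * (kappa + rho2) * Gam (P t f) (P t f) x - 2 * rho2 * F x.
have SX : S X := gcB gc (SZ _ SG) (SZ _ SF).
pose Zm x := - (2 * form 1 nu (P t f) (rem2 t s f) x).
have SZm : S Zm := gcN gc (SZ 2 SFz).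
pose W x := (t - s) * (nu^-1 * X x) + Zm x.
have SW : S W := SD (SZ _ (SZ _ SX)) SZm.
have F0 x : 0 <= F x := pf_ge0 mf x Su.
have step : forall x, F x - form 1 nu (P s f) (P s f) x <= (t - s) * L F x + W x.
  move=> x; apply: (le_trans (form_step x cf ler01 (ltW nu0) s0 st')).
  rewrite /W addrA lerD2r -mulrDr ler_wpM2l ?(ltW r0) //.
  apply: cdF; first exact: (gc_Gamma_ge0 gc x Su).
  exact: (form_CD x ltr01 nu0 Su).
have sq2 (y : R) : 0 <= derive1 (derive1 (fun x : R => x ^+ 2)) y by rewrite derive2_sqr.
have dF x : derive1 (fun x : R => x ^+ 2) (F x) = 2 * F x by rewrite derive1_sqr.
have := energy_step ds smooth_sqr SFs SF (gc_sqr gc SF) SW cc (expr0n _ 2) (ltW r0) sq2 _ _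
  (fun x => sqr_ge0 (F x)) step.
move=> /(_ _ _)/le_trans; apply.
- by move=> x; rewrite dF mulr_ge0.
- by move=> x; rewrite dF derive2_sqr le_eqVlt; apply/orP; left; apply/eqP; ring.
rewrite mulrDr -addrA lerD2l.
have w u : S u -> intg mu (fun x => chi x ^+ 2 * u x) by move=> Sv; exact: (Sc_intg ds (ScM ds c2 Sv)).
have S2F : S (fun x => 2 * F x) := SZ 2 SF.
rewrite (eq_Int mu (g := fun x => (t - s) * (nu^-1 * (chi x ^+ 2 * (2 * F x) * X x)) +
    chi x ^+ 2 * (2 * F x) * Zm x)); last first.
  by move=> x; rewrite dF /W; move: (chi x) (F x) (X x) (Zm x) => *; ring.
have iX : intg mu (fun x => chi x ^+ 2 * (2 * F x) * X x).
  exact: (Sc_intg ds (ScM ds (ScM ds c2 S2F) SX)).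
have iZ : intg mu (fun x => chi x ^+ 2 * (2 * F x) * Zm x).
  exact: (Sc_intg ds (ScM ds (ScM ds c2 S2F) SZm)).
rewrite IntD //; last exact/intgZ/intgZ.
rewrite IntZ; last exact: intgZ.
rewrite IntZ //; apply: lerD.
  rewrite ler_wpM2l ?(ltW r0) // ler_wpM2l ?invr_ge0 ?(ltW nu0) //.
  have iF2 := w _ (gc_sqr gc SF); have iG2 := w _ (gc_sqr gc SG).
  rewrite -mulNr -(IntZ _ iF2) -(IntZ _ iG2) -(IntD (intgZ _ iF2) (intgZ _ iG2)).
  apply: le_Int => //; first exact: (intgD (intgZ _ iF2) (intgZ _ iG2)).
  by move=> x; apply: young; exact: sqr_ge0.
apply: (HC s t 1 nu) => //; [exact: ltW|exact: le_trans A1|] => x.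
rewrite mulr_ge0 //=; have [k1 k2] := HK t x t0 tT; rewrite /F.
have := ler_wpM2l (ltW nu0) k2; have := ler_wpM2r K0 nu1.
by move: (Gam _ _ x) (GZ _ _ x) k1 => g z k1; lra.
Qed.

(** For fixed k, let A_j be the cut energy of (Gamma + 4^-j Gamma^Z)^2 with the cut-off of scale
    2^(j+1). The cut-off error of A_j lives where the next cut-off is 1, so it is bounded by
    A_(j+1), and the damping of rate 4^j 2 rho2 outweighs it. This gives A_j <= D + (sup A_(j+1)) /
    2. Iterated n times from a crude bound V, common to all j, it leaves 2 D + V / 2^n; the limit 2
    D does not depend on k. *)
Lemma form_L2 f T : Sc f -> 0 <= T -> exists2 B, 0 <= B & forall t, 0 <= t -> t <= T ->
  intg mu (fun x => (1 * Gam (P t f) (P t f) x + 1 * GZ (P t f) (P t f) x) ^+ 2) /\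
  \int[mu]_x ((1 * Gam (P t f) (P t f) x + 1 * GZ (P t f) (P t f) x) ^+ 2) <= B.
Proof.
move=> cf T0.
have cmp (g z n : R) : 0 <= g -> 0 <= z -> 0 <= n ->
    (1 * g + n * z) ^+ 2 <= 16 * (1 * g + n / 4 * z) ^+ 2.
  move=> g0 z0 n0; have := mulr_ge0 n0 z0.
  have -> : n / 4 * z = 4^-1 * (n * z) by rewrite mulrAC mulrC.
  by move: (n * z) => y y0; nra.
have cmp4 (F2 F2' G C2 p e : R) : 0 <= F2 -> F2 <= 16 * F2' -> G <= p * e -> 1 <= C2 ->
    0 <= G -> 2 * (F2 * G) <= 32 * (p * e) * (C2 * F2').
  move=> F0 FF GG C1 G0; have F'0 : 0 <= F2' by lra.
  have h1 : F2 * G <= 16 * F2' * (p * e) by apply: ler_pM.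
  have pe0 : 0 <= p * e := le_trans G0 GG.
  have h2 : F2' * (p * e) <= C2 * F2' * (p * e).
    by rewrite ler_wpM2r // ler_peMl.
  lra.
have absorb (r n x y A m c q : R) : 0 <= r -> 0 < n -> x <= n^-1 * (128 * (rho2 / 128) * m) -> y <= q ->
    0 <= c ->
    r * (x + n^-1 * (- (2 * rho2 * A) + c * y)) <=
    r * (- (n^-1 * (2 * rho2)) * (A - (c * q / (2 * rho2) + m / 2))).
  move=> r0 n0 xm yq c0; apply: ler_wpM2l => //.
  have -> : - (n^-1 * (2 * rho2)) * (A - (c * q / (2 * rho2) + m / 2)) =
      n^-1 * (128 * (rho2 / 128) * m) + n^-1 * (- (2 * rho2 * A) + c * q).
    by field; rewrite !gt_eqF.
  apply: lerD => //; rewrite ler_wpM2l ?invr_ge0 ?(ltW n0) // lerD2l.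
  exact: ler_wpM2l.
have c1 := ScL ds cf.
have [K K0 HK] := H3 cf T0.
pose cG := K * (ip f f + ip (L f) (L f)).
have cG0 : 0 <= cG by rewrite mulr_ge0 // addr_ge0 // ip_ge0.
have Su t : 0 <= t -> S (P t f) by move=> t0; exact: (hp_S hp t0 cf).
have sq u : \int[mu]_x (u x ^+ 2) = ip u u by apply: eq_Int => x; rewrite expr2.
have IG t : 0 <= t -> intg mu (Gam (P t f) (P t f)) /\
    \int[mu]_x Gam (P t f) (P t f) x <= ip f f + ip (L f) (L f).
  move=> t0; have P2 := hp_L2 hp t0 cf; have P2' := hp_L2 hp t0 c1.
  apply: (Gamma_le_sqr ds (Su t t0) P2); rewrite ?(P_L ds hp t0 cf) ?sq //.
    exact: (P_contract ds hp t0 cf).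
  exact: (P_contract ds hp t0 c1).
have IG2 chi t : 0 <= t -> t <= T -> Sc chi -> (forall x, chi x ^+ 2 <= 1) ->
    \int[mu]_x (chi x ^+ 2 * Gam (P t f) (P t f) x ^+ 2) <= cG.
  move=> t0 tT cc cc1; have [Ig Gle] := IG t t0; have SG := pf_S Gf (Su t t0) (Su t t0).
  apply: (@le_trans _ _ (\int[mu]_x (K * Gam (P t f) (P t f) x))).
    apply: le_Int; [exact: (Sc_intg ds (ScM ds (Sc_sqr ds cc) (gc_sqr gc SG)))|exact: intgZ|] => x.
    have g0 := gc_Gamma_ge0 gc x (Su t t0); have [gK _] := HK t x t0 tT.
    apply: (@le_trans _ _ (1 * Gam (P t f) (P t f) x ^+ 2)); first by rewrite ler_wpM2r ?sqr_ge0.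
    by rewrite mul1r expr2 ler_wpM2r.
  by rewrite IntZ // ler_wpM2l.
have mf nu : 0 <= nu -> psd_form S (fun f g x => 1 * Gam f g x + nu * GZ f g x) by move=> n0; exact: psd_mixed.
have SF nu t : 0 <= nu -> 0 <= t -> S (form 1 nu (P t f) (P t f)).
  by move=> n0 t0; exact: (pf_S (mf nu n0) (Su t t0) (Su t t0)).
have F0 nu t x : 0 <= nu -> 0 <= t -> 0 <= form 1 nu (P t f) (P t f) x.
  by move=> n0 t0; exact: (pf_ge0 (mf nu n0) x (Su t t0)).
pose A00 := \int[mu]_x (form 1 1 f f x ^+ 2).
have cF0 : Sc (fun x => form 1 1 f f x ^+ 2).
  apply: (Sc_sqr ds); apply: (ScD ds); apply: (ScZ ds).
    exact: (Sc_form ds (Gamma_derivation ds) cf cf.1).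
  exact: (Sc_form ds gz cf cf.1).
have A000 : 0 <= A00 by apply: Int_ge0 => x; exact: sqr_ge0.
pose cc1 := 2 * (kappa + rho2) ^+ 2 / rho2.
have cc10 : 0 <= cc1 by rewrite /cc1 divr_ge0 ?(ltW rho2_gt0) // mulr_ge0 // sqr_ge0.
pose D := A00 + cc1 * cG / (2 * rho2).
have D0 : 0 <= D.
  rewrite /D addr_ge0 // divr_ge0 //; first exact: mulr_ge0.
  by rewrite mulr_ge0 // ltW.
exists (2 * D); first exact: mulr_ge0.
(* 128 = 2 times 16 times 4: the 2 of the energy estimate, the 16 of [cmp], and the 4 in (2^(j+1))^2
   = 4 * 4^j. The cut-off error becomes (rho2 / nu_j) A_(j+1), against a damping rate 2 rho2 / nu_j,
   hence the factor 1/2. *)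
have e0 : 0 < rho2 / 128 by rewrite divr_gt0.
have key : \forall k \near \oo, forall t, 0 <= t -> t <= T ->
    \int[mu]_x (cut 2 k x ^+ 2 * form 1 1 (P t f) (P t f) x ^+ 2) <= 2 * D.
  move: (Gamma_cut_le ds e0); apply: filterS => k Hk.
  (* All the cut-offs [ch j] vanish where [h k] does, so [cut 2 m] dominates them and V bounds every
     A_j at once. *)
  have [m _ Hm] := Sc_plateau ds (ds_h ds k); have hm := Hm m (leqnn _).
  pose V := \int[mu]_x ((2 * K) ^+ 2 * cut 2 m x).
  have V0 : 0 <= V by apply: Int_ge0 => x; rewrite mulr_ge0 ?sqr_ge0 ?cut_ge0.
  pose nu (j : nat) : R := 4^-1 ^+ j.
  have nu0 j : 0 < nu j by rewrite exprn_gt0.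
  have nu1 j : nu j <= 1 by rewrite exprn_ile1 //; lra.
  pose ch (j : nat) := cut (2 ^+ j.+1) k.
  have cch j : Sc (ch j) := Sc_cut ds _ k.
  have ch1 j x : ch j x ^+ 2 <= 1 by have /andP[] := cut_sqr01 (h := h) (2 ^+ j.+1) k x.
  pose A j t := \int[mu]_x (ch j x ^+ 2 * form 1 (nu j) (P t f) (P t f) x ^+ 2).
  have iA j u : S u -> intg mu (fun x => ch j x ^+ 2 * u x).
    by move=> Sv; exact: (Sc_intg ds (ScM ds (Sc_sqr ds (cch j)) Sv)).
  have AV j t : 0 <= t -> t <= T -> A j t <= V.
    move=> t0 tT; apply: le_Int.
    - exact: (iA _ _ (gc_sqr gc (SF _ _ (ltW (nu0 j)) t0))).
    - exact: (intgZ _ (Sc_intg ds (Sc_cut ds 2 m))).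
    move=> x; have f0 := F0 (nu j) t x (ltW (nu0 j)) t0.
    have fK : form 1 (nu j) (P t f) (P t f) x ^+ 2 <= (2 * K) ^+ 2.
      rewrite lerXn2r ?nnegrE ?mulr_ge0 //; have [k1 k2] := HK t x t0 tT.
      have := ler_wpM2l (ltW (nu0 j)) k2; have := ler_wpM2r K0 (nu1 j).
      by move: (Gam _ _ x) (GZ _ _ x) k1 => g z k1; lra.
    rewrite mulrC; apply: ler_pM; rewrite ?sqr_ge0 //.
    have [hx|hx] := eqVneq (h k x) 0.
      by rewrite /ch cut_h0 // expr0n cut_ge0.
    by have [-> _] := cut2_plateau (hm x hx); exact: ch1.
  have A0le j : A j 0 <= A00.
    rewrite /A (P_zero ds hp cf); apply: le_Int.
    - exact: (iA _ _ (gc_sqr gc (pf_S (mf _ (ltW (nu0 j))) cf.1 cf.1))).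
    - exact: (Sc_intg ds cF0).
    move=> x; have g0 := gc_Gamma_ge0 gc x cf.1; have z0 := pf_ge0 Zf x cf.1.
    apply: (@le_trans _ _ (1 * form 1 (nu j) f f x ^+ 2)).
      by rewrite ler_wpM2r ?sqr_ge0.
    have le1 : form 1 (nu j) f f x <= form 1 1 f f x.
      by apply: lerD => //; exact: (ler_wpM2r z0 (nu1 j)).
    rewrite mul1r; apply: lerXn2r => //; rewrite nnegrE.
      exact: (pf_ge0 (mf _ (ltW (nu0 j))) x cf.1).
    exact: (pf_ge0 (mf _ ler01) x cf.1).
  have A_ge0 j t : 0 <= A j t by apply: Int_ge0 => x; rewrite mulr_ge0 ?sqr_ge0.
  (* The induction is on the number of iterations, with j universally quantified, since each use
     passes from j to j + 1. *)
  have main (n : nat) : forall j t, 0 <= t -> t <= T -> A j t <= 2 * D + V / 2 ^+ n.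
    elim: n => [|n IH] j t t0 tT.
      by rewrite expr0 divr1; apply: (le_trans (AV j t t0 tT)); rewrite lerDr mulr_ge0.
    pose mm := 2 * D + V / 2 ^+ n.
    have mm0 : 0 <= mm by rewrite /mm addr_ge0 ?mulr_ge0 // divr_ge0.
    have [Kj Kj0 HKj] := form_increment cf T0 (nu0 j) (nu1 j) (cch j).
    have b0 : 0 <= cc1 * cG / (2 * rho2) + mm / 2.
      apply: addr_ge0; last by rewrite divr_ge0.
      apply: divr_ge0; first exact: mulr_ge0.
      by apply: mulr_ge0 => //; exact: ltW.
    have l0 : 0 <= (nu j)^-1 * (2 * rho2).
      by rewrite mulr_ge0 ?invr_ge0 ?(ltW (nu0 j)) // mulr_ge0 // ltW.
    have := damped_increments (A := A j) t0 l0 Kj0 (A_ge0 j 0) b0.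
    have -> : 2 * D + V / 2 ^+ n.+1 = A00 + (cc1 * cG / (2 * rho2) + mm / 2).
      have n2 : (2 : R) ^+ n != 0 by rewrite expf_neq0.
      rewrite /mm exprS invfM addrA -/D [V * _]mulrCA; move: (V / 2 ^+ n) => y; lra.
    move=> H; apply: (le_trans (H _)); last by rewrite lerD2r.
    move=> s r s0 sr rt; have rT := le_trans rt tT.
    have r0 := ltW (le_lt_trans s0 sr).
    apply: (le_trans (HKj s r s0 sr rT)); rewrite lerD2r.
    apply: absorb => //; [by rewrite subr_ge0 ltW| |exact: IG2].
    rewrite (_ : (nu j)^-1 * (128 * (rho2 / 128) * mm) = 32 * (2 ^+ j.+1 ^+ 2 * (rho2 / 128)) * mm); last first.
      have p2 : (2 : R) ^+ j.+1 ^+ 2 = 4 * 4 ^+ j.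
        by rewrite -exprM mulnC exprM exprS; rewrite (_ : (2 : R) ^+ 2 = 4) //; ring.
      by rewrite p2 /nu exprVn invrK; move: (4 ^+ j) => p; field.
    have p0 : 0 <= 32 * (2 ^+ j.+1 ^+ 2 * (rho2 / 128)).
      by rewrite mulr_ge0 // mulr_ge0 ?sqr_ge0 // ltW.
    apply: le_trans (ler_wpM2l p0 (IH j.+1 r r0 rT)).
    rewrite /A -IntZ; last exact: (iA _ _ (gc_sqr gc (SF _ _ (ltW (nu0 _)) r0))).
    have cGc : Sc (Gam (ch j) (ch j)) := Sc_form ds (Gamma_derivation ds) (cch j) (cch j).1.
    apply: le_Int.
    - exact: (intgZ 2 (Sc_intg ds (ScMr ds (gc_sqr gc (SF _ _ (ltW (nu0 j)) r0)) cGc))).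
    - exact: (intgZ _ (iA _ _ (gc_sqr gc (SF _ _ (ltW (nu0 _)) r0)))).
    move=> x; have q0 : (0 : R) <= 2 ^+ j.+1 by exact: exprn_ge0.
    have g0 := gc_Gamma_ge0 gc x (Su r r0); have z0 := pf_ge0 Zf x (Su r r0).
    have [hx|hx] := leP (2 ^+ j.+1 * h k x) 2^-1.
      rewrite (Gamma_cut0 ds (cch j).1) ?hx // !mulr0.
      by rewrite mulr_ge0 // mulr_ge0 // sqr_ge0.
    apply: cmp4; rewrite ?sqr_ge0 //.
    - have := cmp _ _ _ g0 z0 (ltW (nu0 j)).
      by rewrite /nu [4^-1 ^+ j.+1]exprSr.
    - exact: Hk.
    - rewrite /ch /cut step_eq1 ?expr1n // exprS -mulrA.
      by move: (_ * h k x) hx => y; lra.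
    - exact: (gc_Gamma_ge0 gc x (cch j).1).
  move=> t t0 tT; apply/ler_addgt0Pr => e e_gt0.
  have [n Hn] := exp2_gt V e_gt0.
  apply: le_trans (le_trans (main n 0%N t t0 tT) _); last by rewrite lerD2l.
  by rewrite /A /ch /nu expr0 expr1.
move=> t t0 tT.
apply: (fatou_Int (f_ := fun k x => cut 2 k x ^+ 2 * form 1 1 (P t f) (P t f) x ^+ 2)).
- by move=> k; exact: (Sc_intg ds (ScM ds (Sc_sqr ds (Sc_cut ds 2 k)) (gc_sqr gc (SF _ _ ler01 t0)))).
- by move=> k x; rewrite mulr_ge0 ?sqr_ge0.
- exact: (S_meas ds (gc_sqr gc (SF _ _ ler01 t0))).
- by move=> x; exact: (@cut2_cvg R M S L mu h ds (fun x => form 1 1 (P t f) (P t f) x ^+ 2) x).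
by move: key; apply: filterS => k; apply.
Qed.

(** The analogue of the remainder estimate for the term e u^2 of the subsolution, where the square
    norms of [P t f] and [rem2] suffice. *)
Lemma product_remainder_bound f T theta A : Sc f -> 0 <= T -> Sc theta -> (forall x, 0 <= theta x) ->
  0 <= A -> exists2 C, 0 <= C & forall s t p, 0 <= s -> s < t -> t <= T ->
    S p -> (forall x, 0 <= p x <= A) ->
    \int[mu]_x (theta x * p x * - (2 * (P t f x * rem2 t s f x))) <= C * (t - s) ^+ 2.
Proof.
move=> cf T0 ct t0 A0.
have [B B0 HB'] := Sc_bounded ct.
have HB x : theta x <= B := le_trans (ler_norm _) (HB' x).
have lin (th p u z r V : R) : 0 <= th -> th <= B -> 0 <= p -> p <= A -> 0 <= r -> r * V = 1 -> 0 <= V ->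
    th * p * - (2 * (u * z)) <= B * A * (r * u ^+ 2 + V * z ^+ 2).
  move=> th0 thB p0 pA r0 rV V0.
  have h1 : - (2 * (u * z)) <= r * u ^+ 2 + V * z ^+ 2.
    have : 0 <= r * (u + V * z) ^+ 2 by rewrite mulr_ge0 ?sqr_ge0.
    have -> : r * (u + V * z) ^+ 2 = r * u ^+ 2 + 2 * (r * V) * (u * z) + (r * V) * (V * z ^+ 2) by ring.
    by rewrite rV; lra.
  have h2 : 0 <= r * u ^+ 2 + V * z ^+ 2 by rewrite addr_ge0 // mulr_ge0 // sqr_ge0.
  apply: (@le_trans _ _ (th * p * (r * u ^+ 2 + V * z ^+ 2))).
    by rewrite ler_wpM2l // mulr_ge0.
  by rewrite ler_wpM2r //; apply: ler_pM.
pose N := ip f f; pose N2 := ip (L (L f)) (L (L f)).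
have N0 : 0 <= N by exact: ip_ge0.
have N20 : 0 <= N2 by exact: ip_ge0.
exists (B * A * (N + N2)); first by rewrite !mulr_ge0 // addr_ge0.
move=> s t p s0 st tT Sp p01; have r0 : 0 < t - s by rewrite subr_gt0.
have st' := ltW st; have tt0 := le_trans s0 st'.
have Su := hp_S hp tt0 cf; have Sz := S_rem2 ds hp s0 st' cf.
have [[iz zb] _] := rem_L2 ds hp s0 st' cf.
have iu := ((L2_intg mu _).1 (hp_L2 hp tt0 cf)).2.
have ub : \int[mu]_x (P t f x ^+ 2) <= N.
  rewrite (eq_Int mu (g := fun x => P t f x * P t f x)); last by move=> y; rewrite expr2.
  exact: (P_contract ds hp tt0 cf).
have r20 : 0 <= (t - s) ^+ 2 by exact: sqr_ge0.
have r20V : 0 <= (t - s) ^- 2 by rewrite invr_ge0.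
have rV : (t - s) ^+ 2 * (t - s) ^- 2 = 1 by rewrite mulfV // gt_eqF // exprn_gt0.
pose g x := B * A * ((t - s) ^+ 2 * P t f x ^+ 2 + (t - s) ^- 2 * rem2 t s f x ^+ 2).
have ig : intg mu g := intgZ _ (intgD (intgZ _ iu) (intgZ _ iz)).
apply: (@le_trans _ _ (\int[mu]_x g x)).
  apply: le_Int => //.
    exact: (Sc_intg ds (ScM ds (ScM ds ct Sp) (gcN gc (SZ 2 (gcM gc Su Sz))))).
  by move=> x; have /andP[p0 pA] := p01 x; exact: lin.
rewrite IntZ; last exact: (intgD (intgZ _ iu) (intgZ _ iz)).
rewrite -[leRHS]mulrA; apply: ler_wpM2l; first exact: mulr_ge0.
rewrite (IntD (intgZ _ iu) (intgZ _ iz)) (IntZ _ iu) (IntZ _ iz) mulrDl; apply: lerD.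
  by rewrite mulrC ler_wpM2r.
apply: (le_trans (ler_wpM2l r20V zb)); rewrite -/N2 le_eqVlt; apply/orP; left; apply/eqP.
by field; rewrite gt_eqF.
Qed.

(** The weights vanish at time 0, so Q <= 0 there reduces to the sup bound on f. At time T, dropping
    the nonnegative terms leaves (E - 1) Gamma <= (rho1 - c / 2) c0^2, with E = exp(c T). *)
Lemma gradient_bound f c0 c T : Sc f -> 0 <= c0 -> (forall x, `|f x| <= c0) ->
  c = rho1 * rho2 / (rho2 + kappa) -> 0 < T ->
  forall x, (expR (c * T) - 1) * Gam (P T f) (P T f) x <= rho1 * c0 ^+ 2.
Proof.
move=> cf c00 fc cE T0.
have rk0 : 0 < rho2 + kappa by rewrite ltr_pwDl.
have c_gt0 : 0 < c by rewrite cE divr_gt0 // mulr_gt0.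
have c_le : c <= rho1.
  by rewrite cE ler_pdivrMr // ler_pM2l // lerDl.
pose K' := (2 * rho1 * c - c ^+ 2) / rho2.
have K'0 : 0 <= K'.
  rewrite /K' divr_ge0 ?(ltW rho2_gt0) //.
  have -> : 2 * rho1 * c - c ^+ 2 = c * (2 * rho1 - c) by ring.
  by rewrite mulr_ge0 ?(ltW c_gt0) //; lra.
pose E s := expR (c * s).
have E1 s : 0 <= s -> 1 <= E s.
  by move=> s0; rewrite -expR0 ler_expR mulr_ge0 // ltW.
have E1' s : 0 < s -> 1 < E s.
  by move=> s0; rewrite -expR0 ltr_expR mulr_gt0.
have EE s t : s <= t -> E s <= E t by move=> st; rewrite ler_expR ler_pM2l.
have dE s t : E t - E s <= c * (t - s) * E t.
  have -> : E s = E t * expR (- (c * (t - s))) by rewrite -expRD; congr expR; ring.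
  have := ler_wpM2l (expR_ge0 (c * t)) (expR_ge1Dx (- (c * (t - s)))); rewrite -/(E t).
  by rewrite mulrDr mulr1 mulrN => H; rewrite lerBlDr addrC -lerBlDr (mulrC _ (E t)).
pose a s := c / rho2 * (E s ^+ 2 - E s); pose b s := (E s - 1) ^+ 2.
pose e := K' / 2 * E T.
have e0 : 0 <= e by rewrite mulr_ge0 ?expR_ge0 // divr_ge0.
have [K K0 HK] := H3 cf (ltW T0); have c1 := ScL ds cf.
have [K1 K10 HK1] := H3 c1 (ltW T0).
have [B B0 HB] := form_L2 cf (ltW T0).
pose A := a T + b T + 1.
have W s t : 0 <= s -> s < t -> t <= T -> [/\ a t - a s <=
        (t - s) * (c ^+ 2 / rho2 * (E t * (2 * E t - 1))),
      b t - b s <= (t - s) * (2 * c * (E t * (E t - 1))),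
      0 <= a s <= a t & 0 <= b s <= b t].
  move=> s0 st tT.
  exact: (weight_increments c_gt0 rho2_gt0 (E1 s s0) (EE s t (ltW st)) (dE s t)).
have ab s : 0 <= s -> s <= T -> [/\ 0 <= a s, a s <= A, 0 <= b s & b s <= A].
  move=> s0 sT; have [sT'|sT'] := ltP s T.
    have [_ _ /andP[h1 h2] /andP[h3 h4]] := W s T s0 sT' (lexx T).
    by split=> //; rewrite /A; lra.
  have -> : s = T by apply/eqP; rewrite eq_le sT.
  have [_ _ /andP[h1 h2] /andP[h3 h4]] := W 0 T (lexx 0) T0 (lexx T).
  by split; rewrite /A; lra.
have A0 : 0 <= A by have [h1 h2 _ _] := ab T (ltW T0) (lexx T); exact: le_trans h2.
have at0 t : 0 < t -> 0 < a t /\ 0 < b t.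
  move=> t0; have h1 := E1' t t0; split; last by rewrite exprn_gt0 // subr_gt0.
  by rewrite mulr_gt0 ?divr_gt0 // expr2 -{3}[E t]mul1r -mulrBl mulr_gt0 ?subr_gt0 // (lt_trans ltr01).
(* derivatives of [a] and [b] on [0, T] *)
pose d := c ^+ 2 / rho2 * (E T * (2 * E T - 1)) + 2 * c * (E T * (E T - 1)).
have d_ge t : 0 <= t -> t <= T -> [/\ 0 <= c ^+ 2 / rho2 * (E t * (2 * E t - 1)),
    c ^+ 2 / rho2 * (E t * (2 * E t - 1)) <= d, 0 <= 2 * c * (E t * (E t - 1)) &
    2 * c * (E t * (E t - 1)) <= d].
  move=> t0 tT; have h1 := E1 t t0; have h2 := EE t T tT; have hT := E1 T (ltW T0).
  have q0 : 0 <= c ^+ 2 / rho2 by rewrite divr_ge0 ?sqr_ge0 // ltW.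
  have p0 : 0 <= 2 * c by rewrite mulr_ge0 // ltW.
  have u0 (y : R) : 1 <= y -> 0 <= y * (2 * y - 1) /\ 0 <= y * (y - 1).
    by move=> y1; split; apply: mulr_ge0; lra.
  have [u1 u2] := u0 _ h1; have [v1 v2] := u0 _ hT.
  have w1 : c ^+ 2 / rho2 * (E t * (2 * E t - 1)) <= c ^+ 2 / rho2 * (E T * (2 * E T - 1)).
    by apply: ler_wpM2l => //; apply: ler_pM => //; lra.
  have w2 : 2 * c * (E t * (E t - 1)) <= 2 * c * (E T * (E T - 1)).
    by apply: ler_wpM2l => //; apply: ler_pM => //; lra.
  have := mulr_ge0 q0 u1; have := mulr_ge0 p0 u2; have := mulr_ge0 q0 v1; have := mulr_ge0 p0 v2.
  by split=> //; rewrite /d; lra.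
have d0 : 0 <= d by have [h1 h2 _ _] := d_ge T (ltW T0) (lexx T); exact: le_trans h2.
pose Q s x := form (a s) (b s) (P s f) (P s f) x + e * P s f x ^+ 2 - e * c0 ^+ 2.
have Su s : 0 <= s -> S (P s f) by move=> s0; exact: (hp_S hp s0 cf).
have uc s x : 0 <= s -> P s f x ^+ 2 <= c0 ^+ 2.
  move=> s0; rewrite -(real_normK (num_real (P s f x))) lerXn2r ?nnegrE //.
  exact: (norm_P_le ds hp cf c00 fc s0).
have SFab s : 0 <= s -> s <= T -> S (form (a s) (b s) (P s f) (P s f)).
  by move=> s0 sT; have [h1 _ h2 _] := ab s s0 sT; exact: (pf_S (psd_mixed h1 h2) (Su s s0) (Su s s0)).
have SQ s : 0 <= s -> s <= T -> S (Q s).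
  move=> s0 sT; exact: (SD (SD (SFab s s0 sT) (SZ e (gc_sqr gc (Su s s0)))) (gc_cst gc (- (e * c0 ^+ 2)))).
have final : forall x, Q T x <= 0 -> (E T - 1) * Gam (P T f) (P T f) x <= rho1 * c0 ^+ 2.
  move=> x; rewrite /Q /e /a; have z0 := pf_ge0 Zf x (Su T (ltW T0)).
  have [_ _ b0 _] := ab T (ltW T0) (lexx T).
  have bz := mulr_ge0 b0 z0; have eu := mulr_ge0 e0 (sqr_ge0 (P T f x)).
  have e1 : 0 < E T := expR_gt0 _; have x0 := sqr_ge0 c0.
  move: bz eu; rewrite /e; move: (Gam _ _ x) (b T * _) (_ * P T f x ^+ 2) => g B1 U B10 U0 HQ.
  have h1 : c / rho2 * (E T ^+ 2 - E T) * g <= K' / 2 * E T * c0 ^+ 2 by lra.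
  have h2 : (c / rho2 * E T) * ((E T - 1) * g) <= (c / rho2 * E T) * ((rho1 - c / 2) * c0 ^+ 2).
    apply: le_trans (le_trans h1 _); rewrite le_eqVlt; apply/orP; left; apply/eqP; first ring.
    by rewrite /K'; field; rewrite gt_eqF.
  rewrite ler_pM2l in h2; last by rewrite mulr_gt0 // divr_gt0.
  apply: (le_trans h2); have := mulr_ge0 (ltW c_gt0) x0; lra.
move=> x; apply: final; apply: (energy_max ds (Q := Q) (ltW T0) SQ) => {x} [x|].
  rewrite /Q /a /b /E mulr0 expR0 expr1n subrr mulr0 expr0n /= !mul0r !add0r.
  by rewrite subr_le0 ler_wpM2l // uc.
move=> ee ee0.
pose AB := A ^+ 2 * B.
have AB0 : 0 <= AB by rewrite mulr_ge0 ?sqr_ge0.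
have AB1 : 0 < 8 * (AB + 1) by rewrite mulr_gt0 // ltr_pwDr.
move: (Gamma_cut_le ds (divr_gt0 ee0 AB1)); apply: filterS => k Hk.
set chi := cut 2 k; have cc : Sc chi := Sc_cut ds 2 k; have cc2 := Sc_sqr ds cc.
(* A bound for phi' along Q: phi'(Q) <= 3 max(Q, 0), which is at most 3 (a Gamma + b Gamma^Z) <= 3 *
   2 A K. *)
pose Ap := 6 * A * K; have Ap0 : 0 <= Ap by rewrite !mulr_ge0.
pose A2 := A + Ap; have A20 : 0 <= A2 by exact: addr_ge0.
have [R1 R10 HR1] := remainder_bound cf (ltW T0) cc2 (fun x => sqr_ge0 (chi x)) A20.
have [R2 R20 HR2] := product_remainder_bound cf (ltW T0) cc2 (fun x => sqr_ge0 (chi x)) Ap0.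
pose c3 := 2 * d * (K + K1).
have c30 : 0 <= c3 by rewrite !mulr_ge0 // addr_ge0.
pose It := \int[mu]_x (chi x ^+ 2).
exists (c3 * Ap * It + R1 + e * R2) => s t s0 st tT; have t0 := le_trans s0 st.
have [->|ts] := eqVneq s t; first by rewrite !subrr mul0r expr0n mulr0 addr0.
have lt : s < t by rewrite lt_neqAle ts.
have sT := le_trans st tT.
have r0 : 0 < t - s by rewrite subr_gt0.
have tp : 0 < t := le_lt_trans s0 lt.
have [W1 W2 /andP[as0 ast] /andP[bs0 bst]] := W s t s0 lt tT.
have [at_gt0 bt_gt0] := at0 t tp.
have [_ d1' _ d2'] := d_ge t t0 tT.
have [_ atA _ btA] := ab t t0 tT.
have Sut := Su t t0; have Sz := S_rem2 ds hp s0 st cf; have SLu := gc_L gc Sut.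
pose F := form (a t) (b t) (P t f) (P t f).
have SF : S F := SFab t t0 tT.
have mt := psd_mixed (ltW at_gt0) (ltW bt_gt0); have ms := psd_mixed as0 bs0.
have F0 y : 0 <= F y := pf_ge0 mt y Sut.
pose Z1 y := - (2 * form (a s) (b s) (P t f) (rem2 t s f) y).
pose Z2 y := - (2 * (P t f y * rem2 t s f y)).
have SZ1 : S Z1 := gcN gc (SZ 2 (pf_S ms Sut Sz)).
have SZ2 : S Z2 := gcN gc (SZ 2 (gcM gc Sut Sz)).
pose Wt y := (t - s) ^+ 2 * c3 + (Z1 y + e * Z2 y).
have SWt : S Wt := SD (gc_cst gc _) (SD SZ1 (SZ e SZ2)).
have step y : Q t y - Q s y <= (t - s) * L (Q t) y + Wt y.
  have -> : L (Q t) y = L F y + e * (2 * (P t f y * L (P t f) y) + 2 * Gam (P t f) (P t f) y).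
    rewrite (gc_LD gc y (SD SF (SZ e (gc_sqr gc Sut))) (gc_cst gc (- (e * c0 ^+ 2)))).
    rewrite (L_cst gc) addr0 (gc_LD gc y SF (SZ e (gc_sqr gc Sut))) (gc_LZ gc e y (gc_sqr gc Sut)).
    by rewrite (LM (P t f) (P t f)); congr (_ + e * _); lra.
  have -> : Q t y - Q s y = (a t - a s) * Gam (P t f) (P t f) y + (b t - b s) * GZ (P t f) (P t f) y +
      (form (a s) (b s) (P t f) (P t f) y - form (a s) (b s) (P s f) (P s f) y) +
      e * (P t f y ^+ 2 - P s f y ^+ 2) by rewrite /Q; ring.
  have SLP : L (P t f) = P t (L f) := P_L ds hp t0 cf.
  have nb (q : (M -> R) -> (M -> R) -> M -> R) : psd_form S q -> q (P t f) (P t f) y <= K ->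
      q (P t (L f)) (P t (L f)) y <= K1 -> `|2 * q (P t f) (L (P t f)) y| <= K + K1.
    move=> qf qK qK1; apply: (le_trans (pf_young qf SD SZ y Sut SLu)).
    by rewrite SLP lerD.
  have [kG kZ] := HK t y t0 tT; have [kG1 kZ1] := HK1 t y t0 tT.
  have KE : K' * E t <= 2 * e.
    rewrite /e -[leRHS]/(2 * (K' / 2 * E T)) mulrA [2 * _]mulrC divfK //.
    by rewrite ler_wpM2l // EE.
  apply: (gradient_step (ltW r0) (gc_Gamma_ge0 gc y Sut) (pf_ge0 Zf y Sut) W1 W2 _ _ d1' d2'
    (addr_ge0 K0 K10) (form_step y cf as0 bs0 s0 st) (nb _ Gf kG kG1) (nb _ Zf kZ kZ1)
    (form_CD y at_gt0 bt_gt0 Sut) _ (weight_equation rho2_gt0 kappa_ge0 cE (E1' t tp)) KE _ e0).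
  - by rewrite subr_ge0.
  - by rewrite subr_ge0.
  - by rewrite SLP /rem2; move: (P s f y) (P t f y) (P t (L f) y) => *; ring.
  - by rewrite /a; field; rewrite gt_eqF.
have eu y : e * P t f y ^+ 2 <= e * c0 ^+ 2 by rewrite ler_wpM2l // uc.
(* Since u^2 <= c0^2, the positive part of Q is at most the form F alone. So B = F^2 is admissible
   in the energy estimate, and its integral is finite, uniformly in time, by [form_L2]. *)
have mQ y : 0 <= Num.max (Q t y) 0 /\ Num.max (Q t y) 0 <= F y.
  have QF : Q t y <= F y by have := eu y; rewrite /Q -/(F y); move: (F y) (e * _) (e * _) => *; lra.
  by rewrite le_max lexx orbT ge_max QF F0.
have B2 y : derive1 softplus2 (Q t y) ^+ 2 <= 2 * F y ^+ 2 * derive1 (derive1 softplus2) (Q t y).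
  have [m0 m1] := mQ y; apply: (le_trans (softplus2_quotient _)).
  apply: ler_wpM2r; first exact: derive2_softplus2_ge0.
  by rewrite ler_pM2l //; apply: lerXn2r; rewrite ?nnegrE ?F0.
have H := energy_step ds smooth_softplus2 (SQ s s0 sT) (SQ t t0 tT) (gc_sqr gc SF) SWt cc
  (softplus2_neg (lexx 0)) (ltW r0) derive2_softplus2_ge0 (fun y => derive1_softplus2_ge0 _)
  B2 (fun y => sqr_ge0 (F y)) step.
apply: (le_trans H); apply: lerD.
  rewrite ler_pM2l //; have [iB leB] := HB t t0 tT.
  have cG : Sc (Gam chi chi) := Sc_form ds (Gamma_derivation ds) cc cc.1.
  apply: (@le_trans _ _ (\int[mu]_y (ee / (AB + 1) * (A ^+ 2 *
      (1 * Gam (P t f) (P t f) y + 1 * GZ (P t f) (P t f) y) ^+ 2)))).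
    apply: le_Int; [exact: (intgZ 2 (Sc_intg ds (ScMr ds (gc_sqr gc SF) cG)))|exact/intgZ/intgZ|] => y.
    have h1 : F y ^+ 2 <= A ^+ 2 * (1 * Gam (P t f) (P t f) y + 1 * GZ (P t f) (P t f) y) ^+ 2.
      have gG := gc_Gamma_ge0 gc y Sut; have gZ := pf_ge0 Zf y Sut.
      rewrite -exprMn; apply: lerXn2r; rewrite ?nnegrE ?F0 //.
        by apply: mulr_ge0 => //; rewrite !mul1r addr_ge0.
      by rewrite !mul1r mulrDr; apply: lerD; exact: ler_wpM2r.
    have h2 : Gam chi chi y <= 2^-1 * (ee / (AB + 1)).
      apply: (le_trans (Hk 2 y (ler0n _ 2))); rewrite le_eqVlt; apply/orP; left; apply/eqP.
      by field; rewrite gt_eqF // ltr_pwDr.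
    rewrite [leRHS](_ : _ = 2 * ((A ^+ 2 * (1 * Gam (P t f) (P t f) y + 1 * GZ (P t f) (P t f) y) ^+ 2) *
       (2^-1 * (ee / (AB + 1))))); last by move: (ee / _) (_ ^+ 2 * _) => *; field.
    by rewrite ler_pM2l //; apply: ler_pM; rewrite ?sqr_ge0 ?(gc_Gamma_ge0 gc y cc.1).
  rewrite IntZ; last exact: intgZ.
  rewrite IntZ //; apply: (@le_trans _ _ (ee / (AB + 1) * AB)).
    by rewrite ler_wpM2l ?divr_ge0 ?(ltW ee0) ?addr_ge0 // ler_wpM2l ?sqr_ge0.
  by rewrite -mulrA ler_piMr ?(ltW ee0) // mulrC ler_pdivrMr ?ltr_pwDr // mul1r lerDl.
pose p y := derive1 softplus2 (Q t y).
have Sp : S p := gc_comp gc (smooth_real_derive1 smooth_softplus2) (SQ t t0 tT).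
have p01 y : 0 <= p y <= Ap.
  rewrite derive1_softplus2_ge0 /=; have [m0 m1] := mQ y.
  apply: (le_trans (derive1_softplus2_le _)).
  have [kG kZ] := HK t y t0 tT.
  have g1 : a t * Gam (P t f) (P t f) y <= A * K.
    by apply: ler_pM => //; [exact: ltW|exact: (gc_Gamma_ge0 gc y Sut)].
  have g2 : b t * GZ (P t f) (P t f) y <= A * K.
    by apply: ler_pM => //; [exact: ltW|exact: (pf_ge0 Zf y Sut)].
  by move: m1; rewrite /F /Ap -mulrA; move: (_ * _) (_ * _) (A * K) g1 g2 => *; lra.
have icp u : S u -> intg mu (fun y => chi y ^+ 2 * p y * u y).
  by move=> Sv; exact: (Sc_intg ds (ScM ds (ScM ds cc2 Sp) Sv)).
have icp0 : intg mu (fun y => chi y ^+ 2 * p y) := Sc_intg ds (ScM ds cc2 Sp).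
rewrite (eq_Int mu (g := fun y => ((t - s) ^+ 2 * c3) * (chi y ^+ 2 * p y) +
   (chi y ^+ 2 * p y * Z1 y + e * (chi y ^+ 2 * p y * Z2 y)))); last first.
  by move=> y; rewrite /Wt -/(p y); move: (chi y) (p y) (Z1 y) (Z2 y) => *; ring.
rewrite (IntD (intgZ _ icp0) (intgD (icp _ SZ1) (intgZ _ (icp _ SZ2)))).
rewrite (IntD (icp _ SZ1) (intgZ _ (icp _ SZ2))) (IntZ _ icp0) (IntZ _ (icp _ SZ2)).
have k1 : \int[mu]_y (chi y ^+ 2 * p y) <= Ap * It.
  rewrite /It -(IntZ _ (Sc_intg ds cc2)); apply: le_Int => //.
    exact: (intgZ _ (Sc_intg ds cc2)).
  by move=> y; have /andP[_ h2] := p01 y; rewrite mulrC ler_wpM2r ?sqr_ge0.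
have k2 : \int[mu]_y (chi y ^+ 2 * p y * Z1 y) <= R1 * (t - s) ^+ 2.
  apply: (HR1 s t (a s) (b s)) => //; rewrite ?/A2.
  - by apply: (le_trans ast); apply: (le_trans atA); rewrite lerDl.
  - by apply: (le_trans bst); apply: (le_trans btA); rewrite lerDl.
  - move=> y; have /andP[-> h2] := p01 y; apply: (le_trans h2); rewrite lerDr //.
have k3 : \int[mu]_y (chi y ^+ 2 * p y * Z2 y) <= R2 * (t - s) ^+ 2 by exact: HR2.
have rc0 : 0 <= (t - s) ^+ 2 * c3 by rewrite mulr_ge0 ?sqr_ge0.
have j1 := ler_wpM2l rc0 k1; have j3 := ler_wpM2l e0 k3.
apply: (le_trans (lerD j1 (lerD k2 j3))); rewrite le_eqVlt; apply/orP; left; apply/eqP; ring.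
Qed.

End vertical.

(* Grows faster than a primitive of [sqrt (rho1 / (exp (c r) - 1))], and stays bounded. *)
Definition decay_primitive {R : realType} (c rho1 r : R) : R :=
  4 / c * Num.sqrt (rho1 * (1 - expR (- (c * r / 2)))).

(** With X = exp(- c t / 2), 1 / (exp(c t) - 1) = X^2 / (1 - X^2) <= X^2 / (1 - X), and X / sqrt(1 -
    X) is the derivative of (4 / c) sqrt(1 - X). The left side is evaluated at the later time, so
    the singularity at 0 is never met. *)
Lemma decay_primitive_increment {R : realType} (c rho1 s t : R) : 0 < c -> 0 <= rho1 -> 0 <= s -> s < t ->
  (t - s) * Num.sqrt (rho1 / (expR (c * t) - 1)) <=
  decay_primitive c rho1 t - decay_primitive c rho1 s.
Proof.
move=> c0 r0 s0 st.
have t0 : 0 < t := le_lt_trans s0 st.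
pose X := expR (- (c * t / 2)).
have X0 : 0 < X := expR_gt0 _.
have X1 : X < 1 by rewrite -expR0 ltr_expR oppr_lt0 divr_gt0 // mulr_gt0.
pose Y := Num.sqrt (1 - X); pose Ys := Num.sqrt (1 - expR (- (c * s / 2))).
have Y0 : 0 < Y by rewrite sqrtr_gt0 subr_gt0.
have Es : X * (1 + c * (t - s) / 2) <= expR (- (c * s / 2)).
  have -> : - (c * s / 2) = - (c * t / 2) + c * (t - s) / 2 by field.
  by rewrite expRD ler_wpM2l ?expR_ge0 // expR_ge1Dx.
have es1 : expR (- (c * s / 2)) <= 1.
  by rewrite -expR0 ler_expR oppr_le0 divr_ge0 // mulr_ge0 // ltW.
have Y2 : Y ^+ 2 = 1 - X by rewrite sqr_sqrtr // subr_ge0 ltW.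
have Ys2 : Ys ^+ 2 = 1 - expR (- (c * s / 2)) by rewrite sqr_sqrtr // subr_ge0.
have Ys0 : 0 <= Ys := sqrtr_ge0 _.
have d0 : 0 <= X * (c * (t - s) / 2).
  by rewrite mulr_ge0 ?(ltW X0) // divr_ge0 // mulr_ge0 ?(ltW c0) // subr_ge0 ltW.
have YY : X * (c * (t - s) / 2) <= Y ^+ 2 - Ys ^+ 2 by rewrite Y2 Ys2; lra.
have YsY : Ys <= Y.
  by rewrite -(ler_pXn2r (ltn0Sn 1)) ?nnegrE ?(ltW Y0) //; lra.
have main : (t - s) * (X / Y) <= 4 / c * (Y - Ys).
  have h1 : X * (c * (t - s) / 2) <= (Y - Ys) * (2 * Y).
    apply: (le_trans YY); have -> : Y ^+ 2 - Ys ^+ 2 = (Y - Ys) * (Y + Ys) by ring.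
    by rewrite ler_wpM2l ?subr_ge0 //; lra.
  rewrite mulrA ler_pdivrMr // -(ler_pM2l c0).
  have -> : c * (4 / c * (Y - Ys) * Y) = 2 * ((Y - Ys) * (2 * Y)) by field; rewrite gt_eqF.
  have -> : c * ((t - s) * X) = 2 * (X * (c * (t - s) / 2)) by field.
  by rewrite ler_pM2l.
have g_le : Num.sqrt (rho1 / (expR (c * t) - 1)) <= Num.sqrt rho1 * (X / Y).
  have XY0 : 0 <= X / Y by rewrite divr_ge0 // ltW.
  rewrite -(ger0_norm XY0) -sqrtr_sqr -sqrtrM //; apply: ler_wsqrtr.
  apply: ler_wpM2l => //.
  have -> : expR (c * t) = X ^- 2.
    have -> : X ^+ 2 = expR (- (c * t)) by rewrite expr2 -expRD; congr expR; field.
    by rewrite expRN invrK.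
  rewrite expr_div_n Y2.
  have e1 : X ^- 2 - 1 = (1 - X ^+ 2) / X ^+ 2 by field; rewrite gt_eqF.
  have p1 : 0 < 1 - X ^+ 2 by rewrite subr_gt0 expr_lt1 // ltW.
  rewrite e1 invf_div; apply: ler_wpM2l; first exact: sqr_ge0.
  rewrite lef_pV2 ?posrE ?subr_gt0 //; last by rewrite expr_lt1 // ltW.
  rewrite lerD2l lerN2 expr2 -[leRHS]mul1r; apply: ler_wpM2r; exact: ltW.
have JE r : decay_primitive c rho1 r =
    4 / c * (Num.sqrt rho1 * Num.sqrt (1 - expR (- (c * r / 2)))).
  by rewrite /decay_primitive sqrtrM.
rewrite !JE.
rewrite -/X -/Y -/Ys.
apply: (@le_trans _ _ ((t - s) * (Num.sqrt rho1 * (X / Y)))).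
  by rewrite ler_wpM2l // subr_ge0 ltW.
have -> : (t - s) * (Num.sqrt rho1 * (X / Y)) = Num.sqrt rho1 * ((t - s) * (X / Y)) by rewrite mulrCA.
have -> : 4 / c * (Num.sqrt rho1 * Y) - 4 / c * (Num.sqrt rho1 * Ys) =
  Num.sqrt rho1 * (4 / c * (Y - Ys)) by ring.
by rewrite ler_wpM2l // sqrtr_ge0.
Qed.

Section horner_powR.
Context {R : realType} {e : R}.
Hypothesis e0 : 0 < e.

Let pos (x : R) : 0 < x ^+ 2 + e. Proof. by rewrite ltr_wpDl ?sqr_ge0. Qed.

(** The products of a polynomial with a real power of x^2 + e are stable under differentiation,
    hence smooth. They supply the regularizations x (x^2 + e)^(-1/2) of the sign and x (x^2 +
    e)^((p-1)/2) of x |x|^(p-1). *)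
Lemma is_derive_horner_powR (q : {poly R}) (a x : R) :
  is_derive x 1 (fun x => q.[x] * (x ^+ 2 + e) `^ a)
    ((q^`() * ('X^2 + e%:P) + (2 * a) *: ('X * q)).[x] * (x ^+ 2 + e) `^ (a - 1)).
Proof.
have d1 : is_derive x 1 (fun x : R => x ^+ 2 + e) (2 * x).
  have := is_derive_poly ('X^2 + e%:P) x.
  rewrite (_ : horner _ = fun x => x ^+ 2 + e); last first.
    by apply/funext => y; rewrite !(hornerD, hornerXn, hornerC).
  move=> H; apply: (is_derive_eq H).
  by rewrite derivD derivC addr0 derivXn /= hornerMn hornerX mulr_natl.
have d2 := @is_derive1_powR R a (x ^+ 2 + e) (pos x).
have H := is_derive_mul1 (is_derive_poly q x) (is_derive_comp1 d1 d2).
apply: (is_derive_eq H).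
rewrite !(hornerD, hornerM, hornerZ, hornerX, hornerXn, hornerC).
have -> : (x ^+ 2 + e) `^ a = (x ^+ 2 + e) * (x ^+ 2 + e) `^ (a - 1).
  by rewrite -{2}(powRr1 (ltW (pos x))) -powRD ?subrKC // (gt_eqF (pos x)) implybT.
by move: (_ `^ (a - 1)) => y; ring.
Qed.

Lemma smooth_horner_powR (q : {poly R}) (a : R) :
  smooth_real (fun x => q.[x] * (x ^+ 2 + e) `^ a).
Proof.
apply: (@smooth_real_coind R [set F | exists q a, F = fun x => q.[x] * (x ^+ 2 + e) `^ a]); last by exists q, a.
move=> _ [{}q [{}a ->]]; split=> [x|]; first by have [] := is_derive_horner_powR q a x.
exists (q^`() * ('X^2 + e%:P) + (2 * a) *: ('X * q)), (a - 1).
by apply/funext => x; rewrite derive1E; have [_ ->] := is_derive_horner_powR q a x.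
Qed.

End horner_powR.

Lemma powR_normr_continuous {R : realType} (b : R) : 0 < b -> continuous (fun x : R => `|x| `^ b).
Proof.
move=> b0 x; have [->|x0] := eqVneq x 0.
  apply/cvgrPdist_le => e e0.
  have r0 : 0 < e `^ b^-1 by exact: powR_gt0.
  have : \forall y \near (0 : R), `|0 - y| < e `^ b^-1.
    by apply: (@nbhsx_ballx R R 0 _ r0).
  apply: filterS => y; rewrite sub0r normrN => yr.
  rewrite normr0 powR0 ?gt_eqF // sub0r normrN ger0_norm ?powR_ge0 //.
  have -> : e = (e `^ b^-1) `^ b by rewrite -powRrM mulVf ?gt_eqF // powRr1 // ltW.
  by apply: ge0_ler_powR; rewrite ?nnegrE ?powR_ge0 ?(ltW b0) // ltW.
have ax : 0 < `|x| by rewrite normr_gt0.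
apply: (@continuous_comp R R R (fun z => `|z|) (fun y => y `^ b)); first exact: norm_continuous.
apply: differentiable_continuous; apply/derivable1_diffP.
by have [] := @is_derive1_powR R b _ ax.
Qed.

(* Young's inequality, by comparing [2 c y] with [x]. *)
Lemma powR_young {R : realType} (p c x y : R) : 1 < p -> 0 <= c -> 0 <= x -> 0 <= y ->
  c * (x `^ (p - 1) * y) <= 2^-1 * x `^ p + c * (2 * c) `^ (p - 1) * y `^ p.
Proof.
move=> p1 c0 x0 y0; have pp : 0 < p by lra.
have pm : 0 <= p - 1 by lra.
have xp := mulr_powRB1 x0 pp; have yp := mulr_powRB1 y0 pp.
have [xy|xy] := leP (2 * c * y) x.
  apply: (@le_trans _ _ (2^-1 * x `^ p)).
    rewrite -xp; have := ler_wpM2r (powR_ge0 x (p - 1)) xy.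
    by move: (x `^ (p - 1)) => z; lra.
  by rewrite lerDl !mulr_ge0 ?powR_ge0.
apply: (@le_trans _ _ (c * (2 * c) `^ (p - 1) * y `^ p)); last first.
  by rewrite lerDr mulr_ge0 ?powR_ge0.
have c20 : 0 <= 2 * c by rewrite mulr_ge0.
rewrite -yp [y * _]mulrC -mulrA ler_wpM2l // mulrA ler_wpM2r //.
rewrite -powRM //; apply: ge0_ler_powR; rewrite ?nnegrE ?mulr_ge0 //.
exact: ltW.
Qed.

Lemma powRD_le {R : realType} (p x y : R) : 0 <= p -> 0 <= x -> 0 <= y ->
  (x + y) `^ p <= 2 `^ p * (x `^ p + y `^ p).
Proof.
move=> p0 x0 y0; wlog xy : x y x0 y0 / x <= y.
  move=> H; have [|/ltW] := leP x y; first exact: H.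
  by move=> yx; rewrite addrC [x `^ p + _]addrC; exact: H.
apply: (@le_trans _ _ ((2 * y) `^ p)).
  by apply: ge0_ler_powR; rewrite ?nnegrE ?mulr_ge0 ?addr_ge0 //; lra.
by rewrite powRM // ler_wpM2l ?powR_ge0 // lerDr powR_ge0.
Qed.

(** * Poincare inequalities *)

Section poincare.
Context {R : realType} {M : ptopologicalType} {S : (M -> R) -> Prop}.
Context {L : (M -> R) -> (M -> R)} {mu : {measure set (borel M) -> \bar R}}.
Context {h : nat -> M -> R} {P : R -> (M -> R) -> (M -> R)} {c rho1 : R}.
Hypothesis ds : diffusion_space S L mu h.
Hypothesis hp : heat_space S L mu P.
Hypothesis c_gt0 : 0 < c.
Hypothesis rho1_gt0 : 0 < rho1.
Hypothesis grad : forall f c0 T, @Sc R M S f -> 0 <= c0 -> (forall x, `|f x| <= c0) -> 0 < T ->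
  forall x, (expR (c * T) - 1) * Gamma L (P T f) (P T f) x <= rho1 * c0 ^+ 2.
Hypothesis conn : forall x y : M, exists2 T, 0 <= T & forall u K, S u -> 0 <= K ->
  (forall z, Gamma L u u z <= K ^+ 2) -> `|u y - u x| <= K * T.
Implicit Types (f g : M -> R).

Local Notation Gam := (Gamma L).
Local Notation ip := (Defs.ip mu).
Local Notation Sc := (@Sc R M S).
Local Notation cut := (@cut R M h).
Let gc := ds_gc ds.
Let C1 := 4 / c * Num.sqrt rho1.

Let C1_ge0 : 0 <= C1. Proof. by rewrite mulr_ge0 ?sqrtr_ge0 // divr_ge0 // ltW. Qed.

Lemma sqrt_Gamma_continuous f : S f -> continuous (fun x => Num.sqrt (Gam f f x)).
Proof.
move=> Sf x; apply: continuous_comp; first exact: (gc_continuous gc (gc_Gamma gc Sf Sf)).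
exact: sqrt_continuous.
Qed.

Lemma continuous_mul_intg f g : continuous f -> Sc g -> (forall x, g x = 0 -> f x = 0) ->
  intg mu f.
Proof.
move=> cf cg fg; have [k _ Hk] := Sc_plateau ds cg; have kg := Hk k (leqnn _).
apply: eq_intg (Sc_intgM ds cf (Sc_cut ds 2 k)) => x.
have [gx|gx] := eqVneq (g x) 0; first by rewrite fg // mul0r.
by have [-> _] := cut2_plateau (kg x gx); rewrite mulr1.
Qed.

Lemma Sc_Gamma f g : Sc f -> S g -> Sc (Gam f g).
Proof. exact: (Sc_form ds (Gamma_derivation ds)). Qed.

Lemma sqrt_Gamma_intg g : Sc g -> intg mu (fun x => Num.sqrt (Gam g g x)).
Proof.
move=> cg; apply: (continuous_mul_intg (sqrt_Gamma_continuous cg.1) (Sc_Gamma cg cg.1)).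
by move=> x ->; rewrite sqrtr0.
Qed.

Lemma Gamma_sqrt_le f g x : S f -> S g -> `|Gam f g x| <= Num.sqrt (Gam f f x) * Num.sqrt (Gam g g x).
Proof.
move=> Sf Sg; rewrite -sqrtrM ?(gc_Gamma_ge0 gc) // -sqrtr_sqr; apply: ler_wsqrtr.
exact: (Gamma_CS gc).
Qed.

Let decay T := Num.sqrt (rho1 / (expR (c * T) - 1)).

Lemma sqrt_Gamma_P f c0 T x : Sc f -> 0 <= c0 -> (forall x, `|f x| <= c0) -> 0 < T ->
  Num.sqrt (Gam (P T f) (P T f) x) <= c0 * decay T.
Proof.
move=> cf c00 fc T0; rewrite -{1}(ger0_norm c00) -sqrtr_sqr -sqrtrM ?sqr_ge0 //.
apply: ler_wsqrtr; have e1 : 0 < expR (c * T) - 1.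
  by rewrite subr_gt0 -expR0 ltr_expR mulr_gt0.
by rewrite mulrA ler_pdivlMr // mulrC [leRHS]mulrC; exact: grad.
Qed.

(** The pairing of L P_t f with g is minus the integral of Gamma(g, P_t f), bounded by c0 N
    [decay t]. As [decay] blows up at 0, each step from s to t is expanded about t > 0, and
    [decay_primitive] sums the steps with the bound C1, whatever T is. *)
Lemma P_variation f g c0 T : Sc f -> 0 <= c0 -> (forall x, `|f x| <= c0) -> Sc g -> 0 <= T ->
  `|ip f g - ip (P T f) g| <= C1 * c0 * \int[mu]_x Num.sqrt (Gam g g x).
Proof.
move=> cf c00 fc cg T0; set N := \int[mu]_x _.
have N0 : 0 <= N by apply: Int_ge0 => x; exact: sqrtr_ge0.
pose J := decay_primitive c rho1.
have J1 : J T <= C1.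
  rewrite /J /decay_primitive /C1 ler_wpM2l // ?divr_ge0 ?(ltW c_gt0) //; apply: ler_wsqrtr.
  by rewrite ler_piMr ?(ltW rho1_gt0) // gerBl expR_ge0.
have J0 : J 0 = 0 by rewrite /J /decay_primitive mulr0 mul0r oppr0 expR0 subrr mulr0 sqrtr0 mulr0.
have [K K0 HK] := hp_taylor hp T0 cf cg.
have c0N : 0 <= c0 * N by exact: mulr_ge0.
have d_le t : 0 < t -> `|ip (P t (L f)) g| <= c0 * N * decay t.
  move=> t0; have Su := hp_S hp (ltW t0) cf.
  rewrite -(P_L ds hp (ltW t0) cf) ipC /Defs.ip (Int_LGamma ds cg Su) normrN.
  apply: (le_trans (norm_Int (Sc_intg ds (Sc_Gamma cg Su)))).
  rewrite mulrAC -IntZ; last exact: sqrt_Gamma_intg.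
  apply: le_Int; [exact: (intg_norm (Sc_intg ds (Sc_Gamma cg Su)))| |].
    exact: (intgZ _ (sqrt_Gamma_intg cg)).
  move=> x; apply: (le_trans (Gamma_sqrt_le x cg.1 Su)); rewrite mulrC.
  by rewrite ler_wpM2r ?sqrtr_ge0 //; exact: sqrt_Gamma_P.
(* One-sided increments are summed for q = 1 and for q = -1, which together bound the absolute
   value. *)
have inc (q : R) : `|q| <= 1 -> q * ip (P T f) g - q * ip (P 0 f) g <= c0 * N * J T.
  move=> q1.
  have := @increments_le R (fun t => q * ip (P t f) g - c0 * N * J t) T 0 K T0.
  rewrite J0 mulr0 subr0 mulr0 addr0 => H; rewrite lerBlDr addrC -lerBlDr; apply: H.
  move=> s t s0 st tT; rewrite mulr0 add0r.
  have [->|ts] := eqVneq s t; first by rewrite !subrr expr0n mulr0.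
  have lt : s < t by rewrite lt_neqAle ts.
  have t0 := le_lt_trans s0 lt; have sT := le_trans st tT.
  have h1 := HK t s (ltW t0) tT s0 sT; have h2 := d_le t t0.
  have h3 := ler_wpM2l c0N (decay_primitive_increment c_gt0 (ltW rho1_gt0) s0 lt).
  have st0 : 0 <= t - s by rewrite subr_ge0.
  have h4 : q * (ip (P t f) g - ip (P s f) g) <= (t - s) * (c0 * N * decay t) + K * (t - s) ^+ 2.
    apply: (le_trans (ler_norm _)); rewrite normrM; apply: (@le_trans _ _ (1 * `|ip (P t f) g - ip (P s f) g|)).
      by rewrite ler_wpM2r.
    rewrite mul1r distrC.
    have -> : ip (P s f) g - ip (P t f) g =
       (ip (P s f) g - ip (P t f) g - (s - t) * ip (P t (L f)) g) + (s - t) * ip (P t (L f)) g by ring.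
    rewrite addrC; apply: (le_trans (ler_normD _ _)); apply: lerD.
      by rewrite normrM distrC (ger0_norm st0) ler_wpM2l.
    by apply: (le_trans h1); rewrite -(sqrrN (s - t)) opprB.
  move: h3 h4; rewrite -/(J t) -/(J s) -/(decay t).
  move: (decay t) (J t) (J s) (ip (P t f) g) (ip (P s f) g) (K * _) => dt Jt Js it is_ k h3 h4.
  lra.
have E0 : ip (P 0 f) g = ip f g by exact: (hp_0 hp).
have JN : c0 * N * J T <= C1 * c0 * N.
  by rewrite -[leRHS]mulrA [leRHS]mulrC ler_wpM2l.
have := inc 1; have := inc (-1); rewrite E0 normrN normr1 => /(_ (lexx 1)) i1 /(_ (lexx 1)) i2.
by rewrite ler_norml; apply/andP; split; lra.
Qed.

Lemma decay_cvg (e : R) : 0 < e -> \forall n \near \oo, decay n.+1%:R <= e.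
Proof.
move=> e0; exists (Num.truncn (rho1 / (c * e ^+ 2))) => // n /= Nn.
have n0 : 0 < c * n.+1%:R by rewrite mulr_gt0.
have h1 : c * n.+1%:R <= expR (c * n.+1%:R) - 1.
  by have := expR_ge1Dx (c * n.+1%:R); rewrite lerBrDl.
rewrite -(ger0_norm (ltW e0)) -sqrtr_sqr; apply: ler_wsqrtr.
rewrite ler_pdivrMr; last exact: lt_le_trans h1.
apply: (@le_trans _ _ (e ^+ 2 * (c * n.+1%:R))); last by rewrite ler_wpM2l ?sqr_ge0.
rewrite mulrA -ler_pdivrMl ?mulr_gt0 ?exprn_gt0 //.
have := truncnS_gt (rho1 / (c * e ^+ 2)); rewrite (mulrC (e ^+ 2)) [X in X <= _]mulrC => /ltW/le_trans; apply.
by rewrite ler_nat ltnS.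
Qed.

(** * Convergence of the heat flow to the mean value *)

Section long_time.
Variables (f : M -> R) (c0 : R).
Hypotheses (cf : Sc f) (c00 : 0 <= c0) (fc : forall x, `|f x| <= c0).

(** The times n + 1 are positive, as the gradient bound requires; [a n] is the value at the base
    point, from which [v n] deviates less and less. *)
Let v n := P n.+1%:R f.
Let a n := v n point.

Let Sv n : S (v n). Proof. exact: (hp_S hp (ler0n _ _) cf). Qed.

Let v_le n x : `|v n x| <= c0. Proof. exact: (norm_P_le ds hp cf c00 fc (ler0n _ _)). Qed.

Let v_flat x : (fun n => v n x - a n) @ \oo --> 0.
Proof.
have [T T0 HT] := conn point x.
apply/cvgrPdist_le => e e0.
have T1 : 0 < c0 * T + 1 by rewrite ltr_pwDr // mulr_ge0.
move: (decay_cvg (divr_gt0 e0 T1)); apply: filterS => n Hn.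
rewrite sub0r normrN; apply: (le_trans (HT (v n) (c0 * decay n.+1%:R) (Sv n) _ _)).
- by rewrite mulr_ge0 // sqrtr_ge0.
- move=> z; have G0 := gc_Gamma_ge0 gc z (Sv n).
  rewrite -[leLHS](sqr_sqrtr G0) lerXn2r ?nnegrE ?mulr_ge0 ?sqrtr_ge0 //.
  by apply: sqrt_Gamma_P => //; rewrite ltr0n.
rewrite mulrAC; apply: (@le_trans _ _ (c0 * T * (e / (c0 * T + 1)))).
  by rewrite ler_wpM2l // mulr_ge0.
rewrite mulrCA; apply: (ler_piMr (ltW e0)).
by rewrite ler_pdivrMr // mul1r lerDl.
Qed.

Let v_flat_Int g : Sc g -> (fun n => ip (v n) g - a n * \int[mu]_x g x) @ \oo --> 0.
Proof.
move=> cg; have Ig := Sc_intg ds cg.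
have Sd n : S (fun x => v n x - a n) := gcD gc (Sv n) (gc_cst gc (- a n)).
have md n : meas (fun x => (v n x - a n) * g x) := S_meas ds (gcM gc (Sd n) cg.1).
have cvd x : (fun n => (v n x - a n) * g x) @ \oo --> 0 * g x.
  by apply: cvgM; [exact: v_flat|exact: cvg_cst].
have dom n x : `|(v n x - a n) * g x| <= 2 * c0 * `|g x|.
  rewrite normrM ler_wpM2r // (le_trans (ler_normB _ _)) //.
  by have := v_le n x; have := v_le n point; rewrite -/(a n); lra.
have m0 : meas (fun x => 0 * g x) by apply: (S_meas ds); exact: (gcM gc (gc_cst gc 0) cg.1).
have [_] := dominated_Int md m0 cvd dom (intgZ _ (intg_norm Ig)).
have -> : (fun n => \int[mu]_x ((v n x - a n) * g x)) =
    fun n => ip (v n) g - a n * \int[mu]_x g x.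
  apply/funext => n.
  rewrite -IntZ // /Defs.ip -IntB; [|exact: (Sc_intg ds (ScMr ds (Sv n) cg))|exact: intgZ].
  by apply: eq_Int => x; rewrite mulrBl.
by rewrite (IntZ 0 Ig) mul0r.
Qed.

Let v_flat_near g e : Sc g -> 0 < e ->
  \forall n \near \oo, `|ip (v n) g - a n * \int[mu]_x g x| <= e.
Proof.
move=> cg e0; move/cvgrPdist_le : (v_flat_Int cg) => /(_ e e0).
by apply: filterS => n; rewrite sub0r normrN.
Qed.

Let I k := \int[mu]_x cut 2 k x.

Let I_ge0 k : 0 <= I k. Proof. by apply: Int_ge0 => x; exact: cut_ge0. Qed.

Let cut_cvg1 x : (fun k => cut 2 k x) @ \oo --> (1 : R).
Proof.
have half : (2^-1 : R) < 1 by lra.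
have H : \forall k \near \oo, 2^-1 < h k x.
  exact: (@cvgr_gt R _ _ _ _ _ (ds_h_cvg ds x) _ half).
by apply: cvg_near_cst; apply: filterS H => k /cut2_plateau[].
Qed.

Let I_unbounded B : mu setT = +oo%E -> exists k, B < I k.
Proof.
move=> muoo; apply: contrapT => nex.
have [I1 _] : intg mu (fun=> 1) /\ \int[mu]_(x in [set: borel M]) 1 <= B.
  apply: (fatou_Int (f_ := fun k x => cut 2 k x)).
  - by move=> k; exact: (Sc_intg ds (Sc_cut ds 2 k)).
  - by move=> k x; exact: cut_ge0.
  - exact: (S_meas ds (gc_cst gc 1)).
  - by move=> x; exact: cut_cvg1.
  by apply: nearW => k; rewrite leNgt; apply/negP => lt; apply: nex; exists k.
move: I1 => /integrableP[_].
by rewrite /= integral_cst // muoo normr1 mul1e.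
Qed.

Let a_le n : `|a n| <= c0. Proof. exact: v_le. Qed.

(** On infinite volume the mass I k of a cut-off can be made as large as desired. As a_n I k is
    close to <v_n, cut>, which is at most sqrt(N I k) with N the squared norm of f, a_n is
    eventually small. *)
Let a_cvg0 : mu setT = +oo%E -> a @ \oo --> 0.
Proof.
move=> muoo; apply/cvgrPdist_le => e e0.
pose N := ip f f; have N0 : 0 <= N by exact: ip_ge0.
have [k Hk] := I_unbounded (4 * N / e ^+ 2 + 1) muoo.
have e20 : 0 < e ^+ 2 by rewrite exprn_gt0.
have Ik1 : 1 <= I k.
  by apply: le_trans (ltW Hk); rewrite lerDr divr_ge0 ?(ltW e20) // mulr_ge0.
have HkN : 4 * N <= e ^+ 2 * I k.
  rewrite [leRHS]mulrC -ler_pdivrMr //; apply: le_trans (ltW Hk); by rewrite lerDl.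
have cc := Sc_cut ds 2 k.
have e2 : 0 < e / 2 by rewrite divr_gt0.
move: (v_flat_near cc e2); apply: filterS => n.
rewrite -/(I k) => Hn; rewrite sub0r normrN.
have CS := cauchy_schwarz_L2 (hp_L2 hp (ler0n _ n.+1) cf) (ds_L2 ds cc).
have h1 : \int[mu]_x (cut 2 k x ^+ 2) <= I k.
  apply: le_Int; [exact: (Sc_intg ds (Sc_sqr ds cc))|exact: (Sc_intg ds cc)|] => x.
  by rewrite expr2; apply: ler_piMr; [exact: cut_ge0|exact: cut_le1].
have h2 : \int[mu]_x (P n.+1%:R f x ^+ 2) <= N.
  rewrite (eq_Int mu (g := fun x => P n.+1%:R f x * P n.+1%:R f x)); last by move=> y; rewrite expr2.
  exact: (P_contract ds hp (ler0n _ _) cf).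
have h3 : ip (v n) (cut 2 k) ^+ 2 <= (e / 2 * I k) ^+ 2.
  apply: (le_trans CS); apply: (@le_trans _ _ (N * I k)).
    by apply: ler_pM => //; apply: Int_ge0 => x; exact: sqr_ge0.
  rewrite exprMn expr_div_n [I k ^+ 2]expr2 mulrA ler_wpM2r //.
  rewrite mulrAC ler_pdivlMr // mulrC; by rewrite -natrX.
have h4 : `|ip (v n) (cut 2 k)| <= e / 2 * I k.
  rewrite -ler_sqr ?nnegrE ?normr_ge0 // ?real_normK ?num_real //.
  by rewrite mulr_ge0 // ltW.
have I0 : 0 < I k by exact: lt_le_trans Ik1.
rewrite -(ler_pM2r I0) -{1}(gtr0_norm I0) -normrM.
have -> : a n * I k = ip (v n) (cut 2 k) - (ip (v n) (cut 2 k) - a n * I k) by ring.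
apply: (le_trans (ler_normB _ _)).
have h5 : e / 2 <= e / 2 * I k by rewrite ler_peMr // ltW.
have -> : e * I k = e / 2 * I k + e / 2 * I k by rewrite -mulrDl -splitr.
exact: (lerD h4 (le_trans Hn h5)).
Qed.

(** Conservation of mass: paired with a cut-off equal to 1 on the support of f, the flow varies by
    at most C1 c0 times the integral of sqrt(Gamma(cut)), uniformly in time. On finite volume that
    integral tends to 0 along the cut-offs. *)
Let a_cvg_finite : mu setT \is a fin_num -> 0 < fine (mu setT) ->
  a @ \oo --> (fine (mu setT))^-1 * \int[mu]_x f x.
Proof.
move=> muf; set V := fine _ => V0.
have I1 : intg mu (fun=> 1).
  apply/integrableP; split; first by apply/measurable_EFinP; exact: (S_meas ds (gc_cst gc 1)).
  by rewrite /= integral_cst // normr1 mul1e ltey_eq muf.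
have V1 : \int[mu]_(x in [set: borel M]) 1 = V.
  by rewrite /V /Rintegral integral_cst // mul1e.
have IV : I @ \oo --> V.
  have c1 k x : `|cut 2 k x| <= 1 by rewrite ger0_norm ?cut_ge0 ?cut_le1.
  have [_] := dominated_Int (fun k => S_meas ds (Sc_cut ds 2 k).1) (S_meas ds (gc_cst gc 1))
    cut_cvg1 c1 I1.
  by rewrite V1.
apply/cvgrPdist_le => e e0.
(* The errors are dl for the variation in time, dl for the flatness of [v n], and c0 dl for the
   missing mass V - I k; they add up to e V. *)
pose dl := e * V / (2 + c0).
have c2 : 0 < 2 + c0 by rewrite ltr_wpDr.
have dl0 : 0 < dl by rewrite divr_gt0 // mulr_gt0.
pose r := dl / (C1 * c0 * V + 1).
have q0 : 0 <= C1 * c0 * V by rewrite mulr_ge0 ?(ltW V0) // mulr_ge0.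
have q1 : 0 < C1 * c0 * V + 1 by rewrite ltr_pwDr.
have r0 : 0 < r by rewrite divr_gt0.
have r20 : 0 < (r / 2) ^+ 2 by rewrite exprn_gt0 // divr_gt0.
have near1 : \forall k \near \oo, `|V - I k| <= dl by move/cvgrPdist_le : IV; apply.
have [k _ Hk] := filterI near1 (filterI (Gamma_cut_le ds r20) (Sc_plateau ds cf)).
have [Ik [Gk fk]] := Hk k (leqnn _).
have cc := Sc_cut ds 2 k.
have G1 : C1 * c0 * \int[mu]_x Num.sqrt (Gam (cut 2 k) (cut 2 k) x) <= dl.
  apply: (@le_trans _ _ (C1 * c0 * (r * V))).
    apply: ler_wpM2l; first exact: mulr_ge0.
    apply: (@le_trans _ _ (\int[mu]_(x in [set: borel M]) (r * 1))); last by rewrite (IntZ r I1) V1.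
    apply: le_Int; [exact: sqrt_Gamma_intg|exact: intgZ|] => x.
    rewrite mulr1 -(ger0_norm (ltW r0)) -sqrtr_sqr; apply: ler_wsqrtr.
    apply: (le_trans (Gk 2 x (ler0n _ 2))); rewrite le_eqVlt; apply/orP; left; apply/eqP.
    by field.
  rewrite mulrA mulrAC /r mulrCA; apply: (ler_piMr (ltW dl0)).
  by rewrite ler_pdivrMr // mul1r lerDl.
have var n : `|ip f (cut 2 k) - ip (v n) (cut 2 k)| <= dl.
  exact: le_trans (P_variation cf c00 fc cc (ler0n _ n.+1)) G1.
have fE : ip f (cut 2 k) = \int[mu]_x f x.
  by apply: eq_Int => x; rewrite mulrC; exact: (congr1 (fun u => u x) (cut2_id fk)).
move: (v_flat_near cc dl0); apply: filterS => n.
rewrite -/(I k) => Hn; have := var n; rewrite fE => Hv.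
have aV : `|a n * (V - I k)| <= c0 * dl by rewrite normrM; apply: ler_pM.
rewrite -(ler_pM2l V0) -{1}(gtr0_norm V0) -normrM.
have -> : V * (V^-1 * \int[mu]_x f x - a n) =
    (\int[mu]_x f x - ip (v n) (cut 2 k)) + (ip (v n) (cut 2 k) - a n * I k) - a n * (V - I k).
  by rewrite mulrBr mulVKf ?gt_eqF //; ring.
apply: (le_trans (ler_normB _ _)); apply: (le_trans (lerD (ler_normD _ _) (lexx _))).
have dlE : V * e = 2 * dl + c0 * dl.
  by rewrite -mulrDl /dl [RHS]mulrC divfK ?gt_eqF // mulrC.
rewrite dlE mulr_natl mulr2n; exact: (lerD (lerD Hv Hn) aV).
Qed.

Lemma ip_mean_le g : Sc g -> `|ip f g - mean mu f * \int[mu]_x g x| <=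
  C1 * c0 * \int[mu]_x Num.sqrt (Gam g g x).
Proof.
move=> cg.
have acv : a @ \oo --> mean mu f.
  have [muf|] := boolP (mu setT \is a fin_num).
    apply: a_cvg_finite => //; rewrite fine_gt0 // ltey_eq muf andbT.
    by apply: (ds_open ds); [exact: openT|exists point].
  rewrite ge0_fin_numE // -leNgt leye_eq => /eqP muoo.
  (* In infinite volume [fine +oo] is 0 and [0^-1] is 0, so [mean] takes the value 0, which is the
     true limit. *)
  by rewrite /mean muoo /= invr0 mul0r; exact: a_cvg0.
have cv : (fun n => ip f g - ip (v n) g) @ \oo --> ip f g - mean mu f * \int[mu]_x g x.
  have -> : (fun n => ip f g - ip (v n) g) =
      fun n => ip f g - ((ip (v n) g - a n * \int[mu]_x g x) + a n * \int[mu]_x g x).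
    by apply/funext => n; rewrite subrK.
  rewrite -[mean mu f * _]add0r.
  apply: cvgB; first exact: cvg_cst.
  by apply: cvgD; [exact: v_flat_Int|apply: cvgM => //; exact: cvg_cst].
have cvn : (fun n => `|ip f g - ip (v n) g|) @ \oo -->
    `|ip f g - mean mu f * \int[mu]_x g x| by exact: cvg_norm cv.
rewrite -(cvg_lim _ cvn) //; apply: limr_le; first exact: cvgP cvn.
by apply: nearW => n; exact: P_variation.
Qed.

End long_time.

Lemma Sc_muM_mean f g : mean mu f * \int[mu]_x g x = mean mu g * \int[mu]_x f x.
Proof. by rewrite /mean mulrAC. Qed.

(** Duality: [mean mu f] times int g equals [mean mu g] times int f, so [ip_mean_le] bounds the
    integral of f (g - m) for any test function with |f| <= 1. These are cut-offs times the smooth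
    functions w / sqrt(w^2 + ep), w = g - m, which converge to the sign of w. *)
Lemma poincare_L1 g : Sc g ->
  intg mu (fun x => `|g x - mean mu g|) /\
  \int[mu]_x `|g x - mean mu g| <= C1 * \int[mu]_x Num.sqrt (Gam g g x).
Proof.
move=> cg; set m := mean mu g.
pose ep k : R := k.+1%:R^-1.
have ep0 k : 0 < ep k by rewrite invr_gt0.
pose th k (x : R) := 'X.[x] * (x ^+ 2 + ep k) `^ (- 2^-1).
have thE k x : th k x = x / Num.sqrt (x ^+ 2 + ep k).
  by rewrite /th hornerX powRN powR12_sqrt // addr_ge0 ?sqr_ge0 // ltW.
have sp k x : 0 < Num.sqrt (x ^+ 2 + ep k) by rewrite sqrtr_gt0 ltr_wpDl ?sqr_ge0.
have th1 k x : `|th k x| <= 1.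
  rewrite thE normrM normfV (gtr0_norm (sp k x)) ler_pdivrMr // mul1r -sqrtr_sqr.
  by apply: ler_wsqrtr; rewrite lerDl ltW.
have Sw : S (fun x => g x - m) := gcD gc cg.1 (gc_cst gc (- m)).
have St k : S (fun x => th k (g x - m)) := gc_comp gc (@smooth_horner_powR R (ep k) (ep0 k) 'X (- 2^-1)) Sw.
pose f k x := cut 2 k x * th k (g x - m).
have cf k : Sc (f k) := ScM ds (Sc_cut ds 2 k) (St k).
have f1 k x : `|f k x| <= 1.
  rewrite normrM (ger0_norm (cut_ge0 _ _ _)) -[leRHS]mulr1.
  by apply: ler_pM; rewrite ?cut_ge0 // cut_le1.
have tx k x : 0 <= th k x * x by rewrite thE mulrAC divr_ge0 ?(ltW (sp k x)) // -expr2 sqr_ge0.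
apply: (fatou_Int (f_ := fun k x => f k x * (g x - m))).
- by move=> k; exact: (Sc_intg ds (ScM ds (cf k) Sw)).
- by move=> k x; rewrite /f -mulrA mulr_ge0 ?cut_ge0.
- apply: continuous_meas => x.
  apply: (@continuous_comp M R R (fun x => g x - m) (fun y => `|y|)); last exact: norm_continuous.
  exact: (gc_continuous gc Sw).
- move=> x; set w := g x - m.
  have e1 : `|w| = 1 * (w / Num.sqrt (w ^+ 2 + 0) * w).
    rewrite mul1r addr0 sqrtr_sqr; have [->|w0] := eqVneq w 0; first by rewrite normr0 mulr0.
    by rewrite mulrAC -expr2 -(real_normK (num_real w)) expr2 mulfK // normr_eq0.
  have [w0|w0] := eqVneq w 0.
    rewrite (_ : (fun k => _) = fun=> 0) ?w0 ?normr0; first exact: cvg_cst.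
    by apply/funext => k; rewrite mulr0.
  rewrite e1 /f -/w; under eq_fun do rewrite thE -mulrA.
  have half : (2^-1 : R) < 1 by lra.
  have H : \forall k \near \oo, 2^-1 < h k x.
    exact: (@cvgr_gt R _ _ _ _ _ (ds_h_cvg ds x) _ half).
  have cutc : (fun k => cut 2 k x) @ \oo --> (1 : R).
    by apply: cvg_near_cst; apply: filterS H => k /cut2_plateau[].
  apply: cvgM => //; apply: cvgM; last exact: cvg_cst.
  apply: cvgM; first exact: cvg_cst.
  apply: cvgV; first by rewrite addr0 sqrtr_sqr normr_eq0.
  apply: continuous_cvg; first exact: sqrt_continuous.
  apply: cvgD; first exact: cvg_cst.
  exact: cvg_harmonic.
apply: nearW => k.
have := ip_mean_le (cf k) ler01 (f1 k) cg; rewrite mulr1 => /(le_trans (ler_norm _)).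
apply: le_trans; rewrite Sc_muM_mean -/m -IntZ; last exact: (Sc_intg ds (cf k)).
rewrite /Defs.ip -IntB; [|exact: (Sc_intg ds (ScM ds (cf k) cg.1))|exact: (intgZ _ (Sc_intg ds (cf k)))].
rewrite le_eqVlt; apply/orP; left; apply/eqP; apply: eq_Int => x.
by rewrite mulrBr (mulrC m).
Qed.

Lemma Gamma_addc f (k : R) x : S f -> Gam (fun y => f y + k) (fun y => f y + k) x = Gam f f x.
Proof.
move=> Sf; have Sk := gc_cst gc k; have Sfk := gcD gc Sf Sk; have Gf := Gamma_form gc.
have kk : Gam (fun=> k) (fun=> k) x = 0.
  by rewrite /Gamma !(L_cst gc) !mulr0 !subrr mulr0.
have k0 u : S u -> Gam (fun=> k) u x = 0 by move=> Su; exact: (Gamma_eq0 gc Sk Su kk).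
rewrite (pfD Gf x Sf Sk Sfk) (k0 _ Sfk) addr0 (pfC Gf x Sf Sfk) (pfD Gf x Sf Sk Sf).
by rewrite k0 ?addr0.
Qed.

(** * Passage to exponents p > 1 *)

Section power.
Variables (p : R) (g : M -> R) (m : R).
Hypotheses (p1 : 1 < p) (cg : Sc g).

Let a := (p - 1) / 2.
Let a0 : 0 < a. Proof. by rewrite divr_gt0 // subr_gt0. Qed.
Let w x := g x - m.
Let Sw : S w. Proof. exact: (gcD gc cg.1 (gc_cst gc (- m))). Qed.

Let phi (e y : R) := y * (y ^+ 2 + e) `^ a.

Let phi_smooth e : 0 < e -> smooth_real (phi e).
Proof.
move=> e0; have := @smooth_horner_powR R e e0 'X a.
by rewrite (_ : (fun x => _) = phi e) //; apply/funext => x; rewrite hornerX.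
Qed.

Let phi_derive e y : 0 < e -> `|derive1 (phi e) y| <= p * (y ^+ 2 + e) `^ a.
Proof.
move=> e0; have [_] := @is_derive_horner_powR R e e0 'X a y.
rewrite (_ : (fun x => _) = phi e); last by apply/funext => x; rewrite hornerX.
rewrite -derive1E => ->.
have ye : 0 < y ^+ 2 + e by rewrite ltr_wpDl ?sqr_ge0.
rewrite !(hornerD, hornerM, hornerZ, hornerX, hornerXn, hornerC) derivX hornerC mul1r.
have -> : (y ^+ 2 + e) `^ a = (y ^+ 2 + e) * (y ^+ 2 + e) `^ (a - 1).
  by rewrite -{2}(powRr1 (ltW ye)) -powRD ?subrKC // (gt_eqF ye) implybT.
have pa : p = 1 + 2 * a by rewrite /a; field.
have s2 := sqr_ge0 y.
have q0 : 0 <= y ^+ 2 + e + 2 * a * (y * y).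
  by rewrite addr_ge0 ?(ltW ye) // -expr2 mulr_ge0 // mulr_ge0 // ltW.
rewrite normrM (ger0_norm (powR_ge0 (y ^+ 2 + e) (a - 1))) (ger0_norm q0) [leRHS]mulrA.
apply: ler_wpM2r; first exact: powR_ge0.
rewrite pa -[y * y]expr2.
have := mulr_ge0 (ltW a0) (ltW e0); lra.
Qed.

Let ep (k : nat) : R := k.+1%:R^-1.
Let ep0 k : 0 < ep k. Proof. by rewrite invr_gt0. Qed.
Let ep1 k : ep k <= 1. Proof. by rewrite invf_le1 ?ltr0n // ler1n. Qed.

Let sqr_powR (y : R) : (y ^+ 2) `^ a = `|y| `^ (p - 1).
Proof.
by rewrite -(real_normK (num_real y)) -powR_mulrn // -powRrM; congr (_ `^ _); rewrite /a; field.
Qed.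

Let pow_cvg (y : R) : (fun k => (y ^+ 2 + ep k) `^ a) @ \oo --> `|y| `^ (p - 1).
Proof.
have -> : (fun k => (y ^+ 2 + ep k) `^ a) = fun k => `|y ^+ 2 + ep k| `^ a.
  by apply/funext => k; rewrite ger0_norm // addr_ge0 ?sqr_ge0 // ltW.
rewrite (_ : `|y| `^ (p - 1) = `|y ^+ 2 + 0| `^ a); last first.
  by rewrite addr0 (ger0_norm (sqr_ge0 y)) sqr_powR.
have cv : (fun k => y ^+ 2 + ep k) @ \oo --> y ^+ 2 + 0.
  by apply: cvgD; [exact: cvg_cst|exact: cvg_harmonic].
exact: (cvg_comp _ _ cv (@powR_normr_continuous R a a0 (y ^+ 2 + 0))).
Qed.

Let phi_cvg (y : R) : (fun k => phi (ep k) y) @ \oo --> y * `|y| `^ (p - 1).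
Proof. by apply: cvgM; [exact: cvg_cst|exact: pow_cvg]. Qed.

Lemma Sc_w_bounded : exists2 B, 0 <= B & forall x, `|w x| <= B.
Proof.
have [k _ Hk] := Sc_plateau ds cg; have kg := Hk k (leqnn _).
have [K K0 HK] := Sc_continuousM (gc_continuous gc cg.1) (Sc_cut ds 2 k).
exists (K + `|m|); first exact: addr_ge0.
move=> x; apply: (le_trans (ler_normB _ _)); rewrite lerD2r.
have := HK x; rewrite mulrC (_ : cut 2 k x * g x = g x); last first.
  exact: (congr1 (fun u => u x) (cut2_id kg)).
move/le_trans; apply; apply: ler_piMr => //.
by rewrite ger0_norm ?cut_ge0 ?cut_le1.
Qed.

(* [m] is chosen so that the regularized powers have vanishing mean in the limit. *)
Lemma power_poincare (ck : nat -> R) :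
  (forall k, mean mu (fun x => phi (ep k) (w x) - phi (ep k) (- m)) =
     ck k - phi (ep k) (- m)) -> ck @ \oo --> (0 : R) ->
  intg mu (fun x => `|w x| `^ p) /\
  \int[mu]_x (`|w x| `^ p) <=
    2 * (C1 * p * (2 * (C1 * p)) `^ (p - 1)) * \int[mu]_x (Num.sqrt (Gam g g x) `^ p).
Proof.
move=> meanE ck0.
have [B B0 HB] := Sc_w_bounded.
have pp : 0 < p by exact: lt_trans ltr01 p1.
pose sG x := Num.sqrt (Gam g g x).
have isG : intg mu sG := sqrt_Gamma_intg cg.
have sG0 x : 0 <= sG x := sqrtr_ge0 _.
have meas_w : meas w := S_meas ds Sw.
have measp b : meas (fun x => `|w x| `^ b).
  exact: (measurableT_comp (measurable_powR b) (measurableT_comp (@normr_measurable R setT) meas_w)).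
(* Off the support of g, w equals -m; subtracting the value there makes G compactly supported, and
   subtracting its mean then leaves phi(w) - ck. *)
pose G k x := phi (ep k) (w x) - phi (ep k) (- m).
have SG k : S (G k) := gcD gc (gc_comp gc (phi_smooth (ep0 k)) Sw) (gc_cst gc (- phi (ep k) (- m))).
have cG k : Sc (G k).
  by apply: (Sc_sub cg (SG k)) => x gx; rewrite /G /w gx sub0r subrr.
have sGk k x : Num.sqrt (Gam (G k) (G k) x) <= p * ((w x ^+ 2 + ep k) `^ a * sG x).
  rewrite /G (Gamma_addc _ x (gc_comp gc (phi_smooth (ep0 k)) Sw)).
  rewrite (Gamma_comp2 gc x (phi_smooth (ep0 k)) Sw) /w (Gamma_addc _ x cg.1).
  rewrite sqrtrM ?sqr_ge0 // sqrtr_sqr mulrA ler_wpM2r //; exact: phi_derive.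
pose D k x := (w x ^+ 2 + ep k) `^ a * sG x.
pose Bp := (B ^+ 2 + 1) `^ a.
have D_le k x : `|D k x| <= Bp * sG x.
  rewrite ger0_norm ?mulr_ge0 ?powR_ge0 // ler_wpM2r //.
  apply: ge0_ler_powR; rewrite ?nnegrE ?(ltW a0) // ?addr_ge0 ?sqr_ge0 ?(ltW (ep0 k)) //.
  by rewrite lerD // -(real_normK (num_real (w x))) lerXn2r ?nnegrE.
have mD k : meas (D k).
  apply: measM; last exact: intg_meas isG.
  apply: (measurableT_comp (measurable_powR a)); apply: measD; last exact: measurable_cst.
  exact: (measM meas_w meas_w).
have mDl : meas (fun x => `|w x| `^ (p - 1) * sG x) by apply: measM => //; exact: intg_meas isG.
have cD x : (fun k => D k x) @ \oo --> `|w x| `^ (p - 1) * sG x.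
  by apply: cvgM; [exact: pow_cvg|exact: cvg_cst].
have [iDl cvD] := dominated_Int mD mDl cD D_le (intgZ Bp isG).
have iD k : intg mu (D k) := le_intg (mD k) (D_le k) (intgZ Bp isG).
set ID := \int[mu]_x _ in cvD.
have wp x : `|w x * `|w x| `^ (p - 1)| = `|w x| `^ p.
  by rewrite normrM [`|_ `^ _|]ger0_norm ?powR_ge0 // mulr_powRB1.
have fat (e : R) : 0 < e -> intg mu (fun x => `|w x| `^ p) /\
    \int[mu]_x (`|w x| `^ p) <= C1 * p * ID + e.
  move=> e0; apply: (fatou_Int (f_ := fun k x => `|phi (ep k) (w x) - ck k|)) => //.
  - move=> k; have [+ _] := poincare_L1 (cG k); apply: eq_intg => x.
    by rewrite meanE /G opprB addrA subrK.
  - move=> x; rewrite -wp -[w x * _]subr0; apply: cvg_norm.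
    by apply: cvgB => //; exact: phi_cvg.
  have q0 : 0 < C1 * p + 1 by rewrite ltr_pwDr // mulr_ge0 // ltW.
  move/cvgrPdist_le : cvD => /(_ _ (divr_gt0 e0 q0)); apply: filterS => k Hk.
  rewrite (eq_Int mu (g := fun x => `|G k x - mean mu (G k)|)); last first.
    by move=> x; rewrite meanE /G opprB addrA subrK.
  have [_ le1] := poincare_L1 (cG k); apply: (le_trans le1).
  apply: (@le_trans _ _ (C1 * (p * \int[mu]_x D k x))).
    rewrite ler_wpM2l // -IntZ //; apply: le_Int; [exact: sqrt_Gamma_intg|exact: intgZ|exact: sGk].
  have Cp0 : 0 <= C1 * p by rewrite mulr_ge0 // ltW.
  have Hk' : \int[mu]_x D k x <= ID + e / (C1 * p + 1).
    by move: Hk; rewrite distrC ler_norml => /andP[_]; rewrite lerBlDl.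
  rewrite mulrA; apply: (le_trans (ler_wpM2l Cp0 Hk')); rewrite mulrDr lerD2l.
  by rewrite mulrCA; apply: (ler_piMr (ltW e0)); rewrite ler_pdivrMr // mul1r lerDl.
have [iw _] := fat 1 ltr01; split => //.
have key : \int[mu]_x (`|w x| `^ p) <= C1 * p * ID.
  by apply/ler_addgt0Pr => e /fat[].
have [Kg Kg0 HKg] : exists2 K, 0 <= K & forall x, sG x <= K.
  have cGg := Sc_Gamma cg cg.1; have [k _ Hk] := Sc_plateau ds cGg; have kg := Hk k (leqnn _).
  have [K K0 HK] := Sc_continuousM (sqrt_Gamma_continuous cg.1) (Sc_cut ds 2 k).
  exists K => // x; have [gx|gx] := eqVneq (Gam g g x) 0; first by rewrite /sG gx sqrtr0.
  have := HK x; have [-> _] := cut2_plateau (kg x gx).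
  by rewrite mulr1 normr1 mulr1 ger0_norm.
have isGp : intg mu (fun x => sG x `^ p).
  apply: le_intg (intgZ (Kg `^ (p - 1)) isG).
    exact: (measurableT_comp (measurable_powR p) (intg_meas isG)).
  move=> x; rewrite ger0_norm ?powR_ge0 // -(mulr_powRB1 (sG0 x) pp) mulrC ler_wpM2r //.
  by apply: ge0_ler_powR; rewrite ?nnegrE ?subr_ge0 ?(ltW p1).
have Cp0 : 0 <= C1 * p by rewrite mulr_ge0 // ltW.
have yg : C1 * p * ID <= \int[mu]_x (2^-1 * `|w x| `^ p +
    C1 * p * (2 * (C1 * p)) `^ (p - 1) * sG x `^ p).
  rewrite -IntZ //; apply: le_Int; [exact: intgZ|by apply: intgD; exact: intgZ|] => x.
  exact: powR_young.
move: key => /le_trans/(_ yg); rewrite IntD; [|exact: intgZ|exact: intgZ].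
have solve (x y : R) : x <= 2^-1 * x + y -> x <= 2 * y by lra.
by rewrite !IntZ // => H; rewrite -[leRHS]mulrA; exact: solve.
Qed.

Lemma power_continuous : continuous (fun y : R => y * `|y| `^ (p - 1)).
Proof.
move=> y; apply: (@continuousM R R (fun y => y) (fun y => `|y| `^ (p - 1)) y); first exact: cvg_id.
by apply: (@powR_normr_continuous R (p - 1)); rewrite subr_gt0.
Qed.

(** The constants ck are the averages of the regularized powers of w; by dominated convergence, w
    being bounded and the volume finite, they tend to the average of w |w|^(p-1), which is 0 by the
    choice of m. *)
Lemma power_center_finite : mu setT \is a fin_num -> 0 < fine (mu setT) ->
  \int[mu]_x (w x * `|w x| `^ (p - 1)) = 0 ->
  intg mu (fun x => `|w x| `^ p) /\
  \int[mu]_x (`|w x| `^ p) <=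
    2 * (C1 * p * (2 * (C1 * p)) `^ (p - 1)) * \int[mu]_x (Num.sqrt (Gam g g x) `^ p).
Proof.
move=> muf V0 z0; have [B B0 HB] := Sc_w_bounded.
have I1 (r : R) : intg mu (fun=> r).
  apply/integrableP; split; first by apply/measurable_EFinP; exact: (S_meas ds (gc_cst gc r)).
  by rewrite /= integral_cst // lte_mul_pinfty // ltey_eq muf.
have Sphi k : S (fun x => phi (ep k) (w x)) := gc_comp gc (phi_smooth (ep0 k)) Sw.
have dom k x : `|phi (ep k) (w x)| <= B * (B ^+ 2 + 1) `^ a.
  rewrite normrM; apply: ler_pM => //; rewrite ger0_norm ?powR_ge0 //.
  apply: ge0_ler_powR; rewrite ?nnegrE ?(ltW a0) // ?addr_ge0 ?sqr_ge0 ?(ltW (ep0 k)) //.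
  by rewrite lerD // -(real_normK (num_real (w x))) lerXn2r ?nnegrE.
have mz : meas (fun x => w x * `|w x| `^ (p - 1)).
  apply: measM; first exact: (S_meas ds Sw).
  exact: (measurableT_comp (measurable_powR (p - 1)) (measurableT_comp (@normr_measurable R setT) (S_meas ds Sw))).
have [_ cv] := dominated_Int (fun k => S_meas ds (Sphi k)) mz (fun x => @phi_cvg (w x)) dom
  (I1 (B * (B ^+ 2 + 1) `^ a)).
rewrite z0 in cv.
have Iphi k : intg mu (fun x => phi (ep k) (w x)).
  exact: le_intg (S_meas ds (Sphi k)) (dom k) (I1 _).
apply: (power_poincare (ck := fun k => (fine (mu setT))^-1 * \int[mu]_x phi (ep k) (w x))).
- move=> k; rewrite /mean IntB // mulrBr; congr (_ - _).
  rewrite -[X in \int[mu]_x X](mulr1 (phi (ep k) (- m))) IntZ // /Rintegral integral_cst // mul1e.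
  by rewrite mulrCA mulVf ?gt_eqF // mulr1.
- by rewrite -[X in _ --> X](mulr0 (fine (mu setT))^-1); apply: cvgM => //; exact: cvg_cst.
Qed.

Lemma power_center_infinite : mu setT = +oo%E -> m = 0 ->
  intg mu (fun x => `|w x| `^ p) /\
  \int[mu]_x (`|w x| `^ p) <=
    2 * (C1 * p * (2 * (C1 * p)) `^ (p - 1)) * \int[mu]_x (Num.sqrt (Gam g g x) `^ p).
Proof.
move=> muoo m0; apply: (power_poincare (ck := fun=> 0)); last exact: cvg_cst.
by move=> k; rewrite /mean muoo /= invr0 mul0r m0 oppr0 /phi mul0r subrr.
Qed.

End power.

(** Intermediate value theorem in m on [-B, B], where B bounds |g|: at the two ends g - m has a
    constant sign. *)
Lemma power_center (p : R) g : 1 < p -> Sc g -> mu setT \is a fin_num -> 0 < fine (mu setT) ->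
  exists m, \int[mu]_x ((g x - m) * `|g x - m| `^ (p - 1)) = 0.
Proof.
move=> p1 cg muf V0.
have [B B0 HB] := @Sc_w_bounded g 0 cg.
have HB' x : `|g x| <= B by have := HB x; rewrite subr0.
pose F (m : R) (x : M) := (g x - m) * `|g x - m| `^ (p - 1).
have cF := power_continuous p1.
have mF m : meas (F m).
  apply: continuous_meas => x.
  apply: (@continuous_comp M R R (fun x => g x - m) (fun y => y * `|y| `^ (p - 1))); last exact: cF.
  exact: (gc_continuous gc (gcD gc cg.1 (gc_cst gc (- m)))).
have I1 (r : R) : intg mu (fun=> r).
  apply/integrableP; split; first by apply/measurable_EFinP; exact: (S_meas ds (gc_cst gc r)).
  by rewrite /= integral_cst // lte_mul_pinfty // ltey_eq muf.
pose B2 := 2 * B + 1; have B20 : 0 <= B2 by rewrite addr_ge0 // mulr_ge0.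
pose Kb := B2 * B2 `^ (p - 1).
have dom m x : m \in `](- (B + 1)), (B + 1)[ -> `|F m x| <= Kb.
  rewrite in_itv /= => /andP[m1 m2].
  have h1 : `|g x - m| <= B2.
    apply: (le_trans (ler_normB _ _)); have := HB' x; have : `|m| <= B + 1 by rewrite ler_norml !ltW.
    by rewrite /B2; move: `|m| `|g x| => y z; lra.
  rewrite /F normrM; apply: ler_pM => //; rewrite ger0_norm ?powR_ge0 //.
  by apply: ge0_ler_powR; rewrite ?nnegrE // subr_ge0 ltW.
pose Psi m := \int[mu]_x F m x.
have IF m : m \in `](- (B + 1)), (B + 1)[ -> intg mu (F m).
  by move=> mI; apply: (le_intg (mF m) (fun x => dom m x mI) (I1 Kb)).
(* The parameter interval exceeds [-B, B] by 1 on each side, so that the endpoints are interior and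
   continuity under the integral reaches them. *)
have cPsi : {in `](- (B + 1)), (B + 1)[ , continuous Psi}.
  have h1 m : `](- (B + 1)), (B + 1)[%classic m -> intg mu (F m) by exact: IF.
  have h2 : {ae mu, forall x : borel M, setT x ->
      {in `](- (B + 1)), (B + 1)[%classic, continuous (F ^~ x)}}.
    apply: aeW => x _ m _.
    apply: (@continuous_comp R R R (fun m => g x - m) (fun y => y * `|y| `^ (p - 1))); last exact: cF.
    by apply: continuousB; [exact: cst_continuous|exact: cvg_id].
  have h3 m : `](- (B + 1)), (B + 1)[%classic m ->
      {ae mu, forall x : borel M, setT x -> `|F m x| <= Kb}.
    by move=> mI; apply: aeW => x _; exact: dom.
  have cont := continuity_under_integral measurableT h1 h2 (I1 Kb) h3.
  by move=> m mI; apply: cont; rewrite inE.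
have BB : - B <= B by lra.
have [m mI mz] : exists2 m, m \in `[(- B), B] & Psi m = 0.
  apply: IVT => //.
  - apply: continuous_in_subspaceT => m; rewrite inE /= in_itv /= => /andP[m1 m2].
    by apply: cPsi; rewrite in_itv /=; apply/andP; split; lra.
  - have P1 : 0 <= Psi (- B).
      apply: Int_ge0 => x; rewrite mulr_ge0 ?powR_ge0 // opprK.
      by have := HB' x; rewrite ler_norml; lra.
    have P2 : Psi B <= 0.
      rewrite -oppr_ge0 -IntN; last by apply: IF; rewrite in_itv /=; apply/andP; split; lra.
      apply: Int_ge0 => x; rewrite -mulNr mulr_ge0 ?powR_ge0 // opprB.
      by have := HB' x; rewrite ler_norml; lra.
    by move: (Psi (- B)) (Psi B) P1 P2 => y z y0 z0; rewrite ge_min le_max y0 z0 orbT.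
by exists m.
Qed.

(** A weak form of Jensen's inequality: with h = |r| / 2, h^(p-1) (|w| - h) <= |w|^p pointwise, and
    its integral gives h^p V because |r| V is at most the integral of |w|. The halving costs the
    factor 2^p. *)
Lemma jensen_center (p : R) (w : M -> R) (V r : R) : 1 < p -> mu setT \is a fin_num ->
  V = fine (mu setT) -> 0 < V -> meas w -> intg mu (fun x => `|w x| `^ p) -> intg mu w ->
  r = V^-1 * \int[mu]_x w x ->
  `|r| `^ p * V <= 2 `^ p * \int[mu]_x (`|w x| `^ p).
Proof.
move=> p1 muf VE V0 mw iwp iw rE.
have pp : 0 < p := lt_trans ltr01 p1.
have I1 (q : R) : intg mu (fun=> q).
  apply/integrableP; split; first by apply/measurable_EFinP; exact: measurable_cst.
  by rewrite /= integral_cst // lte_mul_pinfty // ltey_eq muf.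
pose h2 := `|r| / 2; have h20 : 0 <= h2 by rewrite divr_ge0.
have pt x : h2 `^ (p - 1) * (`|w x| - h2) <= `|w x| `^ p.
  have [wh|wh] := leP `|w x| h2.
    apply: le_trans (powR_ge0 _ _); rewrite mulr_ge0_le0 ?powR_ge0 // subr_le0 //.
  rewrite -(mulr_powRB1 (normr_ge0 (w x)) pp) [leRHS]mulrC.
  apply: ler_pM; rewrite ?powR_ge0 ?subr_ge0 ?(ltW wh) // ?gerBl //.
  by apply: ge0_ler_powR; rewrite ?nnegrE ?subr_ge0 ?(ltW p1) // ltW.
have i1 : intg mu (fun x => h2 `^ (p - 1) * (`|w x| - h2)).
  by apply: intgZ; apply: intgB; [exact: intg_norm|exact: I1].
have := le_Int i1 iwp pt; rewrite IntZ; last by apply: intgB; [exact: intg_norm|exact: I1].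
rewrite IntB; [|exact: intg_norm|exact: I1].
have -> : \int[mu]_(x in [set: borel M]) h2 = h2 * V.
  by rewrite VE /Rintegral integral_cst // fineM.
have rV : `|r| * V <= \int[mu]_x `|w x|.
  apply: le_trans (norm_Int iw); rewrite rE normrM normfV (gtr0_norm V0).
  by rewrite mulrAC mulVf ?gt_eqF // mul1r.
move=> H.
have H' : h2 `^ p * V <= \int[mu]_x (`|w x| `^ p).
  apply: le_trans H; have -> : h2 `^ p * V = h2 `^ (p - 1) * (h2 * V).
    by rewrite -(mulr_powRB1 h20 pp) mulrAC mulrC.
  apply: ler_wpM2l; first exact: powR_ge0.
  rewrite lerBrDr; apply: le_trans rV; rewrite -mulrDl /h2 -splitr //.
have -> : `|r| `^ p * V = 2 `^ p * (h2 `^ p * V).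
  by rewrite mulrA -powRM //; congr (_ `^ p * _); rewrite /h2; field.
by rewrite ler_wpM2l ?powR_ge0.
Qed.

(* Replacing the center [m] by the mean costs a factor depending only on [p]. *)
Lemma poincare_Lp (p : R) g : 1 < p -> Sc g ->
  intg mu (fun x => `|g x - mean mu g| `^ p) /\
  \int[mu]_x (`|g x - mean mu g| `^ p) <=
    2 `^ p * (1 + 2 `^ p) * (2 * (C1 * p * (2 * (C1 * p)) `^ (p - 1))) *
    \int[mu]_x (Num.sqrt (Gam g g x) `^ p).
Proof.
move=> p1 cg; have pp : 0 < p := lt_trans ltr01 p1.
set IG := \int[mu]_x (Num.sqrt (Gam g g x) `^ p).
set Kp := 2 * (C1 * _ * _).
have IG0 : 0 <= IG by apply: Int_ge0 => x; exact: powR_ge0.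
have Kp0 : 0 <= Kp.
  by rewrite /Kp mulr_ge0 // mulr_ge0 ?powR_ge0 // mulr_ge0 // ltW.
have c0 : 0 <= (2 : R) `^ p := powR_ge0 _ _.
have mwp m b : meas (fun x => `|g x - m| `^ b).
  exact: (measurableT_comp (measurable_powR b) (measurableT_comp (@normr_measurable R setT)
    (S_meas ds (gcD gc cg.1 (gc_cst gc (- m)))))).
have c1 : 1 <= (2 : R) `^ p.
  have : (1 : R) `^ p <= 2 `^ p by apply: ge0_ler_powR; rewrite ?nnegrE ?(ltW pp) // ler1n.
  by rewrite powR1.
have [muf|] := boolP (mu setT \is a fin_num); last first.
  rewrite ge0_fin_numE // -leNgt leye_eq => /eqP muoo.
  have m0 : mean mu g = 0 by rewrite /mean muoo /= invr0 mul0r.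
  have [i1 le1] := power_center_infinite p1 cg muoo (erefl 0).
  rewrite m0; split => //; apply: (le_trans le1); rewrite -/Kp -/IG -mulrA.
  apply: ler_peMl; first exact: mulr_ge0.
  have : forall z : R, 1 <= z -> 1 <= z * (1 + z) by move=> z z1; nra.
  by apply.
have V0 : 0 < fine (mu setT).
  rewrite fine_gt0 // ltey_eq muf andbT.
  by apply: (ds_open ds); [exact: openT|exists point].
have [m mz] := power_center p1 cg muf V0.
have [iw lew] := power_center_finite p1 cg muf V0 mz.
set V := fine (mu setT) in V0.
have I1 (q : R) : intg mu (fun=> q).
  apply/integrableP; split; first by apply/measurable_EFinP; exact: measurable_cst.
  by rewrite /= integral_cst // lte_mul_pinfty // ltey_eq muf.
have Ig := Sc_intg ds cg.
have Vm : V^-1 * \int[mu]_x (g x - m) = mean mu g - m.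
  rewrite IntB // mulrBr -/(mean mu g); congr (_ - _).
  by rewrite /Rintegral integral_cst // fineM // mulrCA -/V mulVf ?gt_eqF // mulr1.
have J := jensen_center p1 muf (erefl V) V0 (S_meas ds (gcD gc cg.1 (gc_cst gc (- m)))) iw
  (intgB Ig (I1 m)) (esym Vm).
(* The triangle inequality for p-th powers costs 2^p, and [jensen_center] bounds the constant term
   by 2^p times the first; hence 2^p (1 + 2^p). *)
pose bnd x := 2 `^ p * (`|g x - m| `^ p + `|mean mu g - m| `^ p).
have pt x : `|g x - mean mu g| `^ p <= bnd x.
  apply: le_trans (powRD_le (ltW pp) (normr_ge0 _) (normr_ge0 _)).
  apply: ge0_ler_powR; rewrite ?nnegrE ?(ltW pp) ?addr_ge0 //.
  have -> : g x - mean mu g = (g x - m) - (mean mu g - m) by rewrite opprB addrA subrK.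
  exact: ler_normB.
have ib : intg mu bnd by apply: intgZ; exact: intgD.
have im : intg mu (fun x => `|g x - mean mu g| `^ p).
  by apply: le_intg ib => // x; rewrite ger0_norm ?powR_ge0.
split; first exact: im.
apply: (le_trans (le_Int im ib pt)).
rewrite IntZ; last exact: intgD.
rewrite (IntD iw (I1 _)) -[leRHS]mulrA -[leRHS]mulrA; apply: ler_wpM2l; first exact: c0.
have -> : \int[mu]_(x in [set: borel M]) (`|mean mu g - m| `^ p) = `|mean mu g - m| `^ p * V.
  by rewrite /Rintegral integral_cst // fineM.
apply: (le_trans (lerD (lexx _) J)); rewrite -[X in X + _]mul1r -mulrDl.
by apply: ler_wpM2l; [rewrite addr_ge0|exact: lew].
Qed.

End poincare.

(** * Absolutely continuous functions *)

Section absolute_continuity.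
Context {R : realType}.
Implicit Types (x y z T e : R) (l : seq (R * R)) (f g F : R -> R).

(** Ordered lists of cells encode the disjoint families of [abs_continuous] in a form suited to
    induction and concatenation. Gaps between cells and degenerate cells are allowed. *)
Fixpoint chain x l y : bool :=
  if l is p :: l' then [&& x <= p.1, p.1 <= p.2 & chain p.2 l' y] else x <= y.

Lemma chain_le x l y : chain x l y -> x <= y.
Proof.
by elim: l x => [|p l IH] x //= /and3P[xp pp /IH]; apply: le_trans; exact: le_trans pp.
Qed.

Lemma chain_weaken x x' l y : x' <= x -> chain x l y -> chain x' l y.
Proof.
case: l => [|p l] /= x'x; first exact: le_trans.
by case/and3P=> xp -> ->; rewrite (le_trans x'x xp).
Qed.

Lemma chain_cat x l z l' y : chain x l z -> chain z l' y -> chain x (l ++ l') y.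
Proof.
elim: l x => [|p l IH] x /=; first exact: chain_weaken.
by case/and3P=> -> -> /IH.
Qed.

Lemma chain_catP x l l' y : chain x (l ++ l') y ->
  exists2 z, chain x l z & chain z l' y.
Proof.
elim: l x => [|p l IH] x /=; first by exists x.
by case/and3P=> -> -> /IH.
Qed.

Lemma chain_mem x l y p : chain x l y -> p \in l -> [/\ x <= p.1, p.1 <= p.2 & p.2 <= y].
Proof.
elim: l x => [|q l IH] x //= /and3P[xq qq c]; rewrite inE => /predU1P[->|pl].
  by split=> //; exact: chain_le c.
have [qp pp py] := IH _ c pl; split=> //.
exact: le_trans xq (le_trans qq qp).
Qed.

Lemma chain_pairwise x l y : chain x l y -> pairwise (fun p q : R * R => p.2 <= q.1) l.
Proof.
elim: l x => [|q l IH] x //= /and3P[xq qq c].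
rewrite (IH _ c) andbT; apply/allP => p pl.
by have [] := chain_mem c pl.
Qed.

Lemma chain_abs_continuous T g e : abs_continuous T g -> 0 < e ->
  exists2 delta, 0 < delta & forall l, chain 0 l T ->
    \sum_(p <- l) (p.2 - p.1) < delta -> \sum_(p <- l) `|g p.2 - g p.1| < e.
Proof.
move=> ac e0; have [d d0 H] := ac _ e0; exists d => // l cl.
rewrite !(big_nth (0, 0)) !big_mkord => ld.
apply: H ld => [i|i j ij].
  by have [? ? ?] := chain_mem cl (mem_nth (0, 0) (ltn_ord i)).
have /(pairwiseP (0, 0)) pw := chain_pairwise cl.
have [lt|gt|/val_inj eq] := ltngtP i j.
- by left; apply: pw => //; rewrite inE.
- by right; apply: pw => //; rewrite inE.
- by rewrite eq eqxx in ij.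
Qed.

Lemma chain_partition a b s : itv_partition a b s -> chain a (pairmap pair a s) b.
Proof.
case=> + /eqP; elim: s a => [|c s IH] a /=; first by move=> _ ->.
by case/andP=> ac ps ls; rewrite lexx (ltW ac) /= IH.
Qed.

Lemma variation_pairmap a b f s :
  variation a b f s = \sum_(p <- pairmap pair a s) `|f p.2 - f p.1|.
Proof.
rewrite /variation (big_nth (0, 0)) size_pairmap; apply: eq_big_nat => i /andP[_ si].
rewrite (nth_pairmap b) //= [in LHS](set_nth_default b) //.
Qed.

Lemma sum_pairmap (a b : R) (s : seq R) : itv_partition a b s ->
  \sum_(p <- pairmap pair a s) (p.2 - p.1) = b - a.
Proof.
case=> _ /eqP <-; elim: s a => [|c s IH] a /=; first by rewrite big_nil subrr.
by rewrite big_cons IH /= addrC subrKA.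
Qed.

Lemma total_variation_ub a b f C : (forall s, itv_partition a b s -> variation a b f s <= C) ->
  (total_variation a b f <= C%:E)%E.
Proof.
move=> H; apply: ge_ereal_sup => _ [_ [s ps <-] <-].
by rewrite lee_fin; exact: H.
Qed.

(* Replaces the cells one at a time by arbitrary partitions of them. *)
Lemma chain_total_variation T g e : abs_continuous T g -> 0 < e ->
  exists2 delta, 0 < delta & forall l, chain 0 l T ->
    \sum_(p <- l) (p.2 - p.1) < delta ->
    (\sum_(p <- l) total_variation p.1 p.2 g <= e%:E)%E.
Proof.
move=> ac e0; have [d d0 H] := chain_abs_continuous ac e0; exists d => // l.
(* In [l'] stand the cells already subdivided, counted by their increments; in [l] those still
   counted by total variation. Moving one cell across takes the supremum over its partitions. *)
suff G l' : chain 0 (l' ++ l) T -> \sum_(p <- l' ++ l) (p.2 - p.1) < d ->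
    ((\sum_(p <- l') `|g p.2 - g p.1|)%:E + \sum_(p <- l) total_variation p.1 p.2 g <= e%:E)%E.
  by move=> cl ld; have := G [::]; rewrite big_nil add0e; apply.
elim: l l' => [|p l IH] l'.
  by rewrite cats0 big_nil adde0 lee_fin => cl ld; apply: ltW; exact: H.
move=> cl ld; rewrite big_cons.
have [z c1 /= /and3P[zp pp c2]] := chain_catP cl.
have part s : itv_partition p.1 p.2 s ->
  ((\sum_(p <- l') `|g p.2 - g p.1|)%:E + ((variation p.1 p.2 g s)%:E +
   \sum_(p <- l) total_variation p.1 p.2 g) <= e%:E)%E.
  move=> ps; rewrite addeA -EFinD variation_pairmap -big_cat.
  apply: IH; rewrite -catA.
    apply: chain_cat c1 _; apply: chain_weaken zp _.
    exact: chain_cat (chain_partition ps) c2.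
  by move: ld; rewrite !big_cat big_cons /= (sum_pairmap ps).
have [s0 ps0] : exists s, itv_partition p.1 p.2 s.
  move: pp; rewrite le_eqVlt => /predU1P[->|pp]; first by exists [::]; split.
  by exists [:: p.2]; exact: itv_partition1.
case: (\sum_(_ <- l) _)%E part => [r| |] part.
- have tv : (total_variation p.1 p.2 g <= (e - \sum_(p <- l') `|g p.2 - g p.1| - r)%:E)%E.
    apply: total_variation_ub => s /part; rewrite -!EFinD lee_fin => H1.
    by move: H1; rewrite addrA lerBrDr lerBrDl addrA.
  apply: le_trans (leeD (le_refl _) (leeD tv (le_refl _))) _.
  by rewrite -!EFinD lee_fin subrK subrKC.
- by have := part _ ps0.
- by rewrite addeNy addeNy leNye.
Qed.

(** The interval splits into N cells shorter than the delta that belongs to e = 1, and each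
    contributes variation at most 1. *)
Lemma abs_continuous_bounded_variation T g : 0 <= T -> abs_continuous T g ->
  (total_variation 0 T g < +oo)%E.
Proof.
move=> T0 ac; have [d d0 H] := chain_total_variation ac (@ltr01 R).
pose N := (Num.truncn (T / d)).+1.
have Nd : T / N%:R < d.
  rewrite ltr_pdivrMr ?ltr0n // mulrC -ltr_pdivrMr //.
  by have /andP[] := truncn_itv (divr_ge0 T0 (ltW d0)).
pose t k := k%:R * (T / N%:R).
have h0 : 0 <= T / N%:R by rewrite divr_ge0.
have tS k : t k.+1 = t k + T / N%:R by rewrite /t -addn1 natrD mulrDl mul1r.
have tle i j : (i <= j)%N -> t i <= t j by move=> ij; rewrite ler_wpM2r ?ler_nat.
have tN : t N = T by rewrite /t mulrC divfK ?pnatr_eq0.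
have t00 : t 0%N = 0 by rewrite /t mul0r.
suff : forall k, (k <= N)%N -> (total_variation 0 (t k) g <= k%:R%:E)%E.
  by move=> /(_ N (leqnn _)); rewrite tN => /le_lt_trans; apply; exact: ltry.
elim=> [_|k IH kN]; first by rewrite t00 total_variationxx.
have tk0 : 0 <= t k by rewrite -t00 tle.
rewrite (@total_variationD _ 0 _ (t k)) ?tle //.
rewrite -natr1 EFinD; apply: leeD; first exact: IH (ltnW kN).
have := H [:: (t k, t k.+1)]; rewrite !big_seq1 /=; apply.
  by rewrite tk0 !tle //= -tN tle.
by rewrite tS addrC addKr.
Qed.
End absolute_continuity.

(** * Lebesgue density of a nondecreasing absolutely continuous function *)

Section density.
Context {R : realType}.
Implicit Types (x y z T e : R) (l : seq (R * R)) (f g F : R -> R).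

Local Notation cells l := (\big[setU/set0]_(p <- l) `]p.1, p.2]%classic).

Lemma chain_cells (m : {measure set (measurableTypeR R) -> \bar R}) x l y : chain x l y ->
  [/\ measurable (cells l : set (measurableTypeR R)), cells l `<=` `]x, y]%classic &
      m (cells l) = (\sum_(p <- l) m `]p.1, p.2]%classic)%E].
Proof.
elim: l x => [|p l IH] x /=; first by rewrite !big_nil measure0; split.
case/and3P=> xp pp c; have [mC sC eC] := IH _ c; rewrite !big_cons.
have py : p.2 <= y := chain_le c.
split.
- by apply: measurableU => //; exact: measurable_itv.
- rewrite subUset; split; first by apply: subset_itv; rewrite bnd_simp.
  apply: subset_trans sC _; apply: subset_itvr; rewrite bnd_simp.
  exact: le_trans xp pp.
- rewrite -eC; apply: (measureU m _ mC); first exact: measurable_itv.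
  apply/seteqP; split=> // z [/=]; rewrite in_itv /= => /andP[_ zp] /sC /=.
  by rewrite in_itv /= ltNge zp.
Qed.

Lemma chain_grid (P : pred nat) (t : nat -> R) m n : (forall k, t k <= t k.+1) ->
  chain (t m) [seq (t k, t k.+1) | k <- iota m n & P k] (t (m + n)%N).
Proof.
move=> tS; elim: n m => [|n IH] m /=; first by rewrite addn0.
rewrite addnS -addSn; case: ifP => _ /=; first by rewrite lexx tS IH.
exact: chain_weaken (tS m) (IH _).
Qed.

(** Composing with [clamp] extends F by constants outside [0, T], as needed for a Stieltjes measure
    on the whole line. *)
Definition clamp T x : R := Num.max 0 (Num.min x T).

Lemma clamp_itv T x : 0 <= T -> 0 <= clamp T x <= T.
Proof. by move=> T0; rewrite le_max lexx ge_max T0 ge_min lexx orbT. Qed.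

Lemma clamp_id T x : 0 <= x <= T -> clamp T x = x.
Proof. by case/andP=> x0 xT; rewrite /clamp (min_idPl xT) (max_idPr x0). Qed.

Lemma clamp_le T x y : x <= y -> clamp T x <= clamp T y.
Proof. by move=> xy; rewrite /clamp ge_max !le_max lexx /= le_min !ge_min xy lexx !orbT. Qed.

Lemma clampB T x y : 0 <= T -> x <= y -> clamp T y - clamp T x <= y - x.
Proof.
by move=> T0 xy; rewrite /clamp !minElt !maxElt; case: (ltP x T) => ?; case: (ltP y T) => ?;
  repeat case: ltP => ?; lra.
Qed.

Variables (T : R) (F : R -> R).
Hypothesis T_gt0 : 0 < T.
Hypothesis F_nd : forall x y, 0 <= x -> x <= y -> y <= T -> F x <= F y.
Hypothesis F_ac : forall e, 0 < e -> exists2 delta, 0 < delta & forall l, chain 0 l T ->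
  \sum_(p <- l) (p.2 - p.1) < delta -> \sum_(p <- l) (F p.2 - F p.1) <= e.

Let Fc := F \o clamp T.

Let Fc_nd : nondecreasing Fc.
Proof.
move=> x y xy; have /andP[x0 xT] := clamp_itv x (ltW T_gt0).
have /andP[y0 yT] := clamp_itv y (ltW T_gt0).
by apply: F_nd => //; exact: clamp_le.
Qed.

Let Fc_rc : right_continuous Fc.
Proof.
move=> x; apply/cvgrPdist_le => e e0.
have [d d0 H] := F_ac e0.
near=> y.
have xy : x <= y by near: y; exact: nbhs_right_ge.
rewrite distrC ger0_norm ?subr_ge0 ?Fc_nd //.
have := H [:: (clamp T x, clamp T y)]; rewrite !big_seq1 /=; apply.
  have /andP[-> _] := clamp_itv x (ltW T_gt0).
  by have /andP[_ ->] := clamp_itv y (ltW T_gt0); rewrite clamp_le.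
apply: le_lt_trans (clampB (ltW T_gt0) xy) _.
rewrite ltrBlDl; near: y; apply: nbhs_right_lt.
by rewrite ltrDl.
Unshelve. all: end_near. Qed.

Let cF : cumulative R R := HB.pack_for (cumulative R R) Fc
  (isCumulative.Build R _ R Fc Fc_nd Fc_rc).

Let nu := lebesgue_stieltjes_measure cF.

Let nu_itv x y : 0 <= x -> x <= y -> y <= T -> nu `]x, y]%classic = (F y - F x)%:E.
Proof.
move=> x0 xy yT.
rewrite /nu /lebesgue_stieltjes_measure /measure_extension measurable_mu_extE; last exact: is_ocitv.
rewrite (_ : (F y - F x)%:E = (Fc y - Fc x)%:E).
  exact: (wlength_itv_bnd cF false false xy).
rewrite /Fc /= !clamp_id //; apply/andP; split=> //.
- exact: le_trans xy yT.
- exact: le_trans x0 xy.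
Qed.

Let mD : measurable (`]0, T]%classic : set (measurableTypeR R)).
Proof. exact: measurable_itv. Qed.

Let nuD : (nu `]0%R, T]%classic < +oo)%E.
Proof. by rewrite nu_itv ?ltry // ltW. Qed.

Let nuT : {finite_measure set (measurableTypeR R) -> \bar R} := mfrestr mD nuD.

(** Absolute continuity controls finite families of cells only, so the open set is exhausted from
    inside by the cells of uniform grids that it contains. *)
Let nu_open (U : set R) (e : R) (A : set (measurableTypeR R)) : open U -> A `<=` U -> measurable A ->
  (forall l, chain 0 l T -> cells l `<=` U -> (nu (cells l) <= e%:E)%E) ->
  (nu (A `&` `]0%R, T]%classic) <= e%:E)%E.
Proof.
move=> oU AU mA H.
pose t N k : R := k%:R * (T / N.+1%:R).
have h0 N : 0 < T / N.+1%:R by rewrite divr_gt0.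
have tS N k : t N k <= t N k.+1 by rewrite ler_wpM2r ?ler_nat // ltW.
have tN N : t N N.+1 = T by rewrite /t mulrC divfK ?pnatr_eq0.
have t0 N : t N 0%N = 0 by rewrite /t mul0r.
pose ls N := [seq (t N k, t N k.+1) | k <- iota 0 N.+1 & `[< `]t N k, t N k.+1]%classic `<=` U >]].
have cls N : chain 0 (ls N) T by have := chain_grid (fun k => `[< `]t N k, t N k.+1]%classic `<=` U >]) 0 N.+1 (tS N); rewrite add0n t0 tN.
pose E N : set (measurableTypeR R) := cells (ls N).
have mE N : measurable (E N) by have [] := chain_cells nu (cls N).
(* Successive grids are not nested. The intersection over all later grids restores monotonicity, and
   a point of U in ]0, T] still belongs to [G N] once the mesh is below its distance to the
   complement. *)
pose G N := \bigcap_(M in [set M | (N <= M)%N]) E M.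
have mG N : measurable (G N) by apply: bigcap_measurable => //; exists N => /=.
have ndG : nondecreasing_seq G.
  by move=> m n mn; apply/subsetPset => x Gx k /= nk; apply: Gx => /=; exact: leq_trans nk.
have mUG : measurable (\bigcup_n G n) by exact: bigcup_measurable.
apply: (@le_trans _ _ (nu (\bigcup_n G n))).
  apply: le_measure; rewrite ?inE //; first exact: measurableI.
  move=> x [/AU Ux /=]; rewrite in_itv /= => /andP[x0 xT].
  have /nbhs_ballP[r /= r0 rU] : nbhs x U by exact: open_nbhs_nbhs.
  pose N0 := (Num.truncn (T / r)).+1.
  exists N0 => // N /= N0N.
  have hN : T / N.+1%:R < r.
    rewrite ltr_pdivrMr ?ltr0n // mulrC -ltr_pdivrMr //.
    apply: (@lt_le_trans _ _ N0%:R); last by rewrite ler_nat ltnW.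
    by have /andP[] := truncn_itv (divr_ge0 (ltW T_gt0) (ltW r0)).
  have [k [kN tk tk1]] : exists k, [/\ (k < N.+1)%N, t N k < x & x <= t N k.+1].
    have ex : exists k, x <= t N k by exists N.+1; rewrite tN.
    case: (ex_minnP ex) => -[|k]; first by rewrite t0 leNgt x0.
    move=> xk mk; exists k; split=> //.
      by apply: mk; rewrite tN.
    by rewrite ltNge; apply/negP => /mk; rewrite ltnn.
  have kU : `]t N k, t N k.+1]%classic `<=` U.
    move=> y /=; rewrite in_itv /= => /andP[ty yt]; apply: rU.
    have tk2 : t N k.+1 = t N k + T / N.+1%:R by rewrite /t -natr1 mulrDl mul1r.
    rewrite /ball /= ltr_norml; move: tk tk1 ty yt hN; rewrite tk2.
    move: (t N k) (T / N.+1%:R) => u h *; apply/andP; split; lra.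
  rewrite /E -bigcup_seq; exists (t N k, t N k.+1) => /=.
    by apply/mapP; exists k => //; rewrite mem_filter mem_iota /= add0n kN andbT; exact/asboolP.
  by rewrite in_itv /= tk tk1.
have cv := nondecreasing_cvg_mu mG mUG ndG : nu \o G @ \oo --> _.
suff : (limn (nu \o G) <= e%:E)%E by rewrite (cvg_lim (@ereal_hausdorff _) cv).
apply: lime_le; first by apply/cvg_ex; eexists; exact: cv.
apply: nearW => N /=; apply: (@le_trans _ _ (nu (E N))).
  by apply: le_measure; rewrite ?inE // => x; apply=> /=.
apply: H (cls N) _; rewrite -bigcup_seq => x [p /= /mapP[k + ->] /=].
by rewrite mem_filter => /andP[/asboolP kU _]; exact: kU.
Qed.

(** Outer regularity encloses a null set in an open set of length below delta; cells inside it have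
    total length below delta, so their nu-measure is at most e. *)
Let nu_dom : nuT `<< (@lebesgue_measure R : set (measurableTypeR R) -> \bar R).
Proof.
apply/null_content_dominatesP => A mA A0.
apply/eqP; rewrite eq_le measure_ge0 andbT; apply/lee_addgt0Pr => e e0; rewrite add0e.
have [d d0 H] := F_ac e0.
have A1 : (@lebesgue_measure R A < +oo)%E by rewrite A0 ltry.
have [U [oU AU Ud]] := lebesgue_regularity_outer mA A1 d0.
have mU : measurable (U : set (measurableTypeR R)) by exact: open_measurable.
have {}Ud : (lebesgue_measure U < d%:E)%E.
  rewrite -(setDUK AU) measureU //; last by rewrite setDIK.
    by rewrite A0 add0e.
  exact: measurableD.
apply: (nu_open oU AU mA) => l cl lU.
have [mC sC eC] := chain_cells nu cl.
have [_ _ eC'] := chain_cells (@lebesgue_measure R) cl.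
have in_l p : p \in l -> [/\ 0 <= p.1, p.1 <= p.2 & p.2 <= T] := chain_mem cl.
have -> : nu (cells l) = (\sum_(p <- l) (F p.2 - F p.1))%:E.
  rewrite -sumEFin; etransitivity; first exact: eC.
  rewrite big_seq [RHS]big_seq; apply: eq_bigr => p /in_l[]; exact: nu_itv.
rewrite lee_fin; apply: H => //; rewrite -lte_fin; apply: le_lt_trans Ud.
rewrite -sumEFin.
have -> : (\sum_(p <- l) (p.2 - p.1)%:E = lebesgue_measure (cells l))%E.
  apply/esym; etransitivity; first exact: eC'.
  rewrite big_seq [RHS]big_seq; apply: eq_bigr => p /in_l[_ pp _].
  etransitivity; first exact: (lebesgue_measure_itv `]p.1, p.2]).
  rewrite /= lte_fin; case: ltP => // p21.
  by rewrite (@le_anti _ _ p.1 p.2) ?pp // subrr.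
by apply: le_measure; rewrite ?inE.
Qed.

Lemma ac_density : exists2 rho : R -> R, lebesgue_measure.-integrable setT (EFin \o rho) &
  forall x, 0 <= x <= T -> F x - F 0 = \int[lebesgue_measure]_(t in `]0, x]) rho t.
Proof.
have [rho [rho0 rhofin irho nuE]] := @radon_nikodym_sigma_finite _ _ _ (@lebesgue_measure R) nuT nu_dom.
have rE : EFin \o (fine \o rho) = rho by apply/funext => x /=; rewrite fineK.
exists (fine \o rho); first by rewrite rE.
move=> x /andP[x0 xT].
have := nuE `]0, x]%classic (measurable_itv _).
have -> : nuT `]0, x]%classic = nu `]0, x]%classic.
  congr (nu _); apply/setIidPl; apply: subset_itvl; by rewrite bnd_simp.
rewrite nu_itv // => e.
rewrite /Rintegral (_ : integral _ _ _ = (F x - F 0)%:E) // e.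
by apply: eq_integral => t _ /=; rewrite fineK.
Qed.

End density.

Section increment_bound.
Context {R : realType}.
Variables (T : R) (g : R -> R).
Hypothesis T_gt0 : 0 < T.
Hypothesis g_ac : abs_continuous T g.

Let V (x : R) : R := fine (total_variation 0 x g).

Let tv_fin a b : 0 <= a -> a <= b -> b <= T -> total_variation a b g \is a fin_num.
Proof.
move=> a0 ab bT; rewrite ge0_fin_numE ?total_variation_ge0 //.
apply: le_lt_trans (abs_continuous_bounded_variation (ltW T_gt0) g_ac).
rewrite (total_variationD g a0 (le_trans ab bT)) (total_variationD g ab bT).
rewrite addeCA; apply: leeDl; apply: adde_ge0; exact: total_variation_ge0.
Qed.

Let V_itv a b : 0 <= a -> a <= b -> b <= T -> total_variation a b g = (V b - V a)%:E.
Proof.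
move=> a0 ab bT; have aT := le_trans ab bT.
rewrite /V (total_variationD g a0 ab) fineD ?tv_fin // addrAC subrr add0r fineK //.
exact: tv_fin.
Qed.

Let g_le_V a b : 0 <= a -> a <= b -> b <= T -> `|g b - g a| <= V b - V a.
Proof. by move=> a0 ab bT; rewrite -lee_fin -V_itv //; exact: total_variation_ge. Qed.

Let V_ac e : 0 < e -> exists2 delta, 0 < delta & forall l, chain 0 l T ->
  \sum_(p <- l) (p.2 - p.1) < delta -> \sum_(p <- l) (V p.2 - V p.1) <= e.
Proof.
move=> e0; have [d d0 H] := chain_total_variation g_ac e0; exists d => // l cl ld.
rewrite -lee_fin -sumEFin; apply: le_trans (H l cl ld).
rewrite big_seq [leRHS]big_seq; apply: lee_sum => p pl.
by have [? ? ?] := chain_mem cl pl; rewrite V_itv.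
Qed.

(** Jordan decomposition: g is the difference of V + g and V, both nondecreasing and absolutely
    continuous, where V is the variation from 0. Radon-Nikodym provides a density for each. *)
Lemma abs_continuous_density : exists2 rho : R -> R,
  lebesgue_measure.-integrable setT (EFin \o rho) &
  forall x, 0 <= x <= T -> g x - g 0 = \int[lebesgue_measure]_(t in `]0, x]) rho t.
Proof.
have V_nd x y : 0 <= x -> x <= y -> y <= T -> V x <= V y.
  by move=> x0 xy yT; rewrite -subr_ge0 (le_trans _ (g_le_V x0 xy yT)).
have [r1 i1 e1] := ac_density T_gt0 V_nd V_ac.
have W_nd x y : 0 <= x -> x <= y -> y <= T -> V x + g x <= V y + g y.
  move=> x0 xy yT; have := g_le_V x0 xy yT.
  by rewrite ler_norml => /andP[+ _]; lra.
have [e|r2 i2 e2] := ac_density T_gt0 W_nd.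
  move=> e0; have e20 : 0 < e / 2 by rewrite divr_gt0.
  have [d1 d10 H1] := V_ac e20; have [d2 d20 H2] := chain_abs_continuous g_ac e20.
  exists (Num.min d1 d2); first by rewrite lt_min d10.
  move=> l cl; rewrite lt_min => /andP[/(H1 _ cl) s1 /(H2 _ cl)/ltW s2].
  rewrite [e in _ <= e]splitr; apply: le_trans (lerD s1 s2).
  rewrite -big_split /=; apply: ler_sum => p _.
  by have := ler_norm (g p.2 - g p.1); lra.
exists (r2 \- r1).
  rewrite (_ : EFin \o _ = (EFin \o r2) \- (EFin \o r1))%E; last by [].
  exact: integrableB.
move=> x xT; rewrite RintegralB //; try exact: integrableS i1; try exact: integrableS i2.
by rewrite -e1 // -e2 //; lra.
Qed.

(* [derive1] takes an arbitrary value where [g] is not derivable; the density is its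
   value almost everywhere. *)
Lemma abs_continuous_increment_le K : 0 <= K ->
  {ae @lebesgue_measure R, forall t, 0 <= t <= T -> `|derive1 g t| <= K} ->
  `|g T - g 0| <= K * T.
Proof.
move=> K0 gK; have [rho irho rhoE] := abs_continuous_density.
have irhoS (A : set R) : measurable A -> lebesgue_measure.-integrable A (EFin \o rho).
  by move=> mA; apply: integrableS irho.
have locrho : locally_integrable setT rho by have := integrable_locally measurableT irho; rewrite patch_setT.
have fin y : lebesgue_measure.-integrable [set` Interval (BRight 0) (BRight y)] (EFin \o rho).
  by apply: irhoS; exact: measurable_itv.
have ftc := FTC1 fin locrho.
(* At t = T the two-sided derivative sees values of g beyond T, about which nothing is known; a
   single point is negligible. *)
have aeT : {ae @lebesgue_measure R, forall t, t != T}.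
  exists [set T]; split; [exact: measurable_set1|exact: lebesgue_measure_set1|].
  by move=> t /= /negP; rewrite negbK => /eqP.
have rhoK : {ae @lebesgue_measure R, forall t, t \in `]0, T] -> (`|rho t|%:E <= K%:E)%E}.
  move: gK ftc aeT; apply: (@filterS3 _ _ (ae_filter_ringOfSetsType _)) => t gt ft tT.
  rewrite in_itv /= lee_fin => /andP[t0 tleT].
  have ltT : t < T by rewrite lt_neqAle tT.
  have [dF eF] := ft t0.
  suff <- : derive1 g t = rho t by apply: gt; rewrite (ltW t0).
  rewrite -eF !derive1E.
  have -> : 'D_1 g t = 'D_1 (fun x => g x - g 0) t.
    rewrite /derive; have -> // : (fun h : R => h^-1 *: (((fun x => g x - g 0) \o shift t) (h *: 1) - (g t - g 0))) =
      (fun h : R => h^-1 *: ((g \o shift t) (h *: 1) - g t)).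
    by apply/funext => h /=; rewrite opprB addrA subrK.
  apply: near_eq_derive; near=> s; apply: rhoE.
  have : s \in `]0, T[ by near: s; apply: near_in_itvoo; rewrite in_itv /= t0.
  by rewrite in_itv /= => /andP[/ltW -> /ltW ->].
rewrite rhoE ?(ltW T_gt0) ?lexx //.
apply: le_trans (le_normr_Rintegral _ (fin T)) _ => //.
have mT : measurable (`]0, T]%classic : set (measurableTypeR R)) by exact: measurable_itv.
have iabs := integrable_norm (fin T).
have : (\int[lebesgue_measure]_(t in `]0%R, T]) `|rho t|%:E <=
        \int[lebesgue_measure]_(t in `]0%R, T]) K%:E)%E.
  apply: ae_ge0_le_integral => //.
  by have /integrableP[] := iabs.
rewrite integral_cst //= lebesgue_measure_itv /= lte_fin T_gt0 sube0 -EFinM => le1.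
by rewrite /Rintegral -lee_fin fineK //; exact: integrable_fin_num iabs.
Unshelve. all: end_near. Qed.

End increment_bound.

(** * The manifold setting *)

Section manifold_setting.
Context {R : realType} {n : nat} {M : ptopologicalType}.
Variables (A : set (chart R n M)) (mu : {measure set (borel M) -> \bar R}).
Variables (L : (M -> R) -> (M -> R)) (GZ : (M -> R) -> (M -> R) -> (M -> R)).
Variable P : R -> (M -> R) -> (M -> R).

(** The length T depends on x and y only and is fixed before u, so a single T bounds the oscillation
    of the whole family P t f. A curve of length 0 is treated apart. *)
Lemma subunit_gradient_le : subunit_connected A L -> forall x y, exists2 T, 0 <= T &
  forall u K, smooth A u -> 0 <= K -> (forall z, Gamma L u u z <= K ^+ 2) ->
    `|u y - u x| <= K * T.
Proof.
move=> sc x y; have [T [T0 [gamma [[_ sg] <- <-]]]] := sc x y.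
exists T => // u K Su K0 uK; have [ac ae] := sg u Su.
move: T0; rewrite le_eqVlt => /predU1P[<-|T0]; first by rewrite subrr normr0 mulr0.
apply: (abs_continuous_increment_le T0 ac K0).
move: ae; apply: (@filterS _ _ (ae_filter_ringOfSetsType _)) => t H tT.
apply: le_trans (H tT) _; rewrite -[leRHS]ger0_norm // -sqrtr_sqr.
exact: ler_wsqrtr.
Qed.

Lemma supnorm_ge (f : M -> R) x : (`|f x|%:E <= supnorm f)%E.
Proof. by apply: ereal_sup_ubound; exists x. Qed.

Lemma supnorm_ge0 (f : M -> R) : (0 <= supnorm f)%E.
Proof. by apply: le_trans (supnorm_ge f point); rewrite lee_fin. Qed.

Lemma H1_diffusion_space : smooth_manifold A -> smooth_measure A mu ->
  diffusion_operator A L -> symmetric_nonpositive A mu L ->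
  heat_semigroup A mu L P -> H1 A L GZ ->
  exists h, diffusion_space (smooth A) L mu h.
Proof.
move=> sA sm dL [symL _] [[D [E [sa DL _ _ _]]] _] [h [hc hmono hcvg hG]].
exists h; split.
- exact: manifold_gamma_calculus.
- by move=> U oU U0; exact: smooth_measure_open_gt0 sA sm oU U0.
- exact: symL.
(* Test functions are square integrable because they lie in the domain of the self-adjoint
   extension. *)
- by move=> f Sf; have [H _ _] := sa; have [] := H _ _ (DL f Sf).
- exact: hc.
- exact: hmono.
- exact: hcvg.
- move=> e e0; have /fine_cvgP[fin /cvgrPdist_le/(_ e e0)] := hG.
  move: fin; apply: filterS2 => k fk; rewrite sub0r normrN => ke x.
  apply: le_trans (ler_norm _) _; rewrite -lee_fin.
  apply: le_trans (supnorm_ge _ x) _; apply: (@le_trans _ _ (supnorm (Gamma L (h k) (h k)) + supnorm (GZ (h k) (h k)))%E).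
    by apply: leeDl; exact: supnorm_ge0.
  by rewrite -(fineK fk) lee_fin; apply: le_trans (ler_norm _) ke.
Qed.

Lemma vertical_derivation_form : smooth_manifold A -> diffusion_operator A L ->
  vertical_form A GZ -> @derivation_form R M (smooth A) GZ.
Proof.
move=> sA dL [vS vC vL vM v0]; have gc := manifold_gamma_calculus sA dL.
have S0 : smooth A (fun=> 0) := gc_cst gc 0.
(* Linearity on 1 * 0 + 0 reads z = z + z, hence z = 0; homogeneity below is then linearity with
   zero second summand. *)
have GZ0 k x : smooth A k -> GZ (fun=> 0) k x = 0.
  move=> Sk; have := congr1 (@^~ x) (vL 1 _ _ _ S0 S0 Sk).
  rewrite (_ : (fun _ : M => 1 * 0 + 0) = (fun=> 0)); last by apply/funext => y; rewrite mulr0 addr0.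
  by rewrite mul1r => /eqP; rewrite -subr_eq0 opprD addrA subrr sub0r oppr_eq0 => /eqP.
split; [split|].
- exact: vS.
- by move=> f g x Sf Sg; rewrite vC.
- move=> f g k x Sf Sg Sk; have := congr1 (@^~ x) (vL 1 f g k Sf Sg Sk).
  rewrite (_ : (fun y => 1 * f y + g y) = (fun y => f y + g y)) ?mul1r //.
  by apply/funext => y; rewrite mul1r.
- move=> a f g x Sf Sg; have := congr1 (@^~ x) (vL a f _ g Sf S0 Sg).
  rewrite (_ : (fun y => a * f y + 0) = (fun y => a * f y)) ?GZ0 ?addr0 //.
  by apply/funext => y; rewrite addr0.
- exact: v0.
- by move=> f g k x Sf Sg Sk; rewrite vM.
Qed.

Lemma heat_semigroup_space : heat_semigroup A mu L P -> heat_space (smooth A) L mu P.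
Proof.
move=> [[D [E [sa DL pvm DE PE]]] sP].
have ScL2 f : smooth_c A f -> L2 mu f.
  by move=> Sf; have [H _ _] := sa; have [] := H _ _ (DL f Sf).
split.
- by move=> t f t0 Sf; exact: sP.
- by move=> t f t0 Sf; exact: (P_L2 PE t0 (ScL2 f Sf)).
- by move=> f g Sf Sg; exact: (P0 pvm PE (ScL2 f Sf) (ScL2 g Sg)).
- by move=> t f g t0 Sf Sg; exact: (P_sym pvm PE t0 (ScL2 f Sf) (ScL2 g Sg)).
- by move=> s f g s0 Sf Sg; exact: (P_semigroup pvm PE s0 (ScL2 f Sf) (ScL2 g Sg)).
- by move=> s f g s0 Sf Sg; exact: (P_generator_sym pvm sa DE PE s0 (DL f Sf) (DL g Sg)).
- by move=> f g T T0 Sf Sg; exact: (P_taylor pvm sa DE PE T0 (DL f Sf) (DL g Sg)).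
Qed.

Lemma H3_bound f T : H3 A L GZ P -> smooth_c A f -> 0 <= T ->
  exists2 K, 0 <= K & forall t x, 0 <= t -> t <= T ->
    Gamma L (P t f) (P t f) x <= K /\ GZ (P t f) (P t f) x <= K.
Proof.
move=> h3 Sf T0; have := h3 f T Sf T0.
set B := [set _ | _ in _] => Bfin.
have ubB t : 0 <= t -> t <= T ->
    (supnorm (Gamma L (P t f) (P t f)) + supnorm (GZ (P t f) (P t f)) <= ereal_sup B)%E.
  by move=> t0 tT; apply: ereal_sup_ubound; exists t => //=; rewrite t0.
have B0 : (0 <= ereal_sup B)%E.
  by apply: le_trans (ubB 0 (lexx _) T0); apply: adde_ge0; exact: supnorm_ge0.
have Bf : (fine (ereal_sup B))%:E = ereal_sup B by rewrite fineK // ge0_fin_numE.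
exists (fine (ereal_sup B)); first exact: fine_ge0.
move=> t x t0 tT; split; rewrite -lee_fin Bf; apply: le_trans (ubB t t0 tT).
- apply: (@le_trans _ _ (supnorm (Gamma L (P t f) (P t f)))).
    by apply: le_trans (supnorm_ge _ x); rewrite lee_fin ler_norm.
  by apply: leeDl; exact: supnorm_ge0.
- apply: (@le_trans _ _ (supnorm (GZ (P t f) (P t f)))).
    by apply: le_trans (supnorm_ge _ x); rewrite lee_fin ler_norm.
  by apply: leeDr; exact: supnorm_ge0.
Qed.

End manifold_setting.

Lemma Lnorm_le {R : realType} {M : ptopologicalType} (mu : {measure set (borel M) -> \bar R})
  (p C : R) (u v : M -> R) : 0 < p -> 0 <= C -> (forall x, 0 <= v x) ->
  intg mu (fun x => `|u x| `^ p) ->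
  \int[mu]_x `|u x| `^ p <= C * \int[mu]_x v x `^ p ->
  (Lnorm mu p%:E (fun x => (u x)%:E) <= (C `^ p^-1)%:E * Lnorm mu p%:E (fun x => (v x)%:E))%E.
Proof.
move=> p0 C0 v0 iu uv; rewrite unlock /=.
under eq_integral do rewrite /=.
under [X in (_ <= _ * poweR X _)%E]eq_integral do rewrite /= ger0_norm //.
set I := integral _ _ _; set J := integral _ _ _.
have J0 : (0 <= J)%E by apply: integral_ge0 => x _; rewrite lee_fin powR_ge0.
have IE : I = (\int[mu]_x `|u x| `^ p)%:E by rewrite fineK //; exact: integrable_fin_num.
have IJ : (I <= C%:E * J)%E.
  rewrite IE; apply: (@le_trans _ _ (C * fine J)%:E); first by rewrite lee_fin.
  rewrite EFinM; apply: lee_wpmul2l; first by rewrite lee_fin.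
  (* If [J] is infinite then [fine J] is 0, so [fine J <= J] holds in every case. *)
  by case: (J) J0.
rewrite -poweR_EFin -poweRM ?lee_fin //.
apply: gt0_ler_poweR IJ; first by rewrite invr_ge0 ltW.
- by rewrite in_itv /= leey andbT IE lee_fin; apply: Rintegral_ge0 => x _; rewrite powR_ge0.
- by rewrite in_itv /= leey andbT; apply: mule_ge0; rewrite ?lee_fin.
Qed.

Theorem proposition1p4 (R : realType) (p rho1 rho2 kappa d : R)
    (hp : 1 <= p) (hrho1 : 0 < rho1) (hrho2 : 0 < rho2) (hkappa : 0 <= kappa)
    (hd : 0 < d) :
  exists2 C : R, 0 < C &
  forall (n : nat) (M : ptopologicalType) (A : set (chart R n M))
    (mu : {measure set (borel M) -> \bar R})
    (L : (M -> R) -> (M -> R))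
    (GZ : (M -> R) -> (M -> R) -> (M -> R))
    (P : R -> (M -> R) -> (M -> R)),
    smooth_manifold A -> connected [set: M] ->
    smooth_measure A mu ->
    diffusion_operator A L ->
    locally_subelliptic A mu L ->
    symmetric_nonpositive A mu L ->
    subunit_connected A L -> subunit_complete A L ->
    vertical_form A GZ ->
    heat_semigroup A mu L P ->
    H1 A L GZ -> H2 A L GZ -> H3 A L GZ P ->
    CD A L GZ rho1 rho2 kappa d ->
    forall f : M -> R, smooth_c A f ->
      (Lnorm mu p%:E (fun x => (f x - mean mu f)%:E) <=
       C%:E * Lnorm mu p%:E (fun x => (Num.sqrt (Gamma L f f x))%:E))%E.
Proof.
pose c := rho1 * rho2 / (rho2 + kappa).
have c0 : 0 < c := divr_gt0 (mulr_gt0 hrho1 hrho2) (ltr_wpDr hkappa hrho2).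
(* [C1] bounds the integral of sqrt(rho1 / (exp(c t) - 1)) over all positive times, through
   [decay_primitive]. *)
pose C1 := 4 / c * Num.sqrt rho1.
have s0 : 0 < Num.sqrt rho1 by rewrite sqrtr_gt0.
have C10 : 0 < C1 := mulr_gt0 (divr_gt0 (ltr0n _ 4) c0) s0.
(* [B] compares the integrals of p-th powers, with separate constants for p = 1 and p > 1; the norms
   are then compared by its 1/p-th power. *)
pose B := if p == 1 then C1 else
  2 `^ p * (1 + 2 `^ p) * (2 * (C1 * p * (2 * (C1 * p)) `^ (p - 1))).
have p0 : 0 < p := lt_le_trans ltr01 hp.
have pw0 (x a : R) : 0 < x -> 0 < x `^ a := powR_gt0 a.
have C1p : 0 < C1 * p := mulr_gt0 C10 p0.
have B0 : 0 < B.
  rewrite /B; case: ifP => // _.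
  have t0 : 0 < 2 `^ p :> R := pw0 _ _ (ltr0n _ 2).
  exact: mulr_gt0 (mulr_gt0 t0 (addr_gt0 ltr01 t0))
    (mulr_gt0 (ltr0n _ 2) (mulr_gt0 C1p (pw0 _ _ (mulr_gt0 (ltr0n _ 2) C1p)))).
exists (B `^ p^-1); first exact: pw0.
move=> n M A mu L GZ P sA _ sm dL _ symL sc _ vf hs h1 _ h3 cd f Sf.
have [h ds] := H1_diffusion_space sA sm dL symL hs h1.
have hsp := heat_semigroup_space hs.
have gz := vertical_derivation_form sA dL vf.
have cd' g nu x : smooth A g -> 0 < nu ->
    (rho1 - kappa / nu) * Gamma L g g x + rho2 * GZ g g x <= Gamma2 L g x + nu * Gamma2Z L GZ g x.
  move=> Sg nu0; apply: le_trans (cd g nu x Sg nu0).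
  have d0 : 0 <= d^-1 * L g x ^+ 2 by apply: mulr_ge0; [rewrite invr_ge0 ltW|exact: sqr_ge0].
  by rewrite lerD2r lerDr.
have grad g c1 T : @Sc R M (smooth A) g -> 0 <= c1 -> (forall x, `|g x| <= c1) -> 0 < T ->
    forall x, (expR (c * T) - 1) * Gamma L (P T g) (P T g) x <= rho1 * c1 ^+ 2.
  move=> Sg c10 gc T0 x.
  exact: (gradient_bound ds hsp gz (fun u T Su => H3_bound h3 Su) hrho1 hrho2 hkappa cd' Sg c10 gc (erefl c) T0 x).
have conn := subunit_gradient_le sc.
have [i1 l1] : intg mu (fun x => `|f x - mean mu f| `^ p) /\
    \int[mu]_x `|f x - mean mu f| `^ p <= B * \int[mu]_x Num.sqrt (Gamma L f f x) `^ p.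
  rewrite /B; case: eqP => [->|/eqP p1].
    have [i l] := poincare_L1 ds hsp c0 hrho1 grad conn Sf.
    have e1 : (fun x => `|f x - mean mu f| `^ 1) = (fun x => `|f x - mean mu f|).
      by apply/funext => x; rewrite powRr1.
    have e2 : (fun x => Num.sqrt (Gamma L f f x) `^ 1) = (fun x => Num.sqrt (Gamma L f f x)).
      by apply/funext => x; rewrite powRr1 // sqrtr_ge0.
    by rewrite e1 e2.
  apply: (poincare_Lp ds hsp c0 hrho1 grad conn) => //.
  by rewrite lt_neqAle eq_sym p1.
exact: (Lnorm_le p0 (ltW B0) (fun x => sqrtr_ge0 _) i1 l1).
Qed.
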